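(* Let $p\in(1/2,1)$ and consider bond percolation on $\mathbb{Z}^2$ in which each nearest-neighbour edge is open independently with probability $p$. For each $p$ there is a deterministic constant $\mu_p$ such that, almost surely on the event $\{\mathbf{0}\leftrightarrow\infty\}$, \[ \mu_p=\lim_{\substack{n\to\infty\\ \mathbf{0}\leftrightarrow(n,0)}}\frac{D(n,0)}{n}, \] and, as $p\to 1$, \[ \mu_p = 1+\frac{1-p}{2}+\mathrm{o}(1-p). \]
   Context: Bond percolation on $\mathbb{Z}^2$: each edge between nearest neighbours is open with probability $p$ and closed with probability $1-p$, independently; $\mathbb{P}_p$ denotes this product measure. For $p>1/2$ there is almost surely a unique infinite connected component (cluster) of open edges. We write $x\leftrightarrow y$ if $x,y$ lie in the same open cluster and $x\leftrightarrow\infty$ if $x$ lies in the infinite cluster. $D(x)$ (also written $D(i,j)$ for $x=(i,j)$) is the graph distance from the origin $\mathbf{0}$ to $x$ in the graph of open edges (infinite if they are not connected). The limit along $n$ with $\mathbf{0}\leftrightarrow(n,0)$ means: if $(T_1(k),0)$ denotes the $k$-th point of $\{(i,0):i\ge 1\}$ belonging to the infinite cluster, the limit is $\lim_{k\to\infty} D(T_1(k),0)/T_1(k)$. *)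

(* Defs.v *)
From HB Require Import structures.
From mathcomp Require Import all_boot all_order all_algebra.
From mathcomp Require Import all_classical all_reals all_analysis.
Set Implicit Arguments. Unset Strict Implicit. Unset Printing Implicit Defensive.
Import Order.TTheory GRing.Theory Num.Theory.
Local Open Scope classical_set_scope.
Local Open Scope ring_scope.

Definition vertex := (int * int)%type.
(* Nearest-neighbour edges of Z^2: (x, false) is the edge {x, x+(1,0)},
   (x, true) is the edge {x, x+(0,1)}.  Each edge has exactly one name. *)
Definition edge := (vertex * bool)%type.
(* A percolation configuration: open (true) / closed (false) state of each edge. *)
Definition config := edge -> bool.

Definition ostep (w : config) (u v : vertex) : bool :=
  [|| (v == (u.1 + 1, u.2)) && w (u, false),
      (u == (v.1 + 1, v.2)) && w (v, false),
      (v == (u.1, u.2 + 1)) && w (u, true)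
    | (u == (v.1, v.2 + 1)) && w (v, true)].

Definition opath (w : config) (u v : vertex) (n : nat) : Prop :=
  exists s : seq vertex, size s = n /\ path (ostep w) u s /\ last u s = v.

Definition conn (w : config) (u v : vertex) : Prop := exists n, opath w u v n.

(* u <-> infinity : the open cluster of u is infinite (equivalently unbounded). *)
Definition inf_cluster (w : config) (u : vertex) : Prop :=
  forall N : nat, exists v : vertex, conn w u v /\ (N < absz v.1 + absz v.2)%N.

Definition origin : vertex := (0%:Z, 0%:Z).

(* Chemical distance D(x) from the origin in the open graph; +oo if not connected. *)
Definition D {R : realType} (w : config) (x : vertex) : \bar R :=
  ereal_inf [set ((n%:R : R)%:E) | n in [set n | opath w origin x n]].

(* T_1(k): the k-th point (k >= 1) of {(i,0) : i >= 1} lying in the infinite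
   cluster (junk value 0 if there is no such point). *)
Definition T1 (w : config) (k : nat) : nat :=
  xget 0%N [set i | (0 < i)%N /\ inf_cluster w (i%:Z, 0%:Z) /\
     (\sum_(1 <= j < i.+1) nat_of_bool (asbool (inf_cluster w (j%:Z, 0%:Z))))%N = k].

(* w : T -> config is distributed as Bernoulli(p) bond percolation under P:
   each edge state is measurable and the finite-dimensional (cylinder)
   probabilities are those of the product measure. *)
Definition bernoulli_percolation {d} {T : measurableType d} {R : realType}
    (P : probability T R) (p : R) (w : T -> config) : Prop :=
  (forall e : edge, measurable [set t | w t e]) /\
  (forall (s : seq edge), uniq s -> forall b : edge -> bool,
     P [set t | forall e, e \in s -> w t e = b e] =
     (\prod_(e <- s) (if b e then p else 1 - p))%:E).

(* Main.v *)
Require Import Defs.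
From HB Require Import structures.
From mathcomp Require Import all_boot all_order all_algebra.
From mathcomp Require Import all_classical all_reals all_analysis.
From mathcomp Require Import ring lra zify.
Set Implicit Arguments. Unset Strict Implicit. Unset Printing Implicit Defensive.
Import Order.TTheory GRing.Theory Num.Theory.
Local Open Scope classical_set_scope.
Local Open Scope ring_scope.

(** The chemical distance is compared with a first passage metric. A closed edge [e] is given the
    passage time [tau], the size of a box around [e] that encloses the dual cluster of [e]: by
    planarity the infinite cluster, entered at one end of [e], can be followed around that dual
    cluster, so on the infinite cluster the metric coincides with the chemical distance. Since [1 - p]
    is below the self-dual point, dual clusters have exponential tails. This uses sharpness in the form
    of Duminil-Copin and Tassion, Zhang's duality argument and the fact that the number of large
    clusters in a box is at most of the order of its boundary. Subadditivity of the mean, an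
    Efron-Stein bound on the variance and the Borel-Cantelli lemma then give the limit [mu p].

    For the expansion, write [eps = 1 - p]. A monotone path pays 2 at a closed horizontal edge unless
    it can profit from a vertical drift; the excess cost evolves from column to column like the height
    of a parallel TASEP, raised by 2 at a local minimum with probability [eps]. On a ring the law
    proportional to [p ^ (- number of minima)] is invariant and a site is a local minimum with
    probability close to 1/4, so the height grows at speed [2 * eps * (1/4) = eps / 2]. The height
    function is 1-Lipschitz for the metric, which gives [mu p >= 1 + eps / 2]. Conversely, on blocks of
    length [K / eps] pairs of adjacent closed edges are negligible as [eps] tends to 0, and the variance
    of the point-to-point passage times of the TASEP is [O(K)], so that their means are [K / 2 + o(K)]. *)

(** * Expectations of functions of finitely many edges *)

(** The chemical distance is infinite with positive probability, so it has no finite mean to which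
    subadditivity could apply. The times [tau] repair this, but the size of a dual cluster depends
    on infinitely many edges. It is therefore truncated at a level [l], which makes every
    expectation a finite sum over states of finitely many edges; [l] grows slowly with the scale,
    and exponential tails control the error.

    In the expansion, the stationary law on the ring gives the growth from a random profile, which
    bounds passage times from below. An upper bound on [mu] needs instead the mean passage time
    between two points. The two are compared because the height at a site is a minimum over starting
    points, the initial profile fluctuates like a random walk and each passage time is concentrated.
    The limits are taken in the order [p] to 1, then [K] to infinity: at fixed [K] the ring has
    about [6 K] sites and its invariant law becomes uniform, while a corridor of height of order [K]
    and length of order [K / eps] contains of the order of [K^2 eps] adjacent pairs of closed
    edges. *)

Section Expectation.
Variables (R : realType) (E : choiceType).
Implicit Types (w : E -> bool) (f g : (E -> bool) -> R) (s : seq E) (p : R).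

Definition upd w e b : E -> bool := fun x => if x == e then b else w x.

(* Integrates out the edges of [s]; the other edges are frozen in the state given by [w]. *)
Fixpoint Ex p s f w : R :=
  if s is e :: s' then
    p * Ex p s' f (upd w e true) + (1 - p) * Ex p s' f (upd w e false)
  else f w.

Definition depon (A : pred E) (Y : Type) (f : (E -> bool) -> Y) :=
  forall w w', (forall e, A e -> w e = w' e) -> f w = f w'.

Definition local (Y : Type) (f : (E -> bool) -> Y) :=
  exists s : seq E, depon (fun e => e \in s) f.

Definition support f := xget [::] [set s : seq E | depon (fun e => e \in s) f].

(* Meaningful for [local f] only: otherwise [support f] is the junk value [[::]]. *)
Definition E_ p f := Ex p (support f) f (fun=> false).

Definition mono f := forall w w', (forall e, w e -> w' e) -> f w <= f w'.

Lemma updC w e e' b b' : e != e' ->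
  upd (upd w e b) e' b' = upd (upd w e' b') e b.
Proof.
move=> ne; apply/funext => x; rewrite /upd.
by case: eqP => // ->; rewrite eq_sym (negbTE ne).
Qed.

Lemma upd_id w e : upd w e (w e) = w.
Proof. by apply/funext => x; rewrite /upd; case: eqP => // ->. Qed.

Lemma upd_same w e b : upd w e b e = b.
Proof. by rewrite /upd eqxx. Qed.

Lemma upd_other w e b x : x != e -> upd w e b x = w x.
Proof. by rewrite /upd => /negbTE ->. Qed.

Lemma depon_sub (A B : pred E) (Y : Type) (f : (E -> bool) -> Y) :
  (forall e, A e -> B e) -> depon A f -> depon B f.
Proof. by move=> AB df w w' h; apply: df => e /AB; apply: h. Qed.

Lemma Ex_dep A p s f w w' : depon A f ->
  (forall e, A e -> e \notin s -> w e = w' e) -> Ex p s f w = Ex p s f w'.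
Proof.
move=> df; elim: s w w' => [|e s IH] w w' h /=.
  by apply: df => e Ae; apply: h.
have H b : Ex p s f (upd w e b) = Ex p s f (upd w' e b).
  apply: IH => x Ax xs; rewrite /upd; case: eqP => // /eqP ne.
  by apply: h; rewrite // inE negb_or ne.
by rewrite !H.
Qed.

Lemma Ex_agree p s f w w' : (forall e, e \notin s -> w e = w' e) ->
  Ex p s f w = Ex p s f w'.
Proof.
move=> h; apply: (@Ex_dep predT) => [|e _ /h//].
by move=> v v' e; congr f; apply/funext => x; apply: e.
Qed.

Lemma Ex_eq p s f g w : (forall v, f v = g v) -> Ex p s f w = Ex p s g w.
Proof. by move=> fg; congr Ex; apply/funext. Qed.

Lemma Ex_red p s f w e : e \in s -> Ex p (e :: s) f w = Ex p s f w.
Proof.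
move=> es /=.
have H b : Ex p s f (upd w e b) = Ex p s f w.
  apply: Ex_agree => x xs; rewrite upd_other //.
  by apply: contraNneq xs => ->.
by rewrite !H -mulrDl subrKC mul1r.
Qed.

Lemma Ex_swap p s f w e e' : Ex p (e :: e' :: s) f w = Ex p (e' :: e :: s) f w.
Proof.
have [->//|ne /=] := eqVneq e e'.
rewrite ![upd (upd w e _) e' _]updC //; ring.
Qed.

Lemma Ex_move p s1 s2 f w e : Ex p (e :: s1 ++ s2) f w = Ex p (s1 ++ e :: s2) f w.
Proof.
elim: s1 w => // a s1 IH w.
rewrite [LHS]Ex_swap /=; congr (_ * _ + _ * _); exact: IH.
Qed.

Lemma Ex_cat p s1 s2 f w : Ex p (s1 ++ s2) f w = Ex p s1 (Ex p s2 f) w.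
Proof. by elim: s1 w => //= e s1 IH w; rewrite !IH. Qed.

Lemma Ex_catC p s1 s2 f w : Ex p (s1 ++ s2) f w = Ex p (s2 ++ s1) f w.
Proof.
elim: s1 s2 w => [|e s1 IH] s2 w; first by rewrite cats0.
by rewrite -Ex_move /= !IH.
Qed.

Lemma Ex_add p s1 s2 f w : {subset s1 <= s2} -> Ex p (s1 ++ s2) f w = Ex p s2 f w.
Proof.
elim: s1 w => // e s1 IH w h; rewrite cat_cons Ex_red.
  by apply: IH => x xs; apply: h; rewrite inE xs orbT.
by rewrite mem_cat h ?orbT// mem_head.
Qed.

Lemma Ex_cst p s c w : Ex p s (fun=> c) w = c.
Proof. by elim: s w => //= e s IH w; rewrite !IH; ring. Qed.

Lemma Ex_drop p s1 s f w w' : depon (fun e => e \in s) f ->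
  Ex p (s1 ++ s) f w = Ex p s f w'.
Proof.
move=> df; rewrite Ex_cat.
transitivity (Ex p s1 (fun=> Ex p s f w') w); last by rewrite Ex_cst.
by apply: Ex_eq => v; apply: (Ex_dep _ df) => e ->.
Qed.

Lemma Ex_sup p s t f w w' : depon (fun e => e \in s) f ->
  {subset s <= t} -> Ex p t f w = Ex p s f w'.
Proof. by move=> df st; rewrite -(Ex_add _ _ _ st) Ex_catC (Ex_drop _ _ _ w'). Qed.

Lemma supportP f : local f -> depon (fun e => e \in support f) f.
Proof. by move=> [s ds]; rewrite /support; case: xgetP => [x _ //|/(_ s)]. Qed.

Lemma E_E p s f w : depon (fun e => e \in s) f -> E_ p f = Ex p s f w.
Proof.
move=> df; have lf : local f by exists s.
rewrite -(@Ex_sup p s (support f ++ s) f w w df); last first.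
  by move=> e es; rewrite mem_cat es orbT.
by rewrite Ex_catC (Ex_drop _ _ _ (fun=> false)) //; apply: supportP.
Qed.

Lemma local_cst (Y : Type) (c : Y) : local (fun=> c).
Proof. by exists [::]. Qed.

Lemma local2 (Y1 Y2 Y : Type) (h : Y1 -> Y2 -> Y) (f1 : (E -> bool) -> Y1) (f2 : (E -> bool) -> Y2) :
  local f1 -> local f2 -> local (fun w => h (f1 w) (f2 w)).
Proof.
move=> [s1 d1] [s2 d2]; exists (s1 ++ s2) => w w' H.
by rewrite (d1 w w') ?(d2 w w')// => e es; apply: H; rewrite mem_cat es ?orbT.
Qed.

Lemma local1 (Y1 Y : Type) (h : Y1 -> Y) (f1 : (E -> bool) -> Y1) :
  local f1 -> local (fun w => h (f1 w)).
Proof. by move=> [s d]; exists s => w w' H; rewrite (d w w'). Qed.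

Lemma local_ext (Y : Type) (f1 f2 : (E -> bool) -> Y) :
  f1 =1 f2 -> local f1 -> local f2.
Proof. by move=> e [s d]; exists s => w w' H; rewrite -!e; apply: d. Qed.

Lemma local_edge e : local (fun w => w e).
Proof. by exists [:: e] => w w' H; apply: H; rewrite inE. Qed.

Lemma local_seq (I : eqType) (r : seq I) (Y : Type) (F : I -> (E -> bool) -> Y) :
  (forall i, i \in r -> local (F i)) ->
  exists s, forall i, i \in r -> depon (fun e => e \in s) (F i).
Proof.
elim: r => [|i r IH] h; first by exists [::].
have [s1 d1] := h i (mem_head _ _).
case: IH => [j jr|s2 d2]; first by apply: h; rewrite inE jr orbT.
exists (s1 ++ s2) => j; rewrite inE => /orP[/eqP->|jr].
  by apply: depon_sub d1 => e es; rewrite mem_cat es.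
by apply: depon_sub (d2 j jr) => e es; rewrite mem_cat es orbT.
Qed.

Lemma local_sum (I : eqType) (r : seq I) (P : pred I) (F : I -> (E -> bool) -> R) :
  (forall i, i \in r -> P i -> local (F i)) ->
  local (fun w => \sum_(i <- r | P i) F i w).
Proof.
move=> h; have [|s d] := @local_seq I [seq i <- r | P i] R F.
  by move=> i; rewrite mem_filter => /andP[Pi ir]; apply: h.
exists s => w w' H; rewrite big_seq_cond [RHS]big_seq_cond.
by apply: eq_bigr => i /andP[ir Pi]; apply: (d i) => //; rewrite mem_filter Pi.
Qed.

Lemma local_E p s f : local f -> local (Ex p s f).
Proof.
move=> [t d]; exists t => w w' H; apply: (Ex_dep _ d) => e et _; exact: H.
Qed.

Lemma common2 f g : local f -> local g -> exists s,
  depon (fun e => e \in s) f /\ depon (fun e => e \in s) g.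
Proof.
move=> [s1 d1] [s2 d2]; exists (s1 ++ s2); split; [move: d1|move: d2];
by apply: depon_sub => e es; rewrite mem_cat es ?orbT.
Qed.

Lemma ExD p s f g w : Ex p s (fun v => f v + g v) w = Ex p s f w + Ex p s g w.
Proof. by elim: s w => //= e s IH w; rewrite !IH; ring. Qed.

Lemma ExZ p s c f w : Ex p s (fun v => c * f v) w = c * Ex p s f w.
Proof. by elim: s w => //= e s IH w; rewrite !IH; ring. Qed.

Lemma Ex_le p s f g w : 0 <= p <= 1 -> (forall v, f v <= g v) ->
  Ex p s f w <= Ex p s g w.
Proof.
move=> /andP[p0 p1] fg; elim: s w => //= e s IH w.
by rewrite lerD// ler_wpM2l// subr_ge0.
Qed.

Lemma E_cst p c : E_ p (fun=> c) = c.
Proof. exact: Ex_cst. Qed.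

Lemma E_eq p f g : (forall v, f v = g v) -> E_ p f = E_ p g.
Proof. by move=> fg; congr E_; apply/funext. Qed.

Lemma E_D p f g : local f -> local g ->
  E_ p (fun v => f v + g v) = E_ p f + E_ p g.
Proof.
move=> lf lg; have [s [df dg]] := common2 lf lg.
rewrite !(@E_E p s _ (fun=> false)) ?ExD// => w w' H.
by rewrite (df w w') ?(dg w w').
Qed.

Lemma E_Z p c f : local f -> E_ p (fun v => c * f v) = c * E_ p f.
Proof.
move=> [s df]; rewrite !(@E_E p s _ (fun=> false)) ?ExZ// => w w' H.
by rewrite (df w w').
Qed.

Lemma E_N p f : local f -> E_ p (fun v => - f v) = - E_ p f.
Proof. by move=> lf; rewrite -mulN1r -E_Z//; apply: E_eq => v; rewrite mulN1r. Qed.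

Lemma E_B p f g : local f -> local g ->
  E_ p (fun v => f v - g v) = E_ p f - E_ p g.
Proof. by move=> lf lg; rewrite E_D ?E_N//; apply: local1. Qed.

Lemma E_sum (I : eqType) (r : seq I) (P : pred I) (F : I -> (E -> bool) -> R) p :
  (forall i, i \in r -> P i -> local (F i)) ->
  E_ p (fun v => \sum_(i <- r | P i) F i v) = \sum_(i <- r | P i) E_ p (F i).
Proof.
elim: r => [|i r IH] h.
  by rewrite big_nil -[RHS](E_cst p 0); apply: E_eq => v; rewrite big_nil.
have h' j : j \in r -> P j -> local (F j) by move=> jr; apply: h; rewrite inE jr orbT.
rewrite big_cons -IH//; case: ifPn => Pi.
  rewrite -E_D; first by apply: E_eq => v; rewrite big_cons Pi.
    by apply: h => //; rewrite mem_head.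
  exact: local_sum.
by apply: E_eq => v; rewrite big_cons (negbTE Pi).
Qed.

Lemma E_le p f g : 0 <= p <= 1 -> local f -> local g -> (forall v, f v <= g v) ->
  E_ p f <= E_ p g.
Proof.
move=> p01 lf lg fg; have [s [df dg]] := common2 lf lg.
by rewrite !(@E_E p s _ (fun=> false))//; apply: Ex_le.
Qed.

Lemma E_ge0 p f : 0 <= p <= 1 -> local f -> (forall v, 0 <= f v) -> 0 <= E_ p f.
Proof. by move=> p01 lf f0; rewrite -(E_cst p 0); apply: E_le => //; apply: local_cst. Qed.

(** Resampling the edges of [s] changes nothing on average; a bound on [Ex p s f] that holds
    conditionally on the other edges can thus be integrated. *)
Lemma E_Ex p s f : local f -> E_ p (Ex p s f) = E_ p f.
Proof.
move=> lf; have [t dt] := lf.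
have dt' : depon (fun e => e \in t ++ s) f.
  by apply: depon_sub dt => e et; rewrite mem_cat et.
rewrite (@E_E p (t ++ s) f (fun=> false)) // Ex_cat (@E_E p t _ (fun=> false)) //.
by move=> w w' H; apply: (Ex_dep _ dt) => e et _; apply: H.
Qed.

Lemma Ex_indep A B p s f g w : depon A f -> depon B g ->
  (forall e, A e -> B e -> False) ->
  Ex p s (fun v => f v * g v) w = Ex p s f w * Ex p s g w.
Proof.
move=> dA dB AB; elim: s w => //= e s IH w; rewrite !IH.
have [Ae|nA] := boolP (A e).
  have H b : Ex p s g (upd w e b) = Ex p s g w.
    by apply: (Ex_dep _ dB) => x Bx _; rewrite upd_other//; apply: contraTneq Bx => ->; apply/negP => /(AB e Ae).
  rewrite !H; ring.
have H b : Ex p s f (upd w e b) = Ex p s f w.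
  by apply: (Ex_dep _ dA) => x Ax _; rewrite upd_other//; apply: contraTneq Ax => ->.
rewrite !H; ring.
Qed.

Lemma E_indep A B p f g : local f -> local g -> depon A f -> depon B g ->
  (forall e, A e -> B e -> False) ->
  E_ p (fun v => f v * g v) = E_ p f * E_ p g.
Proof.
move=> lf lg dA dB AB; have [s [df dg]] := common2 lf lg.
rewrite !(@E_E p s _ (fun=> false)) ?(Ex_indep _ _ _ dA dB)// => w w' H.
by rewrite (df w w') ?(dg w w').
Qed.

Lemma mono_Ex p s f : 0 <= p <= 1 -> mono f -> mono (Ex p s f).
Proof.
move=> /andP[p0 p1] mf; elim: s => //= e s IH w w' h.
rewrite lerD// ler_wpM2l ?subr_ge0//; apply: IH => x; rewrite /upd; by case: eqP => // _ /h.
Qed.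

Lemma upd_mono w e : forall x, upd w e false x -> upd w e true x.
Proof. by move=> x; rewrite /upd; case: eqP. Qed.

(** Harris' inequality, one edge at a time: the covariance of two functions of the state of [e] is
    [p * (1 - p)] times the product of their increments, which have the same sign. *)
Lemma Ex_FKG p s f g w : 0 <= p <= 1 -> mono f -> mono g ->
  Ex p s f w * Ex p s g w <= Ex p s (fun v => f v * g v) w.
Proof.
move=> p01 mf mg; elim: s w => //= e s IH w.
have /andP[p0 p1] := p01.
have hf := mono_Ex s p01 mf (@upd_mono w e).
have hg := mono_Ex s p01 mg (@upd_mono w e).
have h1 := IH (upd w e true); have h0 := IH (upd w e false).
set F1 := Ex p s f (upd w e true) in hf h1 *; set G1 := Ex p s g (upd w e true) in hg h1 *.
set F0 := Ex p s f (upd w e false) in hf h0 *.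
set G0 := Ex p s g (upd w e false) in hg h0 *.
apply: (@le_trans _ _ (p * (F1 * G1) + (1 - p) * (F0 * G0))); last first.
  by rewrite lerD// ler_wpM2l// subr_ge0.
rewrite -subr_ge0.
have -> : p * (F1 * G1) + (1 - p) * (F0 * G0) -
  (p * F1 + (1 - p) * F0) * (p * G1 + (1 - p) * G0) =
  p * (1 - p) * ((F1 - F0) * (G1 - G0)) by ring.
by rewrite !mulr_ge0// subr_ge0.
Qed.

Lemma E_FKG p f g : 0 <= p <= 1 -> local f -> local g -> mono f -> mono g ->
  E_ p f * E_ p g <= E_ p (fun v => f v * g v).
Proof.
move=> p01 lf lg mf mg; have [s [df dg]] := common2 lf lg.
rewrite !(@E_E p s _ (fun=> false))//; first exact: Ex_FKG.
by move=> w w' H; rewrite (df w w') ?(dg w w').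
Qed.

Lemma Ex_mono_p p p' s f w : 0 <= p -> p <= p' -> p' <= 1 -> mono f ->
  Ex p s f w <= Ex p' s f w.
Proof.
move=> p0 pp p1 mf; elim: s w => //= e s IH w.
have p01 : 0 <= p' <= 1 by rewrite p1 (le_trans p0).
have h1 := IH (upd w e true); have h0 := IH (upd w e false).
have hf := mono_Ex s p01 mf (@upd_mono w e).
apply: (@le_trans _ _ (p * Ex p' s f (upd w e true) + (1 - p) * Ex p' s f (upd w e false))).
  by rewrite lerD// ler_wpM2l// subr_ge0 (le_trans pp).
rewrite -subr_ge0; set a := Ex p' s f (upd w e true) in hf *; set b := Ex p' s f (upd w e false) in hf *.
have -> : p' * a + (1 - p') * b - (p * a + (1 - p) * b) = (p' - p) * (a - b) by ring.
by rewrite mulr_ge0 ?subr_ge0.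
Qed.

Lemma E_mono_p p p' f : 0 <= p -> p <= p' -> p' <= 1 -> local f -> mono f ->
  E_ p f <= E_ p' f.
Proof.
by move=> p0 pp p1 [s df] mf; rewrite !(@E_E _ s _ (fun=> false))//; apply: Ex_mono_p.
Qed.

Lemma Ex_upd p s f w e b : e \notin s ->
  Ex p s f (upd w e b) = Ex p s (fun v => f (upd v e b)) w.
Proof.
elim: s w => //= a s IH w; rewrite inE negb_or => /andP[ne es].
by rewrite -!IH// !(updC _ _ _ ne).
Qed.

Lemma Ex_B p s f g w : Ex p s (fun v => f v - g v) w = Ex p s f w - Ex p s g w.
Proof.
rewrite -[- Ex p s g w]mulN1r -ExZ -ExD; by apply: Ex_eq => v; rewrite mulN1r.
Qed.

Definition infl e f : (E -> bool) -> R := fun v => f (upd v e true) - f (upd v e false).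

Lemma local_infl e f : local f -> local (infl e f).
Proof.
move=> [s d]; exists s => w w' H; rewrite /infl.
by congr (_ - _); apply: d => x xs; rewrite /upd; case: eqP => // _; apply: H.
Qed.

Lemma Ex_infl_head p s e f w : Ex p (e :: s) (infl e f) w = Ex p s (infl e f) w.
Proof.
rewrite /=.
have H b : Ex p s (infl e f) (upd w e b) = Ex p s (infl e f) w.
  apply: (@Ex_dep (fun x => x != e)) => [v v' h|x xe _]; last by rewrite upd_other.
  by rewrite /infl; congr (f _ - f _); apply/funext => x; rewrite /upd; case: eqP => // /eqP; apply: h.
by rewrite !H; ring.
Qed.

(** Russo's formula for an arbitrary function. An influence does not read the state of its own edge,
    so no factor for the pivotal edge to be open appears. *)
Lemma Ex_russo s f w p : uniq s ->
  is_derive p (1 : R) (fun q => Ex q s f w) (\sum_(e <- s) Ex p s (infl e f) w).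
Proof.
elim: s w => [|e s IH] w /=; first by rewrite big_nil => _; apply: is_derive_cst.
move=> /andP[es us].
have D1 := IH (upd w e true) us; have D0 := IH (upd w e false) us.
have DM := is_deriveM (is_derive_id p (1:R)) D1.
have DC : is_derive p (1 : R) (fun q : R => 1 - q) (- 1).
  by have := is_deriveB (is_derive_cst (1:R) p (1:R)) (is_derive_id p (1:R)); rewrite sub0r.
have DM0 := is_deriveM DC D0.
have DD := is_deriveD DM DM0.
apply: (is_derive_eq DD).
rewrite big_cons -/(Ex p (e :: s) (infl e f) w) Ex_infl_head /infl Ex_B -!Ex_upd//.
rewrite [in RHS]big_split/= -!mulr_sumr /GRing.scale/=.
ring.
Qed.

Lemma Ex_sqr p s f w : 0 <= p <= 1 -> (Ex p s f w) ^+ 2 <= Ex p s (fun v => f v ^+ 2) w.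
Proof.
move=> p01; set m := Ex p s f w.
have : 0 <= Ex p s (fun v => (f v - m) ^+ 2) w.
  rewrite -(Ex_cst p s 0 w); apply: Ex_le => // v; exact: sqr_ge0.
rewrite (@Ex_eq _ _ _ (fun v => f v ^+ 2 + ((- 2 * m) * f v + m ^+ 2))); last by move=> v; ring.
rewrite !ExD ExZ Ex_cst -/m; nra.
Qed.

(** Given the state of [e], the variance splits into the mean conditional variance and the variance
    [p * (1 - p) * (A - B) ^ 2] of the conditional mean, which Jensen's inequality bounds by the
    mean square influence of [e]. *)
Lemma Ex_efron_stein p s f w : 0 <= p <= 1 -> uniq s ->
  Ex p s (fun v => f v ^+ 2) w - (Ex p s f w) ^+ 2 <=
  \sum_(e <- s) p * (1 - p) * Ex p s (fun v => infl e f v ^+ 2) w.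
Proof.
move=> p01; have /andP[p0 p1] := p01.
elim: s w => [|e s IH] w /=; first by rewrite big_nil subrr.
move=> /andP[es us]; have h1 := IH (upd w e true) us; have h0 := IH (upd w e false) us.
rewrite big_cons /=.
rewrite (eq_bigr (fun j => p * (p * (1 - p) * Ex p s (fun v => infl j f v ^+ 2) (upd w e true))
  + (1 - p) * (p * (1 - p) * Ex p s (fun v => infl j f v ^+ 2) (upd w e false)))); last by move=> j _; ring.
rewrite big_split/= -!mulr_sumr.
have hJ := Ex_sqr s (infl e f) w p01.
have hd : Ex p s f (upd w e true) - Ex p s f (upd w e false) = Ex p s (infl e f) w.
  by rewrite /infl Ex_B -!Ex_upd.
have hc b : Ex p s (fun v => infl e f v ^+ 2) (upd w e b) = Ex p s (fun v => infl e f v ^+ 2) w.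
  apply: (@Ex_dep (fun x => x != e)) => [v v' h|x xe _]; last by rewrite upd_other.
  by rewrite /infl; congr ((f _ - f _) ^+ 2); apply/funext => x; rewrite /upd; case: eqP => // /eqP; apply: h.
rewrite -!mulr_sumr in h1 h0; rewrite !hc -hd in hJ *.
set V := Ex p s _ w in hJ *.
set S1 := (_ * \sum_(e <- s) _) in h1 *; set S0 := (_ * \sum_(e <- s) _) in h0 *.
set A2 := Ex p s (fun v => f v ^+ 2) (upd w e true) in h1 *; set B2 := Ex p s (fun v => f v ^+ 2) (upd w e false) in h0 *.
set A := Ex p s f (upd w e true) in h1 hJ *; set B := Ex p s f (upd w e false) in h0 hJ *.
have k1 : p * (A2 - A ^+ 2) <= p * S1 by rewrite ler_wpM2l.
have k0 : (1 - p) * (B2 - B ^+ 2) <= (1 - p) * S0 by rewrite ler_wpM2l// subr_ge0.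
have k2 : p * (1 - p) * (A - B) ^+ 2 <= p * (1 - p) * V by rewrite ler_wpM2l// mulr_ge0// subr_ge0.
have -> : p * (1 - p) * (p * V + (1 - p) * V) = p * (1 - p) * V by ring.
have -> : p * A2 + (1 - p) * B2 - (p * A + (1 - p) * B) ^+ 2 =
  p * (A2 - A ^+ 2) + (1 - p) * (B2 - B ^+ 2) + p * (1 - p) * (A - B) ^+ 2 by ring.
clearbody A B A2 B2 S1 S0 V; lra.
Qed.

(** Finite energy: whatever the other edges, those of [s] take the states prescribed by [w1] with
    probability at least [c ^ size s]. *)
Lemma Ex_lower p s g w w1 c : 0 <= c -> c <= p -> c <= 1 - p ->
  (forall v, 0 <= g v) -> (forall e, e \notin s -> w1 e = w e) ->
  c ^+ size s * g w1 <= Ex p s g w.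
Proof.
move=> c0 cp cq g0; have p01 : 0 <= p <= 1 by lra.
have Eg0 s' v : 0 <= Ex p s' g v by rewrite -(Ex_cst p s' 0 v); apply: Ex_le.
elim: s w => [|e s IH] w h /=.
  by rewrite mul1r; have -> : w1 = w by apply/funext => e; apply: h.
have : c ^+ size s * g w1 <= Ex p s g (upd w e (w1 e)).
  apply: IH => x xs; rewrite /upd; case: eqP => [->//|/eqP ne].
  by apply: h; rewrite inE negb_or ne.
have := Eg0 s (upd w e true); have := Eg0 s (upd w e false).
rewrite exprS -mulrA; set X := c ^+ _ * _.
have X0 : 0 <= X by rewrite /X mulr_ge0// exprn_ge0.
set a := Ex p s g (upd w e false); set b := Ex p s g (upd w e true).
case: (w1 e); rewrite -/a -/b => a0 b0 hX.
  apply: (@le_trans _ _ (p * b)); first by rewrite ler_pM.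
  by rewrite lerDl mulr_ge0//; lra.
apply: (@le_trans _ _ ((1 - p) * a)); first by rewrite ler_pM.
by rewrite lerDr mulr_ge0//; lra.
Qed.

Lemma Ex_map p s f phi w : injective phi ->
  Ex p (map phi s) (fun v => f (v \o phi)) w = Ex p s f (w \o phi).
Proof.
move=> inj; elim: s w => //= e s IH w; rewrite !IH.
by congr (_ * Ex _ _ _ _ + _ * Ex _ _ _ _); apply/funext => x; rewrite /upd /= (inj_eq inj).
Qed.

Lemma local_map (Y : Type) (f : (E -> bool) -> Y) phi :
  local f -> local (fun v => f (v \o phi)).
Proof.
move=> [s d]; exists (map phi s) => w w' h; apply: d => e es /=; apply: h.
exact: map_f.
Qed.

Lemma E_map p f phi : injective phi -> local f -> E_ p (fun v => f (v \o phi)) = E_ p f.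
Proof.
move=> inj [s d]; rewrite (@E_E p s f ((fun=> false) \o phi))// -Ex_map//.
apply: E_E => w w' h; apply: d => e es /=; apply: h.
exact: map_f.
Qed.

Lemma Ex_neg p s f w : Ex p s (fun v => f (negb \o v)) w = Ex (1 - p) s f (negb \o w).
Proof.
elim: s w => //= e s IH w; rewrite !IH.
have H b : negb \o upd w e b = upd (negb \o w) e (~~ b).
  by apply/funext => x; rewrite /upd /=; case: eqP.
rewrite !H /=; ring.
Qed.

Lemma E_neg p f : local f -> E_ p (fun v => f (negb \o v)) = E_ (1 - p) f.
Proof.
move=> [s d]; rewrite (@E_E _ s f (negb \o (fun=> false)))// -Ex_neg.
by apply: E_E => w w' h; apply: d => e es /=; rewrite h.
Qed.

Lemma local_neg (Y : Type) (f : (E -> bool) -> Y) : local f -> local (fun v => f (negb \o v)).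
Proof. by move=> [s d]; exists s => w w' h; apply: d => e es /=; rewrite h. Qed.

Lemma E_edge p e : E_ p (fun w => (w e)%:R) = p.
Proof.
rewrite (@E_E _ [:: e] _ (fun=> false)) /=; first by rewrite /upd eqxx /= mulr1 mulr0 addr0.
by move=> w w' h; rewrite h// inE.
Qed.

Lemma Ex_prod p s (h : E -> bool -> R) w : uniq s ->
  Ex p s (fun v => \prod_(e <- s) h e (v e)) w =
  \prod_(e <- s) (p * h e true + (1 - p) * h e false).
Proof.
elim: s w => [|e s IH] w /=; first by rewrite !big_nil.
move=> /andP[es us]; rewrite big_cons -(IH w)//.
have H b : Ex p s (fun v => \prod_(j <- e :: s) h j (v j)) (upd w e b) =
  h e b * Ex p s (fun v => \prod_(j <- s) h j (v j)) w.
  rewrite -ExZ Ex_upd//; apply: Ex_eq => v; rewrite big_cons upd_same; congr (_ * _).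
  rewrite big_seq [RHS]big_seq; apply: eq_bigr => j js; rewrite upd_other//.
  by apply: contraNneq es => <-.
rewrite !H; ring.
Qed.

Lemma E_prod p s (h : E -> bool -> R) : uniq s ->
  E_ p (fun v => \prod_(e <- s) h e (v e)) =
  \prod_(e <- s) (p * h e true + (1 - p) * h e false).
Proof.
move=> us; rewrite -(Ex_prod p h (fun=> false) us); apply: E_E => w w' H.
by rewrite big_seq [RHS]big_seq; apply: eq_bigr => e es; rewrite H.
Qed.

End Expectation.

(** * Probabilities of local events *)

Section Probability.
Variables (R : realType) (E : choiceType).
Implicit Types (w : E -> bool) (A B : (E -> bool) -> Prop) (s : seq E) (p : R).

Definition ind (A : Prop) : R := (`[<A>])%:R.

Definition pr p A : R := E_ p (fun w => ind (A w)).

Lemma indT (A : Prop) : A -> ind A = 1.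
Proof. by move=> a; rewrite /ind asboolT. Qed.

Lemma indF (A : Prop) : ~ A -> ind A = 0.
Proof. by move=> a; rewrite /ind asboolF. Qed.

Lemma ind_ge0 (A : Prop) : 0 <= ind A.
Proof. by rewrite /ind ler0n. Qed.

Lemma ind_le1 (A : Prop) : ind A <= 1.
Proof. by rewrite /ind lern1 leq_b1. Qed.

Lemma ind_le (A B : Prop) : (A -> B) -> ind A <= ind B.
Proof.
move=> AB; have [a|na] := pselect A; first by rewrite !indT//; apply: AB.
by rewrite (indF na) ind_ge0.
Qed.

Lemma indI (A B : Prop) : ind (A /\ B) = ind A * ind B.
Proof. by rewrite /ind asbool_and -natrM mulnb. Qed.

Lemma indN (A : Prop) : ind (~ A) = 1 - ind A.
Proof. by rewrite /ind asbool_neg; case: asboolP => _; rewrite ?subrr ?subr0. Qed.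

Lemma ind_bool (b : bool) : ind b = b%:R.
Proof. by rewrite /ind asboolb. Qed.

Lemma ind_orle (A B : Prop) : ind (A \/ B) <= ind A + ind B.
Proof.
have [a|na] := pselect A; first by rewrite (indT a) (le_trans (ind_le1 _))// lerDl ind_ge0.
by rewrite (indF na) add0r; apply: ind_le => -[].
Qed.

Lemma ind_ex_le (I : eqType) (r : seq I) (A : I -> Prop) :
  ind (exists2 i, i \in r & A i) <= \sum_(i <- r) ind (A i).
Proof.
elim: r => [|i r IH]; first by rewrite big_nil indF// => -[].
rewrite big_cons; apply: le_trans (lerD (lexx _) IH); apply: le_trans (ind_orle _ _).
apply: ind_le => -[j]; rewrite inE => /orP[/eqP->|jr] Aj; [by left|by right; exists j].
Qed.

Lemma deponP (D : pred E) A :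
  (forall w w', (forall e, D e -> w e = w' e) -> A w -> A w') -> depon D A.
Proof.
move=> h w w' H; apply/propext; split; first exact: h.
by apply: h => e /H.
Qed.

Lemma local_ind A : local A -> local (fun w => ind (A w)).
Proof. exact: (local1 ind). Qed.

Lemma local_and A B : local A -> local B -> local (fun w => A w /\ B w).
Proof. exact: (local2 and). Qed.

Lemma local_or A B : local A -> local B -> local (fun w => A w \/ B w).
Proof. exact: (local2 or). Qed.

Lemma local_not A : local A -> local (fun w => ~ A w).
Proof. exact: (local1 not). Qed.

Lemma local_ex (I : eqType) (r : seq I) (F : I -> (E -> bool) -> Prop) :
  (forall i, i \in r -> local (F i)) -> local (fun w => exists2 i, i \in r & F i w).
Proof.
move=> h; have [s d] := local_seq h; exists s; apply: deponP => w w' H [i ir Fi].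
by exists i => //; rewrite -(d i ir w w').
Qed.

Lemma local_all (I : eqType) (r : seq I) (F : I -> (E -> bool) -> Prop) :
  (forall i, i \in r -> local (F i)) -> local (fun w => forall i, i \in r -> F i w).
Proof.
move=> h; have [s d] := local_seq h; exists s; apply: deponP => w w' H hF i ir.
by rewrite -(d i ir w w')//; apply: hF.
Qed.

Lemma local_openedge e : local (fun w => w e : Prop).
Proof. exact: (local1 is_true (local_edge e)). Qed.

Section p01.
Variable p : R.
Hypothesis p01 : 0 <= p <= 1.

Lemma pr_le A B : local A -> local B -> (forall w, A w -> B w) -> pr p A <= pr p B.
Proof. by move=> lA lB AB; apply: E_le; [done|exact: local_ind|exact: local_ind|move=> v; exact/ind_le/AB]. Qed.

Lemma pr_ge0 A : local A -> 0 <= pr p A.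
Proof. by move=> lA; apply: E_ge0; [done|exact: local_ind|move=> v; exact: ind_ge0]. Qed.

Lemma pr_le1 A : local A -> pr p A <= 1.
Proof.
move=> lA; rewrite -(E_cst E p 1); apply: E_le; [done|exact: local_ind|exact: local_cst|move=> v; exact: ind_le1].
Qed.

Lemma pr_not A : local A -> pr p (fun w => ~ A w) = 1 - pr p A.
Proof.
move=> lA; rewrite /pr -[1 in RHS](E_cst E p) -E_B; [|exact: local_cst|exact: local_ind].
by apply: E_eq => v; rewrite indN.
Qed.

Lemma pr_or A B : local A -> local B -> pr p (fun w => A w \/ B w) <= pr p A + pr p B.
Proof.
move=> lA lB; rewrite /pr -E_D; [|exact: local_ind|exact: local_ind].
apply: E_le; [done|exact/local_ind/local_or|by apply: local2; apply: local_ind|move=> v; exact: ind_orle].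
Qed.

Lemma pr_ex (I : eqType) (r : seq I) (F : I -> (E -> bool) -> Prop) :
  (forall i, i \in r -> local (F i)) ->
  pr p (fun w => exists2 i, i \in r & F i w) <= \sum_(i <- r) pr p (F i).
Proof.
move=> h; rewrite -E_sum; last by move=> i ir _; exact/local_ind/h.
apply: E_le; [done|exact/local_ind/local_ex| |move=> v; exact: ind_ex_le].
by apply: local_sum => i ir _; exact/local_ind/h.
Qed.

Lemma pr_markov (f : (E -> bool) -> R) (c : R) : local f -> (forall w, 0 <= f w) ->
  c * pr p (fun w => c <= f w) <= E_ p f.
Proof.
move=> lf f0; have l1 : local (fun w => ind (c <= f w)) by apply: (local1 (fun y => ind (c <= y))).
rewrite /pr -E_Z//; apply: E_le; [done|exact: local1|done|move=> v].
have [h|h] := boolP (c <= f v); first by rewrite indT// mulr1.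
by rewrite indF ?mulr0//; apply/negP.
Qed.

End p01.

Lemma pr_map p A phi : injective phi -> local A ->
  pr p (fun w => A (w \o phi)) = pr p A.
Proof. by move=> inj lA; apply: (E_map p inj (local_ind lA)). Qed.

Lemma pr_neg p A : local A -> pr p (fun w => A (negb \o w)) = pr (1 - p) A.
Proof. by move=> lA; apply: (E_neg p (local_ind lA)). Qed.

Lemma pr_eq p A B : (forall w, A w <-> B w) -> pr p A = pr p B.
Proof. by move=> AB; apply: E_eq => v; congr ind; apply/propext. Qed.

Lemma pr_indep (D1 D2 : pred E) p A B : local A -> local B -> depon D1 A -> depon D2 B ->
  (forall e, D1 e -> D2 e -> False) -> pr p (fun w => A w /\ B w) = pr p A * pr p B.
Proof.
move=> lA lB d1 d2 D; rewrite /pr -(@E_indep R E D1 D2).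
- by apply: E_eq => v; rewrite indI.
- exact: local_ind.
- exact: local_ind.
- by move=> w w' h; rewrite (d1 w w').
- by move=> w w' h; rewrite (d2 w w').
- exact: D.
Qed.

End Probability.

(** * Transfer to an arbitrary Bernoulli percolation *)

Section Link.
Variables (d : measure_display) (T : measurableType d) (R : realType) (P : probability T R).
Variables (p : R) (w : T -> config).
Hypothesis wP : bernoulli_percolation P p w.

Lemma measurable_cylinder (r : seq edge) (b : edge -> bool) :
  measurable [set t | forall e, e \in r -> w t e = b e].
Proof.
elim: r => [|e r IH].
  by rewrite (_ : [set t | _] = setT)//; apply/seteqP; split => t.
rewrite (_ : [set t | _] = [set t | w t e = b e] `&` [set t | forall e, e \in r -> w t e = b e]).
  apply: measurableI => //; have := wP.1 e; case: (b e) => // h.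
  rewrite (_ : [set t | _] = ~` [set t | w t e]); first exact: measurableC.
  by apply/seteqP; split => t /=; case: (w t e).
apply/seteqP; split => t /=.
  by move=> h; split => [|x xr]; apply: h; rewrite inE ?eqxx// xr orbT.
by move=> [h1 h2] x; rewrite inE => /orP[/eqP->//|/h2].
Qed.

(** The statement is generalized over cylinders so that the edges still to be integrated, in [s],
    can be moved one by one to the list [r] of edges with a prescribed state. *)
Lemma cylinder_pr (A : config -> Prop) (s r : seq edge) (b : edge -> bool) :
  uniq (s ++ r) -> depon (fun e => e \in s ++ r) A ->
  measurable [set t | (forall e, e \in r -> w t e = b e) /\ A (w t)] /\
  P [set t | (forall e, e \in r -> w t e = b e) /\ A (w t)] =
  ((\prod_(e <- r) (if b e then p else 1 - p)) * Ex p s (fun v => ind R (A v)) b)%:E.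
Proof.
elim: s r b => [|e s IH] r b us dA /=.
  have [Ab|nA] := pselect (A b); last first.
    rewrite indF// mulr0 (_ : [set t | _] = set0) ?measure0//.
    by apply/seteqP; split => t //= -[h]; rewrite (dA (w t) b).
  rewrite indT// mulr1 (_ : [set t | _] = [set t | forall e, e \in r -> w t e = b e]).
    by split; [exact: measurable_cylinder|exact: wP.2].
  by apply/seteqP; split => t //= => [[]//|h]; split => //; rewrite (dA (w t) b).
have pe : perm_eq (s ++ e :: r) ((e :: s) ++ r) by rewrite -[e :: r]cat1s perm_catCA.
have us' : uniq (s ++ e :: r) by rewrite (perm_uniq pe).
have dA' : depon (fun x => x \in s ++ e :: r) A.
  by apply: depon_sub dA => x; rewrite (perm_mem pe).
have er : e \notin r by move: us => /=; rewrite mem_cat negb_or => /andP[/andP[]].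
pose C c := [set t | (forall x, x \in e :: r -> w t x = upd b e c x) /\ A (w t)].
have [m1 e1] : measurable (C true) /\ P (C true) = _ := IH (e :: r) (upd b e true) us' dA'.
have [m0 e0] : measurable (C false) /\ P (C false) = _ := IH (e :: r) (upd b e false) us' dA'.
have eP c : \prod_(x <- r) (if upd b e c x then p else 1 - p) = \prod_(x <- r) (if b x then p else 1 - p).
  rewrite big_seq [RHS]big_seq; apply: eq_bigr => x xr; rewrite upd_other//.
  by apply: contraNneq er => <-.
rewrite (_ : [set t | _] = C true `|` C false).
  split; first exact: measurableU.
  have disj : C true `&` C false = set0.
    apply/seteqP; split => t //= [[h1 _] [h0 _]].
    by have := h1 e (mem_head _ _); rewrite h0 ?mem_head// !upd_same.
  transitivity (P (C true) + P (C false))%E; first exact: measureU.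
  rewrite e1 e0 !big_cons !eP !upd_same -EFinD; congr EFin; ring.
have H c t : w t e = c -> (forall x, x \in r -> w t x = b x) <->
    (forall x, x \in e :: r -> w t x = upd b e c x).
  move=> ec; split => h x.
    rewrite inE /upd; case: eqP => [->//|_ /= xr]; exact: h.
  move=> xr; rewrite h ?inE ?xr ?orbT// upd_other//.
  by apply: contraNneq er => <-.
apply/seteqP; split => t /=.
  move=> [h At]; case E : (w t e); [left|right]; split => //; exact/H.
move=> [] [h At]; split => //; move: (h e (mem_head _ _)); rewrite upd_same => ec.
  by apply/(H true).
by apply/(H false).
Qed.

Lemma percolation_pr (A : config -> Prop) : local A ->
  measurable [set t | A (w t)] /\ P [set t | A (w t)] = (pr p A)%:E.
Proof.
move=> [s0 dA0]; pose s := undup s0.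
have dA : depon (fun e => e \in s) A by apply: depon_sub dA0 => e; rewrite mem_undup.
have us : uniq (s ++ [::]) by rewrite cats0 undup_uniq.
have dA' : depon (fun e => e \in s ++ [::]) A by rewrite cats0.
have := cylinder_pr (fun=> false) us dA'.
rewrite (_ : [set t | _ /\ _] = [set t | A (w t)]).
  move=> [m ->]; split => //; rewrite big_nil mul1r; congr EFin.
  rewrite /pr (@E_E _ _ p s _ (fun=> false))// => v v' H.
  by rewrite (dA v v').
by apply/seteqP; split => t /= => [[]|].
Qed.

End Link.
Arguments local_ind {R E A}.

Section IncreasingEvents.
Variables (R : realType) (E : choiceType).
Implicit Types (A B : (E -> bool) -> Prop) (p : R).

Definition incr A := forall w w' : E -> bool, (forall e, w e -> w' e) -> A w -> A w'.

Lemma incr_mono A : incr A -> mono (fun w => ind R (A w)).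
Proof. by move=> iA w w' h; apply: ind_le; apply: iA. Qed.

Lemma pr_incr p p' A : 0 <= p -> p <= p' -> p' <= 1 -> local A -> incr A ->
  pr p A <= pr p' A.
Proof.
by move=> p0 pp p1 lA iA; apply: E_mono_p => //; [exact: local_ind|exact: incr_mono].
Qed.

Lemma pr_FKG_dec p A B : 0 <= p <= 1 -> local A -> local B -> incr A -> incr B ->
  pr p (fun w => ~ A w) * pr p (fun w => ~ B w) <= pr p (fun w => ~ A w /\ ~ B w).
Proof.
move=> p01 lA lB iA iB.
have l1 : local (fun w => ind R (~ A w)) by apply/local_ind/local_not.
have l2 : local (fun w => ind R (~ B w)) by apply/local_ind/local_not.
have := @E_FKG R E p (fun w => - ind R (~ A w)) (fun w => - ind R (~ B w)) p01.
rewrite !E_N// mulrNN => /(_ (local1 _ l1) (local1 _ l2)).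
have mN C : incr C -> mono (fun w => - ind R (~ C w)).
  by move=> iC w w' h; rewrite lerN2; apply: ind_le => nC Cw; apply: nC; apply: iC Cw.
move=> /(_ (mN _ iA) (mN _ iB)) /le_trans; apply.
by rewrite le_eqVlt; apply/orP; left; apply/eqP/E_eq => v; rewrite mulrNN indI.
Qed.

End IncreasingEvents.

(** * The lattice and its dual *)

Section Lattice.
Implicit Types (u v x y c : vertex) (e : edge) (w : config) (V U : pred vertex).

Definition nrm v : nat := maxn `|v.1|%N `|v.2|%N.
Arguments nrm v%_R.

Definition src e : vertex := e.1.
Definition tgt e : vertex := if e.2 then (e.1.1, e.1.2 + 1) else (e.1.1 + 1, e.1.2).

Definition nb u v : bool := ostep (fun=> true) u v.

Definition eo u v : edge :=
  if v == (u.1 + 1, u.2) then (u, false) else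
  if u == (v.1 + 1, v.2) then (v, false) else
  if v == (u.1, u.2 + 1) then (u, true) else (v, true).

Lemma ostep_src w e : ostep w (src e) (tgt e) = w e.
Proof.
case: e => [[x y] []]; rewrite /ostep /src /tgt /= !xpair_eqE.
  have -> : (x == x + 1) = false by lia.
  have -> : (y == y + 1 + 1) = false by lia.
  by rewrite !eqxx /= orbF.
have -> : (x == x + 1 + 1) = false by lia.
have -> : (y == y + 1) = false by lia.
by rewrite !eqxx /= !andbF !orbF.
Qed.

Variant nb_spec u v : edge -> Prop :=
| NbFwd e of u = src e & v = tgt e : nb_spec u v e
| NbBwd e of v = src e & u = tgt e : nb_spec u v e.

Lemma eoP u v : nb u v -> nb_spec u v (eo u v).
Proof.
rewrite /nb /ostep /eo !andbT; case: ifP => [/eqP e _|_ /=].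
  by apply: NbFwd => //; rewrite e.
case: ifP => [/eqP e _|_ /=]; first by apply: NbBwd => //; rewrite e.
case: ifP => [/eqP e _|_ /= /eqP e]; first by apply: NbFwd => //; rewrite e.
by apply: NbBwd => //; rewrite e.
Qed.

Lemma ostepC w u v : ostep w u v = ostep w v u.
Proof. by rewrite /ostep; do 4![case: (_ && _) => //=]. Qed.

Lemma nb_src e : nb (src e) (tgt e).
Proof. by rewrite /nb ostep_src. Qed.

Lemma ostepE w u v : ostep w u v = nb u v && w (eo u v).
Proof.
have [n|nn] := boolP (nb u v); last first.
  apply/negbTE; apply: contraNN nn; rewrite /nb /ostep !andbT.
  by move=> /or4P[] /andP[-> _]; rewrite ?orbT.
by case: (eoP n) => e -> ->; rewrite /= ?(ostepC _ (tgt e)) ostep_src.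
Qed.

Lemma eo_src e : eo (src e) (tgt e) = e.
Proof.
pose w : config := fun a : edge => a == e.
by have := ostep_src w e; rewrite ostepE nb_src /= /w eqxx => /eqP.
Qed.

Lemma nbC u v : nb u v = nb v u.
Proof. exact: ostepC. Qed.

Lemma eoC u v : nb u v -> eo u v = eo v u.
Proof.
move=> n; pose w : config := fun a : edge => a == eo u v.
have := ostepC w u v; rewrite !ostepE n nbC n /= /w eqxx => /esym/eqP ->//.
Qed.

Lemma ostep_nb w u v : ostep w u v -> nb u v.
Proof. by rewrite ostepE => /andP[]. Qed.

Lemma ostep_mono w w' u v : (forall e, w e -> w' e) -> ostep w u v -> ostep w' u v.
Proof. by move=> h; rewrite !ostepE => /andP[-> /h]. Qed.

Lemma nb_nrm u v : nb u v -> nrm (v - u) = 1%N.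
Proof.
rewrite /nb /ostep !andbT /nrm; case: u v => [a b] [c d] /=; rewrite !xpair_eqE /=.
lia.
Qed.

Lemma nrmD u v : (nrm (u + v) <= nrm u + nrm v)%N.
Proof. rewrite /nrm; case: u v => [a b] [c d] /=; lia. Qed.

Lemma nrmN u : nrm (- u) = nrm u.
Proof. rewrite /nrm; case: u => [a b] /=; lia. Qed.

Lemma nrm_dist u v x : (nrm (u - x) <= nrm (u - v) + nrm (v - x))%N.
Proof. by have := nrmD (u - v) (v - x); rewrite addrA subrK. Qed.

Lemma nrmC u v : nrm (u - v) = nrm (v - u).
Proof. by rewrite -nrmN opprB. Qed.

Lemma nb_dist u v x : nb u v -> (nrm (v - x) <= (nrm (u - x)).+1)%N.
Proof. by move=> /nb_nrm n; have := nrm_dist v u x; rewrite n add1n. Qed.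

Lemma nrm0 u : nrm (u - u) = 0%N.
Proof. by rewrite subrr. Qed.

Definition vbox c n : seq vertex :=
  [seq (c.1 - n%:Z + i%:Z, c.2 - n%:Z + j%:Z) | i <- iota 0 (2 * n).+1, j <- iota 0 (2 * n).+1].

Lemma mem_vbox c n v : (v \in vbox c n) = (nrm (v - c) <= n)%N.
Proof.
case: c v => [c1 c2] [v1 v2]; apply/allpairsP/idP.
  move=> [[i j] []]; rewrite !mem_iota /nrm /= => hi hj [-> ->]; lia.
move=> h; exists (absz (v1 - c1 + n%:Z), absz (v2 - c2 + n%:Z)).
move: h; rewrite !mem_iota /nrm /= => h; split; [lia|lia|congr pair; lia].
Qed.

Lemma vbox_uniq c n : uniq (vbox c n).
Proof.
apply: allpairs_uniq; rewrite ?iota_uniq// => -[i j] [i' j'] _ _ /= [h1 h2].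
congr pair; lia.
Qed.

Lemma size_vbox c n : size (vbox c n) = ((2 * n).+1 ^ 2)%N.
Proof. by rewrite size_allpairs size_iota mulnn. Qed.

Definition ebox c n : seq edge := [seq (v, b) | v <- vbox c n, b <- [:: false; true]].

Lemma mem_ebox c n e : (e \in ebox c n) = (nrm (e.1 - c) <= n)%N.
Proof.
apply/allpairsP/idP => [[[v b] /= []]|]; first by rewrite mem_vbox => h _ ->.
by case: e => v b h; exists (v, b); rewrite mem_vbox; split => //; case: (b).
Qed.

Lemma ebox_uniq c n : uniq (ebox c n).
Proof. by apply: allpairs_uniq; rewrite ?vbox_uniq// => -[i j] [i' j'] _ _. Qed.

Lemma size_ebox c n : size (ebox c n) = (2 * (2 * n).+1 ^ 2)%N.
Proof. by rewrite size_allpairs size_vbox mulnC. Qed.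

Definition connin w V u v : Prop :=
  exists s, [/\ path (ostep w) u s, last u s = v & all V (u :: s)].

Lemma connin_refl w V u : V u -> connin w V u u.
Proof. by move=> Vu; exists [::]; rewrite /= Vu. Qed.

Lemma connin_trans w V u v x : connin w V u v -> connin w V v x -> connin w V u x.
Proof.
move=> [s [ps ls as_]] [t [pt lt at_]]; exists (s ++ t).
rewrite cat_path ps ls pt last_cat ls lt; split => //.
by move: as_ at_; rewrite -cat_cons all_cat => -> /= /andP[].
Qed.

Lemma connin_sym w V u v : connin w V u v -> connin w V v u.
Proof.
move=> [s [ps ls as_]]; exists (rev (belast u s)); split.
- by rewrite -ls rev_path; apply: sub_path ps => x y; rewrite ostepC.
- by case: s {ps as_} ls => [<-//|a s] _; rewrite /= rev_cons last_rcons.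
- by rewrite -ls -rev_rcons -lastI all_rev.
Qed.

Lemma connin_step w V u v : V u -> V v -> ostep w u v -> connin w V u v.
Proof. by move=> Vu Vv s; exists [:: v]; rewrite /= s Vu Vv. Qed.

Lemma connin_sub w w' V V' u v :
  (forall x y, V x -> V y -> ostep w x y -> ostep w' x y) ->
  (forall x, V x -> V' x) -> connin w V u v -> connin w' V' u v.
Proof.
move=> h VV [s [ps ls as_]]; exists s; split => //; last by apply: sub_all as_.
elim: s u ps {ls} as_ => //= x s IH u /andP[st ps] /and3P[Vu Vx as_].
by rewrite h//= IH//= Vx.
Qed.

Lemma connin_incr w w' V u v : (forall e, w e -> w' e) -> connin w V u v -> connin w' V u v.
Proof. by move=> h; apply: connin_sub => // x y _ _; apply: ostep_mono. Qed.

Lemma connin_subV w V V' u v : (forall x, V x -> V' x) -> connin w V u v -> connin w V' u v.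
Proof. by move=> h; apply: connin_sub. Qed.

Lemma connin_l w V u v : connin w V u v -> V u.
Proof. by move=> [s [_ _ /= /andP[]]]. Qed.

Lemma connin_r w V u v : connin w V u v -> V v.
Proof. by move=> /connin_sym/connin_l. Qed.

Lemma connin_ind w V u v (Q : vertex -> Prop) : connin w V u v -> Q u ->
  (forall x y, V x -> V y -> ostep w x y -> Q x -> Q y) -> Q v.
Proof.
move=> [s [ps ls as_]] Qu h; elim: s u ps ls as_ Qu => /= [u _ <-//|x s IH u].
move=> /andP[st ps] ls /and3P[Vu Vx as_] Qu; apply: (IH x) => //=; first by rewrite Vx.
exact: (h u).
Qed.

Lemma first_exit w V U u v : connin w V u v -> U u -> ~~ U v ->
  exists x y, [/\ connin w (predI V U) u x, ostep w x y, ~~ U y & V y].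
Proof.
move=> [s [ps ls as_]]; elim: s u ps ls as_ => /= [u _ <- _ ->//|y s IH u].
move=> /andP[st ps] ls /and3P[Vu Vy as_] Uu nUv.
have [Uy|nUy] := boolP (U y); last first.
  by exists u, y; split => //; apply: connin_refl; rewrite /= Vu.
have [|x [z [c1 c2 c3 c4]]] := IH y ps ls _ Uy nUv; first by rewrite Vy.
exists x, z; split => //; apply: connin_trans c1; apply: connin_step => //=; by rewrite ?Vu ?Vy.
Qed.

Lemma connin_predT w u v : connin w predT u v <-> conn w u v.
Proof.
split=> [[s [ps ls _]]|[n [s [_ [ps ls]]]]]; first by exists (size s), s.
by exists s; rewrite all_predT.
Qed.

Lemma connin_dep V u v :
  depon (fun e => V (src e) && V (tgt e)) (fun w => connin w V u v).
Proof.
apply: deponP => w w' h; apply: connin_sub => // x y Vx Vy.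
rewrite !ostepE => /andP[n we]; rewrite n -h//.
by case: (eoP n) => e <- <-; rewrite Vx Vy.
Qed.

Lemma connin_dep_box V c n u v : (forall x, V x -> (nrm (x - c) <= n)%N) ->
  depon (fun e => e \in ebox c n) (fun w => connin w V u v).
Proof.
move=> h; apply: depon_sub (@connin_dep V u v) => e /andP[Vs _].
by rewrite mem_ebox; apply: h.
Qed.

Lemma connin_local V c n u v : (forall x, V x -> (nrm (x - c) <= n)%N) ->
  local (fun w => connin w V u v).
Proof. by move=> h; exists (ebox c n); apply: connin_dep_box. Qed.

Definition inbox c n : pred vertex := fun x => (nrm (x - c) <= n)%N.

Definition reach w u n : Prop := exists v, connin w (inbox u n) u v /\ (n <= nrm (v - u))%N.

Lemma reachP w u n V v : connin w V u v -> (n <= nrm (v - u))%N ->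
  exists x, connin w (predI V (inbox u n)) u x /\ (n <= nrm (x - u))%N.
Proof.
move=> c h; pose U x := (nrm (x - u) < n)%N.
have [n0|n0] := posnP n.
  by exists u; rewrite n0; split => //; apply: connin_refl; rewrite /= (connin_l c) /inbox nrm0.
have [||x [y [c1 c2 c3 c4]]] := first_exit c (U := U).
- by rewrite /U nrm0.
- by rewrite /U -leqNgt.
exists y; move: c3; rewrite /U -leqNgt => c3; split => //.
have hx : (nrm (x - u) < n)%N by have /andP[] := connin_r c1.
apply: (@connin_trans _ _ _ x).
  by apply: connin_subV c1 => z /andP[/= -> /ltnW].
apply: connin_step => //=.
  by have /andP[-> _] := connin_r c1; apply: ltnW.
rewrite c4; have := nb_dist u (ostep_nb c2); rewrite /inbox; lia.
Qed.

Lemma reach_conn w u n V v : connin w V u v -> (n <= nrm (v - u))%N -> reach w u n.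
Proof.
move=> c h; have [x [c1 c2]] := reachP c h; exists x; split => //.
by apply: connin_subV c1 => z /andP[].
Qed.

Lemma reach_le w u n m : (n <= m)%N -> reach w u m -> reach w u n.
Proof. by move=> nm [v [c h]]; apply: reach_conn c _; lia. Qed.

Lemma reach_dep u n : depon (fun e => e \in ebox u n) (fun w => reach w u n).
Proof.
apply: deponP => w w' h [v [c hv]]; exists v; split => //.
by rewrite -(@connin_dep_box (inbox u n) u n u v _ w w').
Qed.

Lemma reach_local u n : local (fun w => reach w u n).
Proof. by exists (ebox u n); apply: reach_dep. Qed.

Lemma reach_incr u n : incr (fun w => reach w u n).
Proof. by move=> w w' h [v [c hv]]; exists v; split => //; apply: connin_incr c. Qed.

Lemma inf_reach w u : inf_cluster w u <-> forall n, reach w u n.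
Proof.
split=> [h n|h N].
  (* [inf_cluster] uses the l1 norm from the origin, [reach] the sup norm from [u]: an l1 norm above
     [2 n + 2 nrm u] forces a sup distance of at least [n] from [u]. *)
  have [v [/connin_predT c hv]] := h (2 * n + 2 * nrm u)%N.
  apply: (reach_conn c); clear c.
  move: hv; rewrite /nrm; clear h; case: u v => [a b] [a' b'] /=; lia.
have [v [c hv]] := h (N + nrm u + 1)%N; exists v; split.
  by apply/connin_predT; apply: connin_subV c.
move: hv; rewrite /nrm; clear h c; case: u v => [a b] [a' b'] /=; lia.
Qed.

Lemma inf_cluster_conn w u v : inf_cluster w u -> conn w u v -> inf_cluster w v.
Proof.
move=> h /connin_predT c N; have [x [/connin_predT cx hx]] := h N; exists x; split => //.
by apply/connin_predT; apply: connin_trans cx; apply: connin_sym.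
Qed.

Definition translate (z : vertex) w : config := w \o (fun e => (e.1 + z, e.2)).

Lemma ostep_shift z w u v : ostep (translate z w) u v = ostep w (u + z) (v + z).
Proof.
rewrite /ostep /translate /=; case: z u v => [z1 z2] [a b] [c d]; rewrite !xpair_eqE /=.
have -> : (c + z1 == a + z1 + 1) = (c == a + 1) by lia.
have -> : (a + z1 == c + z1 + 1) = (a == c + 1) by lia.
have -> : (d + z2 == b + z2) = (d == b) by lia.
have -> : (b + z2 == d + z2) = (b == d) by lia.
have -> : (d + z2 == b + z2 + 1) = (d == b + 1) by lia.
have -> : (b + z2 == d + z2 + 1) = (b == d + 1) by lia.
have -> : (c + z1 == a + z1) = (c == a) by lia.
have -> : (a + z1 == c + z1) = (a == c) by lia.
by [].
Qed.

Lemma connin_map w w' V V' (phi : vertex -> vertex) u v :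
  (forall x y, V x -> V y -> ostep w x y -> ostep w' (phi x) (phi y)) ->
  (forall x, V x -> V' (phi x)) -> connin w V u v -> connin w' V' (phi u) (phi v).
Proof.
move=> h VV c; have Vu := connin_l c.
apply: (connin_ind c (Q := fun x => connin w' V' (phi u) (phi x))).
  by apply: connin_refl; apply: VV.
move=> x y Vx Vy st c'; apply: connin_trans c' _; apply: connin_step; [exact: VV|exact: VV|exact: h].
Qed.

Lemma connin_shift z w V u v :
  connin (translate z w) V u v <-> connin w (fun x => V (x - z)) (u + z) (v + z).
Proof.
split=> c.
  apply: (connin_map (phi := fun x => x + z)) c => [x y _ _|x]; first by rewrite ostep_shift.
  by rewrite addrK.
rewrite -(addrK z u) -(addrK z v).
apply: (connin_map (phi := fun x => x - z)) c => [x y _ _|x]//.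
by rewrite ostep_shift !subrK.
Qed.

Lemma shift_inj (z : vertex) : injective (fun e : edge => (e.1 + z, e.2)).
Proof. by move=> [[a b] c] [[a' b'] c'] [/addIr -> /addIr -> ->]. Qed.

Lemma pr_shift (R : realType) (p : R) z (A : config -> Prop) : local A ->
  pr p (fun w => A (translate z w)) = pr p A.
Proof. by move=> lA; rewrite /translate (pr_map p (@shift_inj z) lA). Qed.

Lemma local_shift (Y : Type) z (A : config -> Y) : local A -> local (fun w => A (translate z w)).
Proof. by move=> lA; apply: (local_map _ lA). Qed.

Lemma E_shift (R : realType) (p : R) z (f : config -> R) : local f ->
  E_ p (fun w => f (translate z w)) = E_ p f.
Proof. by move=> lf; rewrite /translate (E_map p (@shift_inj z) lf). Qed.

Lemma reach_shift z w u n : reach (translate z w) u n <-> reach w (u + z) n.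
Proof.
have H x : x + z - (u + z) = x - u by rewrite opprD addrACA subrr addr0.
split=> [[v [/connin_shift c hv]]|[v [c hv]]].
  exists (v + z); rewrite H; split => //; apply: connin_subV c => x.
  by rewrite /inbox -(H (x - z)) subrK.
exists (v - z); rewrite -[v - z - u](H) subrK; split => //.
apply/connin_shift; rewrite subrK; apply: connin_subV c => x.
by rewrite /inbox -(H (x - z)) subrK.
Qed.

Lemma pr_reach (R : realType) (p : R) u n :
  pr p (fun w => reach w u n) = pr p (fun w => reach w origin n).
Proof.
rewrite -[RHS](pr_shift p u); last exact: reach_local.
by apply: pr_eq => w; rewrite reach_shift add0r.
Qed.

(** The dual lattice is encoded on the same vertices: [(x, y)] stands for the centre of the face
    with lower left corner [(x, y)], and [dual_e e] is the primal edge crossed by the dual edge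
    [e]. *)
Definition dual_e e : edge :=
  if e.2 then ((e.1.1, e.1.2 + 1), false) else ((e.1.1 + 1, e.1.2), true).

Definition dual w : config := fun e => ~~ w (dual_e e).

Lemma dual_e_inj : injective dual_e.
Proof.
move=> [[a b] []] [[c d] []] //= [].
- by move=> -> /addIr ->.
- by move=> /addIr -> ->.
Qed.

Lemma local_dual (Y : Type) (A : config -> Y) : local A -> local (fun w => A (dual w)).
Proof. by move=> lA; apply: (local_map dual_e (local_neg lA)). Qed.

Lemma pr_dual (R : realType) (p : R) (A : config -> Prop) : local A ->
  pr p (fun w => A (dual w)) = pr (1 - p) A.
Proof.
by move=> lA; rewrite -(pr_neg p lA) -(pr_map p dual_e_inj (local_neg lA)).
Qed.

Lemma lattice_path u v n : (nrm (v - u) <= n)%N ->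
  exists s, [/\ path nb u s, last u s = v, all (inbox u n) (u :: s) & (size s <= 2 * n)%N].
Proof.
have hor : forall (k : nat) (a b c : int), a + k%:Z = c \/ a - k%:Z = c ->
    exists s, [/\ path nb (a, b) s, last (a, b) s = (c, b), size s = k &
     forall x, x \in s -> x.2 = b /\ ((a <= x.1 <= c) || (c <= x.1 <= a))].
  elim=> [|k IH] a b c; first by move=> h; exists [::]; split => //=; congr pair; lia.
  move=> h; pose a' := if a < c then a + 1 else a - 1.
  have [|s [ps ls ss hs]] := IH a' b c; first by rewrite /a'; case: (ltP a c) => ?; lia.
  exists ((a', b) :: s); split => //=; last 2 first.
  - by rewrite ss.
  - move=> x; rewrite inE => /orP[/eqP->/=|/hs[-> hx]]; rewrite ?eqxx; split => //.
      by rewrite /a'; case: (ltP a c) => ?; lia.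
    by move: hx; rewrite /a'; case: (ltP a c) => ?; lia.
  - by rewrite ps andbT /nb /ostep !xpair_eqE /= !andbT /a'; case: (ltP a c) => ?; lia.
have ver : forall (k : nat) (a b c : int), b + k%:Z = c \/ b - k%:Z = c ->
    exists s, [/\ path nb (a, b) s, last (a, b) s = (a, c), size s = k &
     forall x, x \in s -> x.1 = a /\ ((b <= x.2 <= c) || (c <= x.2 <= b))].
  elim=> [|k IH] a b c; first by move=> h; exists [::]; split => //=; congr pair; lia.
  move=> h; pose b' := if b < c then b + 1 else b - 1.
  have [|s [ps ls ss hs]] := IH a b' c; first by rewrite /b'; case: (ltP b c) => ?; lia.
  exists ((a, b') :: s); split => //=; last 2 first.
  - by rewrite ss.
  - move=> x; rewrite inE => /orP[/eqP->/=|/hs[-> hx]]; rewrite ?eqxx; split => //.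
      by rewrite /b'; case: (ltP b c) => ?; lia.
    by move: hx; rewrite /b'; case: (ltP b c) => ?; lia.
  - by rewrite ps andbT /nb /ostep !xpair_eqE /= !andbT /b'; case: (ltP b c) => ?; lia.
case: u v => [a b] [c d]; rewrite /nrm /= => h.
have [|s [ps ls ss hs]] := hor (absz (c - a)) a b c; first lia.
have [|t [pt lt st ht]] := ver (absz (d - b)) c b d; first lia.
exists (s ++ t); split.
- by rewrite cat_path ps ls.
- by rewrite last_cat ls.
- rewrite {1}/inbox nrm0 /=; apply/allP => x; rewrite mem_cat /inbox => /orP[/hs|/ht].
  + by case: x => x1 x2 /= [-> hx]; rewrite /nrm /=; lia.
  + by case: x => x1 x2 /= [-> hx]; rewrite /nrm /=; lia.
- by rewrite size_cat ss st; lia.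
Qed.

End Lattice.
Arguments nrm v%_R.

Lemma bernoulli_ineq (R : realType) (x : R) n : 0 <= x -> x <= 1 -> 1 - n%:R * x <= (1 - x) ^+ n.
Proof.
move=> x0 x1; elim: n => [|n IH]; first by rewrite mul0r subr0 expr0.
rewrite exprS; apply: le_trans (ler_wpM2l _ IH); last lra.
have : 0 <= n%:R * x * x by rewrite !mulr_ge0.
rewrite -natr1; lra.
Qed.

Lemma pr_false (R : realType) (E : choiceType) (p : R) (A : (E -> bool) -> Prop) :
  (forall w, ~ A w) -> pr p A = 0.
Proof.
move=> nA; rewrite -[RHS](E_cst E p); apply: E_eq => w; exact: indF.
Qed.

Lemma pr_true (R : realType) (E : choiceType) (p : R) (A : (E -> bool) -> Prop) :
  (forall w, A w) -> pr p A = 1.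
Proof.
move=> nA; rewrite -[RHS](E_cst E p); apply: E_eq => w; exact: indT.
Qed.

Lemma pr_neq0_ex (R : realType) (E : choiceType) (p : R) (A : (E -> bool) -> Prop) :
  pr p A != 0 -> exists w, A w.
Proof.
move=> h; apply: contrapT => nA; move: h; rewrite pr_false ?eqxx// => w Aw.
by apply: nA; exists w.
Qed.

Lemma pr_edge (R : realType) (E : choiceType) (p : R) (e : E) :
  pr p (fun w => w e : Prop) = p.
Proof. by rewrite -[RHS](E_edge p e); apply: E_eq => w; rewrite ind_bool. Qed.

Section Splitting.
Variables (R : realType) (E : choiceType) (Y : eqType).

Lemma E_split (p : R) (g : (E -> bool) -> Y) (cs : seq Y) (f : (E -> bool) -> R) :
  uniq cs -> (forall w, g w \in cs) -> local g -> local f ->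
  E_ p f = \sum_(C <- cs) E_ p (fun w => ind R (g w = C) * f w).
Proof.
move=> us gc lg lf; rewrite -E_sum; last first.
  by move=> C _ _; apply: local2 lf; apply: (local1 (fun y => ind R (y = C))).
apply: E_eq => w; rewrite (bigD1_seq (g w))//= indT// mul1r big1 ?addr0// => C ne.
by rewrite indF ?mul0r// => e; rewrite e eqxx in ne.
Qed.

Lemma pr_split (p : R) (g : (E -> bool) -> Y) (cs : seq Y) (A : (E -> bool) -> Prop) :
  uniq cs -> (forall w, g w \in cs) -> local g -> local A ->
  pr p A = \sum_(C <- cs) pr p (fun w => g w = C /\ A w).
Proof.
move=> us gc lg lA; rewrite /pr (E_split p us gc lg (local_ind lA)).
by apply: eq_bigr => C _; apply: E_eq => w; rewrite indI.
Qed.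

(** Enumerates the possible values of a random set of vertices; keeping the order of [V] makes equal
    sets equal lists. *)
Definition sublists (V : seq Y) : seq (seq Y) :=
  undup [seq mask (val m) V | m <- enum {: (size V).-tuple bool}].

Lemma filter_sublists (V : seq Y) (a : pred Y) : [seq x <- V | a x] \in sublists V.
Proof.
rewrite mem_undup filter_mask; apply/mapP.
by exists (map_tuple a (in_tuple V)) => //; rewrite mem_enum.
Qed.

End Splitting.

(** * Sharpness of the phase transition *)

Section Sharpness.
Variable R : realType.
Implicit Types (q : R) (w : config) (n N : nat) (S : pred vertex).

Definition theta q n : R := pr q (fun w => reach w origin n).

Definition xend (e : edge) (b : bool) : vertex := if b then src e else tgt e.

Lemma xend_nb e b : nb (xend e b) (xend e (~~ b)).
Proof. by case: b => /=; rewrite ?(nbC (tgt e)) nb_src. Qed.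

Lemma ostep_xend w e b : ostep w (xend e b) (xend e (~~ b)) = w e.
Proof. by case: b => /=; rewrite ?(ostepC _ (tgt e)) ostep_src. Qed.

Lemma nb_xend u v : nb u v -> exists b, u = xend (eo u v) b /\ v = xend (eo u v) (~~ b).
Proof. by move=> n; case: (eoP n) => e -> ->; [exists true|exists false]. Qed.

(** The functional of Duminil-Copin and Tassion: the mean number of open edges leaving [S] whose
    inner end is joined to the origin inside [S]. The boolean orients the edge, and the box of
    radius [N], which is to contain [S], makes the sum finite. *)
Definition phi q S N : R :=
  q * \sum_(e <- ebox origin N) \sum_(b <- [:: true; false])
    ind R (S (xend e b) /\ ~~ S (xend e (~~ b))) *
    pr q (fun w => connin w S origin (xend e b)).

Lemma phi_mono q q' S N : 0 <= q -> q <= q' -> q' <= 1 -> (forall x, S x -> (nrm x < N)%N) ->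
  phi q S N <= phi q' S N.
Proof.
move=> q0 qq q1 SN; rewrite /phi.
have H e b : pr q (fun w => connin w S origin (xend e b)) <= pr q' (fun w => connin w S origin (xend e b)).
  apply: pr_incr => //.
    by apply: (@connin_local _ origin N) => x /SN; rewrite subr0 => /ltnW.
  by move=> w w' h; apply: connin_incr.
apply: ler_pM => //.
  apply: sumr_ge0 => e _; apply: sumr_ge0 => b _; rewrite mulr_ge0 ?ind_ge0//.
  apply: pr_ge0; first lra.
  by apply: (@connin_local _ origin N) => x /SN; rewrite subr0 => /ltnW.
by apply: ler_sum => e _; apply: ler_sum => b _; rewrite ler_wpM2l ?ind_ge0.
Qed.

Lemma theta_ge0 q n : 0 <= q <= 1 -> 0 <= theta q n.
Proof. by move=> q01; apply: pr_ge0 => //; apply: reach_local. Qed.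

Lemma theta_le1 q n : 0 <= q <= 1 -> theta q n <= 1.
Proof. by move=> q01; apply: pr_le1 => //; apply: reach_local. Qed.

Lemma theta_mono q q' n : 0 <= q -> q <= q' -> q' <= 1 -> theta q n <= theta q' n.
Proof. by move=> ???; apply: pr_incr => //; [apply: reach_local|apply: reach_incr]. Qed.

Section Decay.
Variables (S : pred vertex) (N : nat).
Hypothesis S0 : S origin.
Hypothesis SN : forall x, S x -> (nrm x < N)%N.

Let V := vbox origin N.

Let clus w : seq vertex := [seq x <- V | `[<connin w S origin x>]].

Let mem_clus w x : (x \in clus w) = `[<connin w S origin x>].
Proof.
rewrite mem_filter; case: asboolP => //= c; rewrite mem_vbox subr0.
by apply: ltnW; apply: SN; apply: connin_r c.
Qed.

(** The cluster is explored outwards from the origin, which reads only the edges of [S] that touch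
    it. *)
Let clus_dep (C : seq vertex) :
  depon (fun e => [&& S (src e), S (tgt e) & (src e \in C) || (tgt e \in C)]) (fun w => clus w = C).
Proof.
apply: deponP => w w' h eC.
have sub x : x \in clus w -> x \in clus w'.
  rewrite !mem_clus => /asboolP c; apply/asboolP.
  have H : connin w (predI S (mem C)) origin x.
    apply: (connin_ind c (Q := fun x => connin w (predI S (mem C)) origin x)).
      by apply: connin_refl; rewrite /= S0 -eC mem_clus; apply/asboolP; apply: connin_refl.
    move=> y z Sy Sz st c'; apply: (connin_trans c'); apply: connin_step => //.
      exact: connin_r c'.
    rewrite /= Sz -eC mem_clus; apply/asboolP.
    apply: (@connin_trans _ _ _ y); last exact: connin_step.
    by apply: connin_subV c' => t /andP[].
  apply: connin_sub H => [y z|y /andP[]//].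
  move=> /andP[/= Sy Cy] /andP[/= Sz Cz]; rewrite !ostepE => /andP[n we].
  rewrite n -h//; case: (eoP n) => e <- <-; by rewrite Sy Sz ?Cy ?Cz ?orbT.
have sub' x : x \in clus w' -> x \in clus w.
  rewrite !mem_clus => /asboolP c; apply/asboolP.
  apply: (connin_ind c (Q := fun x => connin w S origin x)).
    exact: connin_refl.
  move=> y z Sy Sz st c'; apply: (connin_trans c'); apply: connin_step => //.
  have Cy : y \in C by rewrite -eC mem_clus; apply/asboolP.
  move: st; rewrite !ostepE => /andP[n we]; rewrite n h//.
  by case: (eoP n) => e <- <-; rewrite Sy Sz ?Cy ?orbT.
rewrite -eC; apply: eq_in_filter => x _; apply/idP/idP => H.
  by have := sub' x; rewrite !mem_clus; apply.
by have := sub x; rewrite !mem_clus; apply.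
Qed.

Let clus_local : local clus.
Proof.
exists (ebox origin N) => w w' h.
symmetry; rewrite -(@clus_dep (clus w) w w')// => e /and3P[Se _ _]; apply: h.
by rewrite mem_ebox subr0; apply: ltnW; apply: SN.
Qed.

(* Explore the cluster of the origin inside [S] before crossing its boundary. *)
Lemma theta_step q n : 0 <= q <= 1 -> theta q (n + N) <= phi q S N * theta q n.
Proof.
move=> q01; have /andP[q0 q1] := q01.
pose M := (n + N)%N.
pose off (C : seq vertex) y w := exists v,
  connin w (predI (fun x => x \notin C) (inbox origin M)) y v /\ (n <= nrm (v - y))%N.
have offdep C y : depon (fun e => (src e \notin C) && (tgt e \notin C)) (off C y).
  apply: deponP => w w' h [v [c hv]]; exists v; split => //.
  rewrite -(@connin_dep _ y v w w')// => e /andP[/andP[/= a _] /andP[/= b _]].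
  by apply: h; rewrite a b.
have offloc C y : local (off C y).
  exists (ebox origin M); apply: deponP => w w' h [v [c hv]]; exists v; split => //.
  rewrite -(@connin_dep_box _ origin M y v _ w w')//.
  by move=> x /andP[].
have off_le C y : pr q (off C y) <= theta q n.
  rewrite /theta -(pr_reach q y); apply: pr_le => //; first exact: reach_local.
  by move=> w [v [c hv]]; apply: reach_conn c hv.
have step w : reach w origin M -> exists2 e, e \in ebox origin N &
   exists2 b, b \in [:: true; false] & (xend e b \in clus w /\ ~~ S (xend e (~~ b))) /\
     (w e /\ off (clus w) (xend e (~~ b)) w).
  move=> [v [c hv]]; rewrite subr0 in hv.
  have cv : v \notin clus w.
    rewrite mem_clus; apply/asboolP => /connin_r /SN; rewrite ltnNge; apply/negP/negPn.
    exact: leq_trans (leq_addl _ _) hv.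
  (* Walk back from the far point [v] to the first vertex [y] of the cluster. The vertex [x] before
     it is joined to [y] by an open edge but is not in the cluster, hence it is outside [S]. *)
  have [||x [y [c1 st c3 c4]]] := first_exit (connin_sym c) (U := fun x => x \notin clus w) => //.
    rewrite negbK mem_clus; apply/asboolP; exact: connin_refl.
  rewrite negbK in c3.
  have cx : x \notin clus w by have /andP[] := connin_r c1.
  have nSx : ~~ S x.
    apply: contraNN cx => Sx; rewrite mem_clus; apply/asboolP.
    apply: (@connin_trans _ _ _ y); last by apply: connin_step; rewrite ?(ostepC _ y) //; move: c3; rewrite mem_clus => /asboolP/connin_r.
    by move: c3; rewrite mem_clus => /asboolP.
  have Sy : S y by move: c3; rewrite mem_clus => /asboolP/connin_r.
  have n' := ostep_nb st; rewrite nbC in n'.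
  have [b [e1 e2]] := nb_xend n'.
  have hx : (nrm x <= N)%N.
    by have := nb_dist 0 n'; rewrite !subr0 => /leq_trans; apply; exact: SN.
  exists (eo y x).
    by rewrite mem_ebox subr0; have := ltnW (SN Sy); case: (eoP n') hx => e -> ->.
  exists b; first by case: (b).
  rewrite -e1 -e2; split; first by split.
  split; first by move: st; rewrite ostepC ostepE => /andP[].
  exists v; split.
    by apply: connin_subV (connin_sym c1) => z /andP[/= h1 h2]; apply/andP.
  have := nrm_dist v x 0; rewrite !subr0 => h.
  by rewrite -(leq_add2r N) (leq_trans hv)// (leq_trans h)// leq_add2l.
have L1 C : local (fun w => clus w = C) by apply: (local1 (fun y => y = C)).
have L2 e C y : local (fun w => w e /\ off C y w).
  by apply: local_and => //; apply: local_openedge.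
have bound C : pr q (fun w => clus w = C /\ reach w origin M) <=
  \sum_(e <- ebox origin N) \sum_(b <- [:: true; false])
    ind R (xend e b \in C /\ ~~ S (xend e (~~ b))) * (pr q (fun w => clus w = C) * (q * theta q n)).
  pose F e b w := (xend e b \in C /\ ~~ S (xend e (~~ b))) /\ (clus w = C /\ (w e /\ off C (xend e (~~ b)) w)).
  have LF e b : local (F e b).
    apply: local_and; first exact: local_cst.
    exact: local_and.
  apply: (@le_trans _ _ (\sum_(e <- ebox origin N) \sum_(b <- [:: true; false]) pr q (F e b))).
    apply: (@le_trans _ _ (pr q (fun w => exists2 e, e \in ebox origin N & exists2 b, b \in [:: true; false] & F e b w))).
      apply: pr_le => //.
      - by apply: local_and => //; apply: reach_local.
      - by apply: local_ex => e _; apply: local_ex.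
      - move=> w [eC /step[e ee [b bb [h1 h2]]]]; exists e => //; exists b => //.
        by subst C; split.
    apply: le_trans (pr_ex q01 _) _; first by move=> e _; apply: local_ex.
    by apply: ler_sum => e _; apply: pr_ex.
  apply: ler_sum => e _; apply: ler_sum => b _.
  have [h|h] := pselect (xend e b \in C /\ ~~ S (xend e (~~ b))); last first.
    by rewrite indF// mul0r pr_false// => w [].
  have [hb nSb] := h.
  rewrite indT// mul1r.
  rewrite (pr_eq q (B := fun w => clus w = C /\ (w e /\ off C (xend e (~~ b)) w))); last first.
    by move=> w; split => [[]//|].
  (* The three events read disjoint sets of edges: the edges of [S] that touch [C], the edge [e],
     which leaves [S], and the edges that avoid [C]. *)
  rewrite (pr_indep (D1 := fun e => [&& S (src e), S (tgt e) & (src e \in C) || (tgt e \in C)])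
     (D2 := fun e' => (e' == e) || ((src e' \notin C) && (tgt e' \notin C)))) //.
  - apply: ler_wpM2l; first exact: pr_ge0.
    rewrite (pr_indep (D1 := fun e' => e' == e) (D2 := fun e' => (src e' \notin C) && (tgt e' \notin C))) //.
    + by rewrite pr_edge; apply: ler_wpM2l => //; apply: off_le.
    + exact: local_openedge.
    + by move=> w w' H; rewrite H//= eqxx.
    + by move=> e' /eqP -> /andP[a1 a2]; move: hb a1 a2; rewrite /xend; case: (b) => ->.
  - apply: deponP => w w' H [we ho]; split; first by rewrite -H ?eqxx.
    by rewrite -(@offdep C (xend e (~~ b)) w w')// => e' he; apply: H; rewrite he orbT.
  - move=> e' /and3P[s1 s2 s3] /orP[/eqP e1|/andP[/negbTE n1 /negbTE n2]].
      by move: nSb; rewrite -e1 /xend; case: (b); rewrite /= ?s1 ?s2.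
    by rewrite n1 n2 in s3.
have us : uniq (sublists V) by apply: undup_uniq.
have mem w : clus w \in sublists V by apply: filter_sublists.
rewrite {1}/theta (pr_split q us mem clus_local); last exact: reach_local.
apply: le_trans (ler_sum _ (fun C _ => bound C)) _.
rewrite exchange_big /= [leRHS](_ : _ = \sum_(e <- ebox origin N) (q * theta q n) * (\sum_(b <- [:: true; false])
    ind R (S (xend e b) /\ ~~ S (xend e (~~ b))) * pr q (fun w => connin w S origin (xend e b)))); last first.
  by rewrite /phi mulrAC mulr_sumr.
apply: ler_sum => e _; rewrite exchange_big /= mulr_sumr; apply: ler_sum => b _.
have -> : pr q (fun w => connin w S origin (xend e b)) = \sum_(C <- sublists V) ind R (xend e b \in C) * pr q (fun w => clus w = C).
  rewrite (pr_split q us mem clus_local); last first.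
    by apply: (@connin_local _ origin N) => x /SN; rewrite subr0 => /ltnW.
  apply: eq_bigr => C _; rewrite /pr -E_Z; last exact: local_ind.
  apply: E_eq => w; rewrite indI mulrC; have [<-|ne] := pselect (clus w = C); last first.
    by rewrite !(indF _ ne) !mulr0.
  by congr (_ * _); congr ind; apply/propext; rewrite mem_clus asboolE.
rewrite !mulr_sumr; apply: ler_sum => C _.
rewrite [leRHS](_ : _ = ind R (S (xend e b) /\ ~~ S (xend e (~~ b))) * ind R (xend e b \in C) * (pr q (fun w => clus w = C) * (q * theta q n))); last ring.
have [->|C0] := eqVneq (pr q (fun w => clus w = C)) 0; first by rewrite !mul0r !mulr0.
apply: ler_wpM2r.
  by apply: mulr_ge0; [exact: pr_ge0|apply: mulr_ge0 => //; exact: theta_ge0].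
rewrite -indI; apply: ind_le => -[h1 h2]; split => //; split => //.
have [w ew] := pr_neq0_ex C0.
by move: h1; rewrite -ew mem_clus => /asboolP /connin_r.
Qed.

Lemma exp_decay q : 0 <= q <= 1 -> phi q S N < 1 ->
  exists C b : R, [/\ 0 < C, 0 < b < 1 & forall n, theta q n <= C * b ^+ n].
Proof.
move=> q01 h; pose f : R := Num.max (phi q S N) (1 / 2).
have f0 : 0 < f by rewrite /f lt_max; apply/orP; right; lra.
have f1 : f < 1 by rewrite /f gt_max h /=; lra.
have N0 : (0 < N)%N by apply: leq_ltn_trans (SN S0).
have N0R : 0 < N%:R :> R by rewrite ltr0n.
(* Chosen so that Bernoulli's inequality gives [b ^ N >= f]; the maximum with 1/2 keeps [f]
   positive. *)
pose b : R := 1 - (1 - f) / N%:R.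
have hN : (1 - f) / N%:R < 1.
  rewrite ltr_pdivrMr// mul1r; apply: (@lt_le_trans _ _ 1); first lra.
  by rewrite ler1n.
have hN0 : 0 < (1 - f) / N%:R by rewrite divr_gt0//; lra.
have b0 : 0 < b by rewrite /b; lra.
have b1 : b < 1 by rewrite /b; lra.
have bN : f <= b ^+ N.
  apply: le_trans (bernoulli_ineq _ (ltW hN0) (ltW hN)).
  by rewrite mulrC divfK ?gt_eqF//; lra.
exists (b ^- N), b; split; [by rewrite invr_gt0 exprn_gt0|by rewrite b0|].
have key k r : (r < N)%N -> theta q (k * N + r) <= (b ^+ N) ^+ k.
  move=> rN; elim: k => [|k IH]; first by rewrite expr0; apply: theta_le1.
  have -> : (k.+1 * N + r = (k * N + r) + N)%N by rewrite mulSn -addnA addnC.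
  apply: le_trans (theta_step _ q01) _.
  rewrite exprS; apply: ler_pM => //.
  - rewrite /phi mulr_ge0//; first by case/andP: q01.
    apply: sumr_ge0 => e _; apply: sumr_ge0 => c _; rewrite mulr_ge0 ?ind_ge0//.
    apply: pr_ge0 => //; apply: (@connin_local _ origin N) => x /SN.
    by rewrite subr0 => /ltnW.
  - exact: theta_ge0.
  - by apply: le_trans bN; rewrite /f le_max lexx.
move=> n; rewrite {1}(divn_eq n N).
apply: le_trans (key _ _ _) _; first by rewrite ltn_mod.
rewrite -exprM ler_pdivlMl ?exprn_gt0// -exprD ler_wiXn2l ?(ltW b0) ?(ltW b1)//.
by rewrite {1}(divn_eq n N) addnC mulnC leq_add2r ltnW// ltn_mod.
Qed.

End Decay.
End Sharpness.

Lemma sublists_sub (Y : eqType) (V C : seq Y) : C \in sublists V -> {subset C <= V}.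
Proof. by rewrite mem_undup => /mapP[m _ ->] x /mem_mask. Qed.

(** * The differential inequality for the one-arm probability *)

Section Percolates.
Variable R : realType.
Implicit Types (q : R) (w : config) (n N : nat).

Section Derivative.
Variables (q0 : R) (n : nat).
Hypothesis q0_gt0 : 0 < q0.
Hypothesis big : forall (S : pred vertex) N, S origin -> (forall x, S x -> (nrm x < N)%N) ->
  1 <= phi q0 S N.

Let V := vbox origin n.

Let toB w x : Prop := exists v, connin w (inbox origin n) x v /\ (n <= nrm v)%N.

Let Sset w : seq vertex := [seq x <- V | ~~ `[<toB w x>]].

Let mem_Sset w x : (x \in Sset w) = ~~ `[<toB w x>] && (nrm x <= n)%N.
Proof. by rewrite mem_filter mem_vbox subr0. Qed.

Let Sset_lt w x : x \in Sset w -> (nrm x < n)%N.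
Proof.
rewrite mem_Sset => /andP[/asboolPn nt hx]; rewrite ltnNge; apply/negP => h.
by apply: nt; exists x; split => //; apply: connin_refl; rewrite /inbox subr0.
Qed.

Let reach_toB w : reach w origin n <-> toB w origin.
Proof. by split=> -[v [c h]]; exists v; rewrite subr0 in h *. Qed.

(** The set is found by exploring the box from its boundary, which never reads an edge with both
    ends in [C]; connections inside [C] are therefore independent of this event. *)
Let Sset_dep (C : seq vertex) :
  depon (fun e => ((src e \notin C) || (tgt e \notin C)) && (e \in ebox origin n)) (fun w => Sset w = C).
Proof.
apply: deponP => w w' h eC.
have opn w1 w2 y z : (forall e, ((src e \notin C) || (tgt e \notin C)) && (e \in ebox origin n) -> w1 e = w2 e) ->
    inbox origin n y -> inbox origin n z -> (y \notin C) || (z \notin C) -> ostep w1 y z -> ostep w2 y z.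
  move=> H; rewrite /inbox !subr0 => iy iz nn; rewrite !ostepE => /andP[a we]; rewrite a -H//.
  by rewrite mem_ebox subr0; case: (eoP a) iy iz nn => e -> -> iy iz; rewrite -/(src e) ?iy ?iz andbT// orbC.
have sub x : toB w x -> toB w' x.
  move=> [v [c hv]]; exists v; split => //.
  pose V' := predI (inbox origin n) (fun y => y \notin C).
  have H : connin w V' x v.
    have mV y : inbox origin n y -> connin w (inbox origin n) y v -> V' y.
      move=> iy c'; rewrite /V' /= iy -eC mem_Sset negb_and negbK.
      by apply/orP; left; apply/asboolP; exists v.
    have := connin_sym c => c'.
    apply: connin_sym; apply: (connin_ind c' (Q := fun y => connin w V' v y)).
      by apply: connin_refl; apply: mV; [exact: connin_l c'|apply: connin_refl; exact: connin_l c'].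
    move=> y z iy iz st cv; apply: (connin_trans cv); apply: connin_step => //.
      exact: connin_r cv.
    apply: mV => //; apply: (@connin_trans _ _ _ y).
      by apply: connin_step; rewrite // ostepC.
    by apply: connin_sym; apply: connin_subV cv => t /andP[].
  apply: connin_sub H => [y z|y /andP[]//].
  by move=> /andP[/= iy ny] /andP[/= iz nz]; apply: opn => //; rewrite ny.
have sub' x : toB w' x -> toB w x.
  move=> [v [c hv]]; apply: contrapT => nt.
  have xC : x \in C.
    rewrite -eC mem_Sset; apply/andP; split; first exact/asboolPn.
    by have := connin_l c; rewrite /inbox subr0.
  have vC : v \notin C.
    by rewrite -eC; apply/negP => /Sset_lt; rewrite ltnNge hv.
  have [y [z [c1 st c3 c4]]] := first_exit c (U := fun y => y \in C) xC vC.
  have /andP[iy yC] := connin_r c1.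
  have st' : ostep w y z.
    apply: (@opn w' w) st => //; last by rewrite c3 orbT.
    by move=> e /h.
  have tz : toB w z.
    by move: c3; rewrite -eC mem_Sset negb_and negbK => /orP[/asboolP//|]; move: c4; rewrite /inbox subr0 => ->.
  move: yC; rewrite /= -eC mem_Sset => /andP[/asboolPn nty _]; apply: nty.
  have [v' [cz hv']] := tz; exists v'; split => //; apply: connin_trans cz.
  exact: connin_step.
rewrite -eC; apply: eq_in_filter => x _; congr (~~ _); apply/asboolP/asboolP; [exact: sub'|exact: sub].
Qed.

Let Sset_local : local Sset.
Proof.
exists (ebox origin n) => w w' h.
by symmetry; rewrite -(@Sset_dep (Sset w) w w')// => e /andP[_ he]; apply: h.
Qed.

Let fR w : R := ind R (reach w origin n).

(** Given [Sset w = C], an edge that leaves [C] from a vertex joined to the origin inside [C] is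
    pivotal. By independence the mean number of such edges is [phi q C n / q], hence at least 1, so
    the influences sum to at least the probability [1 - theta q n] that the origin lies in
    [Sset w]. *)
Lemma theta_russo q : q0 <= q -> q <= 1 ->
  1 - theta q n <= \sum_(e <- ebox origin n) E_ q (infl e fR).
Proof.
move=> qq q1; have q01 : 0 <= q <= 1 by rewrite q1 (le_trans (ltW q0_gt0)).
have lf : local fR by apply/local_ind/reach_local.
have us : uniq (sublists V) by apply: undup_uniq.
have memS w : Sset w \in sublists V by apply: filter_sublists.
have fmono w w' : (forall e, w e -> w' e) -> fR w <= fR w'.
  by move=> h; apply: ind_le; apply: reach_incr.
have infl0 e w : 0 <= infl e fR w by rewrite subr_ge0; apply: fmono; apply: upd_mono.
pose G (C : seq vertex) e w := \sum_(b <- [:: true; false]) ind R ((xend e b \in C) /\ (xend e (~~ b) \notin C)) *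
    ind R (connin w (fun y => y \in C) origin (xend e b)).
have point (C : seq vertex) e w : origin \in C -> Sset w = C -> G C e w <= infl e fR w.
  move=> oC eC; rewrite /G !big_cons big_nil addr0.
  have bound b : ind R ((xend e b \in C) /\ (xend e (~~ b) \notin C)) *
      ind R (connin w (fun y => y \in C) origin (xend e b)) <= infl e fR w.
    rewrite -indI; have [[[xC yC] c]|h] := pselect (((xend e b \in C) /\ (xend e (~~ b) \notin C)) /\
      connin w (fun y => y \in C) origin (xend e b)); last by rewrite (indF _ h) infl0.
    rewrite indT// /infl /fR indT; last first.
      apply/reach_toB.
      have xn : (nrm (xend e b) < n)%N by apply: (@Sset_lt w); rewrite eC.
      have yn : (nrm (xend e (~~ b)) <= n)%N.
        by have := nb_dist 0 (xend_nb e b); rewrite !subr0 => /leq_trans; apply.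
      have [v [cv hv]] : toB w (xend e (~~ b)).
        by move: yC; rewrite -eC mem_Sset negb_and negbK yn orbF => /asboolP.
      have up : forall e', w e' -> upd w e true e' by move=> e'; rewrite /upd; case: eqP.
      exists v; split => //; apply: (@connin_trans _ _ _ (xend e b)).
        apply: connin_sub c => [y z _ _|y]; first exact: ostep_mono.
        by rewrite /= -eC => /Sset_lt/ltnW; rewrite /inbox subr0.
      apply: (@connin_trans _ _ _ (xend e (~~ b))); last exact: connin_incr cv.
      apply: connin_step; rewrite /inbox ?subr0//; first exact: ltnW.
      by rewrite ostep_xend upd_same.
    rewrite indF ?subr0// => /(reach_incr (w' := w)) H.
    have /reach_toB t0 : reach w origin n.
      by apply: H => e'; rewrite /upd; case: eqP.
    by move: oC; rewrite -eC mem_Sset => /andP[/asboolPn].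
  have zero b c : xend e (~~ b) \in C \/ xend e b \notin C ->
     ind R ((xend e b \in C) /\ (xend e (~~ b) \notin C)) * c = 0.
    by move=> h; rewrite indF ?mul0r// => -[h1 h2]; case: h; apply/negP; rewrite ?h1.
  have [h|h] : xend e true \in C \/ xend e true \notin C by apply/orP; rewrite orbN.
    by rewrite (zero false) ?addr0; [exact: bound|left].
  by rewrite (zero true) ?add0r; [exact: bound|right].
have cloc (C : seq vertex) x : C \in sublists V -> local (fun w => connin w (fun y => y \in C) origin x).
  move=> CV; apply: (@connin_local _ origin n) => y yC.
  by have := sublists_sub CV yC; rewrite mem_vbox.
have lSC C : local (fun w => Sset w = C) by apply: (local1 (fun y => y = C)).
have lG (C : seq vertex) e : C \in sublists V -> local (G C e).
  move=> CV; apply: local_sum => b _ _; apply: (local1 (fun y => _ * y)); apply: local_ind.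
  exact: cloc.
have EG (C : seq vertex) e : C \in sublists V -> E_ q (fun w => ind R (Sset w = C) * G C e w) =
   pr q (fun w => Sset w = C) * \sum_(b <- [:: true; false]) ind R ((xend e b \in C) /\ (xend e (~~ b) \notin C)) *
     pr q (fun w => connin w (fun y => y \in C) origin (xend e b)).
  move=> CV; rewrite mulr_sumr /G.
  transitivity (E_ q (fun w => \sum_(b <- [:: true; false]) ind R ((xend e b \in C) /\ (xend e (~~ b) \notin C)) *
    ind R (Sset w = C /\ connin w (fun y => y \in C) origin (xend e b)))).
    by apply: E_eq => w; rewrite mulr_sumr; apply: eq_bigr => b _; rewrite (indI _ (Sset w = C)); ring.
  rewrite E_sum; last first.
    move=> b _ _; apply: (local1 (fun y => _ * y)); apply: local_ind; apply: local_and => //; exact: cloc.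
  apply: eq_bigr => b _; rewrite E_Z; last by apply: local_ind; apply: local_and => //; exact: cloc.
  rewrite -/(pr q _) (pr_indep (D1 := fun e => ((src e \notin C) || (tgt e \notin C)) && (e \in ebox origin n))
    (D2 := fun e => (src e \in C) && (tgt e \in C))) //; [ring|exact: cloc|exact: connin_dep|].
  by move=> e' /andP[/orP[/negbTE->|/negbTE->] _] /andP[].
apply: (@le_trans _ _ (\sum_(C <- sublists V | origin \in C) pr q (fun w => Sset w = C))).
  have -> : 1 - theta q n = pr q (fun w => origin \in Sset w).
    rewrite -pr_not//; last exact: reach_local.
    apply: pr_eq => w; rewrite mem_Sset /nrm /= andbT.
    by split => [h|/asboolPn h /reach_toB//]; apply/asboolPn => /reach_toB.
  rewrite (pr_split q us memS Sset_local); last by apply: (local1 (fun S => is_true (origin \in S))).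
  rewrite (bigID (fun C => origin \in C)) /= [X in _ + X]big1 ?addr0; last first.
    by move=> C nC; apply: pr_false => w [->] h; rewrite h in nC.
  by apply: ler_sum => C oC; apply: pr_le => //; [apply: local_and => //; apply: (local1 (fun S => is_true (origin \in S)))|move=> w []].
apply: (@le_trans _ _ (\sum_(e <- ebox origin n) \sum_(C <- sublists V | origin \in C) E_ q (fun w => ind R (Sset w = C) * G C e w))); last first.
  apply: ler_sum => e _; rewrite (E_split q us memS Sset_local); last exact: local_infl.
  rewrite [leRHS](bigID (fun C => origin \in C)) /= -[leLHS]addr0; apply: lerD; last first.
    apply: sumr_ge0 => C _; apply: E_ge0 => //; first by apply: local2; [exact: local_ind|exact: local_infl].
    by move=> w; rewrite mulr_ge0 ?ind_ge0.
  rewrite big_seq_cond [leRHS]big_seq_cond; apply: ler_sum => C /andP[CV oC]; apply: E_le => //.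
  - by apply: local2; [exact: local_ind|exact: lG].
  - by apply: local2; [exact: local_ind|exact: local_infl].
  - move=> w; have [eC|neC] := pselect (Sset w = C); last by rewrite !(indF _ neC) !mul0r.
    by rewrite (indT _ eC) !mul1r; exact: point.
rewrite exchange_big /= big_seq_cond [leRHS]big_seq_cond; apply: ler_sum => C /andP[CV oC].
rewrite (eq_bigr _ (fun e _ => EG C e CV)) -mulr_sumr.
have [->|C0] := eqVneq (pr q (fun w => Sset w = C)) 0; first by rewrite mul0r.
have [w ew] := pr_neq0_ex C0.
have Cn x : x \in C -> (nrm x < n)%N by rewrite -ew; exact: Sset_lt.
have := big oC Cn => /le_trans/(_ (phi_mono (ltW q0_gt0) qq q1 Cn)).
rewrite /phi; set X := \sum_(e <- _) _ => hX.
have X0 : 0 <= X.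
  apply: sumr_ge0 => e _; apply: sumr_ge0 => b _; rewrite mulr_ge0 ?ind_ge0//.
  by apply: pr_ge0 => //; exact: cloc.
rewrite -[leLHS]mulr1; apply: ler_wpM2l; first exact: pr_ge0.
by apply: le_trans hX _; rewrite -[leRHS]mul1r; apply: ler_wpM2r.
Qed.

(** With [d = q1 - q0], the mean value theorem and monotonicity give
    [theta q1 n >= d * (1 - theta q1 n)], which is solved for [theta q1 n]. *)
Lemma theta_lower q1 : q0 < q1 -> q1 <= 1 -> (q1 - q0) / (1 + (q1 - q0)) <= theta q1 n.
Proof.
move=> qq qle.
have df := @reach_dep origin n.
have dfR : depon (fun e => e \in ebox origin n) fR by move=> w w' h; rewrite /fR (df w w').
have tE q : theta q n = Ex q (ebox origin n) fR (fun=> false) by apply: E_E.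
have der q : is_derive q (1 : R) (fun q => theta q n) (\sum_(e <- ebox origin n) E_ q (infl e fR)).
  rewrite (_ : (fun q => theta q n) = (fun q => Ex q (ebox origin n) fR (fun=> false))); last first.
    by apply/funext => x; rewrite tE.
  apply: (is_derive_eq (Ex_russo fR (fun=> false) q (ebox_uniq origin n))).
  apply: eq_bigr => e _; symmetry; apply: E_E => w w' h; rewrite /infl.
  have H b : fR (upd w e b) = fR (upd w' e b).
    by apply: dfR => e' he; rewrite /upd; case: ifP => // _; exact: h.
  by rewrite !H.
have [|c cI hc] := @MVT R (fun q => theta q n) (fun q => \sum_(e <- ebox origin n) E_ q (infl e fR)) q0 q1 qq (fun x _ => der x).
  apply: derivable_within_continuous => x _; by case: (der x).
move: cI; rewrite in_itv /= => /andP[h1 h2].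
have c0 : 0 <= c by rewrite ltW// (lt_trans q0_gt0).
have hr := theta_russo (ltW h1) (le_trans (ltW h2) qle).
have hm := theta_mono n c0 (ltW h2) qle.
have q01 : 0 <= q0 <= 1 by rewrite (ltW q0_gt0) /= (le_trans _ qle)// ltW.
have ht := theta_ge0 n q01.
have aux (t1 t0 t s d : R) : 0 < d -> t1 - t0 = s * d -> 1 - t <= s -> t <= t1 -> 0 <= t0 -> d <= t1 * (1 + d).
  move=> d0 e h3 h4 h5; have : (1 - t1) * d <= s * d by apply: ler_wpM2r; [exact: ltW|lra].
  rewrite -e; lra.
rewrite ler_pdivrMr; last by rewrite addr_gt0// subr_gt0.
by apply: (aux _ _ _ _ _ _ hc hr hm ht); rewrite subr_gt0.
Qed.

End Derivative.
End Percolates.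

(** * One of many spaced points reaches far *)

Section SpacedReach.
Variable R : realType.
Implicit Types (q c eta : R) (w : config) (n k m : nat).

Lemma pr_all_indep q (D k J M : nat) : 0 <= q <= 1 -> (2 * k < D)%N ->
  pr q (fun w => forall i, i \in iota 0 J -> ~ reach w ((M + i * D)%N%:Z, 0) k) = (1 - theta q k) ^+ J.
Proof.
move=> q01 kD; elim: J => [|J IH]; first by rewrite pr_true.
have lr v : local (fun w => ~ reach w v k) by apply/local_not/reach_local.
rewrite -[J.+1]addn1 iotaD add0n (pr_eq q (B := fun w => (forall i, i \in iota 0 J -> ~ reach w ((M + i * D)%N%:Z, 0) k) /\ ~ reach w ((M + J * D)%N%:Z, 0) k)); last first.
  move=> w; split => [h|[h1 h2] i].
    by split => [i iJ|]; apply: h; rewrite mem_cat ?iJ// inE eqxx orbT.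
  by rewrite mem_cat inE => /orP[/h1//|/eqP->].
pose D1 (e : edge) := e.1.1 < (M + J * D)%N%:Z - k%:Z.
pose D2 (e : edge) := (M + J * D)%N%:Z - k%:Z <= e.1.1.
rewrite (pr_indep (D1 := D1) (D2 := D2)) //.
- rewrite IH addn1 exprSr; congr (_ * _); rewrite pr_not//; last exact: reach_local.
  by rewrite pr_reach.
- by apply: local_all => i _.
- apply: deponP => w w' h hA i iJ; rewrite -(@reach_dep _ k w w'); first exact: hA.
  move=> e; rewrite mem_ebox => he; apply: h; rewrite /D1.
  move: iJ he; rewrite mem_iota add0n => /andP[_ iJ]; rewrite /nrm /= => he.
  have : (M + i * D + D <= M + J * D)%N by rewrite -addnA leq_add2l -mulSnr leq_mul2r iJ orbT.
  lia.
- apply: deponP => w w' h hA; rewrite -(@reach_dep _ k w w')// => e.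
  rewrite mem_ebox => he; apply: h; rewrite /D2; move: he; rewrite /nrm /=; lia.
- by move=> e; rewrite /D1 /D2 ltNge => /negP.
Qed.

Lemma theta_cauchy q c (delta : R) : 0 <= q <= 1 -> 0 < delta ->
  exists k, forall n, (k <= n)%N -> theta q k - theta q n <= delta.
Proof.
move=> q01 d0; pose A := [set theta q n | n in [set: nat]].
have hA : has_inf A.
  split; first by exists (theta q 0), 0%N.
  by exists 0 => _ [n _ <-]; apply: theta_ge0.
have [_ [k _ <-] hk] := inf_adherent d0 hA.
exists k => n kn; have : inf A <= theta q n by apply: ge_inf; [exact: hA.2|exists n].
lra.
Qed.

Lemma expr_small c eta : 0 < c -> c <= 1 -> 0 < eta -> exists J, (1 - c) ^+ J <= eta.
Proof.
move=> c0 c1 e0.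
have h : `|1 - c| < 1 by rewrite ger0_norm; lra.
have /cvgrPdist_le/(_ eta e0)[N _ hN] := cvg_expr h.
exists N; have := hN N (leqnn N); rewrite sub0r normrN ger0_norm// exprn_ge0//; lra.
Qed.

(** At distance [k] the events at points spaced by [2 k + 1] are independent, so all fail with small
    probability for [J] large. Then [k] is chosen, depending on [J], such that reaching [k] but not
    [n] is unlikely even when summed over the [J] points. Hence [J] and [D] are uniform in [n] and
    [M]. *)
Lemma spaced_reach q c eta : 0 <= q <= 1 -> 0 < c -> (forall n, c <= theta q n) -> 0 < eta ->
  exists J D, forall M n, 1 - eta <=
    pr q (fun w => exists2 i, i \in iota 0 J & reach w ((M + i * D)%N%:Z, 0) n).
Proof.
move=> q01 c0 hc e0.
have c1 : c <= 1 by apply: le_trans (hc 0%N) (theta_le1 _ _).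
have e2 : 0 < eta / 2 by lra.
have [J hJ] := expr_small c0 c1 e2.
have J1 : 0 < J.+1%:R :> R by rewrite ltr0n.
have [k hk] := theta_cauchy c q01 (divr_gt0 e2 J1).
exists J, (2 * k).+1 => M n.
pose x i : vertex := ((M + i * (2 * k).+1)%N%:Z, 0).
have lx v n' : local (fun w => reach w v n') by apply: reach_local.
pose n' := maxn n k.
apply: (@le_trans _ _ (pr q (fun w => exists2 i, i \in iota 0 J & reach w (x i) n'))); last first.
  apply: pr_le => //; try (apply: local_ex => i _; exact: lx).
  by move=> w [i iJ h]; exists i => //; apply: reach_le h; rewrite leq_maxl.
rewrite lerBlDr -lerBlDl -pr_not//; last by apply: local_ex => i _; exact: lx.
pose A w := forall i, i \in iota 0 J -> ~ reach w (x i) k.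
pose B w := exists2 i, i \in iota 0 J & (reach w (x i) k /\ ~ reach w (x i) n').
have lB i : local (fun w => reach w (x i) k /\ ~ reach w (x i) n') by apply: local_and; [exact: lx|apply: local_not; exact: lx].
have lA : local A by apply: local_all => i _; apply: local_not; exact: lx.
apply: (@le_trans _ _ (pr q (fun w => A w \/ B w))).
  apply: pr_le => //; first by apply: local_not; apply: local_ex => i _; exact: lx.
    by apply: local_or => //; apply: local_ex.
  move=> w h; have [hB|nB] := pselect (B w); [by right|left] => i iJ hr.
  by apply: nB; exists i => //; split => // h'; apply: h; exists i.
apply: le_trans (pr_or _ _ _) _ => //; first by apply: local_ex.
rewrite /A pr_all_indep//.
have h1 : (1 - theta q k) ^+ J <= eta / 2.
  apply: le_trans hJ; rewrite lerXn2r ?nnegrE ?subr_ge0//; last by rewrite lerD2l lerN2.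
  exact: theta_le1.
have h2 : pr q B <= eta / 2.
  apply: le_trans (pr_ex _ _) _ => //.
  apply: (@le_trans _ _ (\sum_(i <- iota 0 J) (eta / 2 / J.+1%:R))).
    apply: ler_sum => i _; apply: le_trans (hk n' (leq_maxr _ _)).
    rewrite /theta -!(pr_reach q (x i)) /pr -E_B; [|exact/local_ind/lx|exact/local_ind/lx].
    apply: E_le => //; first exact/local_ind/lB.
      by apply: (local2 (fun a b => a - b)); exact/local_ind/lx.
    move=> w; have [h|h] := pselect (reach w (x i) k); last first.
      by rewrite (indF R (A := _ /\ _)) ?subr_ge0; [apply: ind_le => /(reach_le (leq_maxr n k))|case].
    by rewrite (indT R h) -indN; apply: ind_le => -[].
  rewrite big_const_seq count_predT size_iota iter_addr_0 -[leLHS]mulr_natr -[_ * J%:R]mulrA.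
  by rewrite ler_piMr ?(ltW e2)// mulrC ler_pdivrMr// mul1r ler_nat.
lra.
Qed.

End SpacedReach.

Lemma eo_fst x y : (eo x y).1 = x \/ (eo x y).1 = y.
Proof. by rewrite /eo; case: ifP => _; [left|case: ifP => _; [right|case: ifP => _; [left|right]]]. Qed.

(** * Exits from a box in the four directions *)

Section Exits.
Variable R : realType.
Implicit Types (w : config) (d : vertex) (n m : nat).

(* The box of radius [m] is joined inside that of radius [n] to an edge leaving it in direction [d]. *)
Definition exits m n d w : Prop := exists u x,
  [/\ (nrm u <= m)%N, connin w (inbox origin n) u x, ostep w x (x + d) & ~~ inbox origin n (x + d)].

Lemma exits_local m n d : local (exits m n d).
Proof.
exists (ebox origin n.+1); apply: deponP => w w' h [u [x [h1 h2 h3 h4]]]; exists u, x; split => //.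
  rewrite -(@connin_dep_box _ origin n.+1 u x _ w w')// => y; rewrite /inbox => /leq_trans; exact.
move: h3; rewrite !ostepE => /andP[a we]; rewrite a -h// mem_ebox subr0.
have xn : (nrm x <= n)%N by have := connin_r h2; rewrite /inbox subr0.
have := nb_dist 0 a; rewrite !subr0 => yn.
case: (eo_fst x (x + d)) => ->; first exact: leqW.
exact: leq_trans yn _.
Qed.

Lemma exits_incr m n d : incr (exits m n d).
Proof.
move=> w w' h [u [x [h1 h2 h3 h4]]]; exists u, x; split => //; first exact: connin_incr h2.
exact: ostep_mono h3.
Qed.

Lemma exits_of_reach m n w x k : (nrm x <= m)%N -> (m <= n)%N -> (m + n < k)%N -> reach w x k ->
  exists2 d, d \in [:: (1, 0); (-1, 0); (0, 1); (0, -1)] & exits m n d w.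
Proof.
move=> xm mn nk [v [c hv]].
have := first_exit (connin_subV (V' := predT) (fun _ _ => isT) c) (U := inbox origin n).
rewrite /inbox !subr0 => /(_ (leq_trans xm mn)).
case; first by have := nrmD v (- x); rewrite nrmN; lia.
move=> y [z [c1 st nz _]]; exists (z - y); last first.
  by exists x, y; rewrite subrKC; split.
have := ostep_nb st; rewrite /nb /ostep !andbT.
case: y z {c1 st nz} => [a b] [a' b'] /=.
rewrite !inE !xpair_eqE /=; lia.
Qed.

Section Symmetry.
Variable f : vertex -> vertex.
Hypothesis fD : {morph f : x y / x + y}.
Hypothesis fK : involutive f.
Hypothesis fnrm : forall x, nrm (f x) = nrm x.
Hypothesis fnb : forall x y, nb x y -> nb (f x) (f y).

Definition fe (e : edge) : edge := eo (f (src e)) (f (tgt e)).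

Lemma fe_eo u v : nb u v -> fe (eo u v) = eo (f u) (f v).
Proof.
by move=> n; rewrite /fe; case: (eoP n) => e -> ->//; exact: eoC (fnb (nb_src e)).
Qed.

Lemma ostep_sym w u v : ostep (w \o fe) u v = ostep w (f u) (f v).
Proof.
have nE : nb u v = nb (f u) (f v).
  by apply/idP/idP => [/fnb//|/fnb]; rewrite !fK.
by rewrite !ostepE -nE; case: (boolP (nb u v)) => //= n; rewrite fe_eo.
Qed.

Lemma fe_inj : injective fe.
Proof.
move=> e e' h; have n := fnb (nb_src e); have n' := fnb (nb_src e').
have finj : injective f by apply: can_inj fK.
rewrite -(eo_src e) -(eo_src e'); move: h; rewrite /fe.
case: (eoP n) => g h1 h2; case: (eoP n') => g' h1' h2' eg; subst g'.
- by rewrite (finj _ _ (etrans h1 (esym h1'))) (finj _ _ (etrans h2 (esym h2'))).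
- by rewrite (finj _ _ (etrans h1 (esym h1'))) (finj _ _ (etrans h2 (esym h2'))) eoC// nbC nb_src.
- by rewrite (finj _ _ (etrans h1 (esym h1'))) (finj _ _ (etrans h2 (esym h2'))) eoC// nbC nb_src.
- by rewrite (finj _ _ (etrans h1 (esym h1'))) (finj _ _ (etrans h2 (esym h2'))).
Qed.

Lemma exits_sym m n d w : exits m n d (w \o fe) -> exits m n (f d) w.
Proof.
move=> [u [x [h1 h2 h3 h4]]]; exists (f u), (f x); split.
- by rewrite fnrm.
- apply: (connin_map (phi := f)) h2 => [y z _ _|y].
    by rewrite ostep_sym.
  by rewrite /inbox !subr0 fnrm.
- by rewrite -fD -ostep_sym.
- by move: h4; rewrite /inbox !subr0 -fD fnrm.
Qed.

Lemma pr_exits_sym (q : R) m n d : 0 <= q <= 1 -> pr q (exits m n d) <= pr q (exits m n (f d)).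
Proof.
move=> q01; rewrite -(pr_map q fe_inj (exits_local m n d)).
apply: pr_le => //; last by move=> w; apply: exits_sym.
  exact: (local_map fe (exits_local m n d)).
exact: exits_local.
Qed.

End Symmetry.

Definition refl (v : vertex) : vertex := (- v.1, v.2).
Definition swp (v : vertex) : vertex := (v.2, v.1).

Lemma pr_exits_refl (q : R) m n d : 0 <= q <= 1 -> pr q (exits m n d) <= pr q (exits m n (refl d)).
Proof.
apply: pr_exits_sym.
- by move=> [a b] [c e]; rewrite /refl /= opprD.
- by move=> [a b]; rewrite /refl /= opprK.
- by move=> [a b]; rewrite /refl /nrm /=; lia.
- move=> [a b] [c e]; rewrite /refl /nb /ostep !andbT /= !xpair_eqE; lia.
Qed.

Lemma pr_exits_swp (q : R) m n d : 0 <= q <= 1 -> pr q (exits m n d) <= pr q (exits m n (swp d)).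
Proof.
apply: pr_exits_sym.
- by move=> [a b] [c e].
- by move=> [a b].
- by move=> [a b]; rewrite /swp /nrm /= maxnC.
- move=> [a b] [c e]; rewrite /swp /nb /ostep !andbT /= !xpair_eqE; lia.
Qed.

(** Square-root trick: by symmetry the four failure probabilities are equal, and by Harris'
    inequality the fourth power of their common value is at most the probability that all four fail,
    which [spaced_reach] brings below [(1 / 8) ^ 4]. *)
Lemma four_exits (q c : R) : 0 <= q <= 1 -> 0 < c -> (forall n, c <= theta q n) ->
  exists m, forall n, (m <= n)%N -> forall d, d \in [:: (1, 0); (-1, 0); (0, 1); (0, -1)] ->
    7 / 8 <= pr q (exits m n d).
Proof.
move=> q01 c0 hc; have e0 : 0 < (1 / 8) ^+ 4 :> R by rewrite exprn_gt0//; lra.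
have [J [D hJ]] := spaced_reach q01 c0 hc e0.
exists (J * D)%N => n mn; set m := (J * D)%N in mn *.
have h1 : pr q (exits m n (1, 0)) <= pr q (exits m n (-1, 0)).
  by have := pr_exits_refl m n (1, 0) q01; rewrite /refl.
have h2 : pr q (exits m n (1, 0)) <= pr q (exits m n (0, 1)).
  by have := pr_exits_swp m n (1, 0) q01.
have h3 : pr q (exits m n (-1, 0)) <= pr q (exits m n (0, -1)).
  by have := pr_exits_swp m n (-1, 0) q01.
have h4 : pr q (exits m n (-1, 0)) <= pr q (exits m n (1, 0)).
  by have := pr_exits_refl m n (-1, 0) q01; rewrite /refl.
have h5 : pr q (exits m n (0, 1)) <= pr q (exits m n (1, 0)).
  by have := pr_exits_swp m n (0, 1) q01.
have h6 : pr q (exits m n (0, -1)) <= pr q (exits m n (-1, 0)).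
  by have := pr_exits_swp m n (0, -1) q01.
have lE d : local (exits m n d) by apply: exits_local.
have iE d : incr (exits m n d) by apply: exits_incr.
set P1 := pr q (exits m n (1, 0)) in h1 h2 h4 h5 *.
suff H : 7 / 8 <= P1.
  by move=> d; rewrite !inE => /or4P[] /eqP ->; rewrite -/P1//; lra.
pose x := 1 - P1.
have xE d : pr q (exits m n d) = P1 -> pr q (fun w => ~ exits m n d w) = x.
  by move=> e; rewrite pr_not// e.
have f1 := pr_FKG_dec q01 (lE (1, 0)) (lE (-1, 0)) (iE _) (iE _).
have f2 := pr_FKG_dec q01 (lE (0, 1)) (lE (0, -1)) (iE _) (iE _).
have lO A B : local A -> local B -> local (fun w : config => A w \/ B w) by apply: local_or.
have iO (A B : config -> Prop) : incr A -> incr B -> incr (fun w => A w \/ B w).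
  by move=> iA iB w w' h [a|b]; [left; apply: iA a|right; apply: iB b].
have f3 := pr_FKG_dec q01 (lO _ _ (lE (1, 0)) (lE (-1, 0))) (lO _ _ (lE (0, 1)) (lE (0, -1))) (iO _ _ (iE _) (iE _)) (iO _ _ (iE _) (iE _)).
have eO (A B : config -> Prop) : pr q (fun w => ~ (A w \/ B w)) = pr q (fun w => ~ A w /\ ~ B w).
  by apply: pr_eq => w; rewrite not_orP.
rewrite !eO in f3.
rewrite !xE // in f1 f2; try lra.
have x0 : 0 <= x by rewrite /x subr_ge0; apply: pr_le1.
have hx : x ^+ 4 <= (1 / 8) ^+ 4.
  apply: (@le_trans _ _ (pr q (fun w => ~ (exits m n (1, 0) w \/ exits m n (-1, 0) w) /\ ~ (exits m n (0, 1) w \/ exits m n (0, -1) w)))).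
    apply: le_trans f3; rewrite (_ : x ^+ 4 = (x * x) * (x * x)); last ring.
    by apply: ler_pM => //; rewrite mulr_ge0.
  have := hJ 0%N (m + n).+1; rewrite lerBlDr -lerBlDl -pr_not//; last first.
    by apply: local_ex => i _; apply: reach_local.
  apply: le_trans; apply: pr_le => //.
    by apply: local_and; apply: local_not; apply: lO.
    by apply: local_not; apply: local_ex => i _; apply: reach_local.
  move=> w [n1 n2] [i iJ hr].
  have [||d] := @exits_of_reach m n w _ _ _ mn _ hr; [|by []|].
  - by rewrite /nrm /= maxn0 add0n leq_mul2r; move: iJ; rewrite mem_iota add0n => /andP[_ /ltnW ->]; rewrite orbT.
  by rewrite !inE => /or4P[] /eqP -> he; [apply: n1; left|apply: n1; right|apply: n2; left|apply: n2; right].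
have : x <= 1 / 8 by rewrite -(@ler_pXn2r _ 4)// nnegrE//; lra.
rewrite /x; lra.
Qed.

End Exits.

(** * Separation by a dual path *)

Section Parity.
Implicit Types (w : config) (x y z : vertex).

Fixpoint par (F : vertex -> vertex -> bool) z s : bool :=
  if s is z' :: s' then F z z' (+) par F z' s' else false.

Lemma par_eq (R : rel vertex) F G z s : path R z s ->
  (forall x y, R x y -> F x y = G x y) -> par F z s = par G z s.
Proof. by move=> p h; elim: s z p => //= y s IH z /andP[/h -> /IH ->]. Qed.

Lemma par_add F G z s : par F z s (+) par G z s = par (fun x y => F x y (+) G x y) z s.
Proof. by elim: s z => //= y s IH z; rewrite -IH; do 4![case: (_ (_ : vertex))]. Qed.

Lemma par_bd (chi : pred vertex) z s :
  par (fun x y => chi x (+) chi y) z s = chi z (+) chi (last z s).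
Proof.
by elim: s z => /= [z|y s IH z]; [rewrite addbb|rewrite IH addbA -(addbA (chi z)) addbb addbF].
Qed.

(* A dual path from below row [-n] to above row [n] that stays in the columns
   [-n .. n] separates the columns [-n-1] and [n+1]: the side of a vertex is the parity of
   the number of steps of the dual path that cross its row to its right. *)
Lemma dual_separates (n : nat) w z s j j' (V : pred vertex) :
  path (ostep (dual w)) z s -> z.2 = - n%:Z - 1 -> (last z s).2 = n%:Z + 1 ->
  all (fun x => - n%:Z <= x.1 <= n%:Z) (z :: s) ->
  (forall x, V x -> - n%:Z <= x.2 <= n%:Z) ->
  - n%:Z <= j <= n%:Z ->
  ~ connin w V (- n%:Z - 1, j) (n%:Z + 1, j').
Proof.
move=> ps z2 l2 az VP jn c.
pose h (v x y : vertex) := (v.1 <= x.1) && ((x.2 < v.2) (+) (y.2 < v.2)).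
pose side v := par (h v) z s.
have dstep x y : ostep (dual w) x y -> [\/ x.2 = y.2 /\ x.1 = y.1 + 1 /\ ~~ w (x, true),
     x.2 = y.2 /\ y.1 = x.1 + 1 /\ ~~ w (y, true),
     x.1 = y.1 /\ x.2 = y.2 + 1 /\ ~~ w (x, false) |
     x.1 = y.1 /\ y.2 = x.2 + 1 /\ ~~ w (y, false)].
  case: x y => [a b] [a' b']; rewrite /ostep /dual /dual_e /= !xpair_eqE.
  by move=> /or4P[] /andP[/andP[/eqP-> /eqP->] hw]; [apply: Or42|apply: Or41|apply: Or44|apply: Or43].
(* The two parities differ only by the dual steps that cross the edge from [(x, y)] to [(x + 1, y)];
   there are none when it is open. *)
have hor (x y : int) : w ((x, y), false) -> side (x, y) = side (x + 1, y).
  move=> hw; apply: (par_eq ps) => u v /dstep H.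
  suff : h (x, y) u v (+) h (x + 1, y) u v = false by do 2![case: (h _ u v) => //].
  rewrite /h /=; case: u v H => [a b] [a' b'] /= [] [-> [-> nw]].
  - by rewrite addbb !andbF.
  - by rewrite addbb !andbF.
  - case: (eqVneq a' x) => [ex|nx]; last first.
      have -> : (x + 1 <= a') = (x <= a') by lia.
      by rewrite addbb.
    subst a'; have -> : (x <= x) by []. have -> : (x + 1 <= x) = false by lia.
    rewrite /= addbF; case: (eqVneq (b' + 1) y) => [ey|ny]; first by rewrite ey hw in nw.
    have -> : (b' + 1 < y) = (b' < y) by lia.
    by rewrite addbb.
  - case: (eqVneq a' x) => [ex|nx]; last first.
      have -> : (x + 1 <= a') = (x <= a') by lia.
      by rewrite addbb.
    subst a'; have -> : (x <= x) by []. have -> : (x + 1 <= x) = false by lia.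
    rewrite /= addbF; case: (eqVneq (b + 1) y) => [ey|ny]; first by rewrite ey hw in nw.
    have -> : (b + 1 < y) = (b < y) by lia.
    by rewrite addbb.
have ver (x y : int) : w ((x, y), true) -> - n%:Z <= y < n%:Z -> side (x, y) = side (x, y + 1).
  (* When the edge is open, the difference of the two crossing counts is the coboundary of [chi]. It
     telescopes, and [chi] vanishes at both ends of the dual path, which lie in rows [- n - 1] and
     [n + 1]. *)
  move=> hw yn; pose chi (u : vertex) := (x <= u.1) && (u.2 == y).
  have /eqP : par (fun u v => chi u (+) chi v) z s = false.
    rewrite par_bd /chi z2 l2.
    have -> : (- n%:Z - 1 == y) = false by lia.
    have -> : (n%:Z + 1 == y) = false by lia.
    by rewrite !andbF.
  rewrite (@par_eq _ _ (fun u v => h (x, y) u v (+) h (x, y + 1) u v) _ _ ps).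
    by rewrite -par_add -/(side (x, y)) -/(side (x, y + 1)); do 2![case: (side _) => //].
  move=> u v /dstep; rewrite /chi /h /=; case: u v => [a b] [a' b'] /= [] [-> [-> nw]].
  - rewrite !addbb ?andbF ?addbb /=.
    case: (eqVneq b' y) => [ey|_]; rewrite ?andbF// !andbT.
    case: (eqVneq (a' + 1) x) => [ex|nx]; first by rewrite ex ey hw in nw.
    have -> : (x <= a' + 1) = (x <= a') by lia.
    by rewrite addbb.
  - rewrite !addbb ?andbF ?addbb /=.
    case: (eqVneq b' y) => [ey|_]; rewrite ?andbF// !andbT.
    case: (eqVneq (a + 1) x) => [ex|nx]; first by rewrite ex ey hw in nw.
    have -> : (x <= a + 1) = (x <= a) by lia.
    by rewrite addbb.
  - case: (x <= a') => //=; lia.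
  - case: (x <= a') => //=; lia.
have sideC u v : V u -> V v -> ostep w u v -> side u = side v.
  move=> /VP uV /VP vV; rewrite ostepE => /andP[nuv].
  by case: (eoP nuv) uV vV => -[[a b] []] -> -> /= uV vV hw; [apply: ver|apply: hor|symmetry; apply: ver|symmetry; apply: hor] => //; lia.
have e : side (- n%:Z - 1, j) = side (n%:Z + 1, j').
  apply: (connin_ind c (Q := fun v => side (- n%:Z - 1, j) = side v)) => // u v Vu Vv st ->.
  exact: sideC.
(* From the left column every crossing of row [j] is counted, and a path from below a row to above
   it crosses it an odd number of times; from the right column none is counted. *)
have L : side (- n%:Z - 1, j) = true.
  transitivity (par (fun u v => (u.2 < j) (+) (v.2 < j)) z s); last first.
    by rewrite (par_bd (fun u => u.2 < j)) z2 l2; lia.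
  have : all (fun x => - n%:Z - 1 <= x.1) (z :: s) by apply: sub_all az => x /andP[]; lia.
  rewrite /side; elim: (s) (z) => //= y s' IH x /and3P[hx hy hs]; rewrite {1}/h /= hx IH//=.
  by rewrite hy.
have Rr : side (n%:Z + 1, j') = false.
  have : all (fun x => x.1 < n%:Z + 1) (z :: s) by apply: sub_all az => x /andP[]; lia.
  rewrite /side; elim: (s) (z) => //= y s' IH x /and3P[hx hy hs]; rewrite {1}/h /= leNgt hx IH//=.
  by rewrite hy.
by rewrite e Rr in L.
Qed.

End Parity.

(** * Zhang's construction of an edge separating two large clusters *)

Section Zhang.
Implicit Types (w : config) (x y z u v : vertex) (n m k : nat).

Lemma connin_upd w (V : pred vertex) a z y : nb a z -> V a -> V z ->
  connin (upd w (eo a z) true) V z y -> connin w V z y \/ connin w V a y.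
Proof.
move=> n Va Vz c; apply: (connin_ind c (Q := fun y => connin w V z y \/ connin w V a y)).
  by left; apply: connin_refl.
move=> x t Vx Vt; rewrite ostepE /upd => /andP[nxt]; case: eqP => [e _ _|_ wxt].
  have [->|->] : t = z \/ t = a; last 2 first.
  - by left; apply: connin_refl.
  - by right; apply: connin_refl.
  by move: e; case: (eoP nxt) => g e1 e2; case: (eoP n) => g' e3 e4 eg; [left|right|right|left]; congruence.
have st : ostep w x t by rewrite ostepE nxt.
by move=> [h|h]; [left|right]; apply: (connin_trans h); apply: connin_step.
Qed.

Definition out n w u := exists x y,
  [/\ connin w (inbox origin n) u x, ostep w x y & ~~ inbox origin n y].

(** Opening such an edge merges two clusters of the box that both leave it. *)
Definition bad n (e : edge) w :=
  [/\ out n w (src e), out n w (tgt e) & ~ connin w (inbox origin n) (src e) (tgt e)].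

Lemma out_conn n w u v : connin w (inbox origin n) u v -> out n w v -> out n w u.
Proof.
by move=> c [x [y [c1 c2 c3]]]; exists x, y; split => //; apply: connin_trans c1.
Qed.

Lemma out_incr n u : incr (fun w => out n w u).
Proof.
move=> w w' h [x [y [c1 c2 c3]]]; exists x, y; split => //; first exact: connin_incr c1.
exact: ostep_mono c2.
Qed.

Lemma bad_nb n w a z : nb a z -> out n w a -> out n w z ->
  ~ connin w (inbox origin n) a z -> bad n (eo a z) w.
Proof.
move=> h; case: (eoP h) => e -> -> oa oz nc; split => //.
by move=> c; apply: nc; apply: connin_sym.
Qed.

(** Consider the next vertex [z] of the path. If it is joined to [a], move on. If not and it leaves
    the box, the edge is bad. Otherwise opening the edge adds [z] to the cluster of [a] without
    joining this cluster to the end of the path. *)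
Lemma bad_on_path n k w a s : (k <= n)%N -> path nb a s -> all (inbox origin k) (a :: s) ->
  out n w a -> out n w (last a s) -> ~ connin w (inbox origin n) a (last a s) ->
  exists w1 e, [/\ forall e', e' \notin ebox origin k -> w1 e' = w e', e \in ebox origin k & bad n e w1].
Proof.
move=> kn; have kN x : inbox origin k x -> inbox origin n x by move=> /leq_trans; apply.
elim: s w a => [|z s IH] w a /=.
  by move=> _ /andP[ka _] _ _ nc; exfalso; apply: nc; apply: connin_refl; apply: kN.
move=> /andP[n1 ps] /and3P[ka kz ks] oa ob nc.
have eB : eo a z \in ebox origin k by rewrite mem_ebox; case: (eo_fst a z) => ->.
have kzs : all (inbox origin k) (z :: s) by rewrite /= kz.
have [caz|ncaz] := pselect (connin w (inbox origin n) a z).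
  apply: (IH w z) => //; first exact: out_conn (connin_sym caz) oa.
  by move=> c; apply: nc; apply: connin_trans c.
have [oz|noz] := pselect (out n w z).
  by exists w, (eo a z); split => //; apply: bad_nb.
pose w' := upd w (eo a z) true.
have ww' e : w e -> w' e by rewrite /w' /upd; case: eqP.
have [|||||w1 [e [h1 h2 h3]]] := IH w' z => //.
- apply: (@out_conn _ _ _ a); last exact: out_incr oa.
  by apply: connin_step; rewrite ?kN// ostepC ostepE n1 /w' upd_same.
- exact: out_incr ob.
- move=> /(connin_upd n1 (kN _ ka) (kN _ kz)) [c|//].
  by apply: noz; apply: out_conn ob.
exists w1, e; split => // e' he'; rewrite h1// /w' upd_other//.
by apply: contraNneq he' => ->.
Qed.

Lemma path_inbox k u v : inbox origin k u -> inbox origin k v ->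
  exists s, [/\ path nb u s, last u s = v & all (inbox origin k) (u :: s)].
Proof.
move=> ku kv; have H x : inbox origin k x -> connin (fun=> true) (inbox origin k) origin x.
  by move=> kx; have [s [ps ls as_ _]] := lattice_path kx; exists s.
have [s [ps ls as_]] := connin_trans (connin_sym (H _ ku)) (H _ kv).
by exists s.
Qed.

(* All edges of the box of radius [m + 1] are closed, which the dual crossings turn into a separation,
   then opened one by one along a path between the primal crossings until these become connected. *)
Lemma zhang m n w : (m + 2 < n)%N ->
  exits m n (1, 0) w -> exits m n (-1, 0) w ->
  exits m n (0, 1) (dual w) -> exits m n (0, -1) (dual w) ->
  exists w1 e, [/\ forall e', e' \notin ebox origin (m + 2) -> w1 e' = w e',
    e \in ebox origin (m + 2) & bad n e w1].
Proof.
move=> mn [uR [xR [R1 R2 R3 R4]]] [uL [xL [L1 L2 L3 L4]]] [uT [xT [T1 T2 T3 T4]]] [uB [xB [B1 B2 B3 B4]]].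
pose w0 : config := fun e => (e \notin ebox origin m.+1) && w e.
have w0w e : w0 e -> w e by case/andP.
have dw0 e : dual w e -> dual w0 e by apply: contraNN => /w0w.
(* Cuts a crossing at its last visit to the box of radius [m + 2], beyond which [w0] and [w]
   agree. *)
have core x u d : (nrm u <= m)%N -> connin w (inbox origin n) u x -> ostep w x (x + d) ->
    ~~ inbox origin n (x + d) -> exists2 b, inbox origin (m + 2) b &
    connin w0 (inbox origin n) b x /\ ostep w0 x (x + d).
  move=> um c st nx.
  have stay y z : ostep w y z -> ~~ inbox origin (m + 2) y -> ostep w0 y z.
    rewrite !ostepE => /andP[nyz wyz] ny; rewrite nyz /w0 wyz andbT mem_ebox.
    apply: contraNN ny => h; rewrite /inbox.
    case: (eo_fst y z) h => -> h; first by apply: leq_trans h _; rewrite addn2.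
    by rewrite nbC in nyz; apply: leq_trans (nb_dist _ nyz) _; rewrite addn2.
  have nxm : ~~ inbox origin (m + 2) x.
    have := nb_dist origin (ostep_nb st); rewrite /inbox in nx *; rewrite -!ltnNge in nx *.
    by move=> h; apply: leq_trans mn _; rewrite -ltnS; apply: leq_trans nx h.
  have [|y [b [c1 c2 c3 c4]]] := first_exit (connin_sym c) (U := fun y => ~~ inbox origin (m + 2) y) nxm.
    by rewrite negbK /inbox subr0; apply: leq_trans um _; rewrite leq_addr.
  have /andP[/= By ny] := connin_r c1.
  rewrite negbK in c3; exists b => //; split; last exact: stay.
  apply: (@connin_trans _ _ _ y).
    by apply: connin_step => //; rewrite ostepC; apply: stay.
  apply: connin_sym; apply: connin_sub c1 => [t t' /andP[_ nt] _ st'|t /andP[]//].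
  exact: stay.
have [b kb [cb sb]] := core _ _ _ R1 R2 R3 R4.
have [a ka [ca sa]] := core _ _ _ L1 L2 L3 L4.
have iR := connin_r R2; have iL := connin_r L2; have iT := connin_r T2; have iB := connin_r B2.
have eR : xR.1 + 1 = n%:Z + 1 /\ - n%:Z <= xR.2 <= n%:Z.
  by move: iR R4; rewrite /inbox !subr0 /nrm /=; clear; case: xR => ? ? /=; lia.
have eL : xL.1 - 1 = - n%:Z - 1 /\ - n%:Z <= xL.2 <= n%:Z.
  by move: iL L4; rewrite /inbox !subr0 /nrm /=; clear; case: xL => ? ? /=; lia.
have eT : xT.2 + 1 = n%:Z + 1 /\ - n%:Z <= xT.1 <= n%:Z.
  by move: iT T4; rewrite /inbox !subr0 /nrm /=; clear; case: xT => ? ? /=; lia.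
have eB : xB.2 - 1 = - n%:Z - 1 /\ - n%:Z <= xB.1 <= n%:Z.
  by move: iB B4; rewrite /inbox !subr0 /nrm /=; clear; case: xB => ? ? /=; lia.
pose Vd x := - n%:Z <= x.1 <= n%:Z.
have BVd x : inbox origin n x -> Vd x.
  by rewrite /inbox subr0 /nrm /Vd; clear; case: x => ? ? /=; lia.
(* The edges closed in [w0] open every dual edge of the box of radius [m], which joins the two dual
   crossings into one. *)
have dpath : connin (dual w0) Vd (xB + (0, -1)) (xT + (0, 1)).
  apply: (@connin_trans _ _ _ xB).
    apply: connin_step; [by case: eB => _; rewrite /Vd /= addr0|by apply: BVd|].
    by rewrite ostepC; apply: ostep_mono B3.
  apply: (@connin_trans _ _ _ xT); last first.
    apply: connin_step; [by apply: BVd|by case: eT => _; rewrite /Vd /= addr0|].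
    by apply: ostep_mono T3.
  apply: (@connin_subV _ (inbox origin n)) => //.
  apply: (@connin_trans _ _ _ uB); first by apply: connin_sym; apply: connin_incr B2.
  apply: (@connin_trans _ _ _ uT); last by apply: connin_incr T2.
  have mB : inbox origin m uB by rewrite /inbox subr0.
  have mT : inbox origin m uT by rewrite /inbox subr0.
  have [s [ps ls as_]] := path_inbox mB mT.
  have : connin (fun=> true) (inbox origin m) uB uT by exists s.
  apply: connin_sub => [x y mx my|x /leq_trans]; last first.
    by apply; apply: leq_trans (ltnW mn); rewrite leq_addr.
  move=> nxy; rewrite ostepE [X in X && _]nxy /= /dual /w0 negb_and negbK; apply/orP; left.
  rewrite mem_ebox subr0; have : (nrm (eo x y).1 <= m)%N.
    by move: mx my; rewrite /inbox !subr0; case: (eo_fst x y) => ->.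
  by rewrite /dual_e; clear; case: (eo x y) => [[? ?] []] /=; rewrite /nrm /=; lia.
have nab : ~ connin w0 (inbox origin n) a b.
  move=> cab; have [s [ps ls as_]] := dpath.
  pose V y := - n%:Z <= y.2 <= n%:Z.
  have BV x : inbox origin n x -> V x.
    by rewrite /inbox subr0 /nrm /V; clear; case: x => ? ? /=; lia.
  apply: (@dual_separates n w0 _ s xL.2 xR.2 V ps _ _ as_ _ _) => //.
  - by case: eB.
  - by rewrite ls; case: eT.
  - by case: eL.
  have -> : (- n%:Z - 1, xL.2) = xL + (-1, 0) by case: eL => <- _; case: (xL) => ? ?; congr pair; rewrite /= addr0.
  have -> : (n%:Z + 1, xR.2) = xR + (1, 0) by case: eR => <- _; case: (xR) => ? ?; congr pair; rewrite /= addr0.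
  apply: (@connin_trans _ _ _ xL).
    apply: connin_step; [by case: eL => _; rewrite /V /= addr0|exact: BV|by rewrite ostepC].
  apply: (@connin_trans _ _ _ xR); last first.
    apply: connin_step; [exact: BV|by case: eR => _; rewrite /V /= addr0|by []].
  apply: (@connin_subV _ (inbox origin n)) => //.
  by apply: (connin_trans (connin_sym ca)); apply: (connin_trans cab).
have [s [ps ls as_]] := path_inbox ka kb.
have [|||w1 [e [h1 h2 h3]]] := @bad_on_path n (m + 2) w0 a s (ltnW mn) ps as_.
- by exists xL, (xL + (-1, 0)).
- by rewrite ls; exists xR, (xR + (1, 0)).
- by rewrite ls.
exists w1, e; split => // e' he'; rewrite h1// /w0 mem_ebox.
have -> : ~~ (nrm (e'.1 - origin) <= m.+1)%N.
  by apply: contraNN he' => h; rewrite mem_ebox addn2; apply: leqW.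
by [].
Qed.

End Zhang.

Lemma ler_sum_subset (R : realType) (I : eqType) (s t : seq I) (F : I -> R) :
  uniq s -> uniq t -> {subset s <= t} -> (forall i, 0 <= F i) ->
  \sum_(i <- s) F i <= \sum_(i <- t) F i.
Proof.
move=> us ut st F0; rewrite [leRHS](bigID (fun i => i \in s)) /= -[leLHS]addr0.
apply: lerD; last by apply: sumr_ge0.
have -> // : \sum_(i <- s) F i = \sum_(i <- t | i \in s) F i.
rewrite -[RHS]big_filter; apply: perm_big; apply: uniq_perm => //; first exact: filter_uniq.
by move=> i; rewrite mem_filter; case: (boolP (i \in s)) => //= /st ->.
Qed.

(** * Counting the clusters that touch the boundary of a box *)

Section ClusterCount.
Variable R : realType.
Implicit Types (w : config) (n m N : nat) (q : R) (z u v : vertex).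

Definition bdry N : seq vertex :=
  [seq (i%:Z - N%:Z, N%:Z) | i <- iota 0 (2 * N).+1] ++
  [seq (i%:Z - N%:Z, - N%:Z) | i <- iota 0 (2 * N).+1] ++
  [seq (N%:Z, i%:Z - N%:Z) | i <- iota 0 (2 * N).+1] ++
  [seq (- N%:Z, i%:Z - N%:Z) | i <- iota 0 (2 * N).+1].

Lemma size_bdry N : size (bdry N) = (4 * (2 * N).+1)%N.
Proof. rewrite !size_cat !size_map !size_iota; lia. Qed.

Lemma mem_bdry N v : nrm v = N -> v \in bdry N.
Proof.
case: v => [a b]; rewrite /nrm /= => h; rewrite !mem_cat.
have H (c : int) : (absz c <= N)%N -> exists2 i, i \in iota 0 (2 * N).+1 & i%:Z - N%:Z = c.
  by move=> hc; exists (absz (c + N%:Z)); rewrite ?mem_iota; lia.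
have [i1 hi1 e1] : exists2 i, i \in iota 0 (2 * N).+1 & i%:Z - N%:Z = a by apply: H; lia.
have [i2 hi2 e2] : exists2 i, i \in iota 0 (2 * N).+1 & i%:Z - N%:Z = b by apply: H; lia.
have : [\/ b = N%:Z, b = - N%:Z, a = N%:Z | a = - N%:Z].
  have : (b == N%:Z) || (b == - N%:Z) || (a == N%:Z) || (a == - N%:Z) by lia.
  by move=> /orP[/orP[/orP[]|]|] /eqP ->; [apply: Or41|apply: Or42|apply: Or43|apply: Or44].
case=> e; apply/or4P.
- by apply: Or41; apply/mapP; exists i1 => //; rewrite e1 e.
- by apply: Or42; apply/mapP; exists i1 => //; rewrite e1 e.
- by apply: Or43; apply/mapP; exists i2 => //; rewrite e2 e.
- by apply: Or44; apply/mapP; exists i2 => //; rewrite e2 e.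
Qed.

Definition bpt N i := nth origin (bdry N) i.

Definition first_rep N i w := forall j, j \in iota 0 i -> ~ connin w (inbox origin N) (bpt N j) (bpt N i).

(* Clusters touching the boundary are counted through their first boundary vertex. *)
Definition nclus N w : R := \sum_(i <- iota 0 (size (bdry N))) ind R (first_rep N i w).

Lemma connbox_dep N u v : depon (fun e => e \in ebox origin N) (fun w => connin w (inbox origin N) u v).
Proof. by apply: connin_dep_box. Qed.

Lemma first_rep_dep N i : depon (fun e => e \in ebox origin N) (first_rep N i).
Proof. by apply: deponP => w w' h f j ji; rewrite -(@connbox_dep N _ _ w w' h); apply: f. Qed.

Lemma nclus_dep N : depon (fun e => e \in ebox origin N) (nclus N).
Proof. by move=> w w' h; apply: eq_bigr => i _; rewrite (@first_rep_dep N i w w' h). Qed.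

Lemma nclus_ge0 N w : 0 <= nclus N w.
Proof. by apply: sumr_ge0 => i _; apply: ind_ge0. Qed.

Lemma nclus_le N w : nclus N w <= (4 * (2 * N).+1)%N%:R.
Proof.
rewrite -size_bdry /nclus -{2}(size_iota 0 (size (bdry N))).
elim: (iota _ _) => [|i s IH]; rewrite ?big_nil ?big_cons//=.
by rewrite -nat1r lerD// ind_le1.
Qed.

Lemma first_rep_decr N i w w' : (forall e, w e -> w' e) -> first_rep N i w' -> first_rep N i w.
Proof. by move=> h f j /f nc c; apply: nc; apply: connin_incr c. Qed.

Lemma out_bpt N w u : out N w u -> exists2 i, i \in iota 0 (size (bdry N)) & connin w (inbox origin N) u (bpt N i).
Proof.
move=> [x [y [c st ny]]].
have xN : nrm x = N.
  have := connin_r c; rewrite /inbox in ny *; have := nb_dist origin (ostep_nb st).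
  rewrite [x - origin]subr0; rewrite -ltnNge in ny; move=> h1 h2; apply/eqP; rewrite eqn_leq h2 /=.
  by rewrite -ltnS; apply: leq_trans ny h1.
exists (index x (bdry N)); first by rewrite mem_iota leq0n add0n index_mem mem_bdry.
by rewrite /bpt nth_index// mem_bdry.
Qed.

Lemma out_first N w u : out N w u -> exists i, [/\ i \in iota 0 (size (bdry N)),
  connin w (inbox origin N) u (bpt N i) & first_rep N i w].
Proof.
move=> /out_bpt[i hi ci].
have ex : exists i, `[<connin w (inbox origin N) u (bpt N i)>] by exists i; apply/asboolP.
case: (ex_minnP ex) => i0 /asboolP c0 min0; exists i0; split => //.
  have h : (i0 <= i)%N by apply: min0; apply/asboolP.
  by move: hi; rewrite !mem_iota !leq0n !add0n; apply: leq_ltn_trans.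
move=> j; rewrite mem_iota add0n /= => ji cj.
have : (i0 <= j)%N.
  by apply: min0; apply/asboolP; apply: connin_trans c0 (connin_sym cj).
by rewrite leqNgt ji.
Qed.

(** Opening an edge never creates a cluster. Opening a bad one merges two clusters with distinct
    first boundary vertices, and the later of these is no longer counted. *)
Lemma infl_nclus N e w : infl e (nclus N) w <= - ind R (bad N e w).
Proof.
have mono_le : nclus N (upd w e true) <= nclus N (upd w e false).
  apply: ler_sum => i _; apply: ind_le; apply: first_rep_decr; exact: upd_mono.
have [[os ot nc]|nb] := pselect (bad N e w); last by rewrite (indF R nb) oppr0 /infl subr_le0.
rewrite indT// /infl.
have is_ : inbox origin N (src e) by have [x [y [/connin_l]]] := os.
have it_ : inbox origin N (tgt e) by have [x [y [/connin_l]]] := ot.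
have we : w e = false.
  by apply/negP => we; apply: nc; apply: connin_step => //; rewrite ostep_src.
have -> : upd w e false = w by rewrite -we upd_id.
set w' := upd w e true.
have ww' x : w x -> w' x by rewrite /w' /upd; case: eqP.
have [i [hi ci fi]] := out_first os; have [j [hj cj fj]] := out_first ot.
have cst : connin w' (inbox origin N) (src e) (tgt e).
  by apply: connin_step => //; rewrite ostep_src /w' upd_same.
have cij : connin w' (inbox origin N) (bpt N i) (bpt N j).
  apply: (@connin_trans _ _ _ (src e)); first by apply: connin_sym; apply: connin_incr ci.
  by apply: (connin_trans cst); apply: connin_incr cj.
have nij : i != j.
  by apply: contra_notN nc => /eqP eij; apply: connin_trans ci _; rewrite eij; apply: connin_sym.
have [k [hk fk nfk]] : exists k, [/\ k \in iota 0 (size (bdry N)), first_rep N k w & ~ first_rep N k w'].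
  move: nij; rewrite neq_ltn => /orP[ij|ji].
    by exists j; split => // /(_ i); rewrite mem_iota add0n => /(_ ij).
  by exists i; split => // /(_ j); rewrite mem_iota add0n => /(_ ji) []; apply: connin_sym.
rewrite /nclus (big_rem k)//= [X in _ - X](big_rem k)//= (indT R fk) (indF R nfk) add0r.
rewrite opprD addrCA -[leRHS]addr0 lerD2l subr_le0; apply: ler_sum => l _.
by apply: ind_le; apply: first_rep_decr.
Qed.

Lemma out_local n u : local (fun w => out n w u).
Proof.
exists (ebox origin n.+1); apply: deponP => w w' h [x [y [c st ny]]]; exists x, y; split => //.
  rewrite -(@connin_dep_box _ origin n.+1 u x _ w w')// => t; rewrite /inbox => /leq_trans; exact.
move: st; rewrite !ostepE => /andP[a we]; rewrite a -h// mem_ebox.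
have xn : (nrm (x - origin) <= n)%N by apply: connin_r c.
case: (eo_fst x y) => ->; first exact: leqW.
by apply: leq_trans (nb_dist _ a) _.
Qed.

Lemma bad_local n e : local (fun w => bad n e w).
Proof.
have : local (fun w => out n w (src e) /\ (out n w (tgt e) /\ ~ connin w (inbox origin n) (src e) (tgt e))).
  apply: local_and; first exact: out_local.
  apply: local_and; first exact: out_local.
  by apply: local_not; exists (ebox origin n); apply: connbox_dep.
apply: local_ext => w; apply/propext; split => [[h1 [h2 h3]]|[h1 h2 h3]]; by split.
Qed.

(** The mean of [nclus] lies between 0 and the size of the boundary, and by Russo's formula its
    derivative is at most minus the mean number of bad edges; [q] comes from the mean value
    theorem. *)
Lemma nclus_diff N (q1 q2 : R) : 0 < q1 -> q1 < q2 -> q2 < 1 ->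
  exists q, [/\ q1 <= q, q <= q2 &
  (\sum_(e <- ebox origin N) pr q (bad N e)) * (q2 - q1) <= (4 * (2 * N).+1)%N%:R].
Proof.
move=> q10 q12 q21; pose g q := E_ q (nclus N).
have lN : local (nclus N) by exists (ebox origin N); apply: nclus_dep.
have gE q : g q = Ex q (ebox origin N) (nclus N) (fun=> false) by apply: E_E; apply: nclus_dep.
have der q : is_derive q (1 : R) g (\sum_(e <- ebox origin N) E_ q (infl e (nclus N))).
  rewrite (_ : g = (fun q => Ex q (ebox origin N) (nclus N) (fun=> false))); last by apply/funext.
  apply: (is_derive_eq (Ex_russo (nclus N) (fun=> false) q (ebox_uniq origin N))).
  apply: eq_bigr => e _; symmetry; apply: E_E => w w' h; rewrite /infl.
  have H b : nclus N (upd w e b) = nclus N (upd w' e b).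
    by apply: nclus_dep => e' he; rewrite /upd; case: ifP => // _; exact: h.
  by rewrite !H.
have [|c cI hc] := @MVT R g (fun q => \sum_(e <- ebox origin N) E_ q (infl e (nclus N))) q1 q2 q12 (fun x _ => der x).
  apply: derivable_within_continuous => x _; by case: (der x).
move: cI; rewrite in_itv /= => /andP[h1 h2].
exists c; split; [exact: ltW|exact: ltW|].
have q101 : 0 <= q1 <= 1 by rewrite (ltW q10)/= ltW// (lt_trans q12).
have q201 : 0 <= q2 <= 1 by rewrite (ltW q21) andbT ltW// (lt_trans q10).
have c01 : 0 <= c <= 1 by rewrite (ltW (lt_trans q10 h1)) (ltW (lt_trans h2 q21)).
have G1 : g q1 <= (4 * (2 * N).+1)%N%:R.
  rewrite -[leRHS](E_cst edge q1); apply: E_le => //; [exact: local_cst|exact: nclus_le].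
have G2 : 0 <= g q2 by apply: E_ge0 => //; exact: nclus_ge0.
have : \sum_(e <- ebox origin N) pr c (bad N e) <= - \sum_(e <- ebox origin N) E_ c (infl e (nclus N)).
  rewrite -sumrN; apply: ler_sum => e _; rewrite lerNr /pr -E_N; last exact/local_ind/bad_local.
  apply: E_le => //; first exact: local_infl.
    apply: (local1 (fun y : R => - y)); exact/local_ind/bad_local.
  exact: infl_nclus.
move=> H; apply: (@le_trans _ _ ((- \sum_(e <- ebox origin N) E_ c (infl e (nclus N))) * (q2 - q1))).
  by apply: ler_wpM2r => //; rewrite subr_ge0 ltW.
rewrite mulNr -hc; lra.
Qed.

(** Badness passes to a smaller box that contains both ends: leaving the large box implies leaving
    the small one, and a connection in the small box is one in the large box. A single estimate in a
    centred box thus serves all translates of an edge. *)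
Lemma shift_bad N n z (c : edge) w : (nrm z + N <= n)%N ->
  inbox origin N (src c + z) -> inbox origin N (tgt c + z) ->
  bad n c (translate z w) -> bad N (src c + z, c.2) w.
Proof.
move=> zn is_ it_ [os ot nc].
have sE : src (src c + z, c.2) = src c + z by [].
have tE : tgt (src c + z, c.2) = tgt c + z.
  by case: c {is_ it_ os ot nc sE} => [[a b] []]; rewrite /tgt /src /=; congr pair; rewrite addrAC.
have sub x : inbox origin N x -> inbox origin n (x - z).
  rewrite /inbox !subr0 => h; apply: leq_trans (nrmD _ _) _; rewrite nrmN addnC.
  by apply: leq_trans zn; rewrite leq_add2l.
have outE u : inbox origin N (u + z) -> out n (translate z w) u -> out N w (u + z).
  move=> iu [x [y [/connin_shift cx st ny]]].
  have cy : connin w predT (u + z) (y + z).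
    apply: (@connin_trans _ _ _ (x + z)); first by apply: connin_subV cx.
    by apply: connin_step => //; rewrite -ostep_shift.
  have [|x' [y' [c1 c2 c3 _]]] := first_exit cy (U := inbox origin N) iu.
    by apply: contraNN ny => /sub; rewrite addrK.
  by exists x', y'; split => //; apply: connin_subV c1 => t /andP[].
rewrite /bad sE tE; split; [exact: outE|exact: outE|] => cN; apply: nc.
by apply/connin_shift; apply: connin_subV cN => x; apply: sub.
Qed.

Lemma bad_pr_lower (q1 q : R) m n : 0 < q1 -> q1 <= q -> q <= 1 / 2 ->
  (forall n, (m <= n)%N -> forall d, d \in [:: (1, 0); (-1, 0); (0, 1); (0, -1)] ->
    7 / 8 <= pr q1 (exits m n d)) -> (m + 2 < n)%N ->
  exists2 c, c \in ebox origin (m + 2) &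
    q1 ^+ size (ebox origin (m + 2)) / 2 / (size (ebox origin (m + 2)))%:R <= pr q (bad n c).
Proof.
move=> q10 qq q2 hm mn; set S := ebox origin (m + 2); set K := size S.
have q01 : 0 <= q <= 1 by lra.
have K0 : 0 < K%:R :> R by rewrite ltr0n /K size_ebox muln_gt0 expn_gt0.
have mn' : (m <= n)%N by lia.
pose Z w := (exits m n (1, 0) w /\ exits m n (-1, 0) w) /\ (exits m n (0, 1) (dual w) /\ exits m n (0, -1) (dual w)).
have lE d : local (exits m n d) by apply: exits_local.
have lD d : local (fun w => exits m n d (dual w)) by apply: local_dual.
have lZ : local Z by apply: local_and; apply: local_and.
have hP d : d \in [:: (1, 0); (-1, 0); (0, 1); (0, -1)] -> pr q (fun w => ~ exits m n d w) <= 1 / 8.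
  move=> dd; rewrite pr_not//; have := hm n mn' d dd.
  have : pr q1 (exits m n d) <= pr q (exits m n d) by apply: pr_incr => //; [lra|lra|exact: exits_incr].
  lra.
have hD d : d \in [:: (1, 0); (-1, 0); (0, 1); (0, -1)] -> pr q (fun w => ~ exits m n d (dual w)) <= 1 / 8.
  move=> dd; rewrite pr_not// (pr_dual q (lE d)); have := hm n mn' d dd.
  have : pr q1 (exits m n d) <= pr (1 - q) (exits m n d) by apply: pr_incr => //; [lra|lra|lra|exact: exits_incr].
  lra.
(* Since [q1 <= q <= 1 - q], both the configuration and its dual satisfy the exit estimate, and four
   failures of probability at most 1/8 leave 1/2. *)
have ZP : 1 / 2 <= pr q Z.
  have : pr q (fun w => ~ Z w) <= 1 / 2.
    apply: (@le_trans _ _ (pr q (fun w => (~ exits m n (1, 0) w \/ ~ exits m n (-1, 0) w) \/ (~ exits m n (0, 1) (dual w) \/ ~ exits m n (0, -1) (dual w))))).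
      apply: pr_le => //; first exact: local_not.
        by apply: local_or; apply: local_or; apply: local_not.
      by move=> w; rewrite /Z !not_andP.
    apply: le_trans (pr_or q01 _ _) _; try by apply: local_or; apply: local_not.
    have l1 : local (fun w => ~ exits m n (1, 0) w) by apply: local_not.
    have l2 : local (fun w => ~ exits m n (-1, 0) w) by apply: local_not.
    have l3 : local (fun w => ~ exits m n (0, 1) (dual w)) by apply: local_not.
    have l4 : local (fun w => ~ exits m n (0, -1) (dual w)) by apply: local_not.
    have := pr_or q01 l1 l2; have := pr_or q01 l3 l4.
    have := hP (1, 0); have := hP (-1, 0); have := hD (0, 1); have := hD (0, -1).
    rewrite !inE !eqxx /= ?orbT => /(_ isT) ? /(_ isT) ? /(_ isT) ? /(_ isT) ? ? ?; lra.
  by rewrite pr_not//; lra.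
pose g w : R := \sum_(e <- S) ind R (bad n e w).
have lg : local g by apply: local_sum => e _ _; exact/local_ind/bad_local.
have step w : q1 ^+ K * ind R (Z w) <= Ex q S g w.
  have g0 (v : config) : 0 <= g v by apply: sumr_ge0 => e _; exact: ind_ge0.
  have [hz|nz] := pselect (Z w); last first.
    by rewrite (indF R nz) mulr0 -(Ex_cst q S 0 w); apply: Ex_le.
  rewrite (indT R hz) mulr1.
  have [w1 [e [h1 h2 h3]]] := zhang mn hz.1.1 hz.1.2 hz.2.1 hz.2.2.
  have q1' : q1 <= 1 - q by lra.
  apply: le_trans (Ex_lower (ltW q10) qq q1' g0 h1).
  rewrite -[leLHS]mulr1 ler_wpM2l ?exprn_ge0 ?(ltW q10)// /g (big_rem e)//= indT// lerDl.
  by apply: sumr_ge0 => ? _; exact: ind_ge0.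
have tot : q1 ^+ K / 2 <= \sum_(e <- S) pr q (bad n e).
  rewrite /pr -E_sum; last by move=> e _ _; exact/local_ind/bad_local.
  rewrite -/g -(E_Ex q S lg); apply: (@le_trans _ _ (E_ q (fun w => q1 ^+ K * ind R (Z w)))).
    rewrite E_Z; last exact: local_ind.
    by apply: ler_wpM2l; [rewrite exprn_ge0// ltW|rewrite -[_^-1]mul1r; exact: ZP].
  apply: E_le => //; [by apply: local1; exact: local_ind|exact: local_E].
apply: contrapT => nex.
have : \sum_(e <- S) pr q (bad n e) < \sum_(e <- S) (q1 ^+ K / 2 / K%:R).
  rewrite big_seq [ltRHS]big_seq; apply: ltr_sum.
    by apply/hasP; exists (head ((0, 0), true) S); move: K0; rewrite /K; case: (S) => [|a l] /=; rewrite ?ltxx ?inE ?eqxx.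
  by move=> e eS; rewrite ltNge; apply/negP => h; apply: nex; exists e.
rewrite big_const_seq count_predT iter_addr_0 -/K -[X in _ < X]mulr_natr divfK ?gt_eqF//.
by rewrite ltNge tot.
Qed.

End ClusterCount.

(** * Exponential decay below one half *)

Section Subcritical.
Variable R : realType.
Implicit Types q : R.

(** Otherwise [theta] is bounded below beyond [q], and bad edges have positive density at every
    parameter between [q1] and [q2]: their mean number in a box is of the order of its area, whereas
    [nclus_diff] bounds it by the perimeter at one such parameter. *)
Lemma subcritical_phi q : 0 < q -> q < 1 / 2 -> exists (S : pred vertex) N,
  [/\ S origin, forall x, S x -> (nrm x < N)%N & phi q S N < 1].
Proof.
move=> q0 q12; apply: contrapT => nex.
have big (S : pred vertex) N : S origin -> (forall x, S x -> (nrm x < N)%N) -> 1 <= phi q S N.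
  by move=> S0 SN; rewrite leNgt; apply/negP => h; apply: nex; exists S, N.
pose q1 := q + (1 / 2 - q) / 3; pose q2 := q + (1 / 2 - q) * 2 / 3.
have q101 : 0 <= q1 <= 1 by rewrite /q1; lra.
have hc n : (q1 - q) / (1 + (q1 - q)) <= theta q1 n by apply: theta_lower => //; rewrite /q1; lra.
have c0 : 0 < (q1 - q) / (1 + (q1 - q)) by rewrite divr_gt0// /q1; lra.
have [m hm] := four_exits q101 c0 hc.
have q10 : 0 < q1 by rewrite /q1; lra.
have q12' : q1 < q2 by rewrite /q1 /q2; lra.
have q21 : q2 <= 1 / 2 by rewrite /q2; lra.
set K := size (ebox origin (m + 2)).
pose beta := q1 ^+ K / 2 / K%:R.
have K0 : 0 < K%:R :> R by rewrite ltr0n /K size_ebox muln_gt0 expn_gt0.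
have b0 : 0 < beta by rewrite /beta !divr_gt0// exprn_gt0.
have bd0 : 0 < beta * (q2 - q1) by rewrite mulr_gt0// subr_gt0.
(* The perimeter bound [4 * (2 * N + 1)] equals [8 m + 28 + 8 t]; this choice puts the area bound
   above [(8 m + 28) * (2 t + 1)]. *)
pose t := Num.truncn ((8 * m + 28)%N%:R / (beta * (q2 - q1))).
pose N := (m + 3 + t)%N.
have [|c [qc1 qc2 hN]] := @nclus_diff R N q1 q2 q10 q12'; first lra.
have [|a aS ha] := @bad_pr_lower R q1 c m (N + N) q10 qc1 (le_trans qc2 q21) hm.
  by rewrite /N; move: (m) (t) => m' t'; clear; lia.
have c01 : 0 <= c <= 1 by lra.
have key : beta * ((2 * t).+1 ^ 2)%N%:R <= \sum_(e <- ebox origin N) pr c (bad N e).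
  have p0 e : 0 <= pr c (bad N e) by apply: pr_ge0 => //; exact: bad_local.
  pose f (z : vertex) : edge := (src a + z, a.2).
  have us : uniq [seq f z | z <- vbox origin t].
    by rewrite map_inj_uniq ?vbox_uniq// => -[z1 z2] [z1' z2'] [/addrI -> /addrI ->].
  have na : (nrm (src a) <= m + 2)%N by move: aS; rewrite mem_ebox subr0.
  have nt : (nrm (tgt a) <= m + 3)%N.
    by have := nb_dist origin (nb_src a); rewrite !subr0 => /leq_trans; apply; rewrite addnS ltnS.
  apply: (@le_trans _ _ (\sum_(e <- [seq f z | z <- vbox origin t]) pr c (bad N e))); last first.
    apply: ler_sum_subset => //; first exact: ebox_uniq.
    move=> e /mapP[z]; rewrite mem_vbox subr0 => hz ->; rewrite mem_ebox /= subr0.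
    apply: leq_trans (nrmD _ _) (leq_trans (leq_add na hz) _).
    by rewrite /N leq_add2r leq_add2l.
  rewrite big_map -(size_vbox origin) mulr_natr -iter_addr_0 -(count_predT (vbox origin t)) -big_const_seq.
  rewrite big_seq [leRHS]big_seq; apply: ler_sum => z; rewrite mem_vbox subr0 => hz.
  apply: le_trans ha _; rewrite -(pr_shift c z (bad_local (N + N) a)).
  apply: pr_le => //; first exact: local_shift (bad_local _ _).
    exact: bad_local.
  move=> w; apply: shift_bad; first by rewrite leq_add2r (leq_trans hz)// /N leq_addl.
    rewrite /inbox subr0; apply: leq_trans (nrmD _ _) (leq_trans (leq_add na hz) _).
    by rewrite /N leq_add2r leq_add2l.
  by rewrite /inbox subr0; apply: leq_trans (nrmD _ _) (leq_add nt hz).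
have : beta * ((2 * t).+1 ^ 2)%N%:R * (q2 - q1) <= (4 * (2 * N).+1)%N%:R.
  by apply: le_trans hN; rewrite ler_wpM2r// subr_ge0 ltW.
have ht : (8 * m + 28)%N%:R / (beta * (q2 - q1)) < (2 * t).+1%:R.
  by apply: lt_le_trans (truncnS_gt _) _; rewrite -/t ler_nat ltnS mul2n -addnn leq_addr.
rewrite ltr_pdivrMr// in ht; rewrite mulrAC -mulnn natrM mulrA => hle.
have : (8 * m + 28)%N%:R * (2 * t).+1%:R < (4 * (2 * N).+1)%N%:R :> R.
  apply: lt_le_trans hle; rewrite ltr_pM2r ?ltr0n//.
  by rewrite [beta * _ * _]mulrC.
rewrite -natrM ltr_nat /N; move: (m) (t) => m' t'; clear; nia.
Qed.

Lemma subcritical_decay q : 0 <= q -> q < 1 / 2 ->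
  exists C b : R, [/\ 0 < C, 0 < b < 1 & forall q' n, 0 <= q' -> q' <= q -> theta q' n <= C * b ^+ n].
Proof.
move=> q0 q12; pose q1 := (q + 1 / 2) / 2.
have h1 : 0 < q1 by rewrite /q1; lra.
have h2 : q1 < 1 / 2 by rewrite /q1; lra.
have [S [N [S0 SN hphi]]] := subcritical_phi h1 h2.
have h01 : 0 <= q1 <= 1 by lra.
have [C [b [C0 b01 H]]] := exp_decay S0 SN h01 hphi.
exists C, b; split => // q' n q'0 q'q; apply: le_trans (H n); apply: theta_mono => //; rewrite /q1; lra.
Qed.

End Subcritical.

(** * Bypassing a dual cluster *)

Section Enclosure.
Implicit Types (u v : vertex) (f : edge).
Variables (w : config) (e : edge) (r : nat) (a : vertex).
Hypothesis rad : ~ reach (dual w) e.1 r.+1.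

Let Lam := inbox e.1 (r + 3).
Let C v := `[<connin w Lam a v>].
Let Kd v := `[<connin (dual w) predT e.1 v>].
Let K f := (C (src f) (+) C (tgt f)) && Kd f.1.

Let Kd_near v : Kd v -> (nrm (v - e.1)%R <= r)%N.
Proof.
move=> /asboolP c; rewrite leqNgt; apply/negP => h; apply: rad.
exact: reach_conn c h.
Qed.

Let near_open f : w f -> (nrm (src f - e.1)%R <= r.+1)%N -> C (src f) = C (tgt f).
Proof.
move=> wf h.
have Ls : Lam (src f) by apply: leq_trans h _; clear; lia.
have Lt : Lam (tgt f).
  by apply: leq_trans (nb_dist _ (nb_src f)) _; rewrite addn3 ltnS leqW.
have st : ostep w (src f) (tgt f) by rewrite ostep_src.
apply/asboolP/asboolP => c; apply: (connin_trans c); apply: connin_step => //.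
by rewrite ostepC.
Qed.

Let K_open f : w f -> K f = false.
Proof.
move=> wf; rewrite /K; case: (boolP (Kd f.1)) => [/Kd_near h|_]; last by rewrite andbF.
by rewrite near_open// ?addbb// leqW.
Qed.

Let K_near f : K f -> (nrm (f.1 - e.1)%R <= r)%N.
Proof. by case/andP => _ /Kd_near. Qed.

Let Kd_dual (x y : int) : ~~ w ((x + 1, y), true) -> Kd (x, y) = Kd (x + 1, y).
Proof.
move=> nw; have st : ostep (dual w) (x, y) (x + 1, y).
  by rewrite /ostep /= eqxx /dual /dual_e /= nw.
apply/asboolP/asboolP => c; apply: (connin_trans c); apply: connin_step => //.
by rewrite ostepC.
Qed.

Let Kd_dual' (x y : int) : ~~ w ((x, y + 1), false) -> Kd (x, y) = Kd (x, y + 1).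
Proof.
move=> nw; have st : ostep (dual w) (x, y) (x, y + 1).
  by rewrite /ostep /= !eqxx /dual /dual_e /= nw /= !orbT.
apply/asboolP/asboolP => c; apply: (connin_trans c); apply: connin_step => //.
by rewrite ostepC.
Qed.

(** [K] attributes the right and top edges to the neighbouring faces, but these lie in the dual
    cluster exactly when this face does, or the edge does not matter: a closed edge joins the two
    faces in the dual, and an open edge near the dual cluster does not bound [C]. The differences of
    [C] around the face then cancel. *)
Let face (x y : int) : K ((x, y), false) (+) K ((x, y + 1), false) =
  K ((x, y), true) (+) K ((x + 1, y), true).
Proof.
have H1 : K ((x + 1, y), true) = (C (x + 1, y) (+) C (x + 1, y + 1)) && Kd (x, y).
  have [wo|nw] := boolP (w ((x + 1, y), true)); last by rewrite (Kd_dual nw).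
  rewrite K_open//; apply/esym/negbTE/negP => /andP[h /Kd_near hk].
  move: h; rewrite (near_open wo) ?addbb//.
  have nn : nb (x, y) (x + 1, y) by rewrite /nb /ostep /= eqxx.
  exact: leq_trans (nb_dist _ nn) _.
have H2 : K ((x, y + 1), false) = (C (x, y + 1) (+) C (x + 1, y + 1)) && Kd (x, y).
  have [wo|nw] := boolP (w ((x, y + 1), false)); last by rewrite (Kd_dual' nw).
  rewrite K_open//; apply/esym/negbTE/negP => /andP[h /Kd_near hk].
  move: h; rewrite (near_open wo) ?addbb//.
  have nn : nb (x, y) (x, y + 1) by rewrite /nb /ostep /= !eqxx /= !orbT.
  exact: leq_trans (nb_dist _ nn) _.
rewrite H1 H2 /K /src /tgt /=; case: (Kd _); rewrite ?andbF// !andbT.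
by do 4![case: (C _)].
Qed.

Let ray n (x y : int) : bool := \big[addb/false]_(i <- iota 0 n) K ((x + i%:Z, y), false).

Let rayS n (x y : int) : ray n.+1 x y = K ((x, y), false) (+) ray n (x + 1) y.
Proof.
rewrite /ray /= big_cons addr0; congr (_ (+) _); rewrite -[1%N]addn0 iotaDl big_map.
by apply: eq_bigr => i _; congr (K ((_, _), _)); rewrite -addrA; congr (_ + _); lia.
Qed.

Let right_far (x y : int) : (e.1.1 + r%:Z < x) -> K ((x, y), false) = false /\ K ((x, y), true) = false.
Proof.
by move=> h; split; apply/negbTE/negP => /K_near /=; rewrite /nrm /=; move: h; clear; lia.
Qed.

Let ray_far n (x y : int) : (e.1.1 + r%:Z < x) -> ray n x y = false.
Proof.
elim: n x => [|n IH] x h; first by rewrite /ray big_nil.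
by rewrite rayS (right_far y h).1 IH//; move: h; clear; lia.
Qed.

Let N (x : int) : nat := (absz (e.1.1 + r%:Z - x)%R).+1.

Let rayN n (x y : int) : (N x <= n)%N -> ray n x y = ray (N x) x y.
Proof.
have H m x' : (e.1.1 + r%:Z < x' + m%:Z) -> forall k, (m <= k)%N -> ray k x' y = ray m x' y.
  elim: m x' => [|m IH] x' h [|k] mk //.
  - by rewrite !ray_far//; move: h; clear; lia.
  - by rewrite !rayS (IH (x' + 1))//; move: h; clear; lia.
by apply: H; rewrite /N; clear; lia.
Qed.

Let side v := ray (N v.1) v.1 v.2.

Let side_hor (x y : int) : side (x, y) (+) side (x + 1, y) = K ((x, y), false).
Proof.
rewrite /side /=; pose n := maxn (N x) (N (x + 1)).
rewrite -(@rayN n.+1 x y) ?(leqW (leq_maxl _ _))// -(@rayN n (x + 1) y) ?leq_maxr// rayS.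
by rewrite -addbA addbb addbF.
Qed.

Let ray_ver n (x y : int) : ray n x y (+) ray n x (y + 1) = K ((x, y), true) (+) K ((x + n%:Z, y), true).
Proof.
elim: n x => [|n IH] x; first by rewrite /ray !big_nil addr0 !addbb.
rewrite !rayS.
have -> : x + n.+1%:Z = x + 1 + n%:Z by clear; lia.
have := IH (x + 1); have := face x y.
case: (K (x, y, false)); case: (K (x, y + 1, false)); case: (K (x, y, true));
case: (K (x + 1, y, true)); case: (K (x + 1 + n%:Z, y, true));
by case: (ray n (x + 1) y); case: (ray n (x + 1) (y + 1)).
Qed.

Let side_ver (x y : int) : side (x, y) (+) side (x, y + 1) = K ((x, y), true).
Proof.
rewrite /side /= ray_ver.
have h : e.1.1 + r%:Z < x + (N x)%:Z by rewrite /N; clear; lia.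
by rewrite (right_far y h).2 addbF.
Qed.

Let side_step u v : nb u v -> side u (+) side v = K (eo u v).
Proof.
move=> n; case: (eoP n) => -[[x y] []] -> ->; rewrite /src /tgt /=; [exact: side_ver|exact: side_hor|rewrite addbC; exact: side_ver|rewrite addbC; exact: side_hor].
Qed.

Let side_rows v : (r%:Z < `|v.2 - e.1.2|) -> side v = false.
Proof.
move=> h; rewrite /side /ray big1// => i _; apply/negbTE/negP => /K_near; move: h.
by rewrite /nrm /=; clear; lia.
Qed.

Let side_far v : (r < nrm (v - e.1)%R)%N -> side v = false.
Proof.
case: v => x y h.
have [h1|h1] := boolP (r%:Z < `|y - e.1.2|); first exact: side_rows.
have [h2|h2] := boolP (e.1.1 + r%:Z < x); first by rewrite /side ray_far.
have h3 : x < e.1.1 - r%:Z by move: h h1 h2; rewrite /nrm /=; clear; lia.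
have up (k : nat) : side (x, y + k%:Z) = side (x, y).
  elim: k => [|k IH]; first by rewrite addr0.
  rewrite -IH (_ : y + k.+1%:Z = y + k%:Z + 1); last by clear; lia.
  have := side_ver x (y + k%:Z); rewrite (_ : K _ = false); first by do 2![case: (side _)].
  by apply/negbTE/negP => /K_near; move: h3; rewrite /nrm /=; clear; lia.
rewrite -(up (absz (y - e.1.2) + r.+1)%N); apply: side_rows => /=.
move: h1; clear; lia.
Qed.

(** No open edge lies in [K], so [side] is constant on open clusters, and it vanishes far away
    because [K] is bounded. *)
Let side_inf v : inf_cluster w v -> side v = false.
Proof.
move=> /inf_reach /(_ (r.+1 + nrm (v - e.1)%R)%N) [x [c hx]].
have : side x = false.
  apply: side_far; have := nrm_dist x e.1 v; rewrite (nrmC e.1) => h.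
  have := leq_trans hx h; rewrite leq_add2r; exact.
move=> <-; symmetry; apply: (connin_ind c (Q := fun x => side x = side v)) => // y z _ _ st <-.
have := side_step (ostep_nb st); rewrite K_open; first by do 2![case: (side _)].
by move: st; rewrite ostepE => /andP[].
Qed.

(* The boundary edges of the cluster of [a] in the box that are dual to the dual cluster of [e] form a
   set [K] that every face meets evenly, so the parity of [K] on the ray to the right of a vertex tells
   on which side of [K] it lies. *)
Lemma enclosure (z : vertex) (s : seq vertex) : nb a z -> eo a z = e -> ~~ w e -> inf_cluster w a ->
  path nb z s -> inf_cluster w (last z s) ->
  exists2 b, b \in z :: s & connin w (inbox e.1 (r + 3)) a b.
Proof.
move=> n eE we ia ps il; apply: contrapT => nex.
have nC v : v \in z :: s -> C v = false.
  by move=> vs; apply/negbTE/negP => /asboolP c; apply: nex; exists v.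
have zy : side z = side (last z s).
  elim: s z ps nC {n eE il nex} => //= y s IH z /andP[nzy ps] nC.
  rewrite -(IH y ps); last by move=> v vs; apply: nC; rewrite inE vs orbT.
  have := side_step nzy; rewrite /K.
  have -> : C (src (eo z y)) = false.
    by case: (eoP nzy) => g e1 e2; [rewrite -e1|rewrite -e1]; apply: nC; rewrite !inE eqxx ?orbT.
  have -> : C (tgt (eo z y)) = false.
    by case: (eoP nzy) => g e1 e2; [rewrite -e2|rewrite -e2]; apply: nC; rewrite !inE eqxx ?orbT.
  by rewrite /=; do 2![case: (side _)].
have La : Lam a.
  rewrite /Lam /inbox; case: (eo_fst a z); rewrite eE => ->; first by rewrite nrm0.
  by rewrite nbC in n; apply: leq_trans (nb_dist _ n) _; rewrite nrm0 addn3.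
have : side a (+) side z = true.
  rewrite side_step// eE /K; have -> : Kd e.1 by apply/asboolP; apply: connin_refl.
  have Ca : C a by apply/asboolP; apply: connin_refl.
  have Cz : C z = false by apply: nC; rewrite mem_head.
  by rewrite -eE; case: (eoP n) => g <- <-; rewrite Ca Cz.
by rewrite zy !side_inf.
Qed.

End Enclosure.

Section Bypass.
Implicit Types (w : config) (x y u v : vertex) (T : edge -> nat).

Fixpoint cost T u (s : seq vertex) : nat :=
  if s is v :: s' then (T (eo u v) + cost T v s')%N else 0%N.

Fixpoint edges u (s : seq vertex) : seq edge :=
  if s is v :: s' then eo u v :: edges v s' else [::].

Lemma cost_cat T u s1 s2 : cost T u (s1 ++ s2) = (cost T u s1 + cost T (last u s1) s2)%N.
Proof. by elim: s1 u => //= v s1 IH u; rewrite IH addnA. Qed.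

Lemma edges_cat u s1 s2 : edges u (s1 ++ s2) = edges u s1 ++ edges (last u s1) s2.
Proof. by elim: s1 u => //= v s1 IH u; rewrite IH. Qed.

Lemma opath_trans w u v x n m : opath w u v n -> opath w v x m -> opath w u x (n + m).
Proof.
move=> [s [ss [ps ls]]] [t [st [pt lt]]]; exists (s ++ t).
by rewrite size_cat ss st cat_path ps ls pt last_cat ls lt.
Qed.

Lemma connin_opath w c n u v : connin w (inbox c n) u v ->
  exists2 k, (k <= (2 * n).+1 ^ 2)%N & opath w u v k.
Proof.
move=> [s [ps ls as_]]; move: ls; case/shortenP: ps as_ => s' ps' us' sub /= /andP[iu as_] ls.
exists (size s'); last by exists s'.
rewrite -(size_vbox c n); apply: leq_trans (leqnSn _) _.
apply: (uniq_leq_size us') => x; rewrite mem_vbox inE => /orP[/eqP->//|xs].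
by have /allP := as_; apply; apply: sub.
Qed.

(** At a closed edge, [enclosure] provides a vertex [b] further along the path and an open detour to
    it. A simple detour is no longer than the number of vertices of the box, which the passage time
    of this one edge covers; the induction resumes at [b]. *)
Lemma bypass w T x s : inf_cluster w x -> inf_cluster w (last x s) -> path nb x s ->
  (forall f, f \in edges x s -> (0 < T f)%N /\
    (~~ w f -> exists2 r, ~ reach (dual w) f.1 r.+1 & ((2 * (r + 3)).+1 ^ 2 <= T f)%N)) ->
  exists2 n, (n <= cost T x s)%N & opath w x (last x s) n.
Proof.
have [k] := ubnP (size s); elim: k x s => // k IH x [|z s] /=.
  by move=> _ _ _ _ _; exists 0%N => //; exists [::].
rewrite ltnS => sk ix il /andP[n ps] good.
have [g0 gc] := good _ (mem_head _ _).
have [wo|nw] := boolP (w (eo x z)).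
  have st : ostep w x z by rewrite ostepE n.
  have iz : inf_cluster w z by apply: inf_cluster_conn ix _; exists 1%N; exists [:: z]; rewrite /= st.
  have [|m hm om] := IH z s sk iz il ps.
    by move=> f fs; apply: good; rewrite inE fs orbT.
  exists (1 + m)%N; first by rewrite leq_add.
  by apply: opath_trans om; exists [:: z]; rewrite /= st.
have [r rad rT] := gc nw.
have [b bs cb] := enclosure rad n erefl nw ix ps il.
have [m1 hm1 om1] := connin_opath cb.
have ib : inf_cluster w b by apply: inf_cluster_conn ix _; exists m1.
have [s1 [s2 [es lb]]] : exists s1 s2, s = s1 ++ s2 /\ last z s1 = b.
  move: bs; rewrite inE => /orP[/eqP->|]; first by exists [::], s.
  by case/splitPr => p1 p2; exists (rcons p1 b), p2; rewrite cat_rcons last_rcons.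
have [||||m2 hm2 om2] := IH b s2 _ ib.
- by apply: leq_ltn_trans sk; rewrite es size_cat leq_addl.
- by rewrite -lb -last_cat -es.
- by move: ps; rewrite es cat_path lb => /andP[].
- by move=> f fs; apply: good; rewrite inE es edges_cat mem_cat lb fs !orbT.
exists (m1 + m2)%N.
  apply: leq_add; first exact: leq_trans hm1 rT.
  by rewrite es cost_cat lb (leq_trans hm2)// leq_addl.
by apply: (opath_trans om1); rewrite es last_cat lb.
Qed.

End Bypass.

(** * First passage metrics *)

Section FirstPassage.
Implicit Types (T : edge -> nat) (x y u v : vertex) (s : seq vertex).

Definition reaches x y s := path nb x s /\ last x s = y.

Lemma reaches_ex x y : exists s, reaches x y s /\ (size s <= 2 * nrm (y - x)%R)%N.
Proof. by have [s [ps ls _ hs]] := lattice_path (leqnn (nrm (y - x))); exists s. Qed.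

Lemma fpp_subproof T x y : exists c, `[<exists2 s, reaches x y s & cost T x s = c>].
Proof. by have [s [rs _]] := reaches_ex x y; exists (cost T x s); apply/asboolP; exists s. Qed.

Definition fpp T x y : nat := ex_minn (fpp_subproof T x y).

Lemma fpp_ex T x y : exists2 s, reaches x y s & cost T x s = fpp T x y.
Proof. by rewrite /fpp; case: ex_minnP => c /asboolP. Qed.

Lemma fpp_le T x y s : reaches x y s -> (fpp T x y <= cost T x s)%N.
Proof.
by move=> rs; rewrite /fpp; case: ex_minnP => c _; apply; apply/asboolP; exists s.
Qed.

Lemma reaches_cat x y z s t : reaches x y s -> reaches y z t -> reaches x z (s ++ t).
Proof. by move=> [p1 l1] [p2 l2]; rewrite /reaches cat_path p1 last_cat l1 p2. Qed.

Lemma fpp_triangle T x y z : (fpp T x z <= fpp T x y + fpp T y z)%N.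
Proof.
have [s rs <-] := fpp_ex T x y; have [t rt <-] := fpp_ex T y z.
apply: leq_trans (fpp_le T (reaches_cat rs rt)) _.
by rewrite cost_cat rs.2.
Qed.

Lemma cost_le T T' x s : (forall e, e \in edges x s -> (T e <= T' e)%N) -> (cost T x s <= cost T' x s)%N.
Proof.
elim: s x => //= y s IH x h; apply: leq_add; first by apply: h; rewrite mem_head.
by apply: IH => e es; apply: h; rewrite inE es orbT.
Qed.

Lemma cost_eq T T' x s : (forall e, e \in edges x s -> T e = T' e) -> cost T x s = cost T' x s.
Proof. by move=> h; apply/eqP; rewrite eqn_leq !cost_le// => e /h ->. Qed.

Lemma fpp_mono T T' x y : (forall e, (T e <= T' e)%N) -> (fpp T x y <= fpp T' x y)%N.
Proof.
move=> h; have [s rs <-] := fpp_ex T' x y.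
by apply: leq_trans (fpp_le T rs) _; apply: cost_le.
Qed.

Lemma cost_size T x s : (forall e, (0 < T e)%N) -> (size s <= cost T x s)%N.
Proof.
move=> h; elim: s x => //= y s IH x; rewrite -add1n; apply: leq_add => //; exact: IH.
Qed.

Lemma cost_max T m x s : (forall e, (T e <= m)%N) -> (cost T x s <= m * size s)%N.
Proof.
by move=> h; elim: s x => //= y s IH x; rewrite mulnS; apply: leq_add.
Qed.

Lemma path_dist x s : path nb x s -> forall v, v \in x :: s -> (nrm (v - x)%R <= size s)%N.
Proof.
elim: s x => [|y s IH] x /=; first by move=> _ v; rewrite inE => /eqP ->; rewrite nrm0.
move=> /andP[n ps] v; rewrite inE => /orP[/eqP->|vs]; first by rewrite nrm0.
apply: leq_trans (nrm_dist v y x) _; rewrite (nb_nrm n) addn1 ltnS; exact: IH.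
Qed.

Lemma edges_endpoint x s e : e \in edges x s -> e.1 \in x :: s.
Proof.
elim: s x => //= y s IH x; rewrite inE => /orP[/eqP->|/IH h]; last by rewrite inE h orbT.
by case: (eo_fst x y) => ->; rewrite !inE eqxx ?orbT.
Qed.

Lemma fpp_ge_nrm T x y : (forall e, (0 < T e)%N) -> (nrm (y - x)%R <= fpp T x y)%N.
Proof.
move=> h; have [s [ps ls] <-] := fpp_ex T x y; apply: leq_trans (cost_size x s h).
by apply: (path_dist ps); rewrite -ls mem_last.
Qed.

Lemma cost_rev T x s : path nb x s -> cost T (last x s) (rev (belast x s)) = cost T x s.
Proof.
elim: s x => //= y s IH x /andP[n ps].
rewrite rev_cons -cats1 cost_cat IH//= addn0 addnC; congr (T _ + _)%N.
by case: s {IH ps} => [|z s] /=; rewrite ?rev_cons ?last_rcons eoC// nbC.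
Qed.

Lemma fpp_sym T x y : fpp T x y = fpp T y x.
Proof.
suff H u v : (fpp T u v <= fpp T v u)%N by apply/eqP; rewrite eqn_leq !H.
have [s [ps ls] <-] := fpp_ex T v u; rewrite -cost_rev// ls; apply: fpp_le; split.
  by rewrite -ls rev_path; apply: sub_path ps => a b; rewrite nbC.
by case: s {ps} ls => [<-//|a s] _; rewrite /= rev_cons last_rcons.
Qed.

Fixpoint hline (x : int) (n : nat) : seq vertex :=
  if n is n'.+1 then (x + 1, 0) :: hline (x + 1) n' else [::].

Lemma hlineP (x : int) n : reaches (x, 0) (x + n%:Z, 0) (hline x n).
Proof.
elim: n x => [|n IH] x; first by rewrite addr0; split.
have [ps ls] := IH (x + 1); split => /=; first by rewrite ps andbT /nb /ostep /= eqxx.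
by rewrite ls; congr pair; clear; lia.
Qed.

Lemma eo_hor (x y : int) : eo (x, y) (x + 1, y) = ((x, y), false).
Proof. by rewrite /eo /= eqxx. Qed.

Lemma eo_ver (x y : int) : eo (x, y) (x, y + 1) = ((x, y), true).
Proof.
rewrite /eo /= !xpair_eqE eqxx /=.
have -> : (x == x + 1) = false by clear; lia.
by rewrite eqxx.
Qed.

Lemma cost_hline T (x : int) n : cost T (x, 0) (hline x n) = (\sum_(i < n) T ((x + i%:Z, 0)%R, false))%N.
Proof.
elim: n x => [|n IH] x; first by rewrite big_ord0.
rewrite big_ord_recl /= eo_hor addr0 IH; congr (_ + _)%N; apply: eq_bigr => i _.
by congr (T (_, _, _)); rewrite /bump /=; clear; lia.
Qed.

End FirstPassage.

(** * Truncated passage times *)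

Section PassageTimes.
Implicit Types (w : config) (e : edge) (l : nat) (x y u v : vertex).

Lemma sum_bool_le (s : seq nat) (A : nat -> bool) : (\sum_(i <- s) nat_of_bool (A i) <= size s)%N.
Proof. by elim: s => [|i s IH]; rewrite ?big_nil ?big_cons//= -add1n leq_add// leq_b1. Qed.

(* The radius of the dual cluster of [e], truncated at [l] in order to depend on finitely many edges. *)
Definition rho l w e : nat := (\sum_(L <- iota 1 l) nat_of_bool `[<reach (dual w) e.1 L>])%N.

(* Number of vertices of the box of radius [l + 3], which bounds the length of an open detour. *)
Definition tmax l : nat := ((2 * (l + 3)).+1 ^ 2)%N.

Definition tau l w e : nat := if w e then 1%N else tmax (rho l w e).

Lemma rho_le l w e : (rho l w e <= l)%N.
Proof.
rewrite /rho -[X in (_ <= X)%N](size_iota 1).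
exact: sum_bool_le.
Qed.

Lemma rho_prefix l w e k : (1 <= k <= l)%N -> reach (dual w) e.1 k -> (k <= rho l w e)%N.
Proof.
move=> /andP[k1 kl] hr; rewrite /rho -(subnKC kl) iotaD big_cat /=.
apply: leq_trans (leq_addr _ _); rewrite -[X in (X <= _)%N](size_iota 1).
rewrite -sum1_size big_seq [X in (_ <= X)%N]big_seq; apply: leq_sum => i; rewrite mem_iota => hi.
by rewrite asboolT//; apply: reach_le hr; rewrite -ltnS; case/andP: hi; rewrite add1n.
Qed.

Lemma rho_radius l w e : (rho l w e < l)%N -> ~ reach (dual w) e.1 (rho l w e).+1.
Proof.
move=> h /(@rho_prefix l w e (rho l w e).+1); rewrite h ltnn => H; by have := H isT.
Qed.

Lemma rho_reach l w e : (0 < rho l w e)%N -> reach (dual w) e.1 (rho l w e).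
Proof.
move=> h; apply: contrapT => nr.
have rl := rho_le l w e.
suff H k : (k <= l)%N -> ~ reach (dual w) e.1 k.+1 -> (rho l w e <= k)%N.
  have := H (rho l w e).-1; rewrite prednK// => /(_ (leq_trans (leq_pred _) rl) nr).
  by rewrite leqNgt ltn_predL h.
move=> kl nk; rewrite /rho -(subnKC kl) iotaD big_cat /= [X in (_ + X)%N]big1_seq ?addn0.
  by rewrite -[X in (_ <= X)%N](size_iota 1); apply: sum_bool_le.
move=> i /=; rewrite mem_iota add1n => /andP[hi _].
by rewrite asboolF// => hr; apply: nk; apply: reach_le hr.
Qed.

Lemma tmax_mono l l' : (l <= l')%N -> (tmax l <= tmax l')%N.
Proof. by move=> h; rewrite /tmax leq_sqr ltnS leq_mul2l /= leq_add2r. Qed.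

Lemma tmax_gt0 l : (0 < tmax l)%N.
Proof. by rewrite /tmax expn_gt0. Qed.

Lemma tau_gt0 l w e : (0 < tau l w e)%N.
Proof. by rewrite /tau; case: (w e) => //; apply: tmax_gt0. Qed.

Lemma tau_max l w e : (tau l w e <= tmax l)%N.
Proof.
rewrite /tau; case: (w e); first exact: tmax_gt0.
exact/tmax_mono/rho_le.
Qed.

Lemma rho_mono l l' w e : (l <= l')%N -> (rho l w e <= rho l' w e)%N.
Proof. by move=> h; rewrite /rho -(subnKC h) iotaD big_cat /= leq_addr. Qed.

Lemma tau_mono l l' w e : (l <= l')%N -> (tau l w e <= tau l' w e)%N.
Proof. by move=> h; rewrite /tau; case: (w e) => //; apply/tmax_mono/rho_mono. Qed.

Lemma tau_closed l w e : ~~ w e -> tau l w e = tmax (rho l w e).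
Proof. by rewrite /tau => /negbTE ->. Qed.

Lemma dual_e_base e : (nrm ((dual_e e).1 - e.1)%R <= 1)%N.
Proof. by case: e => [[a b] []]; rewrite /dual_e /nrm /=; clear; lia. Qed.

Lemma rho_dep l e : depon (fun f => nrm (f.1 - e.1)%R <= l.+1)%N (fun w => rho l w e).
Proof.
move=> w w' h; rewrite /rho big_seq [RHS]big_seq; apply: eq_bigr => L; rewrite mem_iota add1n ltnS => /andP[_ Ll].
congr (nat_of_bool `[<_>]); apply: (@reach_dep e.1 L) => f; rewrite mem_ebox => hf.
rewrite /dual h//; apply: leq_trans (nrm_dist _ f.1 _) _; rewrite addnC -addn1.
by apply: leq_add; [exact: leq_trans hf Ll|exact: dual_e_base].
Qed.

Lemma tau_dep l e : depon (fun f => nrm (f.1 - e.1)%R <= l.+1)%N (fun w => tau l w e).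
Proof. by move=> w w' h; rewrite /tau (rho_dep h) h// nrm0. Qed.

Lemma dual_translate z w : dual (translate z w) = translate z (dual w).
Proof.
apply/funext => -[[a b] c]; rewrite /dual /translate /dual_e /=; case: c => /=; congr (~~ w _).
  by congr (_, _, _); rewrite addrAC.
by congr (_, _, _); rewrite addrAC.
Qed.

Lemma tau_translate l z w e : tau l (translate z w) e = tau l w (e.1 + z, e.2).
Proof.
rewrite /tau /rho; congr (if _ then _ else tmax _); apply: eq_bigr => L _.
by congr (nat_of_bool `[<_>]); apply/propext; rewrite dual_translate reach_shift.
Qed.

Definition X l w x y : nat := fpp (tau l w) x y.

Lemma eo_translate z u v : nb u v -> eo (u + z) (v + z) = ((eo u v).1 + z, (eo u v).2).
Proof.
move=> n; pose w : config := fun a : edge => a == ((eo u v).1 + z, (eo u v).2).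
have := ostep_shift z w u v; rewrite ostepE n /= /translate /= /w eqxx => /esym.
by rewrite ostepE => /andP[_ /eqP].
Qed.

Lemma nb_translate z u v : nb (u + z) (v + z) = nb u v.
Proof. by rewrite /nb -(ostep_shift z). Qed.

Lemma reaches_translate z x y s : reaches x y s -> reaches (x + z) (y + z) (map (fun v => v + z) s).
Proof.
move=> [ps ls]; split; last by rewrite -ls; elim: (s) x {ps ls} => //= a s' IH x.
by elim: s x ps {ls} => //= a s IH x /andP[n ps]; rewrite nb_translate n IH.
Qed.

Lemma cost_translate T T' z x s : path nb x s -> (forall e, T' e = T (e.1 + z, e.2)) ->
  cost T (x + z) (map (fun v => v + z) s) = cost T' x s.
Proof.
by move=> ps h; elim: s x ps => //= a s IH x /andP[n ps]; rewrite IH// eo_translate// h.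
Qed.

Lemma X_translate l z w x y : X l (translate z w) x y = X l w (x + z) (y + z).
Proof.
apply/eqP; rewrite eqn_leq; apply/andP; split; rewrite /X.
  have [s rs <-] := fpp_ex (tau l w) (x + z) (y + z).
  have := reaches_translate (- z) rs; rewrite !addrK => rs'.
  apply: leq_trans (fpp_le _ rs') _.
  rewrite -(@cost_translate (tau l w) (tau l (translate z w)) z) ?(proj1 rs')//; last by move=> e; rewrite tau_translate.
  by rewrite -map_comp (eq_map (g := id)) ?map_id// => v /=; rewrite subrK.
have [s rs <-] := fpp_ex (tau l (translate z w)) x y.
apply: leq_trans (fpp_le _ (reaches_translate z rs)) _.
by rewrite (@cost_translate _ (tau l (translate z w))) ?(proj1 rs)// => e; rewrite tau_translate.
Qed.

Lemma X_bound l w x y : (X l w x y <= tmax l * (2 * nrm (y - x)%R))%N.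
Proof.
have [s [rs hs]] := reaches_ex x y.
apply: leq_trans (fpp_le _ rs) _; apply: leq_trans (cost_max _ _ (tau_max l w)) _.
by rewrite leq_mul2l hs orbT.
Qed.

(** A geodesic has at most as many edges as the bound of [X_bound], and each passage time reads
    edges at distance at most [l + 1]. *)
Definition Xrad l x y : nat := (tmax l * (2 * nrm (y - x)%R) + l.+1)%N.

Lemma cost_agree l w w' x y s :
  (forall e, e \in ebox x (Xrad l x y) -> w e = w' e) -> path nb x s ->
  (size s <= tmax l * (2 * nrm (y - x)%R))%N -> cost (tau l w) x s = cost (tau l w') x s.
Proof.
move=> h ps hs; apply: cost_eq => e es; apply: (tau_dep (e := e)) => f hf; apply: h.
rewrite mem_ebox; apply: leq_trans (nrm_dist _ e.1 _) _; rewrite /Xrad addnC leq_add//.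
by apply: leq_trans hs; apply: (path_dist ps); apply: edges_endpoint.
Qed.

Lemma X_dep l x y : depon (fun e => e \in ebox x (Xrad l x y)) (fun w => X l w x y).
Proof.
suff H w w' : (forall e, e \in ebox x (Xrad l x y) -> w e = w' e) -> (X l w x y <= X l w' x y)%N.
  by move=> w w' h; apply/eqP; rewrite eqn_leq !H// => e /h.
move=> h; rewrite {2}/X; have [s rs eX] := fpp_ex (tau l w') x y; rewrite -eX.
rewrite -(@cost_agree l w w' x y)//; [exact: fpp_le|exact: rs.1|].
apply: leq_trans (X_bound l w' x y); rewrite /X -eX; exact/cost_size/tau_gt0.
Qed.

Lemma X_local l x y : local (fun w => X l w x y).
Proof. by exists (ebox x (Xrad l x y)); apply: X_dep. Qed.

Lemma X_mono l l' w x y : (l <= l')%N -> (X l w x y <= X l' w x y)%N.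
Proof. by move=> h; apply: fpp_mono => e; apply: tau_mono. Qed.

End PassageTimes.

(** * Influence of one edge and the variance of passage times *)

Section Detour.
Implicit Types (w : config) (e : edge) (l : nat) (x y u v : vertex).

Definition agree_off (e : edge) w w' := forall f, f != e -> w f = w' f.

Lemma tau_far l e w w' f : agree_off e w w' -> (l.+1 < nrm (f.1 - e.1)%R)%N -> tau l w f = tau l w' f.
Proof.
move=> h far; apply: (tau_dep (e := f)) => g hg; apply: h; apply: contraTneq far => ge.
by rewrite -leqNgt nrmC -ge.
Qed.

Definition near l e : pred vertex := inbox e.1 l.+2.

Lemma first_hit l e w w' x s : agree_off e w w' -> path nb x s -> has (near l e) (x :: s) ->
  exists s1 s2, [/\ s = s1 ++ s2, near l e (last x s1) & cost (tau l w) x s1 = cost (tau l w') x s1].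
Proof.
move=> h; elim: s x => [|y s IH] x /=; first by rewrite orbF => _ hx; exists [::], [::].
move=> /andP[n ps] hh; have [hx|hx] := boolP (near l e x); first by exists [::], (y :: s).
move: hh; rewrite (negbTE hx) /= => hh.
have [s1 [s2 [-> lh cs]]] := IH y ps hh.
exists (y :: s1), s2; split => //=; congr addn => //; apply: (tau_far h).
move: hx; rewrite /near /inbox -ltnNge => hx.
case: (eo_fst x y) => ->; first exact: ltnW.
have := nrm_dist x y e.1; rewrite [nrm (x - y)]nrmC (nb_nrm n) add1n => hd.
by rewrite -ltnS; apply: leq_trans hx hd.
Qed.

Definition detour l : nat := (tmax l * (2 * (2 * l.+2)))%N.

(** Let [u] be the first vertex near [e] on a geodesic from [x] to [y], and [v] the first one near
    [e] on a geodesic from [y] to [u]. The outer pieces avoid the edges whose passage time changes,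
    and a direct path from [u] to [v] costs at most [detour l]. *)
Lemma X_infl l e w w' x y : agree_off e w w' -> (X l w' x y <= X l w x y + detour l)%N.
Proof.
move=> h; have [s [ps ls] eX] := fpp_ex (tau l w) x y.
have [hs|ns] := boolP (has (near l e) (x :: s)); last first.
  rewrite /X -eX; apply: leq_trans (leq_addr _ _); apply: leq_trans (fpp_le _ (conj ps ls)) _.
  rewrite leq_eqVlt; apply/orP; left; apply/eqP/esym/cost_eq => f /edges_endpoint fs.
  apply: (tau_far h); move/hasPn: ns => /(_ _ fs); rewrite /near /inbox -ltnNge; exact: ltnW.
have [s1 [s2 [es hu c1]]] := first_hit h ps hs.
set u := last x s1 in hu.
move: ps; rewrite es cat_path -/u => /andP[p1 p2].
have l2 : last u s2 = y by rewrite -ls es last_cat.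
have [t [pt lt] eX2] := fpp_ex (tau l w) y u.
have ht : has (near l e) (y :: t) by apply/hasP; exists u => //; rewrite -lt mem_last.
have [t1 [t2 [et hv c2]]] := first_hit h pt ht.
set v := last y t1 in hv; move: pt; rewrite et cat_path -/v => /andP[q1 q2].
have key1 : (X l w' x u <= cost (tau l w) x s1)%N by rewrite c1; apply: fpp_le.
have key2 : (X l w' y v <= X l w u y)%N.
  rewrite {2}/X fpp_sym -eX2 et cost_cat c2; apply: leq_trans (leq_addr _ _); exact: fpp_le.
have key3 : (X l w u y <= cost (tau l w) u s2)%N by apply: fpp_le.
have key4 : (X l w' u v <= detour l)%N.
  apply: leq_trans (X_bound _ _ _ _) _; rewrite /detour leq_mul// leq_mul//.
  rewrite mul2n -addnn; apply: leq_trans (nrm_dist v e.1 u) _; apply: leq_add => //; by rewrite nrmC.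
have eXw : X l w x y = (cost (tau l w) x s1 + cost (tau l w) u s2)%N by rewrite /X -eX es cost_cat.
have t1' := fpp_triangle (tau l w') x u y; have t2' := fpp_triangle (tau l w') u v y.
move: key1 key2 key3 key4 t1' t2'; rewrite eXw /X (fpp_sym (tau l w') y v); clear; lia.
Qed.

(* All the geodesics are required to pass near [e], so that no geodesic has to be chosen. *)
Definition meets l e w x y := forall s, reaches x y s -> cost (tau l w) x s = X l w x y -> has (near l e) (x :: s).

Lemma X_infl0 l e w w' x y : agree_off e w w' -> ~ meets l e w x y -> (X l w' x y <= X l w x y)%N.
Proof.
move=> h nm; apply: contrapT => /negP; rewrite -ltnNge => lt; apply: nm => s rs cs.
apply: contrapT => /negP /hasPn ns; move: lt; rewrite ltnNge -cs => /negP; apply.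
apply: leq_trans (fpp_le _ rs) _.
rewrite leq_eqVlt; apply/orP; left; apply/eqP/esym/cost_eq => f /edges_endpoint fs.
apply: (tau_far h); move: (ns _ fs); rewrite /near /inbox -ltnNge; exact: ltnW.
Qed.

Lemma meets_dep l e x y : depon (fun f => f \in ebox x (Xrad l x y)) (fun w => meets l e w x y).
Proof.
apply: deponP => w w' h m s rs cs.
have eX := X_dep h; apply: m => //; rewrite eX -cs; apply: (cost_agree h) rs.1 _.
apply: leq_trans (X_bound l w' x y); rewrite -cs; exact/cost_size/tau_gt0.
Qed.

Lemma meets_local l e x y : local (fun w => meets l e w x y).
Proof. by exists (ebox x (Xrad l x y)); apply: meets_dep. Qed.

Lemma agree_upd e w b b' : agree_off e (upd w e b) (upd w e b').
Proof. by move=> f fe; rewrite /upd (negbTE fe). Qed.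

End Detour.

Section Variance.
Variable R : realType.
Implicit Types (w : config) (e : edge) (l n : nat) (p : R) (x y : vertex).

Lemma Ex_upd_notin p (s : seq edge) (f : config -> R) w e b : e \notin s ->
  Ex p s f (upd w e b) = Ex p s (fun v => f (upd v e b)) w.
Proof.
elim: s w => //= a s IH w; rewrite inE negb_or => /andP[ea es].
by rewrite !(updC w b _ ea) !IH.
Qed.

Lemma E_upd p (e : edge) (f : config -> R) : local f ->
  E_ p f = p * E_ p (fun v => f (upd v e true)) + (1 - p) * E_ p (fun v => f (upd v e false)).
Proof.
move=> [s ds]; pose t := [seq x <- s | x != e].
have et : e \notin t by rewrite mem_filter eqxx.
have dt : depon (mem (e :: t)) f.
  move=> v v' h; apply: ds => x xs; apply: h; rewrite inE /= in_cons mem_filter xs andbT.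
  exact: orbN.
have du b : depon (mem t) (fun v => f (upd v e b)).
  move=> v v' h; apply: dt => x; rewrite inE /= in_cons /upd; case: eqP => // _ /= xt; exact: h.
rewrite (E_E _ (fun=> false) dt) !(E_E _ (fun=> false) (du _)) /=.
by rewrite !Ex_upd_notin.
Qed.

Lemma depon_upd (Y : Type) (S : pred edge) (e : edge) b (f : config -> Y) :
  depon S f -> depon S (fun v => f (upd v e b)).
Proof. by move=> df v v' h; apply: df => x xs; rewrite /upd; case: eqP => // _; apply: h. Qed.

Lemma local_upd (Y : Type) (e : edge) b (f : config -> Y) : local f -> local (fun v => f (upd v e b)).
Proof.
by move=> [s ds]; exists s; apply: depon_upd.
Qed.

(** The Efron-Stein bound involves both states of [e]; as [p * (1 - p)] is at most [p] and at most
    [1 - p], they recombine into one expectation. *)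
Lemma E_upd_le p (e : edge) (h : config -> R) : 0 <= p <= 1 -> local h -> (forall v, 0 <= h v) ->
  p * (1 - p) * E_ p (fun v => h (upd v e true) + h (upd v e false)) <= E_ p h.
Proof.
move=> p01 lh h0; rewrite E_D; [|exact: local_upd..]; rewrite (E_upd p e lh).
have h1 : 0 <= E_ p (fun v => h (upd v e true)) by apply: E_ge0 => //; apply: local_upd.
have h2 : 0 <= E_ p (fun v => h (upd v e false)) by apply: E_ge0 => //; apply: local_upd.
move: h1 h2 p01; move: (E_ _ _) (E_ _ _) => a b h1 h2 /andP[p0 p1].
have := mulr_ge0 (mulr_ge0 p0 p0) h1; have : 0 <= (1 - p) * (1 - p) * a by rewrite mulr_ge0// -expr2 sqr_ge0.
by clear; lra.
Qed.

Definition Xr l x y w : R := (X l w x y)%:R.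

Lemma Xr_local l x y : local (Xr l x y).
Proof. exact/(local1 (fun k : nat => k%:R : R))/X_local. Qed.

Lemma sqr_dist_le (a b d : nat) : (a <= b + d)%N -> (b <= a + d)%N -> (a%:R - b%:R : R) ^+ 2 <= d%:R ^+ 2.
Proof.
rewrite -!(ler_nat R) !natrD; move: (a%:R : R) (b%:R : R) (d%:R : R) => r s t ab ba.
by rewrite -subr_ge0 subr_sqr mulr_ge0//; lra.
Qed.

Lemma depon_add (S : pred edge) (f g : config -> R) : depon S f -> depon S g -> depon S (fun v => f v + g v).
Proof. by move=> df dg w w' h; rewrite (df _ _ h) (dg _ _ h). Qed.

Lemma sqr_infl (a b d : nat) (A B : Prop) : (a <= b + d)%N -> (b <= a + d)%N ->
  (~ B -> (a <= b)%N) -> (~ A -> (b <= a)%N) ->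
  (a%:R - b%:R : R) ^+ 2 <= d%:R ^+ 2 * (ind R A + ind R B).
Proof.
move=> ab ba ab0 ba0; have sq := sqr_dist_le ab ba.
have [m1|n1] := pselect A.
  rewrite (indT _ m1); apply: le_trans sq _; rewrite ler_peMr ?sqr_ge0// lerDl; exact: ind_ge0.
have [m2|n2] := pselect B.
  rewrite (indT _ m2); apply: le_trans sq _; rewrite ler_peMr ?sqr_ge0// lerDr; exact: ind_ge0.
have -> : a = b by apply/eqP; rewrite eqn_leq ab0 ?ba0.
by rewrite subrr expr0n /= mulr_ge0 ?sqr_ge0 ?addr_ge0 ?ind_ge0.
Qed.

Lemma infl_X l e x y w : (infl e (Xr l x y) w) ^+ 2 <=
  (detour l)%:R ^+ 2 * (ind R (meets l e (upd w e true) x y) + ind R (meets l e (upd w e false) x y)).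
Proof.
apply: sqr_infl.
- exact: X_infl (@agree_upd e w false true).
- exact: X_infl (@agree_upd e w true false).
- exact: X_infl0 (@agree_upd e w false true).
- exact: X_infl0 (@agree_upd e w true false).
Qed.

Lemma count_near l (S : seq edge) v : uniq S -> (count (fun e => near l e v) S <= size (ebox v l.+2))%N.
Proof.
move=> uS; rewrite -size_filter; apply: uniq_leq_size; first exact: filter_uniq.
by move=> e; rewrite mem_filter mem_ebox nrmC => /andP[].
Qed.

Definition vconst l n : nat := (((detour l) ^ 2) * ((tmax l * (2 * n)).+1 * (2 * (2 * l.+2).+1 ^ 2)))%N.

Lemma sum_meets l (S : seq edge) x y w : uniq S ->
  \sum_(e <- S) ind R (meets l e w x y) <=
  ((tmax l * (2 * nrm (y - x)%R)).+1 * (2 * (2 * l.+2).+1 ^ 2))%N%:R.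
Proof.
move=> uS; have [s rs cs] := fpp_ex (tau l w) x y.
have size_s : (size s <= tmax l * (2 * nrm (y - x)%R))%N.
  by apply: leq_trans (X_bound l w x y); rewrite /X -cs; apply/cost_size/tau_gt0.
apply: (@le_trans _ _ (\sum_(e <- S) \sum_(v <- x :: s) (near l e v)%:R)).
  apply: ler_sum => e _; have [m|nm] := pselect (meets l e w x y); last first.
    by rewrite (indF _ nm) sumr_ge0// => v _; case: near.
  rewrite (indT _ m); have /hasP[v vs nv] := m s rs cs.
  by rewrite (big_rem v)//= nv lerDl sumr_ge0// => u _; case: near.
rewrite exchange_big /=.
apply: (@le_trans _ _ (\sum_(v <- x :: s) (2 * (2 * l.+2).+1 ^ 2)%N%:R)).
  apply: ler_sum => v _; rewrite -natr_sum ler_nat -(size_ebox v l.+2).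
  by have := count_near l v uS; rewrite -sum1_count big_mkcond; under eq_bigr do rewrite -mulnbl muln1.
rewrite big_const_seq iter_addr addr0 count_predT -[X in X <= _]mulr_natl -natrM ler_nat leq_mul2r /= ltnS size_s.
by [].
Qed.

(** An influence is at most [detour l], and vanishes unless, for one of the two states of [e], every
    geodesic passes near [e]. Summing over [e] counts the edges near a single geodesic, whose length
    is linear in the distance for fixed [l]. *)
Lemma X_variance p l x y : 0 <= p <= 1 ->
  E_ p (fun w => Xr l x y w ^+ 2) - E_ p (Xr l x y) ^+ 2 <= (vconst l (nrm (y - x)))%:R.
Proof.
move=> p01; have [S [uS dX dm]] : exists S, [/\ uniq S, depon (mem S) (Xr l x y) &
    forall e, depon (mem S) (fun w => ind R (meets l e w x y))].
  exists (ebox x (Xrad l x y)); split; first exact: ebox_uniq.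
    by move=> w w' h; rewrite /Xr (X_dep h).
  by move=> e w w' h; rewrite (@meets_dep l e x y w w' h).
have dX2 : depon (mem S) (fun w => Xr l x y w ^+ 2) by move=> w w' h; rewrite (dX _ _ h).
rewrite (E_E _ (fun=> false) dX) (E_E _ (fun=> false) dX2).
apply: le_trans (Ex_efron_stein (Xr l x y) (fun=> false) p01 uS) _.
have H e : p * (1 - p) * Ex p S (fun v => infl e (Xr l x y) v ^+ 2) (fun=> false) <=
    (detour l)%:R ^+ 2 * E_ p (fun w => ind R (meets l e w x y)).
  have lm : local (fun w => ind R (meets l e w x y)) by exists S.
  apply: le_trans (ler_wpM2l (sqr_ge0 _) (E_upd_le e p01 lm (fun=> ind_ge0 _ _))).
  rewrite mulrCA ler_wpM2l//; first by nra.
  rewrite (@E_E _ _ _ S _ (fun=> false)); last first.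
    by apply: depon_add; apply: depon_upd (dm e).
  rewrite -ExZ; apply: Ex_le => // v; exact: infl_X.
apply: le_trans (ler_sum _ (fun e _ => H e)) _.
rewrite -mulr_sumr -(@E_sum _ _ _ _ xpredT) => [|e _ _]; last by apply/local_ind/meets_local.
rewrite /vconst natrM natrX ler_wpM2l ?sqr_ge0//.
rewrite -[X in _ <= X](E_cst edge p); apply: E_le => //; last by move=> w; apply: sum_meets.
  by apply: local_sum => e _ _; apply/local_ind/meets_local.
exact: local_cst.
Qed.

Lemma vconst_poly : exists C : nat, forall l n, (vconst l n <= C * (l.+1 ^ 10 * n.+1))%N.
Proof.
(* From [tmax l <= 49 * (l + 1) ^ 2]: 392 is [49 * 8] for [detour], 99 is [2 * 49 + 1] for the
   length of a geodesic, and 50 is [2 * 5 ^ 2] for the edges of a box. *)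
exists (392 ^ 2 * (99 * 50))%N => l n.
have tm : (tmax l <= 49 * l.+1 ^ 2)%N by rewrite /tmax -[49%N]/(7 ^ 2)%N -expnMn leq_sqr; lia.
have dt : (detour l <= 392 * l.+1 ^ 3)%N.
  apply: (@leq_trans ((49 * l.+1 ^ 2) * (8 * l.+1))); first by apply: leq_mul => //; lia.
  by rewrite (expnSr _ 2); lia.
have d2 : (detour l ^ 2 <= 392 ^ 2 * l.+1 ^ 6)%N.
  by rewrite (expnM _ 3 2) -expnMn leq_sqr.
have t2 : ((tmax l * (2 * n)).+1 <= 99 * (l.+1 ^ 2 * n.+1))%N.
  apply: (@leq_trans ((49 * l.+1 ^ 2) * (2 * n)).+1); first by rewrite ltnS leq_mul.
  have : (0 < l.+1 ^ 2)%N by rewrite expn_gt0.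
  move: (l.+1 ^ 2)%N; clear => a; nia.
have b2 : (2 * (2 * l.+2).+1 ^ 2 <= 50 * l.+1 ^ 2)%N.
  by rewrite -[50%N]/(2 * 5 ^ 2)%N -mulnA -expnMn leq_mul2l /= leq_sqr; lia.
rewrite /vconst; apply: leq_trans (leq_mul d2 (leq_mul t2 b2)) _.
rewrite (_ : 10 = 6 + (2 + 2))%N// !expnD; move: (l.+1 ^ 6)%N (l.+1 ^ 2)%N => a c; clear.
by apply/eq_leq; rewrite -!mulnA; congr (_ * _)%N; ring.
Qed.

End Variance.

(** * Moments and mean passage times *)

Section Moments.
Variable R : realType.
Implicit Types (w : config) (e : edge) (l n k : nat) (p b c : R) (u : vertex).

Lemma geo_le c n : 0 < c < 1 -> \sum_(i <- iota 0 n) c ^+ i <= (1 - c)^-1.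
Proof.
move=> /andP[c0 c1]; have c1' : 0 < 1 - c by rewrite subr_gt0.
rewrite -[X in _ <= X]mulr1 ler_pdivlMl//.
suff -> : (1 - c) * \sum_(i <- iota 0 n) c ^+ i = 1 - c ^+ n by rewrite gerBl exprn_ge0// ltW.
elim: n => [|n IH]; first by rewrite big_nil mulr0 subrr.
by rewrite -addn1 iotaD big_cat /= big_seq1 add0n mulrDr IH exprD expr1; ring.
Qed.

Lemma poly_geo k b : 0 < b < 1 -> exists2 C : R, 0 < C & forall n, n.+1%:R ^+ k * b ^+ n <= C.
Proof.
elim: k b => [|k IH] b /andP[b0 b1].
  by exists 1 => // n; rewrite expr0 mul1r exprn_ile1// ltW.
pose c := Num.sqrt b.
have c0 : 0 < c by rewrite sqrtr_gt0.
have c1 : c < 1 by rewrite -sqrtr1 ltr_sqrt.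
have cc : c ^+ 2 = b by rewrite sqr_sqrtr// ltW.
have [|C C0 hC] := IH c; first by rewrite c0.
(* One half [c ^ n] of [b ^ n] absorbs a factor [n + 1], because [(n + 1) * c ^ n] is at most the
   geometric sum up to [c ^ n]; the other half is left to the induction. *)
exists (C * (1 - c)^-1) => [|n]; first by rewrite mulr_gt0// invr_gt0 subr_gt0.
rewrite -cc -exprM mul2n -addnn exprD exprSr mulrACA; apply: ler_pM.
- by rewrite mulr_ge0// exprn_ge0// ltW.
- by rewrite mulr_ge0// exprn_ge0// ltW.
- exact: hC.
apply: le_trans (geo_le n.+1 _); last by rewrite c0.
rewrite -[X in X * _](_ : \sum_(i <- iota 0 n.+1) 1 = n.+1%:R); last first.
  by rewrite big_const_seq count_predT size_iota iter_addr addr0.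
rewrite mulr_suml big_seq [X in _ <= X]big_seq; apply: ler_sum => i; rewrite mem_iota add0n ltnS mul1r => /= hi.
by rewrite ler_wiXn2l// ltW.
Qed.

Lemma dual_reach_local u L : local (fun w => reach (dual w) u L).
Proof. exact: (local_dual (reach_local u L)). Qed.

Lemma dual_reach p0 : 1 / 2 < p0 -> p0 <= 1 -> exists C b, [/\ 0 < C, 0 < b < 1 &
  forall p u L, p0 <= p <= 1 -> pr p (fun w => reach (dual w) u L) <= C * b ^+ L].
Proof.
move=> h h1; have [|//|C [b [C0 b01 H]]] := @subcritical_decay R (1 - p0); [lra|lra|].
exists C, b; split=> // p u L hp; rewrite (pr_dual p (reach_local u L)) pr_reach.
by apply: H; lra.
Qed.

Lemma tau_local l e : local (fun w => tau l w e).
Proof.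
exists (ebox e.1 l.+1) => w w' h; apply: tau_dep => f hf; apply: h; by rewrite mem_ebox.
Qed.

(** The term [L = rho l w e] alone suffices. Bounding by the whole sum makes moments linear in the
    tail probabilities of the dual cluster. *)
Lemma rho_pow l w e k : (rho l w e).+1%:R ^+ k <=
  1 + \sum_(L <- iota 1 l) L.+1%:R ^+ k * ind R (reach (dual w) e.1 L).
Proof.
have pos : forall L, 0 <= L.+1%:R ^+ k * ind R (reach (dual w) e.1 L).
  by move=> L; rewrite mulr_ge0 ?exprn_ge0// ind_ge0.
case: (posnP (rho l w e)) => [->|h0]; first by rewrite expr1n lerDl sumr_ge0.
have hi : rho l w e \in iota 1 l by rewrite mem_iota h0 add1n ltnS rho_le.
rewrite (big_rem _ hi)/= indT; last exact: rho_reach.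
by rewrite mulr1 addrCA lerDl addr_ge0// sumr_ge0.
Qed.

Lemma tau_rho l w e : (tau l w e <= 49 * (rho l w e).+1 ^ 2)%N.
Proof.
rewrite /tau; case: (w e); first by rewrite muln_gt0 expn_gt0.
by rewrite /tmax -[49%N]/(7 ^ 2)%N -expnMn leq_sqr; lia.
Qed.

Definition taur l e k w : R := (tau l w e)%:R ^+ k.

Lemma taur_local l e k : local (taur l e k).
Proof. exact/(local1 (fun m : nat => (m%:R : R) ^+ k))/tau_local. Qed.

Lemma taur_ge0 l e k w : 0 <= taur l e k w.
Proof. by rewrite /taur exprn_ge0. Qed.

Lemma tau_moment p0 k : 1 / 2 < p0 -> p0 <= 1 -> exists2 C : R, 0 < C &
  forall p l e, p0 <= p <= 1 -> E_ p (taur l e k) <= C.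
Proof.
move=> h h1; have [C [b [C0 /andP[b0 b1] H]]] := dual_reach h h1.
pose c := Num.sqrt b.
have c0 : 0 < c by rewrite sqrtr_gt0.
have c1 : c < 1 by rewrite -sqrtr1 ltr_sqrt.
have cc : c ^+ 2 = b by rewrite sqr_sqrtr// ltW.
have [|C' C'0 hC'] := @poly_geo (2 * k) c; first by rewrite c0.
have c'0 : 0 < (1 - c)^-1 by rewrite invr_gt0 subr_gt0.
exists (49 ^+ k * (1 + C * (C' * (1 - c)^-1))) => [|p l e hp].
  by rewrite mulr_gt0 ?exprn_gt0// addr_gt0// !mulr_gt0.
have p01 : 0 <= p <= 1 by lra.
have lr L : local (fun w => L.+1%:R ^+ (2 * k) * ind R (reach (dual w) e.1 L)).
  exact/(local1 (fun x : R => _ * x))/local_ind/dual_reach_local.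
have ls : local (fun w => \sum_(L <- iota 1 l) L.+1%:R ^+ (2 * k) * ind R (reach (dual w) e.1 L)).
  by apply: local_sum => L _ _; apply: lr.
have l1 : local (fun w => 1 + \sum_(L <- iota 1 l) L.+1%:R ^+ (2 * k) * ind R (reach (dual w) e.1 L)).
  exact: (local1 (fun x : R => 1 + x)).
apply: (@le_trans _ _ (E_ p (fun w => 49 ^+ k * (1 + \sum_(L <- iota 1 l) L.+1%:R ^+ (2 * k) * ind R (reach (dual w) e.1 L))))).
  apply: E_le => //; first exact: taur_local.
    exact: (local1 (fun x : R => 49 ^+ k * x)).
  move=> w; apply: le_trans (ler_wpM2l _ (rho_pow l w e (2 * k))); last by rewrite exprn_ge0.
  rewrite /taur exprM -exprMn lerXn2r ?nnegrE ?mulr_ge0 ?exprn_ge0//.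
  by rewrite -natrX -natrM ler_nat tau_rho.
rewrite E_Z// ler_wpM2l ?exprn_ge0//.
rewrite E_D//; last exact: local_cst.
rewrite E_cst lerD2l (@E_sum _ _ _ _ xpredT) => [|L _ _]; last exact: lr.
apply: (@le_trans _ _ (\sum_(L <- iota 1 l) C * (C' * c ^+ L))).
  apply: ler_sum => L _; rewrite E_Z; last exact/local_ind/dual_reach_local.
  have := H p e.1 L hp; rewrite /pr => HL.
  apply: le_trans (ler_wpM2l _ HL) _; first by rewrite exprn_ge0.
  rewrite mulrCA ler_wpM2l ?(ltW C0)//; rewrite -cc -exprM (mul2n L) -(addnn L) exprD mulrA ler_wpM2r//.
  by rewrite exprn_ge0// ltW.
rewrite -mulr_sumr -mulr_sumr ler_wpM2l ?(ltW C0)// ler_wpM2l ?(ltW C'0)//.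
apply: le_trans (geo_le l.+1 _); last by rewrite c0.
by rewrite /= big_cons expr0 lerDr.
Qed.

End Moments.

Definition axis (n : nat) : vertex := (n%:Z, 0%:Z).

Lemma nrm_axis n : nrm (axis n) = n.
Proof. by rewrite /nrm /axis /=; lia. Qed.

(** * Comparison with the chemical distance off a rare event *)

Section Bad.
Implicit Types (w : config) (e : edge) (l n r : nat).

(** The event that the truncation at [l] may be felt in the box of radius [r]. *)
Definition long_dual l r w := exists2 e, e \in ebox origin r & reach (dual w) e.1 l.

Lemma long_dual_local l r : local (long_dual l r).
Proof. by apply: local_ex => e _; apply: dual_reach_local. Qed.

Lemma rho_stable l l' w e : (l <= l')%N -> ~ reach (dual w) e.1 l -> rho l' w e = rho l w e.
Proof.
move=> h nr; rewrite /rho -(subnKC h) iotaD big_cat /= [X in (_ + X)%N]big1_seq ?addn0// => i /=.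
rewrite mem_iota add1n => /andP[hi _]; rewrite asboolF// => hr; apply: nr; apply: reach_le hr; exact: ltnW.
Qed.

Lemma tau_stable l l' w e : (l <= l')%N -> ~ reach (dual w) e.1 l -> tau l' w e = tau l w e.
Proof. by move=> h nr; rewrite /tau (rho_stable h nr). Qed.

Lemma rho_lt l w e : ~ reach (dual w) e.1 l -> (rho l w e < l)%N.
Proof.
move=> nr; rewrite ltn_neqAle rho_le andbT; apply/eqP => h; apply: nr.
rewrite -h; case: (posnP (rho l w e)) => [->|]; last exact: rho_reach.
by exists e.1; split => //; apply: connin_refl; rewrite /inbox nrm0.
Qed.

Definition geo_rad l n : nat := (tmax l * (2 * n))%N.

Lemma X_cost l w n s : reaches origin (axis n) s -> cost (tau l w) origin s = X l w origin (axis n) ->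
  forall e, e \in edges origin s -> e \in ebox origin (geo_rad l n).
Proof.
move=> [ps ls] cs e es; rewrite mem_ebox.
apply: leq_trans (path_dist ps (edges_endpoint es)) _.
apply: (@leq_trans (X l w origin (axis n))); first by rewrite -cs; apply/cost_size/tau_gt0.
by apply: leq_trans (X_bound _ _ _ _) _; rewrite subr0 nrm_axis.
Qed.

Lemma X_line l w n : (X l w origin (axis n) <= \sum_(i < n) tau l w ((i%:Z, 0)%R, false))%N.
Proof.
have := fpp_le (tau l w) (hlineP 0 n); rewrite cost_hline add0r => h.
by apply: leq_trans h _; apply: leq_sum => i _; rewrite add0r.
Qed.

Lemma X_up l l' w n : (l <= l')%N -> ~ long_dual l (geo_rad l n) w -> (X l' w origin (axis n) <= X l w origin (axis n))%N.
Proof.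
move=> h nb; rewrite {2}/X; have [s rs cs] := fpp_ex (tau l w) origin (axis n); rewrite -cs.
apply: leq_trans (fpp_le _ rs) _; rewrite leq_eqVlt; apply/orP; left; apply/eqP/cost_eq => e es.
apply: tau_stable => // hr; apply: nb; exists e => //; exact: (X_cost rs cs).
Qed.

Lemma opath_reaches w u v n : opath w u v n -> exists s, [/\ reaches u v s, size s = n &
  forall l, cost (tau l w) u s = n].
Proof.
move=> [s [sz [ps ls]]]; exists s; split => //; last first.
  move=> l; rewrite -sz; elim: s u ps {sz ls} => //= y s IH u /andP[os ps].
  by rewrite IH// /tau; move: os; rewrite ostepE => /andP[_ ->].
by split => //; apply: sub_path ps => a b; rewrite ostepE => /andP[].
Qed.

(** An open path costs its length, so [X] bounds the chemical distance from below. Off [long_dual]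
    the truncated radii along a geodesic are the true ones, and [bypass] yields an open path no
    longer than [X]. *)
Lemma opath_X w l n : ~ long_dual l (geo_rad l n) w -> inf_cluster w origin -> inf_cluster w (axis n) ->
  opath w origin (axis n) (X l w origin (axis n)) /\
  forall m, opath w origin (axis n) m -> (X l w origin (axis n) <= m)%N.
Proof.
move=> nb i0 i1.
have lo m : opath w origin (axis n) m -> (X l w origin (axis n) <= m)%N.
  by move=> /opath_reaches[s [rs _ /(_ l) <-]]; apply: fpp_le.
have [s rs cs] := fpp_ex (tau l w) origin (axis n).
have [||||m hm om] := @bypass w (tau l w) origin s => //; first by rewrite rs.2.
- exact: rs.1.
- move=> f fs; split; first exact: tau_gt0.
  move=> cf; have nr : ~ reach (dual w) f.1 l.
    by move=> hr; apply: nb; exists f => //; apply: (X_cost rs cs).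
  exists (rho l w f); first exact/rho_radius/rho_lt.
  by rewrite tau_closed.
rewrite rs.2 in om; split => //; suff <- : m = X l w origin (axis n) by [].
by apply/eqP; rewrite eqn_leq lo// /X -cs hm.
Qed.

End Bad.

(** * Mean passage times and the time constant *)

Section Means.
Variable R : realType.
Implicit Types (w : config) (e : edge) (l n r : nat) (p : R).

Definition am p l n : R := E_ p (Xr R l origin (axis n)).

Lemma am_shift p l x y : E_ p (Xr R l x y) = E_ p (Xr R l origin (y - x)).
Proof.
rewrite -(E_shift p x (Xr_local R l origin (y - x))); apply: E_eq => w.
by rewrite /Xr X_translate add0r subrK.
Qed.

Lemma am_axis p l m n : E_ p (Xr R l (axis m) (axis (m + n))) = am p l n.
Proof.
by rewrite am_shift; congr E_; congr Xr; rewrite /axis; congr pair => /=; clear; lia.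
Qed.

Lemma am_sub p l m n : 0 <= p <= 1 -> am p l (m + n) <= am p l m + am p l n.
Proof.
move=> p01; rewrite -(am_axis p l m n) /am -E_D; [|exact: Xr_local..].
apply: E_le => // [||w]; first exact: Xr_local.
  by apply: (local2 +%R); apply: Xr_local.
by rewrite /Xr -natrD ler_nat; apply: fpp_triangle.
Qed.

Lemma am_mono p l l' n : 0 <= p <= 1 -> (l <= l')%N -> am p l n <= am p l' n.
Proof.
move=> p01 h; apply: E_le => // [||w]; [exact: Xr_local|exact: Xr_local|].
by rewrite ler_nat X_mono.
Qed.

Lemma am_ge p l n : 0 <= p <= 1 -> n%:R <= am p l n.
Proof.
move=> p01; rewrite -[X in X <= _](E_cst edge p); apply: E_le => //; [exact: local_cst|exact: Xr_local|].
move=> w; rewrite ler_nat; have := fpp_ge_nrm origin (axis n) (tau_gt0 l w).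
by rewrite subr0 nrm_axis.
Qed.

Lemma am0 p l : am p l 0 = 0.
Proof.
rewrite -[RHS](E_cst edge p); apply: E_eq => w; rewrite /Xr (_ : X _ _ _ _ = 0%N)//.
apply/eqP; rewrite -leqn0; exact: (@fpp_le (tau l w) origin origin [::]).
Qed.

Lemma am_le p0 : 1 / 2 < p0 -> p0 <= 1 -> exists2 C : R, 0 < C &
  forall p l n, p0 <= p <= 1 -> am p l n <= C * n%:R.
Proof.
move=> h h1; have [C C0 H] := tau_moment 1 h h1; exists C => // p l n hp.
have p01 : 0 <= p <= 1 by lra.
have lt (i : 'I_n) : local (taur R l ((i%:Z, 0), false) 1) by apply: taur_local.
apply: (@le_trans _ _ (E_ p (fun w => \sum_(i < n) taur R l ((i%:Z, 0), false) 1 w))).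
  apply: E_le => //; first exact: Xr_local.
    by apply: local_sum => i _ _.
  move=> w; rewrite /taur /Xr; under eq_bigr do rewrite expr1.
  by rewrite -natr_sum ler_nat X_line.
rewrite (@E_sum _ _ _ _ xpredT) => [|i _ _]; last exact: lt.
apply: (@le_trans _ _ (\sum_(i < n) C)); first by apply: ler_sum => i _; apply: H.
by rewrite sumr_const card_ord mulr_natr.
Qed.

(* The truncation is removed by monotone limits: [asup] stands for the mean of the untruncated passage time. *)
Definition asup p n : R := sup [set am p l n | l in setT].
Definition mu p : R := inf [set asup p n.+1 / n.+1%:R | n in setT].

Lemma long_dual_pr p0 (A K m : nat) : 1 / 2 < p0 -> p0 <= 1 -> exists2 C : R, 0 < C &
  forall p l r, p0 <= p <= 1 -> (r <= A * l.+1 ^ K)%N -> pr p (long_dual l r) <= C / l.+1%:R ^+ m.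
Proof.
move=> h h1; have [C [b [C0 b01 H]]] := dual_reach h h1.
have [C' C'0 hC'] := poly_geo (2 * K + m) b01.
pose B := (2 * (2 * A).+1 ^ 2)%N.
exists (B%:R * C * C') => [|p l r hp hr]; first by rewrite !mulr_gt0// ltr0n /B muln_gt0 expn_gt0.
have p01 : 0 <= p <= 1 by lra.
have hb : (size (ebox origin r) <= B * l.+1 ^ (2 * K))%N.
  rewrite size_ebox /B [(2 * K)%N]mulnC expnM -mulnA leq_mul2l /= -expnMn leq_sqr.
  have : (0 < l.+1 ^ K)%N by rewrite expn_gt0.
  move: hr; move: (l.+1 ^ K)%N; clear; nia.
apply: (@le_trans _ _ ((B * l.+1 ^ (2 * K))%N%:R * (C * b ^+ l))).
  apply: le_trans (pr_ex p01 _) _ => [e _|]; first exact: dual_reach_local.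
  apply: le_trans (ler_sum _ (fun e _ => H p e.1 l hp)) _.
  rewrite big_const_seq iter_addr addr0 count_predT -[X in X <= _]mulr_natl ler_wpM2r//.
    by case/andP: b01 => b0 _; rewrite mulr_ge0 ?exprn_ge0// ltW.
  by rewrite ler_nat.
rewrite ler_pdivlMr ?exprn_gt0// natrM natrX.
have -> : B%:R * l.+1%:R ^+ (2 * K) * (C * b ^+ l) * l.+1%:R ^+ m = B%:R * C * (l.+1%:R ^+ (2 * K + m) * b ^+ l).
  by rewrite exprD; ring.
by rewrite ler_wpM2l// mulr_ge0// ltW.
Qed.


Section Limit.
Variables (p0 : R) (hp0 : 1 / 2 < p0) (hp1 : p0 <= 1).

Section FixedParameter.
Variables (p : R) (hp : p0 <= p <= 1).

Let p01 : 0 <= p <= 1.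
Proof. by move: hp hp0; lra. Qed.

Lemma am_has_sup n : has_sup [set am p l n | l in setT].
Proof.
have [C C0 H] := am_le hp0 hp1; split; first by exists (am p 0 n), 0%N.
by exists (C * n%:R) => _ [l _ <-]; apply: H.
Qed.

Lemma am_asup l n : am p l n <= asup p n.
Proof. by apply: sup_ubound; [case: (am_has_sup n)|exists l]. Qed.

Lemma asup_le n (c : R) : (forall l, am p l n <= c) -> asup p n <= c.
Proof.
by move=> h; apply: ge_sup => [|_ [l _ <-]]; [case: (am_has_sup n)|].
Qed.

Lemma asup_sub m n : asup p (m + n) <= asup p m + asup p n.
Proof. by apply: asup_le => l; apply: le_trans (am_sub l m n p01) _; apply: lerD; apply: am_asup. Qed.

Lemma asup0 : asup p 0 = 0.
Proof.
by apply/eqP; rewrite eq_le; apply/andP; split; [apply: asup_le => l|apply: le_trans (am_asup 0 0)]; rewrite am0.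
Qed.

Lemma asup_mul m q : asup p (q * m) <= q%:R * asup p m.
Proof.
elim: q => [|q IH]; first by rewrite mul0n asup0 mul0r.
by rewrite mulSn -[X in X%:R]add1n natrD mulrDl mul1r; apply: le_trans (asup_sub _ _) _; rewrite lerD2l.
Qed.

Lemma mu_has_inf : has_inf [set asup p n.+1 / n.+1%:R | n in setT].
Proof.
split; first by exists (asup p 1 / 1), 0%N.
by exists 0 => _ [n _ <-]; rewrite divr_ge0//; apply: le_trans (am_asup 0 _); apply: le_trans (am_ge _ _ p01).
Qed.

Lemma mu_le n : mu p * n%:R <= asup p n.
Proof.
case: n => [|n]; first by rewrite mulr0 asup0.
by rewrite -ler_pdivlMr//; apply: ge_inf; [case: mu_has_inf|exists n].
Qed.

Lemma mu_ge c : (forall n, c * n.+1%:R <= asup p n.+1) -> c <= mu p.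
Proof.
move=> h; apply: lb_le_inf; first by case: mu_has_inf.
by move=> _ [n _ <-]; rewrite ler_pdivlMr.
Qed.

(** Euclidean division of [n] by a length at which the infimum is almost attained; the remainder
    contributes the constant [K]. *)
Lemma fekete (d : R) : 0 < d -> exists2 K : R, 0 <= K & forall n, asup p n <= (mu p + d) * n%:R + K.
Proof.
move=> d0; have [C C0 HC] := am_le hp0 hp1.
have [_ [m _ <-] hm] := inf_adherent d0 mu_has_inf; rewrite -/(mu p) in hm.
exists (C * m.+1%:R) => [|n]; first by rewrite mulr_ge0// ltW.
have mu0 : 0 <= mu p + d.
  rewrite ltW// (le_lt_trans _ hm)// divr_ge0//.
  by apply: le_trans (am_asup 0 _); apply: le_trans (am_ge _ _ p01).
rewrite {1}(divn_eq n m.+1); apply: le_trans (asup_sub _ _) _; apply: lerD; last first.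
  apply: asup_le => l; apply: le_trans (HC p l _ hp) _.
  by rewrite ler_wpM2l ?(ltW C0)// ler_nat ltnW// ltn_pmod.
apply: le_trans (asup_mul _ _) _.
apply: (@le_trans _ _ ((n %/ m.+1)%N%:R * ((mu p + d) * m.+1%:R))).
  by rewrite ler_wpM2l// -ler_pdivrMr// ltW.
by rewrite mulrCA ler_wpM2l// -natrM ler_nat leq_trunc_div.
Qed.

End FixedParameter.

Lemma young (x M : R) : 0 < M -> x ^+ 1 <= M + M^-1 * x ^+ 2.
Proof.
move=> M0; rewrite expr1; have h : 0 <= M^-1 * (x - M) ^+ 2 by rewrite mulr_ge0 ?sqr_ge0// invr_ge0 ltW.
have h2 : 2 * x - M <= M^-1 * x ^+ 2.
  rewrite -subr_ge0; suff -> : M^-1 * x ^+ 2 - (2 * x - M) = M^-1 * (x - M) ^+ 2 by [].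
  by rewrite sqrrB; field; rewrite gt_eqF.
have : 0 <= M^-1 * x ^+ 2 by rewrite mulr_ge0 ?invr_ge0 ?sqr_ge0// ltW.
by move: M0 h2; clear; lra.
Qed.

(** Off [long_dual] a higher truncation level does not increase [X]. On it, [X] is bounded by the
    cost of the axis, and [young] with [M = l + 1] splits each time into [M] on an event of
    probability [O(1 / M ^ 2)] and [tau ^ 2 / M], of mean [O(1 / M)]. *)
Lemma asup_am (A K : nat) : exists2 C : R, 0 < C & forall p l n, p0 <= p <= 1 -> (n <= A * l.+1 ^ K)%N ->
  asup p n <= am p l n + C * n%:R / l.+1%:R.
Proof.
have [C2 C20 H2] := tau_moment 2 hp0 hp1.
have [C C0 HC] := long_dual_pr (98 * A) (K + 2) 2 hp0 hp1.
exists (C + C2) => [|p l n hp hn]; first exact: addr_gt0.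
have p01 : 0 <= p <= 1 by move: hp hp0; lra.
apply: (asup_le hp) => l'.
have M0 : 0 < l.+1%:R :> R by [].
have [ll|/ltnW ll] := leqP l' l.
  apply: le_trans (am_mono n p01 ll) _; rewrite lerDl divr_ge0// mulr_ge0//; apply: addr_ge0; exact: ltW.
pose Y w := \sum_(i < n) (l.+1%:R * ind R (long_dual l (geo_rad l n) w) + l.+1%:R^-1 * taur R l' ((i%:Z, 0), false) 2 w).
have l1 : local (fun w => l.+1%:R * ind R (long_dual l (geo_rad l n) w)).
  exact/(local1 (fun x : R => _ * x))/local_ind/long_dual_local.
have l2 (e : edge) : local (fun w => l.+1%:R^-1 * taur R l' e 2 w).
  exact/(local1 (fun x : R => _ * x))/taur_local.
have lY0 (e : edge) : local (fun w => l.+1%:R * ind R (long_dual l (geo_rad l n) w) + l.+1%:R^-1 * taur R l' e 2 w).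
  exact: (local2 +%R).
have lY : local Y by apply: local_sum => i _ _.
have EY : E_ p Y <= (C + C2) * n%:R / l.+1%:R.
  rewrite (@E_sum _ _ _ _ xpredT) => [|i _ _]; last exact: lY0.
  apply: (@le_trans _ _ (\sum_(i < n) ((C + C2) / l.+1%:R))); last first.
    by rewrite sumr_const card_ord -[X in X <= _]mulr_natr mulrAC.
  apply: ler_sum => i _; rewrite E_D// !E_Z; [|exact: taur_local|exact/local_ind/long_dual_local].
  rewrite mulrDl; apply: lerD; last by rewrite mulrC ler_wpM2r// H2.
  rewrite mulrC -ler_pdivlMr// -mulrA -invfM -expr2; apply: HC => //.
  rewrite /geo_rad expnD; have t : (tmax l <= 49 * l.+1 ^ 2)%N by rewrite /tmax -[49%N]/(7 ^ 2)%N -expnMn leq_sqr; lia.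
  move: hn t; move: (l.+1 ^ K)%N (l.+1 ^ 2)%N (tmax l) => u v t; clear => h1 h2.
  have := leq_mul h2 h1; nia.
rewrite {1}/am; apply: le_trans (_ : _ <= E_ p (fun w => Xr R l origin (axis n) w + Y w)) _; last first.
  by rewrite E_D//; [rewrite lerD2l|exact: Xr_local].
apply: E_le => //; [exact: Xr_local|by apply: (local2 +%R) => //; exact: Xr_local|move=> w].
have Y0 : 0 <= Y w.
  by apply: sumr_ge0 => i _; rewrite addr_ge0// mulr_ge0 ?ind_ge0 ?taur_ge0 ?invr_ge0.
have [b|nb] := pselect (long_dual l (geo_rad l n) w); last first.
  by rewrite ler_wpDr// ler_nat X_up.
apply: ler_wpDl; first by [].
apply: le_trans (_ : _ <= (\sum_(i < n) tau l' w ((i%:Z, 0)%R, false))%N%:R) _; first by rewrite ler_nat X_line.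
rewrite natr_sum; apply: ler_sum => i _; rewrite (indT _ b) mulr1 /taur -[X in X <= _]expr1.
exact: young.
Qed.

End Limit.

Lemma X_chebyshev p l n (t : R) : 0 <= p <= 1 -> 0 < t ->
  pr p (fun w => t <= `|Xr R l origin (axis n) w - am p l n|) <= (vconst l n)%:R / t ^+ 2.
Proof.
move=> p01 t0; rewrite ler_pdivlMr ?exprn_gt0// mulrC.
set m := am p l n; set Z := Xr R l origin (axis n).
have lZ : local Z by exact: Xr_local.
have lf : local (fun w => (Z w - m) ^+ 2) by apply: (local1 (fun x : R => (x - m) ^+ 2)).
have H : E_ p (fun w => (Z w - m) ^+ 2) <= (vconst l n)%:R.
  have := X_variance l origin (axis n) p01; rewrite subr0 nrm_axis; apply: le_trans; rewrite -/Z.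
  have E1 : E_ p Z = m by [].
  have l2 : local (fun w => Z w ^+ 2) by apply: (local1 (fun x : R => x ^+ 2)).
  have l3 : local (fun w => - (2 * m) * Z w) by apply: (local1 (fun x : R => - (2 * m) * x)).
  have -> : E_ p (fun w => (Z w - m) ^+ 2) = E_ p (fun w => Z w ^+ 2 + (- (2 * m) * Z w + m ^+ 2)).
    by apply: E_eq => w; ring.
  rewrite E_D//; last exact: (local1 (fun x : R => x + m ^+ 2)).
  rewrite E_D//; last exact: local_cst.
  by rewrite E_Z// E_cst E1; lra.
apply: le_trans H; apply: le_trans (pr_markov p01 (t ^+ 2) lf _) => [|w]; last exact: sqr_ge0.
rewrite ler_wpM2l ?sqr_ge0//; apply: pr_le => //.
- by apply: (local1 (fun x : R => t <= `|x - m| : Prop)).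
- by apply: (local1 (fun x : R => t ^+ 2 <= x : Prop)).
- by move=> w h; rewrite -(real_normK (num_real (Z w - m))) lerXn2r ?nnegrE// ltW.
Qed.

End Means.

(** * Almost sure convergence along the axis *)

Section Scales.
Implicit Types j l n : nat.

Lemma level_ex j : exists l, (l ^ 4 <= j < l.+1 ^ 4)%N.
Proof.
elim: j => [|j [l /andP[h1 h2]]]; first by exists 0%N.
have [h|h] := leqP (l.+1 ^ 4) j.+1; last by exists l; rewrite h andbT ltnW.
exists l.+1; rewrite h /=; apply: leq_ltn_trans h2 _; by rewrite ltn_exp2r.
Qed.

(* At the scale [n = (j + 1) ^ 8] passage times are truncated at [level j], about [j ^ (1/4)]: polynomial
   factors in [level j] are negligible with respect to [j], and exponentials in [level j] are summable. *)
Definition level j : nat := sval (cid (level_ex j)).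

Lemma levelP j : (level j ^ 4 <= j < (level j).+1 ^ 4)%N.
Proof. by rewrite /level; case: cid. Qed.

Lemma level_ge l j : (l ^ 4 <= j)%N -> (l <= level j)%N.
Proof.
case/andP: (levelP j) => _ h2 h; have := leq_ltn_trans h h2.
by rewrite ltn_exp2r// ltnS.
Qed.

Lemma level_hi j : ((level j).+1 ^ 4 <= 16 * j.+1)%N.
Proof.
case/andP: (levelP j) => h _; case: (level j) h => [|l] h; first by rewrite exp1n; lia.
apply: (@leq_trans ((2 * l.+1) ^ 4)); first by rewrite leq_exp2r//; lia.
rewrite expnMn; move: h; move: (l.+1 ^ 4)%N => x; clear; lia.
Qed.

Definition scale j : nat := (j.+1 ^ 8)%N.

Lemma scale_le j l : (j <= l)%N -> (scale j <= scale l)%N.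
Proof. by move=> h; rewrite leq_exp2r. Qed.

Lemma scale_level j : (scale j.+1 <= 256 * (level j).+1 ^ 32)%N.
Proof.
rewrite /scale (expnM _ 4 8) -[256%N]/(2 ^ 8)%N -expnMn leq_exp2r//.
case/andP: (levelP j) => _; move: (_ ^ 4)%N => x; clear; lia.
Qed.

(** The binomial coefficients other than the leading one sum to [255 = 2 ^ 8 - 1]. *)
Lemma scale_gap j : (scale j.+1 <= scale j + 255 * j.+1 ^ 7)%N.
Proof.
rewrite /scale -addn1 -[X in (_ <= X)%N]addnC addn1.
have h k : (k < 8)%N -> (j.+1 ^ k <= j.+1 ^ 7)%N by move=> hk; rewrite leq_pexp2l.
have := (h 0%N isT, h 1%N isT, h 2%N isT, h 3%N isT, h 4%N isT, h 5%N isT, h 6%N isT).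
have -> : (j.+2 ^ 8 = j.+1 ^ 8 + 8 * j.+1 ^ 7 + 28 * j.+1 ^ 6 + 56 * j.+1 ^ 5 + 70 * j.+1 ^ 4 + 56 * j.+1 ^ 3 + 28 * j.+1 ^ 2 + 8 * j.+1 ^ 1 + j.+1 ^ 0)%N.
  by rewrite -addn1; move: j.+1 => x; clear; rewrite !expnS expn0; ring.
move: (j.+1 ^ 0)%N (j.+1 ^ 1)%N (j.+1 ^ 2)%N (j.+1 ^ 3)%N (j.+1 ^ 4)%N (j.+1 ^ 5)%N (j.+1 ^ 6)%N (j.+1 ^ 7)%N (j.+1 ^ 8)%N.
clear; move=> x0 x1 x2 x3 x4 x5 x6 x7 x8 [[[[[[h0 h1] h2] h3] h4] h5] h6]; lia.
Qed.

Lemma scale_find J n : (scale J <= n)%N -> exists2 j, (J <= j)%N & (scale j <= n < scale j.+1)%N.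
Proof.
elim: n => [|n IH] h; first by move: h; rewrite leqn0 expn_eq0.
have [e|ne] := eqVneq (scale J) n.+1.
  exists J => //; by rewrite -e leqnn /= /scale ltn_exp2r.
have {}/IH[j Jj /andP[h1 h2]] : (scale J <= n)%N by rewrite -ltnS ltn_neqAle ne.
have [h3|h3] := leqP (scale j.+1) n.+1.
  exists j.+1; first exact: leqW.
  by rewrite h3 /=; apply: leq_ltn_trans h2 _; rewrite ltn_exp2r.
by exists j => //; rewrite h3 ltnW.
Qed.

End Scales.

Section AlmostSure.
Context d (T : measurableType d) (R : realType) (P : probability T R) (p : R) (w : T -> config).
Hypothesis (wP : bernoulli_percolation P p w) (p01 : 0 <= p <= 1).

Lemma square_sum n : \sum_(0 <= j < n) (j.+1%:R ^+ 2 : R)^-1 <= 2 - 2 * n.+1%:R^-1.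
Proof.
elim: n => [|n IH]; first by rewrite big_geq// invr1; lra.
rewrite big_nat_recr//=; apply: le_trans (lerD IH (lexx _)) _.
rewrite -subr_ge0 -[n.+2]addn1 natrD; have : 1 <= n.+1%:R :> R by rewrite ler1n.
move: (n.+1%:R : R) => x x0.
have -> : 2 - 2 * (x + 1)^-1 - (2 - 2 * x^-1 + (x ^+ 2)^-1) = (x - 1) / (x ^+ 2 * (x + 1)) :> R.
  by field; rewrite !gt_eqF//; lra.
by rewrite divr_ge0 ?mulr_ge0 ?sqr_ge0//; lra.
Qed.

Lemma borel_cantelli (A : nat -> config -> Prop) (C : R) : (forall j, local (A j)) -> 
  (forall j, pr p (A j) <= C / j.+1%:R ^+ 2) ->
  {ae P, forall t, exists j0, forall j, (j0 <= j)%N -> ~ A j (w t)}.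
Proof.
move=> lA hA; pose F j := [set t | A j (w t)].
have mF j : measurable (F j) := (percolation_pr wP (lA j)).1.
have PF j : P (F j) = (pr p (A j))%:E := (percolation_pr wP (lA j)).2.
have C0 : 0 <= C.
  by have := le_trans (pr_ge0 p01 (lA 0%N)) (hA 0%N); rewrite expr1n divr1.
have h : P (lim_sup_set F) = 0.
  apply: lim_sup_set_cvg0 => //.
  apply: (@le_lt_trans _ _ (C * 2)%:E); last exact: ltry.
  apply: lime_le; first by apply: is_cvg_nneseries => n _ _; exact: measure_ge0.
  near=> n.
  have -> : (\sum_(0 <= i < n) P (F i) = (\sum_(0 <= i < n) pr p (A i))%:E)%E.
    by rewrite -sumEFin; apply: eq_bigr => i _; rewrite PF.
  rewrite lee_fin; apply: (@le_trans _ _ (\sum_(0 <= i < n) C / i.+1%:R ^+ 2)); first by apply: ler_sum.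
  rewrite -mulr_sumr ler_wpM2l//; apply: le_trans (square_sum n) _.
  by rewrite gerBl mulr_ge0.
exists (lim_sup_set F); split => //.
  apply: bigcapT_measurable => n; apply: bigcup_measurable => k _; exact: mF.
move=> t /= /forallNP nt j0 _ /=.
have := nt j0; move/existsNP => [j /not_implyP[jj /contrapT Aj]].
by exists j.
Unshelve. all: by end_near.
Qed.

Lemma negligible_small (N : set T) :
  (forall eta : R, 0 < eta -> exists A, [/\ measurable A, N `<=` A & (P A <= eta%:E)%E]) -> P.-negligible N.
Proof.
move=> h.
have {}h n : {A | [/\ measurable A, N `<=` A & (P A <= (n.+1%:R^-1)%:E)%E]}.
  by apply: cid; apply: h; rewrite invr_gt0.
pose A := \bigcap_n sval (h n).
have mA : measurable A by apply: bigcapT_measurable => n; case: (svalP (h n)).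
exists A; split => //; last by move=> t Nt n _; case: (svalP (h n)) => _ /(_ _ Nt).
apply/eqP; rewrite eq_le measure_ge0 andbT.
apply/lee_addgt0Pr => eps eps0; rewrite add0e.
have [n hn] : exists n, (n.+1%:R^-1 : R) <= eps.
  exists (Num.trunc eps^-1); rewrite -[X in _ <= X]invrK lef_pV2 ?posrE ?invr_gt0//.
  by apply/ltW/truncnS_gt.
have [mn sn Pn] := svalP (h n).
apply: (@le_trans _ _ (P (sval (h n)))); first by apply: le_measure; rewrite ?inE// => t; apply.
by apply: le_trans Pn _; rewrite lee_fin.
Qed.

(** If [theta] has no positive lower bound, the origin almost surely has a finite cluster.
    Otherwise, beyond any [M] and for every [n], one of [J] given points reaches distance [n] with
    probability at least [1 - eta]. The failures increase with [n], so their union has probability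
    at most [eta], and off it one of these finitely many points reaches every distance. *)
Lemma axis_infinitely_often : {ae P, forall t, inf_cluster (w t) origin ->
  forall M, exists2 n, (M <= n)%N & inf_cluster (w t) (axis n)}.
Proof.
have [[c [c0 hc]]|nc] := pselect (exists c : R, 0 < c /\ forall n, c <= theta p n); last first.
  suff H : P.-negligible [set t | inf_cluster (w t) origin].
    by apply: negligibleS H => t /= /not_implyP[].
  apply: negligible_small => eta eta0.
  have [n hn] : exists n, theta p n < eta.
    apply: contrapT => /forallNP h; apply: nc; exists eta; split => // n; rewrite leNgt; apply/negP; exact: h.
  have [m Pm] := percolation_pr wP (reach_local origin n).
  exists [set t | reach (w t) origin n]; split => //; first by move=> t /inf_reach; apply.
  by rewrite Pm lee_fin ltW.
suff H M : P.-negligible [set t | forall n, (M <= n)%N -> ~ inf_cluster (w t) (axis n)].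
  have : {ae P, forall t, forall M, exists2 n, (M <= n)%N & inf_cluster (w t) (axis n)}.
    apply: ae_foralln => M; apply: negligibleS (H M) => t /= h n Mn i; apply: h; by exists n.
  by apply: filterS => t h _.
apply: negligible_small => eta eta0.
have [J [D HD]] := spaced_reach p01 c0 hc eta0.
pose G n := fun v : config => ~ exists2 i, i \in iota 0 J & reach v ((M + i * D)%N%:Z, 0) n.
have lG n : local (G n) by apply: local_not; apply: local_ex => i _; apply: reach_local.
have [mG PG] : (forall n, measurable [set t | G n (w t)]) /\ (forall n, P [set t | G n (w t)] = (pr p (G n))%:E).
  by split => n; have [] := percolation_pr wP (lG n).
have prG n : pr p (G n) <= eta.
  rewrite pr_not//; last by apply: local_ex => i _; apply: reach_local.
  by have := HD M n; lra.
exists (\bigcup_n [set t | G n (w t)]); split; first by apply: bigcup_measurable.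
  move=> t /= h; apply: contrapT => ng.
  have {}ng n : exists2 i, i \in iota 0 J & reach (w t) ((M + i * D)%N%:Z, 0) n.
    by apply: contrapT => x; apply: ng; exists n.
  have [i hi] : exists i, forall n, reach (w t) ((M + i * D)%N%:Z, 0) n.
    apply: contrapT => /forallNP hh.
    have {}hh i : {n | ~ reach (w t) ((M + i * D)%N%:Z, 0) n}.
      by apply: cid; apply/existsNP/hh.
    have [i hi hr] := ng (\max_(i <- iota 0 J) sval (hh i))%N.
    by apply: (svalP (hh i)); apply: reach_le hr; exact: (@leq_bigmax_seq _ _ xpredT (fun i => sval (hh i)) i hi isT).
  by apply: (h (M + i * D)%N); [exact: leq_addr|apply/inf_reach].
have := @nondecreasing_cvg_mu _ _ _ P (fun n => [set t | G n (w t)]) mG (bigcup_measurable (fun n _ => mG n)).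
move=> /(_ _)/cvge_to_le; apply.
  move=> n m nm; apply/subsetPset => t /= h [i hi hr]; apply: h; exists i => //; exact: reach_le hr.
by near=> n; rewrite /= PG lee_fin.
Unshelve. all: by end_near.
Qed.

End AlmostSure.

Section AxisPoints.
Implicit Types (v : config).

Definition axis_count v i : nat := (\sum_(1 <= j < i.+1) nat_of_bool `[<inf_cluster v (j%:Z, 0%:Z)>])%N.

Lemma axis_count_S v i : axis_count v i.+1 = (axis_count v i + nat_of_bool `[<inf_cluster v (i.+1%:Z, 0%:Z)>])%N.
Proof. by rewrite /axis_count big_nat_recr. Qed.

Lemma axis_count_le v i : (axis_count v i <= i)%N.
Proof.
elim: i => [|i IH]; first by rewrite /axis_count big_geq.
by rewrite axis_count_S -addn1 leq_add// leq_b1.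
Qed.

Lemma axis_count_mono v i j : (i <= j)%N -> (axis_count v i <= axis_count v j)%N.
Proof.
move=> /subnKC <-; elim: (j - i)%N => [|m IH]; first by rewrite addn0.
by rewrite addnS axis_count_S; apply: leq_trans IH (leq_addr _ _).
Qed.

(** The count of points increases by at most 1 at each step, so the first index at which it reaches
    [k] is the required point, and [T1] does not take its junk value. *)
Lemma T1P v k : (forall M, exists2 n, (M <= n)%N & inf_cluster v (axis n)) -> (0 < k)%N ->
  (k <= T1 v k)%N /\ inf_cluster v (axis (T1 v k)).
Proof.
move=> io k0.
have [i hi] : exists i, (k <= axis_count v i)%N.
  elim: (k) => [|m [i hi]]; first by exists 0%N.
  have [[//|n] hn inn] := io i.+1; exists n.+1.
  rewrite axis_count_S asboolT//= addn1 ltnS.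
  by apply: leq_trans hi _; apply: axis_count_mono.
suff [e pT] : exists e, (0 < e)%N /\ inf_cluster v (e%:Z, 0%:Z) /\ axis_count v e = k.
  have [_ [h1 h2]] : (0 < T1 v k)%N /\ inf_cluster v ((T1 v k)%:Z, 0%:Z) /\ axis_count v (T1 v k) = k.
    exact: (@xgetPex _ 0%N [set i | (0 < i)%N /\ inf_cluster v (i%:Z, 0%:Z) /\ axis_count v i = k]) (ex_intro _ e pT).
  by split => //; rewrite -[X in (X <= _)%N]h2 axis_count_le.
have := ex_minnP (ex_intro (fun i => k <= axis_count v i)%N i hi).
case: ex_minnP => m hm min _; case: m hm min => [|m] hm min.
  by move: hm; rewrite leqNgt (leq_ltn_trans (axis_count_le v 0)).
have lt : (axis_count v m < k)%N by rewrite ltnNge; apply/negP => /min; rewrite ltnn.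
exists m.+1; split => //; move: hm; rewrite axis_count_S.
case: (pselect (inf_cluster v (m.+1%:Z, 0%:Z))) => hv; last by rewrite asboolF//= addn0 leqNgt lt.
by rewrite asboolT//= addn1 => hm; split => //; apply/eqP; rewrite eqn_leq hm lt.
Qed.

End AxisPoints.

Section Estimate.
Variables (R : realType) (p0 p : R).
Hypotheses (hp0 : 1 / 2 < p0) (hp1 : p0 <= 1) (hp : p0 <= p <= 1).
Implicit Types (v : config) (j l n : nat).

Let p01 : 0 <= p <= 1.
Proof. by move: hp hp0; lra. Qed.

Definition long_dual_scale j v := long_dual (level j) (geo_rad (level j) (scale j.+1)) v.

Definition far_scale j v : Prop := (scale j)%:R / j.+1%:R <=
  `|Xr R (level j) origin (axis (scale j)) v - am p (level j) (scale j)|.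

Lemma tmax_le l : (tmax l <= 49 * l.+1 ^ 2)%N.
Proof. by rewrite /tmax -[49%N]/(7 ^ 2)%N -expnMn leq_sqr; lia. Qed.

Lemma long_dual_scale_pr : exists C : R, forall j, pr p (long_dual_scale j) <= C / j.+1%:R ^+ 2.
Proof.
(* With [l = level j], the radius is at most [98 * 256 * (l + 1) ^ (2 + 32)]; the power 8 in the
   bound yields [(j + 1) ^ 2] because [(l + 1) ^ 4] exceeds [j]. *)
have [C C0 H] := long_dual_pr (98 * 256) 34 8 hp0 hp1; exists C => j.
apply: le_trans (H p _ _ hp _) _.
  rewrite /geo_rad (expnD _ 32 2).
  have := leq_mul (tmax_le (level j)) (scale_level j).
  move: (tmax _) (scale _) (_ ^ 32)%N (_ ^ 2)%N; clear => a b c e; nia.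
rewrite ler_wpM2l ?(ltW C0)// lef_pV2 ?posrE ?exprn_gt0//.
rewrite -!natrX ler_nat (expnM _ 4 2) leq_sqr; by case/andP: (levelP j).
Qed.

Lemma far_local j : local (far_scale j).
Proof.
exact: (local1 (fun x : R => (scale j)%:R / j.+1%:R <= `|x - am p (level j) (scale j)| : Prop) (Xr_local R (level j) origin (axis (scale j)))).
Qed.

Lemma far_scale_pr : exists C : R, forall j, pr p (far_scale j) <= C / j.+1%:R ^+ 2.
Proof.
(* With [l = level j], the variance is [O((l + 1) ^ 10 * (j + 1) ^ 8)], hence [O((j + 1) ^ 11)] by
   [level_hi], and the square of the deviation is [(j + 1) ^ 14]. *)
have [C H] := vconst_poly; exists (C * 16 ^ 3 * 2)%N%:R => j.
have t0 : 0 < (scale j)%:R / j.+1%:R :> R by rewrite divr_gt0// ltr0n expn_gt0.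
apply: le_trans (X_chebyshev (level j) (scale j) p01 t0) _.
rewrite /scale; have x0 : 0 < j.+1%:R :> R by [].
rewrite natrX ler_pdivrMr ?exprn_gt0 ?divr_gt0 ?exprn_gt0//.
have -> : (C * 16 ^ 3 * 2)%N%:R / j.+1%:R ^+ 2 * (j.+1%:R ^+ 8 / j.+1%:R) ^+ 2 =
   (C * 16 ^ 3 * 2 * j.+1 ^ 12)%N%:R :> R.
  rewrite [in RHS]natrM natrX; move: (_%N%:R : R) (j.+1%:R : R) x0 => c x x0.
  by field; rewrite gt_eqF.
rewrite ler_nat; apply: leq_trans (H _ _) _.
have h1 : ((level j).+1 ^ 10 <= 16 ^ 3 * j.+1 ^ 3)%N.
  apply: (@leq_trans ((level j).+1 ^ 12)); first by rewrite leq_pexp2l.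
  by rewrite (expnM _ 4 3) -expnMn leq_exp2r// level_hi.
have h2 : ((j.+1 ^ 8).+1 <= 2 * j.+1 ^ 8)%N by rewrite mul2n -addnn -addn1 leq_add2l expn_gt0.
have -> : (C * 16 ^ 3 * 2 * j.+1 ^ 12 = C * ((16 ^ 3 * j.+1 ^ 3) * (2 * j.+1 ^ 8) * j.+1))%N.
  rewrite (expnS _ 11) (expnD _ 3 8); move: (16 ^ 3)%N (j.+1 ^ 3)%N (j.+1 ^ 8)%N (j.+1); clear => k x z m; ring.
rewrite leq_mul2l; apply/orP; right; apply: leq_trans (leq_mul h1 h2) _; exact: leq_pmulr.
Qed.

Lemma axis_dist m n : (m <= n)%N -> nrm (axis n - axis m) = (n - m)%N.
Proof. by rewrite /nrm /axis /= => h; lia. Qed.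

Lemma nat_dist (a b t m n : nat) : (m <= n)%N -> (b <= a + t * (2 * (n - m)))%N ->
  (a <= b + t * (2 * (n - m)))%N -> `|b%:R - a%:R| <= 2 * t%:R * (n%:R - m%:R) :> R.
Proof.
move=> mn; rewrite -!(ler_nat R) !natrD !natrM natrB//.
move: (a%:R : R) (b%:R : R) (t%:R : R) (n%:R : R) (m%:R : R) => A B t' x y; rewrite ler_norml; lra.
Qed.

Lemma passage_estimate (dd : R) : 0 < dd -> exists2 K : R, 0 < K & forall v j n, ~ far_scale j v ->
  (scale j <= n < scale j.+1)%N ->
  `|Xr R (level j) origin (axis n) v - mu p * n%:R| <= n%:R * (dd + K / (level j).+1%:R).
Proof.
move=> d0; have [C C0 HC] := asup_am hp0 hp1 256 32.
have [K0 K00 HK] := fekete hp0 hp1 hp d0.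
have mu0 : 0 <= mu p.
  apply: (mu_ge hp0 hp1 hp) => n; rewrite mul0r; apply: le_trans (am_asup hp0 hp1 hp 0 _).
  by apply: le_trans (am_ge _ _ p01).
(* All errors are compared with [y = scale j / (level j + 1)]. Here [510 = 2 * 255] and
   [4080 = 255 * 16], where 255 comes from [scale_gap], 16 from [level_hi] and [784 = 49 * 16] from
   [tmax_le]. *)
have [B hB] : exists B : R, B = 510 * 784 by exists (510 * 784).
have B0 : 0 <= B by rewrite hB; apply: mulr_ge0; apply: ler0n.
exists (B + 16 + 16 * K0 + C + 4080 * mu p) => [|v j n nf /andP[n1 n2]].
  by move: B0 C0 K00 mu0; lra.
have l0 : 0 < (level j).+1%:R :> R by [].
pose l := level j; pose q : R := (j.+1 ^ 7)%N%:R; pose N : R := (scale j)%:R.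
pose y := N / l.+1%:R.
have N0 : 0 <= N by [].
have lhi := level_hi j.
have eN : scale j = (j.+1 ^ 7 * j.+1)%N by rewrite /scale (expnSr _ 7).
have F1 : q <= 16 * y.
  rewrite /y mulrA ler_pdivlMr// /q /N -!natrM ler_nat eN.
  have : ((level j).+1 <= (level j).+1 ^ 4)%N by rewrite -{1}[X in (X <= _)%N]expn1 leq_pexp2l.
  move: (j.+1 ^ 7)%N => z; rewrite -/l in lhi *; move: lhi; move: (l.+1 ^ 4)%N => x; clear; nia.
have F2 : n%:R - N <= 255 * q.
  rewrite /q /N lerBlDr addrC -natrM -natrD ler_nat; exact/ltnW/(leq_trans n2)/scale_gap.
have F3 : (tmax l)%:R * q <= 784 * y.
  rewrite /y mulrA ler_pdivlMr// /q /N -!natrM ler_nat eN.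
  have h3 : (l.+1 ^ 2 * l.+1 <= l.+1 ^ 4)%N by rewrite -expnSr leq_pexp2l.
  apply: (@leq_trans (49 * l.+1 ^ 2 * j.+1 ^ 7 * l.+1)); first by rewrite leq_mul2r leq_mul2r tmax_le !orbT.
  rewrite -/l in lhi; move: lhi h3; move: (j.+1 ^ 7)%N (l.+1 ^ 4)%N (l.+1 ^ 2)%N => z x a; clear => h1 h2.
  have := leq_mul (leqnn z) h1; have := leq_mul (leqnn z) h2; lia.
have F4 : `|Xr R l origin (axis n) v - Xr R l origin (axis (scale j)) v| <= 2 * (tmax l)%:R * (n%:R - N).
  have hX : (X l v (axis (scale j)) (axis n) <= tmax l * (2 * (n - scale j)))%N.
    by rewrite -axis_dist//; apply: X_bound.
  have t1 := fpp_triangle (tau l v) origin (axis (scale j)) (axis n).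
  have t2 := fpp_triangle (tau l v) origin (axis n) (axis (scale j)).
  rewrite [X in (_ <= _ + X)%N]fpp_sym in t2.
  have {}t1 := leq_trans t1 (leq_add (leqnn _) hX); have {}t2 := leq_trans t2 (leq_add (leqnn _) hX).
  exact: nat_dist.
have F5 : `|Xr R l origin (axis (scale j)) v - am p l (scale j)| <= q.
  move/negP: nf; rewrite -ltNge => /ltW; rewrite eN natrM mulfK ?pnatr_eq0//.
have F6 := am_asup hp0 hp1 hp l (scale j).
have F7 := HK (scale j).
have F8 := HC p l (scale j) hp (leq_trans (scale_le (leqnSn j)) (scale_level j)).
have F9 := mu_le hp0 hp1 hp (scale j).
rewrite -/N -/y in F7 F8 F9; rewrite -mulrA -/y in F8.
have q1 : 1 <= q by rewrite /q ler1n expn_gt0.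
have F10 : K0 <= 16 * (K0 * y) by have := ler_wpM2l K00 F1; have := ler_wpM2l K00 q1; lra.
have n0 : 0 <= n%:R - N by rewrite subr_ge0 ler_nat.
have F11 : mu p * (n%:R - N) <= 4080 * (mu p * y) by have := ler_wpM2l mu0 F2; have := ler_wpM2l mu0 F1; lra.
have F12 : 2 * (tmax l)%:R * (n%:R - N) <= B * y.
  rewrite hB -mulrA; have := ler_wpM2l (ler0n R (tmax l)) F2; move: F3; lra.
have F13 : 0 <= mu p * (n%:R - N) by apply: mulr_ge0.
apply: (@le_trans _ _ (N * dd + (B + 16 + 16 * K0 + C + 4080 * mu p) * y)); last first.
  rewrite [X in _ <= X]mulrDr; apply: lerD; first by rewrite ler_wpM2r ?(ltW d0)//; move: n0; lra.
  have : 0 <= B + 16 + 16 * K0 + C + 4080 * mu p by move: B0 C0 K00 mu0; lra.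
  move: (_ + 4080 * _) => B' B'0; rewrite /y mulrCA -/l ler_wpM2r ?divr_ge0//.
  by move: n0; lra.
rewrite ler_norml in F4; rewrite ler_norml in F5; rewrite ler_norml -/l.
move: F4 F5 F6 F7 F8 F9 F10 F11 F12 F13 F1; lra.
Qed.

Lemma D_opath v x m : opath v origin x m -> (forall k, opath v origin x k -> (m <= k)%N) ->
  D v x = (m%:R : R)%:E.
Proof.
move=> om min; apply/eqP; rewrite eq_le; apply/andP; split.
  by apply: ereal_inf_lbound; exists m.
by apply: le_ereal_inf_tmp => _ [k /= ok <-]; rewrite lee_fin ler_nat min.
Qed.

Lemma long_dual_le l r r' v : (r <= r')%N -> long_dual l r v -> long_dual l r' v.
Proof.
move=> h [e er re]; exists e => //; move: er; rewrite !mem_ebox => er; exact: leq_trans er h.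
Qed.

Lemma axis_limit v (dd : R) : 0 < dd ->
  (exists j0, forall j, (j0 <= j)%N -> ~ long_dual_scale j v) ->
  (exists j0, forall j, (j0 <= j)%N -> ~ far_scale j v) -> inf_cluster v origin ->
  exists n0, forall n, (n0 <= n)%N -> inf_cluster v (axis n) ->
  exists2 m : nat, D v (axis n) = (m%:R : R)%:E & `|m%:R / n%:R - mu p| <= dd.
Proof.
move=> d0 [j1 h1] [j2 h2] i0.
have d20 : 0 < dd / 2 by lra.
have [K K0 HK] := passage_estimate d20.
pose l0 := Num.trunc (K / (dd / 2)).
have hl0 l : (l0 <= l)%N -> K / l.+1%:R <= dd / 2.
  move=> hl; rewrite ler_pdivrMr// mulrC -ler_pdivrMr//.
  apply/ltW; apply: lt_le_trans (truncnS_gt _) _; by rewrite ler_nat ltnS.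
exists (scale (j1 + (j2 + l0 ^ 4))) => n hn inn.
have [j hj /andP[hn1 hn2]] := scale_find hn.
have [hj1 [hj2 hj3]] : (j1 <= j)%N /\ (j2 <= j)%N /\ (l0 ^ 4 <= j)%N by move: (_ ^ 4)%N hj; clear; lia.
have nb : ~ long_dual (level j) (geo_rad (level j) n) v.
  move=> b; apply: (h1 _ hj1); apply: long_dual_le b; rewrite /geo_rad leq_mul2l leq_mul2l (ltnW hn2) !orbT//.
have [om min] := opath_X nb i0 inn.
exists (X (level j) v origin (axis n)); first exact: D_opath.
have n0 : 0 < n%:R :> R by rewrite ltr0n; apply: leq_trans hn1; rewrite expn_gt0.
have := HK v j n (h2 _ hj2); rewrite hn1 hn2 => /(_ isT) h.
rewrite -(ler_pM2l n0) -[X in X * `|_|](gtr0_norm n0) -normrM mulrBr mulrCA divff ?gt_eqF// mulr1 [X in _ - X]mulrC.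
apply: le_trans h _; rewrite ler_wpM2l ?(ltW n0)//.
by apply: le_trans (lerD (lexx _) (hl0 _ (level_ge hj3))) _; lra.
Qed.

Lemma limit_ae d (T : measurableType d) (P : probability T R) (w : T -> config) :
  bernoulli_percolation P p w ->
  {ae P, forall t, inf_cluster (w t) origin ->
     (fun k : nat => (D (w t) ((T1 (w t) k)%:Z, 0%:Z) * (((T1 (w t) k)%:R : R)^-1)%:E)%E) @ \oo --> (mu p)%:E}.
Proof.
move=> wP; have [C1 HC1] := long_dual_scale_pr; have [C2 HC2] := far_scale_pr.
have B1 := borel_cantelli wP p01 (fun j => long_dual_local _ _) HC1.
have B2 := borel_cantelli wP p01 far_local HC2.
have B3 := axis_infinitely_often wP p01.
apply: filterS3 B1 B2 B3 => t b1 b2 b3 i0.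
have {b3} io := b3 i0.
have lim dd (d0 : 0 < dd) : \forall k \near \oo, exists2 m : nat, D (w t) (axis (T1 (w t) k)) = (m%:R : R)%:E &
    `|m%:R / (T1 (w t) k)%:R - mu p| <= dd.
  have [n0 hn0] := axis_limit d0 b1 b2 i0.
  near=> k; have k0 : (0 < k)%N by near: k; exists 1%N.
  have [hk ik] := T1P io k0; apply: hn0 => //.
  by apply: leq_trans hk; near: k; exists n0.
apply/fine_cvgP; split.
  have := lim 1 ltr01; apply: filterS => k [m hm _].
  by rewrite -/(axis _) hm -EFinM.
apply/cvgrPdist_le => eps e0; have := lim eps e0; apply: filterS => k [m hm h] /=.
by rewrite -/(axis _) hm -EFinM /= distrC.
Unshelve. all: by end_near.
Qed.

End Estimate.

(** * The excess cost of monotone paths *)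

Section Dynamics.
Implicit Types (w : config) (e : edge) (x y z : int) (n m : nat) (G : int -> int).

Definition hor x y : edge := ((x, y), false).

(** Excess of the cost of a monotone path over the number of columns: at a closed horizontal edge
    the path takes the edge above or below, treated as open, and a vertical step. What this
    idealization omits is measured by [jam]. *)
Definition Ustep w x G y : int := if w (hor x y) then G y else Num.min (G (y - 1)) (G (y + 1)) + 1.

Fixpoint Uiter w x0 n G : int -> int :=
  if n is n'.+1 then Ustep w (x0 + n'%:Z) (Uiter w x0 n' G) else G.

Definition lip1 G := forall y, `|G (y + 1) - G y| <= 1.

(** The cost of reaching height [y] vertically, hence the initial profile for paths that start at
    the point of height [z]. *)
Definition wedge z y : int := `|y - z|.

Lemma lip1_wedge z : lip1 (wedge z).
Proof. by move=> y; rewrite /wedge; lia. Qed.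

Lemma lip1_dist G : lip1 G -> forall y z, `|G y - G z| <= `|y - z|.
Proof.
move=> hG; suff H n z : `|G (z + n%:Z) - G z| <= n%:Z.
  move=> y z; have [h|h] := leP z y.
    have := H `|y - z|%N z; rewrite (_ : z + `|y - z|%N%:Z = y) => [|]; last by move: h; clear; lia.
    by move: h; clear; lia.
  have := H `|y - z|%N y; rewrite (_ : y + `|y - z|%N%:Z = z) => [|]; last by move: h; clear; lia.
  by move: h; clear; lia.
elim: n => [|n IH]; first by rewrite addr0; lia.
have := hG (z + n%:Z); rewrite -addrA (_ : n%:Z + 1 = n.+1%:Z); last by clear; lia.
by move: IH; move: (G (z + n%:Z)) (G (z + n.+1%:Z)) (G z) => a b c; clear; lia.
Qed.

Lemma Ustep_ge w x G y : lip1 G -> G y <= Ustep w x G y <= G y + 2.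
Proof.
move=> hG; rewrite /Ustep; case: (w _); first by clear; lia.
have := hG y; have := hG (y - 1); rewrite subrK; clear; lia.
Qed.

Lemma Ustep_lip w x G : lip1 G -> lip1 (Ustep w x G).
Proof.
move=> hG y; have := Ustep_ge w x y hG; have := Ustep_ge w x (y + 1) hG; rewrite /Ustep addrK.
have := hG y; case: (w (hor x y)); case: (w (hor x (y + 1))); clear; lia.
Qed.

Lemma Uiter_lip w x0 n G : lip1 G -> lip1 (Uiter w x0 n G).
Proof. by move=> hG; elim: n => //= n; apply: Ustep_lip. Qed.

Lemma Uiter_mono w x0 n G G' c : (forall y, G y <= G' y + c) -> forall y, Uiter w x0 n G y <= Uiter w x0 n G' y + c.
Proof.
move=> h; elim: n => //= n IH y; rewrite /Ustep; case: (w _); first exact: IH.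
have := IH (y - 1); have := IH (y + 1); clear; lia.
Qed.

Lemma Uiter_add w x0 m n G : Uiter w x0 (m + n) G = Uiter w (x0 + m%:Z) n (Uiter w x0 m G).
Proof.
elim: n => [|n IH]; first by rewrite addn0.
by rewrite addnS /= IH; congr Ustep; clear; lia.
Qed.

Definition move_to G y : int := if G (y - 1) <= G (y + 1) then y - 1 else y + 1.

(** The horizontal edges met, from right to left, by an optimal path ending at [y], including the
    closed ones at which it changes row; [tend] is the height where it starts. *)
Fixpoint trace w x0 n G y : seq edge :=
  if n is n'.+1 then
    let e := hor (x0 + n'%:Z) y in
    e :: trace w x0 n' G (if w e then y else move_to (Uiter w x0 n' G) y)
  else [::].

Fixpoint tend w x0 n G y : int :=
  if n is n'.+1 then
    tend w x0 n' G (if w (hor (x0 + n'%:Z) y) then y else move_to (Uiter w x0 n' G) y)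
  else y.

Definition nclosed w (s : seq edge) : nat := count (fun e => ~~ w e) s.

Lemma size_trace w x0 n G y : size (trace w x0 n G y) = n.
Proof. by elim: n y => //= n IH y; rewrite IH. Qed.

Lemma trace_val w x0 n G y :
  Uiter w x0 n G y = G (tend w x0 n G y) + (nclosed w (trace w x0 n G y))%:Z.
Proof.
elim: n y => [|n IH] y /=; first by rewrite addr0.
rewrite {1}/Ustep; case: ifP => hw /=; first by rewrite IH add0n.
rewrite PoszD addrCA [RHS]addrC -IH /move_to; case: ifP => h; move: h; clear; lia.
Qed.

(** A configuration that agrees with [w] on the trace can use the same path, so edges off the trace
    cannot raise the value. *)
Lemma trace_le w w' x0 n G G' y : (forall e, e \in trace w x0 n G y -> w e = w' e) ->
  Uiter w' x0 n G' y <= G' (tend w x0 n G y) + (nclosed w (trace w x0 n G y))%:Z.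
Proof.
elim: n y => [|n IH] y /= h; first by rewrite addr0.
have hw : w (hor (x0 + n%:Z) y) = w' (hor (x0 + n%:Z) y) by apply: h; rewrite mem_head.
have {}IH y' : (forall e, e \in trace w x0 n G y' -> e \in trace w x0 n.+1 G y) ->
    Uiter w' x0 n G' y' <= G' (tend w x0 n G y') + (nclosed w (trace w x0 n G y'))%:Z.
  by move=> hy; apply: IH => e /hy; apply: h.
have {}IH := IH _ (fun e es => mem_behead (s := trace w x0 n.+1 G y) es).
rewrite /Ustep -hw; move: IH; case: (w (hor _ _)) => /= IH; first by rewrite add0n.
rewrite PoszD addrCA [X in _ <= X]addrC; move: IH; rewrite /move_to; case: ifP => _; clear; lia.
Qed.

Lemma Uiter_dep x0 n G y : depon (fun e => nrm (e.1 - (x0, y))%R <= n)%N (fun w => Uiter w x0 n G y).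
Proof.
elim: n y => [|n IH] y w w' h //=; rewrite /Ustep h /=; last first.
  by rewrite /nrm /=; clear; lia.
rewrite (IH y w w') => [|e he]; last by apply: h; apply: leqW.
rewrite (IH (y - 1) w w') => [|e he]; last first.
  by apply: h; move: he; rewrite /nrm /=; clear; lia.
rewrite (IH (y + 1) w w') => [//|e he].
by apply: h; move: he; rewrite /nrm /=; clear; lia.
Qed.

Lemma trace_dep x0 n G y : depon (fun e => nrm (e.1 - (x0, y))%R <= n)%N (fun w => trace w x0 n G y).
Proof.
elim: n y => [|n IH] y w w' h //=.
have hh (e : edge) z : (`|z - y| <= 1) -> (nrm (e.1 - (x0, z))%R <= n)%N -> w e = w' e.
  by move=> hz he; apply: h; move: hz he; rewrite /nrm /=; clear; lia.
have -> : w (hor (x0 + n%:Z) y) = w' (hor (x0 + n%:Z) y) by apply: h; rewrite /nrm /=; clear; lia.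
have -> : move_to (Uiter w x0 n G) y = move_to (Uiter w' x0 n G) y.
  rewrite /move_to (@Uiter_dep x0 n G (y - 1) w w'); last by move=> e; apply: hh; clear; lia.
  by rewrite (@Uiter_dep x0 n G (y + 1) w w')// => e; apply: hh; clear; lia.
congr cons; apply: IH => e; apply: hh; case: (w' _); first by clear; lia.
by rewrite /move_to; case: ifP => _; clear; lia.
Qed.

Lemma Uiter_local x0 n G y : local (fun w => Uiter w x0 n G y).
Proof. by exists (ebox (x0, y) n) => w w' h; apply: Uiter_dep => e he; apply: h; rewrite mem_ebox. Qed.

Lemma Uiter_infl w w' e x0 n G y : lip1 G -> agree_off e w w' ->
  Uiter w' x0 n G y <= Uiter w x0 n G y + 2.
Proof.
move=> hG h; elim: n y => [|n IH] y /=; first by clear; lia.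
have [ee|ne] := eqVneq (hor (x0 + n%:Z) y) e; last first.
  rewrite /Ustep (h _ ne); case: (w' _); first exact: IH.
  have := IH (y - 1); have := IH (y + 1); clear; lia.
(* The columns before that of [e] agree, and in either configuration one step raises a 1-Lipschitz
   profile by 0 to 2. *)
have eqn z : Uiter w' x0 n G z = Uiter w x0 n G z.
  have dep m (le : (m <= n)%N) : forall z, Uiter w' x0 m G z = Uiter w x0 m G z.
    elim: m le => //= m IHm le {}z; rewrite /Ustep !IHm; try exact: ltnW.
    rewrite h//; apply: contraTneq le => em; move: em; rewrite -ee => -[em _]; move: em; clear; lia.
  exact: dep.
have := Ustep_ge w (x0 + n%:Z) y (Uiter_lip w x0 n hG).
have := Ustep_ge w' (x0 + n%:Z) y (Uiter_lip w' x0 n hG); rewrite eqn; clear; lia.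
Qed.

Lemma Uiter_infl0 w w' e x0 n G y : agree_off e w w' -> e \notin trace w x0 n G y ->
  Uiter w' x0 n G y <= Uiter w x0 n G y.
Proof.
move=> h ne; rewrite [X in _ <= X]trace_val; apply: trace_le => f ft; apply: h.
by apply: contraNneq ne => <-.
Qed.

Definition row_closed w x0 n y : nat := (\sum_(i <- iota 0 n) nat_of_bool (~~ w (hor (x0 + i%:Z)%R y)))%N.

Lemma row_closedS w x0 n y : row_closed w x0 n.+1 y = (row_closed w x0 n y + nat_of_bool (~~ w (hor (x0 + n%:Z)%R y)))%N.
Proof. by rewrite /row_closed -addn1 iotaD big_cat /= big_seq1. Qed.

Lemma Uiter_row w x0 n G y : lip1 G -> Uiter w x0 n G y <= G y + 2 * (row_closed w x0 n y)%:Z.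
Proof.
move=> hG; elim: n => [|n IH] /=; first by rewrite /row_closed big_nil; clear; lia.
have := Ustep_ge w (x0 + n%:Z) y (Uiter_lip w x0 n hG); move: IH; rewrite row_closedS PoszD /Ustep.
by case: (w _) => /=; clear; lia.
Qed.

Lemma Uiter_nneg w x0 n G y : (forall z, 0 <= G z) -> 0 <= Uiter w x0 n G y.
Proof. by move=> h; rewrite trace_val; have := h (tend w x0 n G y); clear; lia. Qed.

Definition W w x0 n z y : int := Uiter w x0 n (wedge z) y.

(** After [m] columns the profile is still 1-Lipschitz, hence below the wedge at [b] raised by its
    value there; the dynamics is monotone and commutes with adding a constant. *)
Lemma W_sub w x0 m n a b c : W w x0 (m + n) a c <= W w x0 m a b + W w (x0 + m%:Z) n b c.
Proof.
rewrite /W Uiter_add [X in _ <= X]addrC; apply: (@Uiter_mono w (x0 + m%:Z) n _ (wedge b)) => y.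
have := lip1_dist (Uiter_lip w x0 m (@lip1_wedge a)) y b; rewrite /wedge -/(wedge a); clear; lia.
Qed.

Lemma W_lip w x0 m a b y : W w x0 m a y <= W w x0 m b y + `|a - b|.
Proof. by apply: Uiter_mono => z; rewrite /wedge; clear; lia. Qed.

Lemma W_translate (u : vertex) w x0 m z y :
  W (translate u w) x0 m z y = W w (x0 + u.1) m (z + u.2) (y + u.2).
Proof.
rewrite /W; elim: m y => [|m IH] y /=; first by rewrite /wedge; clear; lia.
rewrite /Ustep !IH /translate /hor /=.
have -> : (x0 + m%:Z, y) + u = (x0 + u.1 + m%:Z, y + u.2) :> vertex.
  by case: (u) => a b; congr pair => /=; clear; lia.
have -> : y - 1 + u.2 = y + u.2 - 1 by clear; lia.
by have -> : y + 1 + u.2 = y + u.2 + 1 by clear; lia.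
Qed.

Definition reflect_e (e : edge) : edge := ((e.1.1, - e.1.2), e.2).

Lemma reflect_e_inj : injective reflect_e.
Proof. by move=> [[a b] c] [[a' b'] c'] [-> /oppr_inj -> ->]. Qed.

Lemma W_reflect w x0 m z y : W (w \o reflect_e) x0 m z y = W w x0 m (- z) (- y).
Proof.
rewrite /W; elim: m y => [|m IH] y /=; first by rewrite /wedge; clear; lia.
rewrite /Ustep !IH /= /reflect_e /hor /= !opprD opprK [in RHS]minC.
by [].
Qed.

End Dynamics.

(** * Variance of the excess cost *)

Section KernelVariance.
Variable (R : realType).
Implicit Types (w : config) (e : edge) (p : R) (x y z : int) (n m : nat).

Definition Ur x0 n (G : int -> int) y w : R := (Uiter w x0 n G y)%:~R.
Definition Rr x0 n y w : R := (row_closed w x0 n y)%:R.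

Lemma Ur_local x0 n G y : local (Ur x0 n G y).
Proof. exact/(local1 (fun k : int => k%:~R : R))/Uiter_local. Qed.

Lemma closed_local e : local (fun w => (~~ w e)%:R : R).
Proof. exact/(local1 (fun b : bool => (~~ b)%:R : R))/local_edge. Qed.

Lemma RrE x0 n y w : Rr x0 n y w = \sum_(i <- iota 0 n) (~~ w (hor (x0 + i%:Z) y))%:R.
Proof. by rewrite /Rr /row_closed natr_sum. Qed.

Lemma Rr_local x0 n y : local (Rr x0 n y).
Proof.
apply: local_ext (_ : local (fun w => \sum_(i <- iota 0 n) (~~ w (hor (x0 + i%:Z) y))%:R : R)) => [w|].
  by rewrite RrE.
by apply: local_sum => i _ _; apply: closed_local.
Qed.

Lemma E_closed p e : E_ p (fun w => (~~ w e)%:R) = 1 - p.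
Proof.
transitivity (E_ p (fun w => 1 - (w e)%:R)); first by apply: E_eq => w; case: (w e); rewrite ?subrr ?subr0.
rewrite E_B ?E_cst ?E_edge//; first exact: local_cst.
exact/(local1 (fun b : bool => b%:R : R))/local_edge.
Qed.

Lemma E_row p x0 n y : E_ p (Rr x0 n y) = n%:R * (1 - p).
Proof.
transitivity (E_ p (fun w => \sum_(i <- iota 0 n) (~~ w (hor (x0 + i%:Z) y))%:R)).
  by apply: E_eq => w; rewrite RrE.
rewrite (@E_sum _ _ _ _ xpredT) => [|i _ _]; last exact: closed_local.
under eq_bigr do rewrite E_closed.
by rewrite big_const_seq count_predT size_iota iter_addr addr0 -[LHS]mulr_natl.
Qed.

Lemma efron_stein p (S : seq edge) (f : config -> R) : 0 <= p <= 1 -> uniq S -> depon (mem S) f ->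
  E_ p (fun w => f w ^+ 2) - E_ p f ^+ 2 <=
  \sum_(e <- S) p * (1 - p) * E_ p (fun w => infl e f w ^+ 2).
Proof.
move=> p01 uS df.
have d2 : depon (mem S) (fun w => f w ^+ 2) by move=> w w' h; rewrite (df _ _ h).
rewrite (E_E _ (fun=> false) df) (E_E _ (fun=> false) d2).
apply: le_trans (Ex_efron_stein f (fun=> false) p01 uS) _.
apply: ler_sum => e _; rewrite (@E_E _ _ _ S _ (fun=> false))// => w w' h.
by rewrite /infl (@depon_upd _ _ e true _ df _ _ h) (@depon_upd _ _ e false _ df _ _ h).
Qed.

Lemma E_upd_true p e (t : config -> R) : local t ->
  p * E_ p (fun v => t (upd v e true)) = E_ p (fun w => t w * (w e)%:R).
Proof.
move=> lt; have l1 : local (fun w => t w * (w e)%:R : R).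
  by apply: (local2 (fun a b : R => a * b)) => //; exact/(local1 (fun b : bool => b%:R : R))/local_edge.
rewrite (E_upd p e l1) (_ : E_ p (fun v => t (upd v e false) * _) = 0) ?mulr0 ?addr0.
  by congr (_ * _); apply: E_eq => v; rewrite upd_same mulr1.
by rewrite -[RHS](E_cst edge p); apply: E_eq => v; rewrite upd_same mulr0.
Qed.

Lemma E_upd_false p e (t : config -> R) : local t ->
  (1 - p) * E_ p (fun v => t (upd v e false)) = E_ p (fun w => t w * (~~ w e)%:R).
Proof.
move=> lt; have l1 : local (fun w => t w * (~~ w e)%:R : R).
  by apply: (local2 (fun a b : R => a * b)) => //; exact: closed_local.
rewrite (E_upd p e l1) (_ : E_ p (fun v => t (upd v e true) * _) = 0) ?mulr0 ?add0r.
  by congr (_ * _); apply: E_eq => v; rewrite upd_same mulr1.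
by rewrite -[RHS](E_cst edge p); apply: E_eq => v; rewrite upd_same mulr0.
Qed.

Definition traced x0 n G y e w : R := (e \in trace w x0 n G y)%:R.

Lemma traced_dep x0 n G y e : depon (mem (ebox (x0, y) n)) (traced x0 n G y e).
Proof. by move=> w w' h; rewrite /traced (@trace_dep x0 n G y w w')// => f hf; apply: h; rewrite /= mem_ebox. Qed.

Lemma traced_local x0 n G y e : local (traced x0 n G y e).
Proof. by exists (ebox (x0, y) n); apply: traced_dep. Qed.

Lemma trace_uniq w x0 n G y : uniq (trace w x0 n G y).
Proof.
elim: n y => //= n IH y; rewrite IH andbT; apply/negP => h.
have H m z e : e \in trace w x0 m G z -> e.1.1 < x0 + m%:Z.
  elim: m z => //= m IHm z; rewrite inE => /orP[/eqP->/=|/IHm]; clear; lia.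
by have := H _ _ _ h; rewrite /= ltxx.
Qed.

Lemma infl_Ur x0 n G y e w : lip1 G -> infl e (Ur x0 n G y) w ^+ 2 <=
  4 * (traced x0 n G y e (upd w e true) + traced x0 n G y e (upd w e false)).
Proof.
move=> hG; rewrite /infl /Ur /traced.
have a1 := Uiter_infl x0 n y hG (@agree_upd e w false true).
have a2 := Uiter_infl x0 n y hG (@agree_upd e w true false).
have b1 := @Uiter_infl0 _ _ e x0 n G y (@agree_upd e w false true).
have b2 := @Uiter_infl0 _ _ e x0 n G y (@agree_upd e w true false).
move: a1 a2 b1 b2; move: (Uiter _ _ _ _ _) (Uiter _ _ _ _ _) => a b.
have sq : a <= b + 2 -> b <= a + 2 -> (b%:~R - a%:~R : R) ^+ 2 <= 4.
  rewrite -2!(ler_int R) !intrD; move: (a%:~R : R) (b%:~R : R) => r s h1 h2.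
  rewrite -subr_ge0 (_ : 4 - (s - r) ^+ 2 = (2 - (s - r)) * (2 + (s - r))); last by ring.
  by apply: mulr_ge0; move: h1 h2; clear; lra.
move=> a1 a2 b1 b2; have {}sq := sq a2 a1; move: b1 b2; case: (e \in _); case: (e \in _) => b1 b2; rewrite /=.
- by apply: le_trans sq _; lra.
- by apply: le_trans sq _; lra.
- by apply: le_trans sq _; lra.
have -> : a = b by apply/eqP; rewrite eq_le b1// b2.
by rewrite subrr expr0n /= addr0 mulr0.
Qed.

Lemma Ur_mean p x0 n G y : 0 <= p <= 1 -> lip1 G ->
  E_ p (Ur x0 n G y) <= (G y)%:~R + 2 * (n%:R * (1 - p)).
Proof.
move=> p01 hG; rewrite -(E_row p x0 n y).
have l2 : local (fun w => 2 * Rr x0 n y w) by exact/(local1 (fun r : R => 2 * r))/Rr_local.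
rewrite -E_Z; last exact: Rr_local.
rewrite -[X in X + _](E_cst edge p) -E_D//; last exact: local_cst.
apply: E_le => //; [exact: Ur_local|exact: (local1 (fun r : R => _ + r))|move=> w].
by rewrite /Ur /Rr -[2 * _]/(2%:~R * (Posz (row_closed w x0 n y))%:~R) -intrM -intrD ler_int Uiter_row.
Qed.

Lemma sum_mem_le (S t : seq edge) (c : edge -> R) : uniq S -> uniq t -> (forall e, 0 <= c e) ->
  \sum_(e <- S) (e \in t)%:R * c e <= \sum_(e <- t) c e.
Proof.
move=> uS ut c0; rewrite (eq_bigr (fun e => if e \in t then c e else 0)) => [|e _]; last first.
  by case: (e \in t); rewrite ?mul1r ?mul0r.
rewrite -big_mkcond -big_filter; apply: ler_sum_subset => //; first exact: filter_uniq.
by move=> e; rewrite mem_filter => /andP[].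
Qed.

(** An influence is at most 2 and vanishes off the trace. Under the factor [p * (1 - p)], an open
    edge of the trace counts for [1 - p] and a closed one for at most 1; there are at most [n] open
    ones, and the closed ones are at most the value of [Ur] in number. The variance is thus of order
    [n * (1 - p)], up to the initial height, and not of order [n]. *)
Lemma Ur_variance p x0 n G y : 0 <= p <= 1 -> lip1 G -> (forall z, 0 <= G z) ->
  E_ p (fun w => Ur x0 n G y w ^+ 2) - E_ p (Ur x0 n G y) ^+ 2 <=
  4 * (3 * (n%:R * (1 - p)) + (G y)%:~R).
Proof.
move=> p01 hG G0; set S := ebox (x0, y) n.
have dU : depon (mem S) (Ur x0 n G y).
  by move=> w w' h; rewrite /Ur (@Uiter_dep x0 n G y w w')// => f hf; apply: h; rewrite /= mem_ebox.
apply: le_trans (efron_stein p01 (ebox_uniq _ _) dU) _.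
set t := traced x0 n G y.
have lt e : local (t e) by exact: traced_local.
have lo e : local (fun w => (1 - p) * (t e w * (w e)%:R)).
  apply: (local1 (fun r : R => (1 - p) * r)); apply: (local2 (fun a b : R => a * b)) => //.
  exact/(local1 (fun b : bool => b%:R : R))/local_edge.
have lc e : local (fun w => p * (t e w * (~~ w e)%:R)).
  apply: (local1 (fun r : R => p * r)); apply: (local2 (fun a b : R => a * b)) => //; exact: closed_local.
have step e : p * (1 - p) * E_ p (fun w => infl e (Ur x0 n G y) w ^+ 2) <=
    4 * E_ p (fun w => (1 - p) * (t e w * (w e)%:R) + p * (t e w * (~~ w e)%:R)).
  rewrite E_D// !E_Z; last first.
  - by apply: (local2 (fun a b : R => a * b)) => //; exact: closed_local.
  - by apply: (local2 (fun a b : R => a * b)) => //; exact/(local1 (fun b : bool => b%:R : R))/local_edge.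
  rewrite -E_upd_true// -E_upd_false//.
  have -> : 4 * ((1 - p) * (p * E_ p (fun v => t e (upd v e true))) + p * ((1 - p) * E_ p (fun v => t e (upd v e false)))) =
     p * (1 - p) * (4 * (E_ p (fun v => t e (upd v e true)) + E_ p (fun v => t e (upd v e false)))) by ring.
  apply: ler_wpM2l; first by case/andP: p01 => q0 q1; rewrite mulr_ge0// subr_ge0.
  have lu b : local (fun v => t e (upd v e b)) by apply: local_upd.
  rewrite -E_D// -E_Z; last exact: (local2 (fun a b : R => a + b)).
  apply: E_le => //; last by move=> w; apply: infl_Ur.
    by apply: (local1 (fun r : R => r ^+ 2)); apply: local_infl; exact: Ur_local.
  by apply: (local1 (fun r : R => 4 * r)); apply: (local2 (fun a b : R => a + b)).
apply: le_trans (ler_sum _ (fun e _ => step e)) _.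
have lsum e : local (fun w => (1 - p) * (t e w * (w e)%:R) + p * (t e w * (~~ w e)%:R)).
  exact: (local2 (fun a b : R => a + b)).
rewrite -mulr_sumr -(@E_sum _ _ _ _ xpredT); last by [].
rewrite ler_pM2l//.
apply: (@le_trans _ _ (E_ p (fun w => n%:R * (1 - p) + Ur x0 n G y w))).
  apply: E_le => //; first by apply: local_sum => e _ _.
    by apply: (local1 (fun r : R => _ + r)); exact: Ur_local.
  move=> w; rewrite big_split /=; apply: lerD.
    rewrite -mulr_sumr mulrC ler_wpM2r//; first by case/andP: p01 => *; rewrite subr_ge0.
    have c0 e : 0 <= (w e)%:R :> R by [].
    apply: le_trans (sum_mem_le (ebox_uniq _ _) (trace_uniq w x0 n G y) c0) _.
    rewrite -natr_sum ler_nat -[X in (_ <= X)%N](size_trace w x0 n G y) -sum1_size.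
    by apply: leq_sum => e _; case: (w e).
  rewrite -mulr_sumr; apply: (@le_trans _ _ (\sum_(e <- S) t e w * (~~ w e)%:R)).
    rewrite -[X in _ <= X]mul1r ler_wpM2r//; last by case/andP: p01.
    by apply: sumr_ge0 => e _; rewrite /t /traced mulr_ge0.
  have c0 e : 0 <= (~~ w e)%:R :> R by [].
  apply: le_trans (sum_mem_le (ebox_uniq _ _) (trace_uniq w x0 n G y) c0) _.
  rewrite -natr_sum (_ : (\sum_(e <- _) _)%N = nclosed w (trace w x0 n G y)); last first.
    by rewrite /nclosed -sum1_count [RHS]big_mkcond; apply: eq_bigr => e _; case: (w e).
  by rewrite /Ur trace_val intrD lerDr ler0z.
rewrite E_D; [|exact: local_cst|exact: Ur_local]; rewrite E_cst.
by have := Ur_mean x0 n y p01 hG; lra.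
Qed.

End KernelVariance.

(** * From monotone paths to the metric in a corridor *)

Section Corridor.
Implicit Types (w : config) (e f : edge) (x y : int) (n m l r : nat).

Definition ver x y : edge := ((x, y), true).

Definition kappa l w f : nat := if w f then 0%N else tau l w f.

Lemma tau_kappa l w f : (tau l w f <= 1 + kappa l w f)%N.
Proof. by rewrite /kappa /tau; case: (w f); rewrite ?addn0 ?leq_addl. Qed.

Definition around x y : seq edge := [:: hor x (y + 1); hor x (y - 1); ver (x + 1) y; ver (x + 1) (y - 1); ver x y].

(* Bounds the extra cost when the detour around a closed horizontal edge meets other closed edges. *)
Definition jam l w x y : nat := if w (hor x y) then 0%N else (\sum_(f <- around x y) kappa l w f)%N.

Definition jam_col l w r (i : nat) : nat := (\sum_(j <- iota 0 (2 * r).+1) jam l w i%:Z (j%:Z - r%:Z)%R)%N.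

Definition jam_base l w r : nat :=
  (\sum_(j <- iota 0 r) (kappa l w (ver 0%R j%:Z) + kappa l w (ver 0%R (- j.+1%:Z)%R)))%N.

Definition jam_box l w r n : nat := (jam_base l w r + \sum_(i <- iota 0 n) jam_col l w r i)%N.

Lemma sum_iotaS (F : nat -> nat) n : (\sum_(j <- iota 0 n.+1) F j = \sum_(j <- iota 0 n) F j + F n)%N.
Proof. by rewrite -addn1 iotaD big_cat /= big_seq1. Qed.

Lemma le_sum_mem (T : eqType) (s : seq T) (F : T -> nat) j : j \in s -> (F j <= \sum_(i <- s) F i)%N.
Proof. by move=> h; rewrite (big_rem j)//= leq_addr. Qed.

Lemma jam_le l w r (i : nat) y : `|y| <= r%:Z -> (jam l w i%:Z y <= jam_col l w r i)%N.
Proof.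
move=> h; have := @le_sum_mem _ (iota 0 (2 * r).+1) (fun j => jam l w i%:Z (j%:Z - r%:Z)) (absz (y + r%:Z)).
rewrite (_ : (absz (y + r%:Z))%:Z - r%:Z = y); last by move: h; clear; lia.
by apply; rewrite mem_iota; move: h; clear; lia.
Qed.

Lemma jam_boxS l w r n : jam_box l w r n.+1 = (jam_box l w r n + jam_col l w r n)%N.
Proof. by rewrite /jam_box sum_iotaS addnA. Qed.

Lemma fpp_step T u v : nb u v -> (fpp T u v <= T (eo u v))%N.
Proof.
move=> n; have := @fpp_le T u v [:: v]; rewrite /= addn0; apply; split => //=.
by rewrite n.
Qed.

Lemma X_step l w u v : nb u v -> (X l w origin v <= X l w origin u + 1 + kappa l w (eo u v))%N.
Proof.
move=> n; apply: leq_trans (fpp_triangle _ _ u _) _; rewrite -addnA leq_add2l.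
exact: leq_trans (fpp_step _ n) (tau_kappa _ _ _).
Qed.

Lemma X_right l w x y : (X l w origin (x + 1, y)%R <= X l w origin (x, y) + 1 + kappa l w (hor x y))%N.
Proof. by rewrite /hor -eo_hor; apply: X_step; rewrite /nb /ostep /= eqxx. Qed.

Lemma nb_up x y : nb (x, y) (x, y + 1).
Proof. by rewrite /nb /ostep /= eqxx !orbT. Qed.

Lemma X_up1 l w x y : (X l w origin (x, y + 1)%R <= X l w origin (x, y) + 1 + kappa l w (ver x y))%N.
Proof. by rewrite /ver -eo_ver; apply: X_step; apply: nb_up. Qed.

Lemma X_down1 l w x y : (X l w origin (x, y) <= X l w origin (x, y + 1)%R + 1 + kappa l w (ver x y))%N.
Proof. have h : nb (x, y + 1) (x, y) by rewrite nbC nb_up.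
by have := X_step l w h; rewrite eoC// eo_ver. Qed.

Lemma X_base l w r y : `|y| <= r%:Z -> (X l w origin (0%R, y) <= `|y| + jam_base l w r)%N.
Proof.
have X0 : X l w origin (0%R, 0%R) = 0%N.
  by apply/eqP; rewrite -leqn0; exact: (@fpp_le (tau l w) origin origin [::]).
have up n : (X l w origin (0%R, n%:Z) <= n + \sum_(j <- iota 0 n) kappa l w (ver 0%R j%:Z))%N.
  elim: n => [|n IH]; first by rewrite X0.
  have := X_up1 l w 0 n%:Z; rewrite (_ : n%:Z + 1 = n.+1%:Z); last by clear; lia.
  by rewrite sum_iotaS /=; move: IH; move: (bigop _ _ _) (X _ _ _ _) (X _ _ _ _) => a b c; clear; lia.
have down n : (X l w origin (0%R, (- n%:Z)%R) <= n + \sum_(j <- iota 0 n) kappa l w (ver 0%R (- j.+1%:Z)%R))%N.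
  elim: n => [|n IH]; first by rewrite oppr0 X0.
  have := X_down1 l w 0 (- n.+1%:Z); rewrite (_ : - n.+1%:Z + 1 = - n%:Z); last by clear; lia.
  by rewrite sum_iotaS /=; move: IH; move: (bigop _ _ _) (X _ _ _ _) (X _ _ _ _) => a b c; clear; lia.
move=> h; have hr : (`|y|%N <= r)%N by move: h; clear; lia.
have sub (F : nat -> nat) : (\sum_(j <- iota 0 `|y|%N) F j <= \sum_(j <- iota 0 r) F j)%N.
  by rewrite -(subnKC hr) iotaD big_cat /= leq_addr.
rewrite /jam_base big_split /=; have [y0|y0] := leP 0 y.
  have := up `|y|%N; rewrite (_ : `|y|%N%:Z = y); last by move: y0; clear; lia.
  have := sub (fun j => kappa l w (ver 0 j%:Z)).
  move: (bigop _ _ _) (bigop _ _ _) (bigop _ _ _) (X _ _ _ _) => a b c e; clear; lia.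
have := down `|y|%N; rewrite (_ : - `|y|%N%:Z = y); last by move: y0; clear; lia.
have := sub (fun j => kappa l w (ver 0 (- j.+1%:Z))).
move: (bigop _ _ _) (bigop _ _ _) (bigop _ _ _) (X _ _ _ _) => a b c e; clear; lia.
Qed.

(** The condition keeps the optimal path in the corridor: each change of row, followed backwards,
    lowers [W] by 1 and raises [|y|] by at most 1. *)
Lemma X_corridor l w r n y : `|y| + W w 0 n 0 y <= r%:Z ->
  (X l w origin (n%:Z, y))%:Z <= n%:Z + W w 0 n 0 y + (jam_box l w r n)%:Z.
Proof.
rewrite /W; elim: n y => [|n IH] y.
  rewrite /= /wedge subr0 -[0%:Z]/(0 : int) => h; have := @X_base l w r y; rewrite /jam_box big_nil addn0.
  have -> : `|y| <= r%:Z by move: h; clear; lia.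
  move=> /(_ isT); move: (X _ _ _ _) (jam_base _ _ _) => a b; clear; lia.
have nn : n.+1%:Z = n%:Z + 1 by clear; lia.
have G0 z : 0 <= Uiter w 0 n (wedge 0) z by apply: Uiter_nneg => a; rewrite /wedge.
rewrite /= {1 2}/Ustep add0r jam_boxS nn.
have hr := X_right l w n%:Z y; rewrite /kappa in hr.
case: ifP hr => hw hr h.
  have := IH y h; move: hr; move: (X _ _ _ _) (X _ _ _ _) (Uiter _ _ _ _ _) (jam_box _ _ _ _) (jam_col _ _ _ _) => a b c e f; clear; lia.
pose y' := move_to (Uiter w 0 n (wedge 0)) y.
have e1 : Num.min (Uiter w 0 n (wedge 0) (y - 1)) (Uiter w 0 n (wedge 0) (y + 1)) = Uiter w 0 n (wedge 0) y'.
  by rewrite /y' /move_to; case: ifP => hh; move: hh; clear; lia.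
rewrite e1 in h *.
have d : `|y'| <= `|y| + 1 by rewrite /y' /move_to; case: ifP => _; clear; lia.
have {}IH := IH y'.
have hy : `|y| <= r%:Z by have := G0 y'; move: h; clear; lia.
have J := jam_le l w n hy; rewrite /jam hw /around !big_cons big_nil addn0 in J.
have s1 := X_right l w n%:Z y'.
have [yy|yy] : y' = y - 1 \/ y' = y + 1 by rewrite /y' /move_to; case: ifP => _; [left|right].
  have s2 := X_up1 l w (n%:Z + 1) y'; rewrite yy subrK in s2; rewrite yy in s1 IH h d *.
  move: IH s1 s2 J h d; move: (jam_col _ _ _ _) (jam_box _ _ _ _) (kappa _ _ _) (kappa _ _ _) (kappa _ _ _) (kappa _ _ _) (kappa _ _ _) (X _ _ _ _) (X _ _ _ _) (X _ _ _ _) (Uiter _ _ _ _ _); clear; lia.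
have s2 := X_down1 l w (n%:Z + 1) y; rewrite yy in s1 IH h d *.
move: IH s1 s2 J h d; move: (jam_col _ _ _ _) (jam_box _ _ _ _) (kappa _ _ _) (kappa _ _ _) (kappa _ _ _) (kappa _ _ _) (kappa _ _ _) (X _ _ _ _) (X _ _ _ _) (X _ _ _ _) (Uiter _ _ _ _ _); clear; lia.
Qed.

(** A cruder bound along row 0, for the rare configurations in which the optimal path might leave
    the corridor. *)
Lemma X_row l w r n :
  (X l w origin (axis n) <= n + 2 * row_closed w 0 n 0 + jam_box l w r n)%N.
Proof.
elim: n => [|n IH].
  by rewrite (_ : X _ _ _ _ = 0%N)//; apply/eqP; rewrite -leqn0; exact: (@fpp_le (tau l w) origin origin [::]).
have nn : n.+1%:Z = n%:Z + 1 by clear; lia.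
have ax k : axis k = (k%:Z, 0) by [].
rewrite jam_boxS row_closedS ax nn add0r; rewrite ax in IH.
have hr := X_right l w n%:Z 0; rewrite /kappa in hr.
case: ifP hr => hw hr; rewrite ?hw /=; first by move: IH hr; move: (X _ _ _ _) (X _ _ _ _) (row_closed _ _ _ _) (jam_box _ _ _ _) (jam_col _ _ _ _) => a b c e f; clear; lia.
have hy : `|0 : int| <= r%:Z by clear; lia.
have J := jam_le l w n hy; rewrite /jam hw /around !big_cons big_nil addn0 in J.
have s1 := X_up1 l w n%:Z 0; have s2 := X_right l w n%:Z (0 + 1); have s3 := X_down1 l w (n%:Z + 1) 0.
move: IH s1 s2 s3 J; move: (X _ _ _ _) (X _ _ _ _) (X _ _ _ _) (X _ _ _ _) (row_closed _ _ _ _) (jam_box _ _ _ _) (jam_col _ _ _ _).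
move: (kappa _ _ _) (kappa _ _ _) (kappa _ _ _) (kappa _ _ _) (kappa _ _ _); clear; lia.
Qed.

End Corridor.

Section CorridorMean.
Variable (R : realType).
Implicit Types (w : config) (e f : edge) (p : R) (x y z : int) (n m l r : nat).

Lemma W_mean_shift p x0 m z y : E_ p (Ur R x0 m (wedge z) y) = E_ p (Ur R 0 m (wedge (z - y)) 0).
Proof.
rewrite -(E_shift p (x0, y) (Ur_local R 0 m (wedge (z - y)) 0)); apply: E_eq => w.
by rewrite /Ur -/(W _ _ _ _ _) -/(W _ _ _ _ _) W_translate /= !add0r subrK.
Qed.

Lemma W_mean_opp p m z : E_ p (Ur R 0 m (wedge (- z)) 0) = E_ p (Ur R 0 m (wedge z) 0).
Proof.
rewrite -(E_map p reflect_e_inj (Ur_local R 0 m (wedge z) 0)); apply: E_eq => w.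
by rewrite /Ur -/(W _ _ _ _ _) -/(W _ _ _ _ _) W_reflect oppr0.
Qed.

(** A passage to height [z] is followed by one back; by translation and reflection both have the
    same mean. *)
Lemma W_mean_double p m z : 0 <= p <= 1 ->
  E_ p (Ur R 0 (m + m) (wedge 0) 0) <= 2 * E_ p (Ur R 0 m (wedge z) 0).
Proof.
move=> p01; have -> : 2 * E_ p (Ur R 0 m (wedge z) 0) = E_ p (Ur R 0 m (wedge 0) z) + E_ p (Ur R m%:Z m (wedge z) 0).
  by rewrite (W_mean_shift p 0 m 0 z) (W_mean_shift p m%:Z m z 0) sub0r subr0 W_mean_opp; lra.
rewrite -E_D; [|exact: Ur_local..]; apply: E_le => //; first exact: Ur_local.
  by apply: (local2 +%R); apply: Ur_local.
move=> w; rewrite /Ur -intrD ler_int; have := W_sub w 0 m m 0 z 0; by rewrite /W add0r.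
Qed.

Lemma row_variance p n y : 0 <= p <= 1 ->
  E_ p (fun w => Rr R 0 n y w ^+ 2) - E_ p (Rr R 0 n y) ^+ 2 <= n%:R * (1 - p).
Proof.
move=> p01; pose S := [seq hor (0 + i%:Z) y | i <- iota 0 n].
have uS : uniq S by rewrite map_inj_uniq ?iota_uniq// => i j [].
have RE w : Rr R 0 n y w = \sum_(e <- S) (~~ w e)%:R by rewrite RrE big_map.
have dR : depon (mem S) (Rr R 0 n y).
  by move=> w w' h; rewrite !RE big_seq [RHS]big_seq; apply: eq_bigr => e eS; rewrite h.
apply: le_trans (efron_stein p01 uS dR) _.
have li e : local (fun w => infl e (Rr R 0 n y) w ^+ 2).
  by apply: (local1 (fun a : R => a ^+ 2)); apply: local_infl; exact: Rr_local.
apply: (@le_trans _ _ (\sum_(e <- S) (1 - p))); last first.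
  by rewrite big_const_seq count_predT size_map size_iota iter_addr addr0 -[X in X <= _]mulr_natl.
rewrite big_seq [X in _ <= X]big_seq; apply: ler_sum => e eS.
have -> : E_ p (fun w => infl e (Rr R 0 n y) w ^+ 2) = 1.
  rewrite -[RHS](E_cst edge p); apply: E_eq => w; rewrite /infl !RE !(big_rem e eS) /= !upd_same /=.
  suff -> : \sum_(f <- rem e S) (~~ upd w e true f)%:R = \sum_(f <- rem e S) (~~ upd w e false f)%:R :> R.
    by ring.
  rewrite big_seq [RHS]big_seq; apply: eq_bigr => f; rewrite (rem_filter _ uS) mem_filter => /andP[fe _].
  by rewrite !upd_other.
rewrite mulr1 -[X in _ <= X]mul1r ler_wpM2r//; by case/andP: p01 => *; rewrite ?subr_ge0.
Qed.

Lemma E_sqr_dist p (f : config -> R) (v : R) : local f ->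
  E_ p (fun w => f w ^+ 2) - E_ p f ^+ 2 <= v -> E_ p (fun w => (f w - E_ p f) ^+ 2) <= v.
Proof.
move=> lf; set m := E_ p f => h.
have l2 : local (fun w => f w ^+ 2) by apply: (local1 (fun x : R => x ^+ 2)).
have l3 : local (fun w => - (2 * m) * f w) by apply: (local1 (fun x : R => - (2 * m) * x)).
have -> : E_ p (fun w => (f w - m) ^+ 2) = E_ p (fun w => f w ^+ 2 + (- (2 * m) * f w + m ^+ 2)).
  by apply: E_eq => w; ring.
rewrite E_D//; last exact: (local1 (fun x : R => x + m ^+ 2)).
rewrite E_D//; last exact: local_cst.
by rewrite E_Z// E_cst -/m; move: h; lra.
Qed.

(** Trades an unbounded passage time for a constant [S] and a fourth moment. With
    [S = (1 - p) ^ (- 1/2)] both terms of [jam_mean] have order [(1 - p) ^ (3/2)], negligible with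
    respect to [1 - p]. *)
Lemma young4 (x S : R) : 0 <= x -> 0 < S -> x <= S + x ^+ 4 / S ^+ 3.
Proof.
move=> x0 S0; have [h|h] := leP x S; first by rewrite ler_wpDr// divr_ge0// ?exprn_ge0// ltW.
rewrite ler_wpDl// ?(ltW S0)// ler_pdivlMr ?exprn_gt0// [x ^+ 4]exprS ler_wpM2l//.
by rewrite lerXn2r ?nnegrE ?(ltW S0)// ltW.
Qed.

Lemma kappa_local l f : local (fun w => kappa l w f).
Proof.
apply: (local2 (fun (b : bool) (k : nat) => if b then 0%N else k)); [exact: local_edge|exact: tau_local].
Qed.

Lemma kapr_local l f : local (fun w => (kappa l w f)%:R : R).
Proof. exact/(local1 (fun k : nat => k%:R : R))/kappa_local. Qed.

Lemma kappa_young l f w (S : R) : 0 < S ->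
  (kappa l w f)%:R <= S * (~~ w f)%:R + (S ^+ 3)^-1 * taur R l f 4 w.
Proof.
move=> S0; rewrite /kappa; case: (w f) => /=.
  by rewrite mulr0 add0r mulr_ge0 ?taur_ge0// invr_ge0 exprn_ge0// ltW.
by rewrite mulr1 /taur mulrC; apply: young4.
Qed.

Lemma jam_local l x y : local (fun w => jam l w x y).
Proof.
apply: (local2 (fun (b : bool) (k : nat) => if b then 0%N else k)); first exact: local_edge.
have [s hs] := local_seq (fun f (_ : f \in around x y) => kappa_local l f).
by exists s => w w' h; rewrite big_seq [RHS]big_seq; apply: eq_bigr => f fa; apply: hs.
Qed.

Lemma local_nsum (I : eqType) (s : seq I) (F : I -> config -> nat) :
  (forall i, local (F i)) -> local (fun w => \sum_(i <- s) F i w)%N.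
Proof.
move=> h; have [t ht] := local_seq (fun i (_ : i \in s) => h i).
by exists t => w w' hw; rewrite big_seq [RHS]big_seq; apply: eq_bigr => f fa; apply: ht.
Qed.

Lemma E_closed2 p (e f : edge) : e != f -> E_ p (fun w => (~~ w e)%:R * (~~ w f)%:R) = (1 - p) ^+ 2.
Proof.
move=> ef; rewrite (@E_indep _ _ (pred1 e) (pred1 f)) ?E_closed//; try exact: closed_local.
- by move=> w w' h; rewrite h /=.
- by move=> w w' h; rewrite h /=.
- by move=> g /= /eqP -> /eqP ee; rewrite ee eqxx in ef.
Qed.

Section JamBound.
Variables (p S C : R) (l : nat).
Hypotheses (p01 : 0 <= p <= 1) (S0 : 0 < S) (hC : forall e, E_ p (taur R l e 4) <= C).

Lemma kappa_mean f : E_ p (fun w => (kappa l w f)%:R) <= S * (1 - p) + (S ^+ 3)^-1 * C.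
Proof.
have lc := closed_local R f; have lt := taur_local R l f 4.
apply: (@le_trans _ _ (E_ p (fun w => S * (~~ w f)%:R + (S ^+ 3)^-1 * taur R l f 4 w))).
  apply: E_le => //; [exact: kapr_local| |by move=> w; apply: kappa_young].
  by apply: (local2 +%R); [exact: (local1 (fun r : R => S * r))|exact: (local1 (fun r : R => _ * r))].
rewrite E_D; [|exact: (local1 (fun r : R => S * r))|exact: (local1 (fun r : R => _ * r))].
by rewrite !E_Z// E_closed lerD2l ler_wpM2l// invr_ge0 exprn_ge0// ltW.
Qed.

Lemma around_neq x y : hor x y \notin around x y.
Proof.
rewrite /around !inE /hor /ver !xpair_eqE eqxx /= !andbF !orbF andbT negb_or.
by apply/andP; split; apply/eqP; clear; lia.
Qed.

Lemma jam_mean x y : E_ p (fun w => (jam l w x y)%:R) <= 5 * (S * (1 - p) ^+ 2 + (S ^+ 3)^-1 * C).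
Proof.
pose g f w : R := S * ((~~ w (hor x y))%:R * (~~ w f)%:R) + (S ^+ 3)^-1 * taur R l f 4 w.
have l1 f : local (fun w => (~~ w (hor x y))%:R * (~~ w f)%:R : R).
  by apply: (local2 (fun a b : R => a * b)); exact: closed_local.
have l2 f : local (fun w => S * ((~~ w (hor x y))%:R * (~~ w f)%:R) : R) by exact: (local1 (fun r : R => S * r)).
have l3 f : local (fun w => (S ^+ 3)^-1 * taur R l f 4 w) by exact/(local1 (fun r : R => _ * r))/taur_local.
have lg f : local (g f) by exact: (local2 +%R).
have ljr : local (fun w => (jam l w x y)%:R : R) by exact/(local1 (fun k : nat => k%:R : R))/jam_local.
apply: (@le_trans _ _ (E_ p (fun w => \sum_(f <- around x y) g f w))).
  apply: E_le => // [|w]; first by apply: local_sum => f _ _.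
  rewrite /jam /g; case: (w (hor x y)) => /=.
    by apply: sumr_ge0 => f _; rewrite mul0r mulr0 add0r mulr_ge0 ?taur_ge0// invr_ge0 exprn_ge0// ltW.
  by rewrite natr_sum; apply: ler_sum => f _; rewrite mul1r; apply: kappa_young.
rewrite (@E_sum _ _ _ _ xpredT) => [|f _ _]; last exact: lg.
apply: (@le_trans _ _ (\sum_(f <- around x y) (S * (1 - p) ^+ 2 + (S ^+ 3)^-1 * C))).
  rewrite big_seq [X in _ <= X]big_seq; apply: ler_sum => f fa.
  rewrite /g E_D// !E_Z//; last exact: taur_local.
  rewrite E_closed2; last by apply: contraTneq fa => <-; apply: around_neq.
  by rewrite lerD2l ler_wpM2l// invr_ge0 exprn_ge0// ltW.
by rewrite big_const_seq iter_addr addr0 /= -[X in X <= _]mulr_natl.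
Qed.

Lemma jam_box_mean r n : E_ p (fun w => (jam_box l w r n)%:R) <=
  r%:R * (2 * (S * (1 - p) + (S ^+ 3)^-1 * C)) + n%:R * ((2 * r).+1%:R * (5 * (S * (1 - p) ^+ 2 + (S ^+ 3)^-1 * C))).
Proof.
have lk f := kapr_local l f.
have ljr x y : local (fun w => (jam l w x y)%:R : R) by exact/(local1 (fun k : nat => k%:R : R))/jam_local.
pose b j w : R := (kappa l w (ver 0 j%:Z))%:R + (kappa l w (ver 0 (- j.+1%:Z)))%:R.
pose c (i : nat) w : R := \sum_(j <- iota 0 (2 * r).+1) (jam l w i%:Z (j%:Z - r%:Z))%:R.
have lb j : local (b j) by apply: (local2 +%R).
have lc i : local (c i) by apply: local_sum => j _ _.
have -> : E_ p (fun w => (jam_box l w r n)%:R) = E_ p (fun w => \sum_(j <- iota 0 r) b j w + \sum_(i <- iota 0 n) c i w).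
  apply: E_eq => w; rewrite /jam_box /jam_base /jam_col natrD !natr_sum; congr (_ + _).
    by apply: eq_bigr => j _; rewrite natrD.
  by apply: eq_bigr => i _; rewrite natr_sum.
rewrite E_D; [|by apply: local_sum => j _ _|by apply: local_sum => i _ _].
rewrite !(@E_sum _ _ _ _ xpredT) => [|i _ _|j _ _]; [|exact: lc|exact: lb].
apply: lerD.
  apply: (@le_trans _ _ (\sum_(j <- iota 0 r) (2 * (S * (1 - p) + (S ^+ 3)^-1 * C)))).
    apply: ler_sum => j _; rewrite E_D//; have := kappa_mean (ver 0 j%:Z); have := kappa_mean (ver 0 (- j.+1%:Z)).
    by lra.
  by rewrite big_const_seq iter_addr addr0 count_predT size_iota -[X in X <= _]mulr_natl.
apply: (@le_trans _ _ (\sum_(i <- iota 0 n) ((2 * r).+1%:R * (5 * (S * (1 - p) ^+ 2 + (S ^+ 3)^-1 * C))))).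
  apply: ler_sum => i _; rewrite (@E_sum _ _ _ _ xpredT) => [|j _ _]; last exact: ljr.
  apply: (@le_trans _ _ (\sum_(j <- iota 0 (2 * r).+1) (5 * (S * (1 - p) ^+ 2 + (S ^+ 3)^-1 * C)))).
    by apply: ler_sum => j _; apply: jam_mean.
  by rewrite big_const_seq iter_addr addr0 count_predT size_iota -[X in X <= _]mulr_natl.
by rewrite big_const_seq iter_addr addr0 count_predT size_iota -[X in X <= _]mulr_natl.
Qed.

Lemma corridor_mean r n (K : R) : 0 < K -> n%:R * (1 - p) <= 2 * K -> 8 * K <= r%:R ->
  am p l n <= n%:R + E_ p (Ur R 0 n (wedge 0) 0) + 4 + E_ p (fun w => (jam_box l w r n)%:R).
Proof.
move=> K0 nK rK; pose V := Rr R 0 n 0; set mV := E_ p V.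
have emV : mV = n%:R * (1 - p) by rewrite /mV E_row.
have lV : local V by exact: Rr_local.
(* When the corridor may be too narrow, [V > 4 K] although its mean is at most [2 K], so that
   [2 * V <= q]; and the mean of [q] is at most [(2 / K) * (2 K) = 4]. *)
pose q w : R := 2 / K * (V w - mV) ^+ 2.
have lq : local q by apply: (local1 (fun x : R => 2 / K * (x - mV) ^+ 2)).
have l1 : local (fun w => (V w - mV) ^+ 2) by apply: (local1 (fun x : R => (x - mV) ^+ 2)).
have lj : local (fun w => (jam_box l w r n)%:R : R).
  apply: (local1 (fun k : nat => k%:R : R)); apply: (local2 addn).
    by apply: local_nsum => j; apply: (local2 addn); apply: kappa_local.
  by apply: local_nsum => i; apply: local_nsum => j; apply: jam_local.
have lU := Ur_local R 0 n (wedge 0) 0.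
have l2 : local (fun w => n%:R + Ur R 0 n (wedge 0) 0 w) by exact: (local1 (fun x : R => n%:R + x)).
have l3 : local (fun w => n%:R + Ur R 0 n (wedge 0) 0 w + q w) by exact: (local2 +%R).
apply: (@le_trans _ _ (E_ p (fun w => n%:R + Ur R 0 n (wedge 0) 0 w + q w + (jam_box l w r n)%:R))).
  apply: E_le => //; [exact: Xr_local|exact: (local2 +%R)|move=> w].
  have q0 : 0 <= q w by rewrite mulr_ge0 ?sqr_ge0// divr_ge0// ltW.
  have U0 : 0 <= Ur R 0 n (wedge 0) 0 w by rewrite /Ur ler0z Uiter_nneg.
  have [h|h] := leqP (2 * row_closed w 0 n 0) r.
    have := @X_corridor l w r n 0; rewrite normr0 add0r.
    have hW := Uiter_row w 0 n 0 (lip1_wedge 0); rewrite (_ : wedge 0 0 = 0)// add0r in hW.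
    have -> : W w 0 n 0 0 <= r%:Z by rewrite /W; apply: le_trans hW _; move: h; clear; lia.
    move=> /(_ isT); rewrite -(ler_int R) !intrD -!pmulrn => h1.
    by rewrite /Xr; apply: le_trans h1 _; rewrite /W -/(Ur R 0 n (wedge 0) 0 w); lra.
  have h1 := X_row l w r n; rewrite -(ler_nat R) natrD natrD natrM in h1.
  have e : (row_closed w 0 n 0)%:R = V w by [].
  rewrite e in h1; have hV : 8 * K < 2 * V w.
    by apply: le_lt_trans rK _; rewrite -e -natrM ltr_nat.
  have qV : 2 * V w <= q w.
    have d1 : V w <= 2 * (V w - mV) by rewrite emV; lra.
    have d2 : 2 * K <= V w - mV by rewrite emV; lra.
    rewrite /q mulrAC ler_pdivlMr// expr2.
    have : 0 <= (V w - mV - 2 * K) * (V w - mV) by rewrite mulr_ge0//; lra.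
    have : 0 <= (2 * (V w - mV) - V w) * (2 * K) by rewrite mulr_ge0//; lra.
    by lra.
  by rewrite /Xr; apply: le_trans h1 _; lra.
rewrite E_D// E_D// E_D//; last exact: local_cst.
rewrite E_cst lerD2r lerD2l.
rewrite /q E_Z//; have := E_sqr_dist lV (row_variance n 0 p01); rewrite -/mV => hv.
apply: (@le_trans _ _ (2 / K * (2 * K))).
  by rewrite ler_wpM2l ?divr_ge0 ?(ltW K0)//; apply: le_trans hv nK.
have -> : 2 / K * (2 * K) = 4 by field; rewrite gt_eqF.
by [].
Qed.

End JamBound.
End CorridorMean.

(** * A parallel TASEP on a ring *)

Section Ring.
Variables (R : realType) (M' : nat).
Notation M := M'.+1.
Notation state := {ffun 'I_M -> bool}.
Implicit Types (s t : state) (i j : 'I_M) (A B : {set 'I_M}) (w : config) (x n : nat).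

Definition lmin s : {set 'I_M} := [set i | ~~ s (ord_pred i) && s i].
Definition lmax s : {set 'I_M} := [set i | s (ord_pred i) && ~~ s i].
(* [s i] tells whether the height increases from [i] to [i + 1]; flipping turns minima into maxima. *)
Definition flip B s : state := [ffun i => s i (+) (i \in B) (+) (ordS i \in B)].

Lemma flipK B : involutive (flip B).
Proof.
by move=> s; apply/ffunP => i; rewrite !ffunE; case: (s i); case: (i \in B); case: (ordS i \in B).
Qed.

Lemma flip_min B s : B \subset lmin s -> B \subset lmax (flip B s).
Proof.
move=> /fintype.subsetP h; apply/fintype.subsetP => i iB; rewrite inE !ffunE ord_predK iB.
have := h _ iB; rewrite inE => /andP[h1 h2]; rewrite h2.
have -> : (ordS i \in B) = false.
  by apply/negP => /h; rewrite inE ordSK h2.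
have -> : (ord_pred i \in B) = false.
  by apply/negP => /h; rewrite inE (negbTE h1) andbF.
by rewrite (negbTE h1).
Qed.

Lemma flip_max B s : B \subset lmax s -> B \subset lmin (flip B s).
Proof.
move=> /fintype.subsetP h; apply/fintype.subsetP => i iB; rewrite inE !ffunE ord_predK iB.
have := h _ iB; rewrite inE => /andP[h1 h2]; rewrite (negbTE h2).
have -> : (ordS i \in B) = false.
  by apply/negP => /h; rewrite inE ordSK (negbTE h2).
have -> : (ord_pred i \in B) = false.
  by apply/negP => /h; rewrite inE h1 andbF.
by rewrite h1.
Qed.

Lemma flip_minmax B s : (B \subset lmin (flip B s)) = (B \subset lmax s).
Proof. by apply/idP/idP => h; [rewrite -(flipK B s); apply: flip_min|apply: flip_max]. Qed.

Lemma card_minmax s : #|lmin s| = #|lmax s|.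
Proof.
have h : (\sum_i nat_of_bool (s (ord_pred i)) = \sum_i nat_of_bool (s i))%N.
  by rewrite [RHS](reindex_inj (can_inj (@ord_predK M))).
have e1 : (\sum_i nat_of_bool (s i) = #|lmin s| + \sum_i nat_of_bool (s i && s (ord_pred i)))%N.
  rewrite -[#|_|]sum1_card [X in (X + _)%N]big_mkcond -big_split /=; apply: eq_bigr => i _; rewrite ?inE.
  by case: (s i); case: (s (ord_pred i)).
have e2 : (\sum_i nat_of_bool (s (ord_pred i)) = #|lmax s| + \sum_i nat_of_bool (s i && s (ord_pred i)))%N.
  rewrite -[#|_|]sum1_card [X in (X + _)%N]big_mkcond -big_split /=; apply: eq_bigr => i _; rewrite ?inE.
  by case: (s i); case: (s (ord_pred i)).
by apply/eqP; rewrite -(eqn_add2r (\sum_i nat_of_bool (s i && s (ord_pred i)))%N) -e1 -e2 h.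
Qed.

Lemma sum_subset A (c : R) : \sum_(B : {set 'I_M} | B \subset A) c ^+ #|B| = (1 + c) ^+ #|A|.
Proof.
have -> : (1 + c) ^+ #|A| = \prod_i ((if i \in A then c else 0) + 1).
  by rewrite -prodr_const big_mkcond; apply: eq_bigr => i _; case: ifP; rewrite ?add0r// addrC.
rewrite bigA_distr big_mkcond /=; apply: eq_bigr => B _.
have [h|h] := boolP (B \subset A).
  rewrite -prodr_const big_mkcond; apply: eq_bigr => i _; case: ifP => // iB.
  by rewrite (fintype.subsetP h _ iB).
have /fintype.subsetPn[i iB iA] := h.
by rewrite (bigD1 i)//= iB (negbTE iA) mul0r.
Qed.

Definition site x i : edge := hor x%:Z (Posz i).

Lemma site_inj x : injective (site x).
Proof. by move=> i j [] h; apply: val_inj. Qed.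

Definition flips w x s : {set 'I_M} := [set i in lmin s | ~~ w (site x i)].

Fixpoint ring w s x : state := if x is x'.+1 then flip (flips w x' (ring w s x')) (ring w s x') else s.

Variables (p : R) (hp : 0 < p <= 1).

Let p01 : 0 <= p <= 1.
Proof. by move: hp; lra. Qed.
Let p_neq0 : p != 0.
Proof. by move: hp; lra. Qed.

Definition weight s : R := p^-1 ^+ #|lmin s|.

Lemma flips_local x s : local (fun w => flips w x s).
Proof.
exists [seq site x i | i <- enum 'I_M] => w w' h; apply/setP => i; rewrite !inE h//.
by apply: map_f; rewrite mem_enum.
Qed.

Lemma flips_pr x s B : pr p (fun w => flips w x s = B) =
  if B \subset lmin s then p ^+ #|lmin s| * ((1 - p) / p) ^+ #|B| else 0.
Proof.
case: ifP => hB; last first.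
  rewrite -[RHS](E_cst edge p); apply: E_eq => w; apply: indF => e; move/negP: hB; apply.
  by rewrite -e; apply/fintype.subsetP => i; rewrite inE => /andP[].
pose h (e : edge) (b : bool) : R := (~~ b == (e \in [seq site x j | j <- enum B]))%:R.
pose es := [seq site x i | i <- enum (lmin s)].
have ues : uniq es by rewrite map_inj_uniq ?enum_uniq//; apply: site_inj.
have mem i : (site x i \in [seq site x j | j <- enum B]) = (i \in B).
  by rewrite mem_map ?mem_enum//; apply: site_inj.
transitivity (E_ p (fun w => \prod_(e <- es) h e (w e))).
  apply: E_eq => w; rewrite /es big_map big_enum /=.
  have [e|ne] := pselect (flips w x s = B).
    rewrite indT// big1// => i hi; rewrite /h mem -e inE hi /=; by rewrite eqxx.
  rewrite indF//; apply/esym.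
  have [i hi nB] : exists2 i, i \in lmin s & (~~ w (site x i)) != (i \in B).
    apply: contrapT => hh; apply: ne; apply/setP => i; rewrite inE.
    have [hi|hi] := boolP (i \in lmin s); last first.
      by apply/esym/negP => iB; move/negP: hi; apply; apply: (fintype.subsetP hB).
    by rewrite andTb; apply: contrapT => hne; apply: hh; exists i => //; apply/eqP.
  by rewrite (bigD1 i)//= /h mem (negbTE nB) mul0r.
rewrite E_prod// /es big_map big_enum /=.
rewrite (eq_bigr (fun i => p * (if i \in B then (1 - p) / p else 1))); last first.
  move=> i _; rewrite /h mem; case: (i \in B) => /=; first by field.
  by rewrite mulr1 mulr0 addr0.
rewrite big_split /= prodr_const; congr (_ * _).
rewrite -big_mkcondr /= (eq_bigl (fun i => i \in B)) ?prodr_const// => i.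
by rewrite andbC; case: (boolP (i \in B)) => //= iB; rewrite (fintype.subsetP hB).
Qed.

(** The weight cancels the factor [p ^ #|lmin s|] of the transition probability, so the flow out of
    [s] through [B] depends only on the size of [B]. *)
Lemma kernel_sum x s (f : state -> R) :
  weight s * E_ p (fun w => f (flip (flips w x s) s)) =
  \sum_(B : {set 'I_M} | B \subset lmin s) ((1 - p) / p) ^+ #|B| * f (flip B s).
Proof.
have lf : local (fun w => f (flip (flips w x s) s)) by apply: (local1 (fun B => f (flip B s))); apply: flips_local.
rewrite (@E_split _ _ _ p (fun w => flips w x s) (enum {: {set 'I_M}}) _ (enum_uniq _) _ _ lf); last 2 first.
- by move=> w; rewrite mem_enum.
- exact: flips_local.
rewrite big_enum /= mulr_sumr [RHS]big_mkcond /=; apply: eq_bigr => B _.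
transitivity (weight s * (f (flip B s) * pr p (fun w => flips w x s = B))).
  congr (_ * _); rewrite /pr -E_Z; last first.
    by apply: local_ind; apply: (local1 (fun A => A = B)); apply: flips_local.
  apply: E_eq => w; have [e|ne] := pselect (flips w x s = B).
    by rewrite indT// e mul1r mulr1.
  by rewrite indF// mul0r mulr0.
rewrite flips_pr; case: ifP => _; last by rewrite !mulr0.
by rewrite mulrCA [in RHS]mulrC; congr (_ * _); rewrite mulrA /weight -exprMn mulVf// expr1n mul1r.
Qed.

(** Flipping [B] is an involution exchanging minima and maxima, so the flow into [s] is a sum over
    the subsets of [lmax s], equal to [(1 + (1 - p) / p) ^ #|lmax s| = p^-1 ^ #|lmax s|]. On a ring
    there are as many maxima as minima. *)
Lemma kernel_invariant x (f : state -> R) :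
  \sum_s weight s * E_ p (fun w => f (flip (flips w x s) s)) = \sum_s weight s * f s.
Proof.
under eq_bigr do rewrite kernel_sum big_mkcond /=.
rewrite exchange_big /=.
transitivity (\sum_(B : {set 'I_M}) \sum_s if B \subset lmax s then ((1 - p) / p) ^+ #|B| * f s else 0).
  apply: eq_bigr => B _; rewrite (reindex_inj (inv_inj (flipK B))) /=.
  by apply: eq_bigr => s _; rewrite flip_minmax flipK.
rewrite exchange_big /=; apply: eq_bigr => s _.
rewrite -big_mkcond -mulr_suml sum_subset /weight card_minmax; congr (_ ^+ _ * _).
by field.
Qed.

Lemma ring_dep s x : depon (fun e : edge => e.1.1 < x%:Z) (fun w => ring w s x).
Proof.
elim: x => [|x IH] w w' h //=.
have IHx : ring w s x = ring w' s x by apply: IH => e he; apply: h; move: he; clear; lia.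
rewrite IHx; congr flip; apply/setP => i; rewrite !inE h//; rewrite /site /=; clear; lia.
Qed.

Lemma ring_local s x : local (fun w => ring w s x).
Proof.
elim: x => [|x IH]; first exact: local_cst.
have lB : local (fun w => flips w x (ring w s x)).
  have [r dr] := IH; exists (r ++ [seq site x i | i <- enum 'I_M]) => w w' h.
  have -> : ring w s x = ring w' s x by apply: dr => e er; apply: h; rewrite /= mem_cat er.
  by apply/setP => i; rewrite !inE h// /= mem_cat (map_f (site x)) ?orbT// mem_enum.
exact: (local2 (fun B t => flip B t)).
Qed.

(** Markov property: the state after [x] columns reads only earlier columns, so column [x] can be
    averaged first. *)
Lemma E_ring_indep s x (Y : eqType) (g : config -> Y) (h : state -> Y -> R) : local g ->
  depon (fun e : edge => e.1.1 == x%:Z) g ->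
  E_ p (fun w => h (ring w s x) (g w)) = E_ p (fun w => (fun t => E_ p (fun v => h t (g v))) (ring w s x)).
Proof.
move=> lg dg.
have lr := ring_local s x.
have ls t : local (fun w => h t (g w)) by exact: (local1 (h t)).
have li t : local (fun w => ind R (ring w s x = t)) by apply: local_ind; apply: (local1 (fun u => u = t)).
rewrite (@E_split _ _ _ p (fun w => ring w s x) (enum {: state}) _ (enum_uniq _) _ lr); last 2 first.
- by move=> w; rewrite mem_enum.
- exact: (local2 h).
rewrite (@E_split _ _ _ p (fun w => ring w s x) (enum {: state}) (fun w => (fun t => E_ p (fun v => h t (g v))) (ring w s x)) (enum_uniq _) _ lr); last 2 first.
- by move=> w; rewrite mem_enum.
- exact: (local1 (fun t => E_ p (fun v => h t (g v)))).
apply: eq_bigr => t _.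
transitivity (E_ p (fun w => ind R (ring w s x = t) * h t (g w))).
  apply: E_eq => w; have [->//|ne] := pselect (ring w s x = t); by rewrite indF// !mul0r.
transitivity (E_ p (fun w => ind R (ring w s x = t) * E_ p (fun v => h t (g v)))); last first.
  apply: E_eq => w; have [->//|ne] := pselect (ring w s x = t); by rewrite indF// !mul0r.
rewrite (@E_indep _ _ (fun e : edge => e.1.1 < x%:Z) (fun e : edge => e.1.1 == x%:Z))//.
- transitivity (E_ p (fun w => E_ p (fun v => h t (g v)) * ind R (ring w s x = t))).
    by rewrite E_Z// mulrC.
  by apply: E_eq => w; rewrite mulrC.
- by move=> w w' hw; rewrite (@ring_dep s x w w').
- by move=> w w' hw; rewrite (dg _ _ hw).
- by move=> e /= h1 /eqP h2; move: h1; rewrite h2 ltxx.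
Qed.

Lemma flips_all w x t : flips w x t = [set i in lmin t | i \in finset (fun j => ~~ w (site x j))].
Proof. by apply/setP => i; rewrite !inE. Qed.

Lemma ring_stationary (f : state -> R) x :
  \sum_s weight s * E_ p (fun w => f (ring w s x)) = \sum_s weight s * f s.
Proof.
elim: x f => [|x IH] f; first by apply: eq_bigr => s _; rewrite /= E_cst.
rewrite -(kernel_invariant x f) -(IH (fun t => E_ p (fun w => f (flip (flips w x t) t)))); apply: eq_bigr => s _; congr (_ * _) => /=.
pose g w : {set 'I_M} := finset (fun j => ~~ w (site x j)).
have lg : local g.
  exists [seq site x i | i <- enum 'I_M] => w w' h; apply/setP => i; rewrite !inE h//.
  by apply: map_f; rewrite mem_enum.
have dg : depon (fun e : edge => e.1.1 == x%:Z) g.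
  by move=> w w' h; apply/setP => i; rewrite !inE h// /site /= eqxx.
transitivity (E_ p (fun w => (fun t (G : {set 'I_M}) => f (flip [set i in lmin t | i \in G] t)) (ring w s x) (g w))).
  by apply: E_eq => w; rewrite flips_all.
rewrite (E_ring_indep s (fun t (G : {set 'I_M}) => f (flip [set i in lmin t | i \in G] t)) lg dg).
by apply: E_eq => w /=; apply: E_eq => v; rewrite flips_all.
Qed.

Definition growth w s n i : nat := (\sum_(x <- iota 0 n) nat_of_bool (i \in flips w x (ring w s x)))%N.

Lemma growthS w s n i : growth w s n.+1 i = (growth w s n i + nat_of_bool (i \in flips w n (ring w s n)))%N.
Proof. by rewrite /growth sum_iotaS. Qed.

(** Divided by [mass], the stationary probability that [i] is a local minimum. *)
Definition min_mass i : R := \sum_s weight s * (i \in lmin s)%:R.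

Lemma flip_in_local s x i : local (fun w => (i \in flips w x (ring w s x))%:R : R).
Proof.
apply: local_ext (_ : local (fun w => (i \in lmin (ring w s x))%:R * (~~ w (site x i))%:R)) => [w|].
  by rewrite [in RHS]inE; case: (i \in lmin _); rewrite ?mul1r ?mul0r.
apply: (local2 (fun a b : R => a * b)); last exact: closed_local.
by apply: (local1 (fun t : state => (i \in lmin t)%:R : R)); apply: ring_local.
Qed.

Lemma growth_local s n i : local (fun w => (growth w s n i)%:R : R).
Proof.
apply: local_ext (_ : local (fun w => \sum_(x <- iota 0 n) (i \in flips w x (ring w s x))%:R : R)) => [w|].
  by rewrite /growth natr_sum.
by apply: local_sum => x _ _; apply: flip_in_local.
Qed.

Lemma mean_growth n i : \sum_s weight s * E_ p (fun w => (growth w s n i)%:R) = n%:R * (1 - p) * min_mass i.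
Proof.
have e1 s : E_ p (fun w => (growth w s n i)%:R) =
    \sum_(x <- iota 0 n) (1 - p) * E_ p (fun w => (i \in lmin (ring w s x))%:R).
  transitivity (E_ p (fun w => \sum_(x <- iota 0 n) (i \in flips w x (ring w s x))%:R)).
    by apply: E_eq => w; rewrite /growth natr_sum.
  rewrite (@E_sum _ _ _ _ xpredT) => [|x _ _]; last exact: flip_in_local.
  apply: eq_bigr => x _.
  have lr : local (fun w => (i \in lmin (ring w s x))%:R : R).
    by apply: (local1 (fun t : state => (i \in lmin t)%:R : R)); apply: ring_local.
  rewrite mulrC -(E_closed p (site x i)).
  rewrite -(@E_indep _ _ (fun e : edge => e.1.1 < x%:Z) (fun e : edge => e.1.1 == x%:Z))//.
  - by apply: E_eq => w; rewrite [in LHS]inE; case: (i \in lmin _); rewrite ?mul1r ?mul0r.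
  - exact: closed_local.
  - by move=> w w' hw; rewrite (@ring_dep s x w w').
  - by move=> w w' hw; rewrite hw//= eqxx.
  - by move=> e /= h1 /eqP h2; move: h1; rewrite h2 ltxx.
transitivity (\sum_(x <- iota 0 n) (1 - p) * min_mass i); last first.
  by rewrite big_const_seq count_predT size_iota iter_addr addr0 -mulrA -[LHS]mulr_natl.
under eq_bigr do rewrite e1 mulr_sumr.
rewrite exchange_big /=; apply: eq_bigr => x _.
rewrite /min_mass -(ring_stationary (fun t => (i \in lmin t)%:R) x) mulr_sumr.
by apply: eq_bigr => s _; rewrite mulrCA.
Qed.


Definition sg s i : R := if s i then 1 else -1.

Definition toggle i s : state := [ffun j => if j == i then ~~ s j else s j].

Lemma toggleK i : involutive (toggle i).
Proof. by move=> s; apply/ffunP => j; rewrite !ffunE; case: eqP; rewrite ?negbK. Qed.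

Lemma sum_toggle i (f : state -> R) : (forall s, f (toggle i s) = - f s) -> \sum_s f s = 0.
Proof.
move=> h; have : \sum_s f s = - \sum_s f s.
  by rewrite {1}(reindex_inj (inv_inj (toggleK i))) -sumrN; apply: eq_bigr => s _; rewrite h.
by lra.
Qed.

Lemma sum_sg i : \sum_s sg s i = 0.
Proof.
by apply: (@sum_toggle i) => s; rewrite /sg ffunE eqxx; case: (s i); rewrite ?opprK.
Qed.

Lemma sum_sg2 i j : \sum_s sg s i * sg s j = (2 ^ M)%:R * (i == j)%:R.
Proof.
have [<-|ne] := eqVneq i j.
  rewrite mulr1 (eq_bigr (fun=> 1)) => [|s _]; last by rewrite /sg; case: (s i); rewrite ?mulrNN mulr1.
  by rewrite sumr_const card_ffun card_bool card_ord.
rewrite mulr0; apply: (@sum_toggle i) => s.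
by rewrite /sg !ffunE eqxx eq_sym (negbTE ne); case: (s i); case: (s j) => /=; lra.
Qed.

Lemma sum_1 : \sum_(s : state) (1 : R) = (2 ^ M)%:R.
Proof. by rewrite sumr_const card_ffun card_bool card_ord. Qed.

(** The indicator is [(1 + sg s i) * (1 - sg s (ord_pred i)) / 4], and the signs of distinct sites
    are uncorrelated under the uniform law. *)
Lemma count_min i : ord_pred i != i -> \sum_s (i \in lmin s)%:R = (2 ^ M)%:R / 4 :> R.
Proof.
move=> ne; have -> : \sum_s (i \in lmin s)%:R =
    \sum_s (1 / 4 + (1 / 4 * sg s i + (- (1 / 4) * sg s (ord_pred i) + - (1 / 4) * (sg s (ord_pred i) * sg s i)))) :> R.
  apply: eq_bigr => s _; rewrite inE /sg; case: (s i); case: (s (ord_pred i)) => /=; lra.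
rewrite !big_split /= -!mulr_sumr !sum_sg sum_sg2 (negbTE ne) !mulr0 !addr0.
by rewrite mul1r sumr_const card_ffun card_bool card_ord [RHS]mulr_natl.
Qed.

Lemma weight_ge1 s : 1 <= weight s.
Proof. by rewrite /weight exprn_ege1// invf_ge1; case/andP: hp. Qed.

Lemma weight_le s : weight s <= p^-1 ^+ M.
Proof.
rewrite /weight ler_weXn2l//; last by rewrite -[X in (_ <= X)%N](card_ord M) max_card.
by rewrite invf_ge1; case/andP: hp.
Qed.

Definition mass : R := \sum_s weight s.

Lemma mass_ge : (2 ^ M)%:R <= mass.
Proof. by rewrite -sum_1; apply: ler_sum => s _; apply: weight_ge1. Qed.

Lemma weighted_le (f : state -> R) : (forall s, 0 <= f s) ->
  \sum_s weight s * f s <= p^-1 ^+ M * \sum_s f s.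
Proof. by move=> f0; rewrite mulr_sumr; apply: ler_sum => s _; rewrite ler_wpM2r// weight_le. Qed.

Lemma min_mass_le i : ord_pred i != i -> min_mass i <= p^-1 ^+ M * ((2 ^ M)%:R / 4).
Proof. by move=> ne; rewrite -(count_min ne); apply: weighted_le. Qed.

Definition rotate s : state := [ffun i => s (ordS i)].

Lemma rotate_inj : injective rotate.
Proof.
move=> s t /ffunP h; apply/ffunP => i; have := h (ord_pred i).
by rewrite !ffunE ord_predK.
Qed.

Lemma rotate_min s i : (i \in lmin (rotate s)) = (ordS i \in lmin s).
Proof. by rewrite !inE !ffunE ord_predK ordSK. Qed.

Lemma rotate_card s : #|lmin (rotate s)| = #|lmin s|.
Proof.
have -> : lmin s = (@ordS M @: lmin (rotate s))%SET.
  apply/setP => j; apply/idP/imsetP => [h|[i hi ->]]; last by rewrite -rotate_min.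
  by exists (ord_pred j); rewrite ?rotate_min ord_predK.
by rewrite card_imset//; apply: (can_inj (@ordSK M)).
Qed.

Lemma min_mass_S i : min_mass (ordS i) = min_mass i.
Proof.
rewrite {2}/min_mass (reindex_inj rotate_inj) /=; apply: eq_bigr => s _.
by rewrite /weight rotate_card rotate_min.
Qed.

Lemma min_mass_const i : min_mass i = min_mass ord0.
Proof.
case: i => k; elim: k => [|k IH] hk; first by congr min_mass; apply: val_inj.
rewrite -(IH (ltnW hk)) -[RHS]min_mass_S; congr min_mass; apply: val_inj => /=.
by rewrite modn_small.
Qed.

Lemma chebyshev_sum (m : state -> R) : (forall s t, 0 <= (weight s - weight t) * (m s - m t)) ->
  mass * \sum_s m s <= (2 ^ M)%:R * \sum_s weight s * m s.
Proof.
move=> h; have : 0 <= \sum_s \sum_t (weight s - weight t) * (m s - m t).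
  by apply: sumr_ge0 => s _; apply: sumr_ge0 => t _.
have -> : \sum_s \sum_t (weight s - weight t) * (m s - m t) =
    \sum_s (weight s * m s * (2 ^ M)%:R - m s * mass - weight s * \sum_t m t + \sum_t weight t * m t).
  apply: eq_bigr => s _; rewrite -sum_1 /mass !mulr_sumr -!sumrB -big_split /=.
  by apply: eq_bigr => t _; ring.
rewrite big_split /= !sumrB -!mulr_suml sumr_const card_ffun card_bool card_ord -mulr_natl -/mass.
by lra.
Qed.

Lemma pred_neq i : (0 < M')%N -> ord_pred i != i.
Proof.
move=> h; apply/eqP => /(congr1 val) /=; case: i => [[|k] hk] /=.
  by rewrite modn_small// => e; rewrite e in h.
by rewrite modnDr modn_small ?(ltnW hk)// => /eqP; rewrite eqn_leq ltnn andbF.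
Qed.

(** By rotation, [min_mass] is the weighted sum of the number of minima per site. The weight
    increases with this number, so Chebyshev's sum inequality compares it with the uniform law, for
    which the mean is 1/4. *)
Lemma min_mass_ge i : (0 < M')%N -> mass / 4 <= min_mass i.
Proof.
move=> M1; pose m s : R := #|lmin s|%:R.
have M0 : 0 < M%:R :> R by [].
have mE s : m s = \sum_i (i \in lmin s)%:R.
  by rewrite /m -sum1_card big_mkcond natr_sum; apply: eq_bigr => j _; case: (j \in _).
have c1 : \sum_s weight s * m s = M%:R * min_mass i.
  transitivity (\sum_j min_mass j).
    rewrite exchange_big; apply: eq_bigr => s _; by rewrite mE mulr_sumr.
  rewrite (eq_bigr (fun=> min_mass i)) => [|j _]; last by rewrite min_mass_const [RHS]min_mass_const.
  by rewrite sumr_const card_ord mulr_natl.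
have c2 : \sum_s m s = M%:R * ((2 ^ M)%:R / 4).
  transitivity (\sum_j \sum_s ((j \in lmin s)%:R : R)).
    by rewrite exchange_big; apply: eq_bigr => s _; rewrite mE.
  rewrite (eq_bigr (fun=> (2 ^ M)%:R / 4)) => [|j _]; last by rewrite count_min// pred_neq.
  by rewrite sumr_const card_ord [RHS]mulr_natl.
have := @chebyshev_sum m; rewrite c1 c2 => h.
have P0 : 0 < (2 ^ M)%:R * M%:R :> R by rewrite mulr_gt0// ltr0n expn_gt0.
rewrite -(ler_pM2l P0).
have -> : (2 ^ M)%:R * M%:R * (mass / 4) = mass * (M%:R * ((2 ^ M)%:R / 4)) by ring.
rewrite -mulrA; apply: h => s t; rewrite /m /weight.
have p1 : 1 <= p^-1 by rewrite invf_ge1; case/andP: hp.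
have [st|/ltnW st] := leqP (#|lmin s|) (#|lmin t|).
  by apply: mulr_le0; rewrite subr_le0 ?ler_nat// ler_weXn2l.
by apply: mulr_ge0; rewrite subr_ge0 ?ler_nat// ler_weXn2l.
Qed.

End Ring.

(** * Heights over a strip and the Lipschitz lower bound *)

Section Heights.
Variable (M' : nat).
Notation M := M'.+1.
Notation state := {ffun 'I_M -> bool}.
Implicit Types (s t : state) (w : config) (x n k z l : nat).

Definition slope (b : bool) : int := if b then 1 else -1.

Definition hgt0 s k : int := \sum_(j <- iota 0 k) slope (s (inord j)).

(** Each flip raises a site by 2. Heights are read along the ring cut open at site 0, since the
    slopes around the ring need not sum to 0. *)
Definition hgt w s x k : int := hgt0 s k + 2 * (growth w s x (inord k))%:Z.

Lemma hgt0S s k : hgt0 s k.+1 = hgt0 s k + slope (s (inord k)).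
Proof. by rewrite /hgt0 -addn1 iotaD big_cat /= big_seq1. Qed.

Lemma ordS_inord k : (k < M')%N -> ordS (inord k : 'I_M) = inord k.+1.
Proof.
move=> h; apply: val_inj; rewrite /= !inordK//; last exact: leqW.
by rewrite modn_small.
Qed.

Lemma ord_pred_inord k : (k < M')%N -> ord_pred (inord k.+1 : 'I_M) = inord k.
Proof. by move=> h; rewrite -ordS_inord// ordSK. Qed.

Lemma hgt_slope w s x k : (k < M')%N -> hgt w s x k.+1 = hgt w s x k + slope (ring w s x (inord k)).
Proof.
move=> h; elim: x => [|x IH].
  by rewrite /hgt hgt0S /growth !big_nil /= !addr0.
move: IH; rewrite /hgt !growthS /= ffunE ordS_inord//.
set F := flips w x (ring w s x); set t := ring w s x.
have h1 : inord k \in F -> t (inord k) by rewrite !inE => /andP[/andP[]].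
have h2 : inord k.+1 \in F -> ~~ t (inord k).
  by rewrite !inE ord_pred_inord// => /andP[/andP[]].
move: h1 h2; case: (inord k \in F) => h1; case: (inord k.+1 \in F) => h2; rewrite /= ?addbT ?addbF ?addn0.
- by have := h2 isT; rewrite h1.
- by rewrite h1//= /slope; clear; lia.
- by have := h2 isT; case: (t _) => //= _; rewrite /slope; clear; lia.
- by [].
Qed.

Lemma hgt_le w s x k : (k < M)%N ->
  hgt w s x k <= hgt w s x.+1 k <= hgt w s x k + 2 * (nat_of_bool (~~ w (hor x%:Z k%:Z)))%:Z.
Proof.
move=> h; rewrite /hgt growthS [in nat_of_bool (_ \in _)]inE /site inordK//.
by case: (_ \in lmin _); case: (w _) => /=; clear; lia.
Qed.

Lemma hgt_interior w s x k : (k.+1 < M')%N ->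
  hgt w s x.+1 k.+1 = if w (hor x%:Z k.+1%:Z) then hgt w s x k.+1
    else Num.min (hgt w s x k) (hgt w s x k.+2) + 1.
Proof.
move=> h; have s1 := @hgt_slope w s x k (ltnW h); have s2 := hgt_slope w s x h.
have e : hgt w s x.+1 k.+1 = hgt w s x k.+1 + 2 * (nat_of_bool [&& ~~ ring w s x (inord k), ring w s x (inord k.+1) & ~~ w (hor x%:Z k.+1%:Z)])%:Z.
  rewrite /hgt growthS [in nat_of_bool (_ \in _)]inE inE ord_pred_inord; last exact: ltnW.
  by rewrite /site inordK ?andbA; [clear; lia|exact: leqW].
rewrite e; move: s1 s2; case: (ring _ _ _ _); case: (ring _ _ _ _); case: (w _) => /=; rewrite /slope; clear; lia.
Qed.

(** An optimal path is followed backwards by [hgt_interior]. It reaches the first column, or it is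
    stopped at an end of the strip, where the recursion fails; each change of row costs 1, so the
    distance to that end is retained. *)
Lemma hgt_trace w s N x k : M' = (2 * N)%N -> (k <= 2 * N)%N -> exists2 z, (z <= 2 * N)%N &
  hgt0 s z + W w 0 x z%:Z k%:Z <= hgt w s x k \/
  ((z = 0%N \/ z = (2 * N)%N) /\ hgt0 s z + `|k%:Z - z%:Z| <= hgt w s x k).
Proof.
move=> eM; elim: x k => [|x IH] k hk.
  by exists k => //; left; rewrite /hgt /growth big_nil /W /= /wedge subrr normr0 mulr0.
have H0 : hgt0 s k <= hgt w s x.+1 k by rewrite /hgt; clear; lia.
have [k0|kpos] := posnP k.
  by exists k => //; right; split; [left|rewrite subrr normr0 addr0].
have [k2|kn] := eqVneq k (2 * N)%N.
  by exists k => //; right; split; [right|rewrite subrr normr0 addr0].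
case: k hk H0 kpos kn => // k hk H0 _ kn.
have hk2 : (k.+1 < M')%N by rewrite eM ltn_neqAle kn hk.
rewrite (hgt_interior _ _ _ hk2) /W /= /Ustep add0r; case: ifP => hw; first exact: IH hk.
have ek : k.+1%:Z - 1 = k%:Z by clear; lia.
have ek2 : k.+1%:Z + 1 = k.+2%:Z by clear; lia.
rewrite ek ek2.
have [m|m] := leP (hgt w s x k) (hgt w s x k.+2).
  have [z hz hh] := IH k (ltnW hk); exists z => //; case: hh => [hh|[hh1 hh]]; [left|right; split => //].
    by move: hh; rewrite /W; clear; lia.
  by move: hh; clear; lia.
have [|z hz hh] := IH k.+2; first by rewrite -eM.
exists z => //; case: hh => [hh|[hh1 hh]]; [left|right; split => //].
  by move: hh; rewrite /W; clear; lia.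
by move: hh; clear; lia.
Qed.

(** Its increment along an edge is at most the passage time: 1 along an open or vertical edge, and
    at most 3 along a closed horizontal one, whose passage time is at least 49. Left of column 0 the
    heights are frozen at their initial values. *)
Definition potential w s (v : vertex) : int :=
  v.1 + hgt w s (if 0 <= v.1 then absz v.1 else 0%N) (absz v.2).

Definition strip (v : vertex) : bool := 0 <= v.2 <= M'%:Z.

Lemma potential_right l w s (x y : int) : strip (x, y) ->
  `|potential w s (x + 1, y) - potential w s (x, y)| <= (tau l w (hor x y))%:Z.
Proof.
rewrite /strip /= => hy; rewrite /potential /=.
have [x0|x0] := leP 0 x; last first.
  have -> : (if 0 <= x + 1 then absz (x + 1) else 0%N) = 0%N by case: ifP => //; move: x0; clear; lia.
  by have := tau_gt0 l w (hor x y); move: (hgt _ _ _ _); clear; lia.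
have -> : 0 <= x + 1 by move: x0; clear; lia.
have -> : absz (x + 1) = (absz x).+1 by move: x0; clear; lia.
have hk : (absz y < M)%N by move: hy; clear; lia.
have := hgt_le w s (absz x) hk.
have -> : hor (absz x)%:Z (absz y)%:Z = hor x y by congr (_, _, _); [move: x0; clear; lia|move: hy; clear; lia].
have := tau_gt0 l w (hor x y); have : ~~ w (hor x y) -> (49 <= tau l w (hor x y))%N.
  by move=> c; rewrite tau_closed// (@tmax_mono 0).
case: (w _) => /=; move: (hgt _ _ _ _) (hgt _ _ _ _) (tau _ _ _); clear; lia.
Qed.

Lemma potential_up l w s (x y : int) : strip (x, y) -> strip (x, y + 1) ->
  `|potential w s (x, y + 1) - potential w s (x, y)| <= (tau l w (ver x y))%:Z.
Proof.
rewrite /strip /= => hy hy1; rewrite /potential /=; move: (if _ then _ else _) => k.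
have -> : absz (y + 1) = (absz y).+1 by move: hy; clear; lia.
rewrite hgt_slope; last by move: hy hy1; clear; lia.
have := tau_gt0 l w (ver x y); rewrite /slope; move: (hgt _ _ _ _) (tau _ _ _); case: (ring _ _ _ _); clear; lia.
Qed.

Lemma potential_step l w s u v : nb u v -> strip u -> strip v ->
  potential w s v - potential w s u <= (tau l w (eo u v))%:Z.
Proof.
case: u v => [a b] [c d] n su sv.
have abs (i j m : int) : `|i - j| <= m -> i - j <= m /\ j - i <= m by clear; lia.
move: n; rewrite /nb /ostep /= !andbT => /or4P[] /eqP[] e1 e2; subst.
- by rewrite eo_hor; case: (abs _ _ _ (potential_right l w s su)).
- by rewrite -eoC ?eo_hor ?/nb /ostep /= ?eqxx//; case: (abs _ _ _ (potential_right l w s sv)).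
- by rewrite eo_ver; case: (abs _ _ _ (potential_up l w s su sv)).
- by rewrite -eoC ?eo_ver ?/nb /ostep /= ?eqxx ?orbT//; case: (abs _ _ _ (potential_up l w s sv su)).
Qed.

Lemma potential_path l w s u r : path nb u r -> all strip (u :: r) ->
  potential w s (last u r) - potential w s u <= (cost (tau l w) u r)%:Z.
Proof.
elim: r u => [|v r IH] u /=; first by rewrite subrr.
move=> /andP[n pr] /andP[su /andP[sv sr]].
have := IH v pr; rewrite /= sv sr => /(_ isT); have := potential_step l w s n su sv.
rewrite PoszD; move: (potential _ _ _) (potential _ _ _) (potential _ _ _); clear; lia.
Qed.

Lemma growth_le w s n i : (growth w s n i <= n)%N.
Proof. by rewrite -[X in (_ <= X)%N](size_iota 0); apply: sum_bool_le. Qed.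

Lemma X_potential l w s N n : M' = (2 * N)%N -> (3 * n <= N)%N ->
  (n + 2 * growth w s n (inord N) <= X l w (0%R, N%:Z) (n%:Z, N%:Z))%N.
Proof.
move=> eM nN; have [r [pr lr] cX] := fpp_ex (tau l w) (0, N%:Z) (n%:Z, N%:Z).
rewrite /X -cX; have [ar|nar] := boolP (all strip ((0, N%:Z) :: r)).
  have g0 i : growth w s 0 i = 0%N by rewrite /growth big_nil.
  have := potential_path l w s pr ar; rewrite lr /potential /= /hgt g0.
  by move: (hgt0 _ _) (growth _ _ _ _) (cost _ _ _); clear; lia.
have /allPn[v vr nv] := nar.
(* A path that leaves the strip has more than [N >= 3 * n] edges, whereas [n + 2 * growth] is at
   most [3 * n]. *)
apply: leq_trans (cost_size _ _ (tau_gt0 l w)); apply: leq_trans (path_dist pr vr).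
have {}nv : ~~ (0 <= v.2 <= (2 * N)%N%:Z) by rewrite -eM.
have := growth_le w s n (inord N); move: nv nN; rewrite /nrm /=; move: (growth _ _ _ _); clear; lia.
Qed.

End Heights.

(** * The expansion of the time constant *)

Section LowerBound.
Variables (R : realType) (p0 p : R).
Hypotheses (hp0 : 1 / 2 < p0) (hp1 : p0 <= 1) (hp : p0 <= p <= 1).

Let p01 : 0 <= p <= 1.
Proof. by move: hp hp0; lra. Qed.
Let hp2 : 0 < p <= 1.
Proof. by move: hp hp0; lra. Qed.

(** The bound of [X_potential] holds from every initial state, hence for the weighted average over
    states, in which the growth per column is at least [(1 - p) / 4]. *)
Lemma am_lower l n : (1 + (1 - p) / 2) * n.+1%:R <= am p l n.+1.
Proof.
pose N := (3 * n.+1)%N; pose M' := (2 * N)%N.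
have Z0 : 0 < mass M' p by apply: lt_le_trans (mass_ge _ hp2); rewrite ltr0n expn_gt0.
have -> : am p l n.+1 = E_ p (Xr R l (0, N%:Z) (n.+1%:Z, N%:Z)).
  by rewrite am_shift; congr (E_ p (Xr R l _ _)); congr pair => /=; clear; lia.
have lg (s : {ffun 'I_M'.+1 -> bool}) := growth_local R s n.+1 (inord N).
have l2 (s : {ffun 'I_M'.+1 -> bool}) : local (fun w => 2 * (growth w s n.+1 (inord N))%:R : R).
  exact: (local1 (fun x : R => 2 * x)).
have H (s : {ffun 'I_M'.+1 -> bool}) : n.+1%:R + 2 * E_ p (fun w => (growth w s n.+1 (inord N))%:R) <=
    E_ p (Xr R l (0, N%:Z) (n.+1%:Z, N%:Z)).
  rewrite -E_Z// -[X in X + _](E_cst edge p) -E_D//; last exact: local_cst.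
  apply: E_le => //; [exact: (local1 (fun x : R => _ + x))|exact: Xr_local|move=> w].
  have := @X_potential M' l w s N n.+1 erefl (leqnn _); rewrite -(ler_nat R) natrD natrM; exact.
rewrite -(ler_pM2l Z0).
have -> : mass M' p * E_ p (Xr R l (0, N%:Z) (n.+1%:Z, N%:Z)) = \sum_(s : {ffun 'I_M'.+1 -> bool}) weight p s * E_ p (Xr R l (0, N%:Z) (n.+1%:Z, N%:Z)).
  by rewrite /mass mulr_suml.
apply: (@le_trans _ _ (\sum_(s : {ffun 'I_M'.+1 -> bool}) weight p s * (n.+1%:R + 2 * E_ p (fun w => (growth w s n.+1 (inord N))%:R)))); last first.
  by apply: ler_sum => s _; apply: ler_wpM2l; [apply: le_trans (weight_ge1 hp2 s); rewrite ler01|exact: H].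
under eq_bigr do rewrite mulrDr mulrCA.
rewrite big_split /= -mulr_suml -mulr_sumr (mean_growth hp2) -/(mass M' p).
have : mass M' p / 4 <= min_mass p (inord N : 'I_M'.+1) by apply: min_mass_ge.
move: (mass _ _) (min_mass _ _) Z0 => Z mm Z0 hm.
have e0 : 0 <= n.+1%:R * (1 - p) by rewrite mulr_ge0// subr_ge0; case/andP: p01.
have := ler_wpM2l e0 hm; move: (n.+1%:R : R) => x; lra.
Qed.

Lemma mu_lower : 1 + (1 - p) / 2 <= mu p.
Proof.
by apply: (mu_ge hp0 hp1 hp) => n; apply: le_trans (am_lower 0 n) (am_asup hp0 hp1 hp 0 n.+1).
Qed.

End LowerBound.

(** * Point-to-point means against the stationary growth *)

Section UpperBound.
Variables (R : realType) (p : R) (hp : 0 < p <= 1).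
Variables (m g q : nat) (lam : R).
Hypotheses (lam0 : 0 < lam) (g0 : (0 < g)%N) (q0 : (0 < q)%N).

Let p01 : 0 <= p <= 1.
Proof. by move: hp; lra. Qed.

Notation N := (g * q)%N.
Notation M' := (2 * N)%N.
Notation state := {ffun 'I_M'.+1 -> bool}.
Implicit Types (s : state) (w : config) (z k : nat).

Definition drift s z : R := (hgt0 s z - hgt0 s N)%:~R.
Definition wbar z : R := E_ p (Ur R 0 m (wedge z%:Z) N%:Z).
(* By subadditivity and reflection, a lower bound for the mean passage time from any height. *)
Definition half_mean : R := E_ p (Ur R 0 (m + m) (wedge 0) 0) / 2.

Lemma half_le z : half_mean <= wbar z.
Proof.
have := W_mean_double m (z%:Z - N%:Z) p01; rewrite -(W_mean_shift p 0 m z%:Z N%:Z) /half_mean /wbar.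
by move: (E_ _ _) (E_ _ _) => a b; lra.
Qed.

(** Equivalent to [(x + 2 * lam) ^ 2 >= 0]. Deviations are charged quadratically, so second moments
    suffice and no exceptional event has to be set apart. *)
Lemma neg_young (x : R) : - lam - x ^+ 2 / (4 * lam) <= x.
Proof.
rewrite -subr_ge0; have -> : x - (- lam - x ^+ 2 / (4 * lam)) = (x + 2 * lam) ^+ 2 / (4 * lam).
  by field; rewrite gt_eqF.
by rewrite divr_ge0 ?sqr_ge0// mulr_ge0// ltW.
Qed.

Definition grid : seq nat := [seq (g * j)%N | j <- iota 0 (2 * q).+1].

(** Penalties for the fluctuation of the initial profile and of the passage time from [z]. They are
    summed over a grid only: both quantities are 1-Lipschitz in [z], which costs [2 g] between grid
    points. *)
Definition defect s w z : R := (drift s z ^+ 2 + (Ur R 0 m (wedge z%:Z) N%:Z w - wbar z) ^+ 2) / (4 * lam).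

Lemma defectE s w z : defect s w z =
  drift s z ^+ 2 / (4 * lam) + (Ur R 0 m (wedge z%:Z) N%:Z w - wbar z) ^+ 2 / (4 * lam).
Proof. by rewrite /defect mulrDl. Qed.

Lemma defect_ge0 s w z : 0 <= defect s w z.
Proof. by rewrite divr_ge0 ?addr_ge0 ?sqr_ge0// mulr_ge0// ltW. Qed.

Lemma defect_le s w z : z \in grid -> defect s w z <= \sum_(z <- grid) defect s w z.
Proof.
by move=> h; rewrite (big_rem z)//= lerDl sumr_ge0// => y _; apply: defect_ge0.
Qed.

Lemma drift_grid s w z : z \in grid -> - lam - \sum_(z <- grid) defect s w z <= drift s z.
Proof.
move=> zg; apply: le_trans (neg_young (drift s z)); apply: lerB => //.
apply: (le_trans _ (defect_le s w zg)); by rewrite defectE lerDl divr_ge0 ?sqr_ge0 ?mulr_ge0 ?(ltW lam0).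
Qed.

Lemma drift_value_grid s w z : z \in grid ->
  half_mean - 2 * lam - \sum_(z <- grid) defect s w z <= drift s z + Ur R 0 m (wedge z%:Z) N%:Z w.
Proof.
move=> zg; have := defect_le s w zg; rewrite {1}defectE; have := half_le z.
have := neg_young (drift s z); have := neg_young (Ur R 0 m (wedge z%:Z) N%:Z w - wbar z).
move: (_ ^+ 2 / _) (_ ^+ 2 / _) (bigop _ _ _) => a b c; lra.
Qed.

Lemma hgt0_lip s z d : `|hgt0 s (z + d) - hgt0 s z| <= d%:Z.
Proof.
elim: d => [|d IH]; first by rewrite addn0 subrr normr0.
by rewrite addnS hgt0S /slope; case: (s _); move: IH; clear; lia.
Qed.

Lemma drift_value s w z : (z <= M')%N ->
  half_mean - 2 * lam - 2 * g%:R - \sum_(z <- grid) defect s w z <= drift s z + Ur R 0 m (wedge z%:Z) N%:Z w.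
Proof.
move=> zM; pose z' := (g * (z %/ g))%N.
have zg : z' \in grid.
  apply/mapP; exists (z %/ g)%N => //; rewrite mem_iota add0n ltnS /= -(leq_pmul2l g0) mulnC.
  by apply: leq_trans (leq_trunc_div z g) _; rewrite mulnCA.
have [ez rg] : z = (z' + z %% g)%N /\ (z %% g < g)%N by split; [rewrite {1}(divn_eq z g) mulnC|rewrite ltn_pmod].
have := drift_value_grid s w zg.
have h1 := hgt0_lip s z' (z %% g); have h2 := W_lip w 0 m z'%:Z z%:Z N%:Z.
rewrite -ez in h1.
have {}h1 : hgt0 s z' <= hgt0 s z + g%:Z by move: h1 rg; clear; lia.
have {}h2 : W w 0 m z'%:Z N%:Z <= W w 0 m z%:Z N%:Z + g%:Z.
  by apply: le_trans h2 _; rewrite lerD2l; move: ez rg; clear; lia.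
move: h1 h2; rewrite -!(ler_int R) !intrD /drift !intrB /Ur /W -pmulrn; move: (bigop _ _ _) => b; lra.
Qed.

(** The height at the middle dominates the smallest sum of an initial height and a passage time from
    it, and up to the penalties each such sum is at least [half_mean - 2 lam - 2 g] above the
    initial height at the middle. A path stopped at an end of the strip costs at least [N], hence
    the hypothesis. *)
Lemma growth_ge s w : half_mean <= N%:R ->
  half_mean - 2 * lam - 2 * g%:R - \sum_(z <- grid) defect s w z <= 2 * (growth w s m (inord N))%:R.
Proof.
move=> hN.
have [|z hz hh] := @hgt_trace M' w s N m N erefl; first by rewrite leq_pmull.
have g1 : 0 <= g%:R :> R by [].
have -> : 2 * (growth w s m (inord N))%:R = (hgt w s m N - hgt0 s N)%:~R :> R.
  by rewrite /hgt addrAC subrr add0r intrM.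
case: hh => [hh|[hz' hh]].
  apply: le_trans (drift_value s w hz) _.
  by rewrite /drift /Ur -intrD ler_int; move: hh; rewrite /W; clear; lia.
have zg : z \in grid.
  case: hz' => ->; apply/mapP; first by exists 0%N; rewrite ?muln0.
  by exists (2 * q)%N; [rewrite mem_iota add0n ltnS leqnn|rewrite mulnCA].
have hd : N%:Z = `|N%:Z - z%:Z| by case: hz' => ->; clear; lia.
apply: (@le_trans _ _ (drift s z + N%:R)).
  have := drift_grid s w zg; move: hN lam0 g1; move: half_mean (drift s z) (bigop _ _ _) (N%:R : R) => a1 a2 b a3; lra.
by rewrite /drift (_ : N%:R = N%:Z%:~R :> R)// -intrD ler_int; move: hh; rewrite -hd; clear; lia.
Qed.


Lemma hgt0_sum s a d : hgt0 s (a + d) - hgt0 s a = \sum_(j <- iota a d) slope (s (inord j)).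
Proof. by rewrite /hgt0 iotaD big_cat /= add0n addrAC subrr add0r. Qed.

(** Under the uniform law the initial profile is a simple random walk. *)
Lemma hgt0_square a d : (a + d <= M')%N ->
  \sum_(s : state) ((hgt0 s (a + d) - hgt0 s a)%:~R : R) ^+ 2 = (2 ^ M'.+1)%:R * d%:R.
Proof.
move=> had; have e s : ((hgt0 s (a + d) - hgt0 s a)%:~R : R) ^+ 2 =
    \sum_(j <- iota a d) \sum_(k <- iota a d) sg R s (inord j) * sg R s (inord k).
  have -> : (hgt0 s (a + d) - hgt0 s a)%:~R = \sum_(j <- iota a d) sg R s (inord j) :> R.
    by rewrite hgt0_sum rmorph_sum; apply: eq_bigr => j _; rewrite /slope /sg; case: (s _).
  by rewrite expr2 mulr_suml; apply: eq_bigr => j _; rewrite mulr_sumr.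
under eq_bigr do rewrite e.
rewrite exchange_big /=; transitivity (\sum_(j <- iota a d) ((2 ^ M'.+1)%:R : R)); last first.
  by rewrite big_const_seq count_predT size_iota iter_addr addr0 mulr_natr.
rewrite big_seq [RHS]big_seq; apply: eq_bigr => j jd.
rewrite exchange_big /= (bigD1_seq j) ?iota_uniq//= sum_sg2 eqxx mulr1 big1_seq ?addr0// => k /andP[kj kd].
rewrite sum_sg2 (_ : (_ == _) = false) ?mulr0//; apply/eqP => /(congr1 (@nat_of_ord _)); move: jd kd; rewrite !mem_iota => jd kd.
by rewrite !inordK; [move=> ee; rewrite ee eqxx in kj|move: kd had; clear; lia|move: jd had; clear; lia].
Qed.

Lemma drift_square z : (z <= M')%N -> \sum_s drift s z ^+ 2 <= (2 ^ M'.+1)%:R * N%:R.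
Proof.
have h d : (d <= N)%N -> (2 ^ M'.+1)%:R * d%:R <= (2 ^ M'.+1)%:R * N%:R :> R.
  by move=> hd; rewrite ler_wpM2l ?ler_nat.
move=> zM; have [zN|/ltnW zN] := leqP N z.
  have := @hgt0_square N (z - N); rewrite subnKC// => /(_ zM) ->; apply: h; move: zM; clear; lia.
have := @hgt0_square z (N - z); rewrite subnKC// => H.
apply: le_trans (h (N - z)%N (leq_subr _ _)); rewrite -H; last by rewrite leq_pmull.
by apply: ler_sum => s _; rewrite /drift -opprB intrN sqrrN.
Qed.

(** Bounds the weight of a state. The ring is kept fixed as [p] tends to 1, so this tends to 1. *)
Definition boost : R := p^-1 ^+ M'.+1.

Lemma grid_le z : z \in grid -> (z <= M')%N.
Proof.
case/mapP => j; rewrite mem_iota add0n ltnS => /andP[_ hj] ->.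
by rewrite mulnCA leq_mul2l hj orbT.
Qed.

Lemma defect_mean z : (z <= M')%N ->
  \sum_s weight p s * E_ p (fun w => defect s w z) <=
  mass M' p * ((boost * N%:R + 4 * (3 * (m%:R * (1 - p)) + N%:R)) / (4 * lam)).
Proof.
move=> zM; have mg := mass_ge M' hp; have l4 : 0 <= (4 * lam)^-1 by rewrite invr_ge0 mulr_ge0// ltW.
set U := Ur R 0 m (wedge z%:Z) N%:Z.
have lU : local U by exact: Ur_local.
set v : R := E_ p (fun w => (U w - wbar z) ^+ 2).
have lv : local (fun w => (U w - wbar z) ^+ 2) by apply: (local1 (fun x : R => (x - wbar z) ^+ 2)).
have hv : v <= 4 * (3 * (m%:R * (1 - p)) + N%:R).
  apply: le_trans (E_sqr_dist lU (Ur_variance 0 m N%:Z p01 (lip1_wedge z%:Z) (fun _ => normr_ge0 _))) _.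
  rewrite ler_pM2l// lerD2l -[N%:R]/(N%:Z%:~R) ler_int /wedge; move: zM; clear; lia.
have e s : E_ p (fun w => defect s w z) = (4 * lam)^-1 * (drift s z ^+ 2 + v).
  transitivity (E_ p (fun w => (4 * lam)^-1 * (drift s z ^+ 2 + (U w - wbar z) ^+ 2))).
    by apply: E_eq => w; rewrite /defect mulrC.
  rewrite E_Z; last exact: (local1 (fun x : R => _ + x)).
  by rewrite E_D// ?E_cst//; exact: local_cst.
under eq_bigr do rewrite e mulrCA mulrDr.
rewrite -mulr_sumr big_split /= -mulr_suml -/(mass M' p) [X in _ <= X]mulrA [X in _ <= X]mulrC ler_wpM2l//.
rewrite mulrDr; apply: lerD; last first.
  by rewrite ler_wpM2l//; apply: le_trans mg.
apply: le_trans (weighted_le hp (fun s => sqr_ge0 _)) _; rewrite -/boost.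
have b0 : 0 <= boost by rewrite exprn_ge0// invr_ge0; case/andP: hp => /ltW.
rewrite mulrCA ler_wpM2l//; apply: le_trans (drift_square zM) _.
by rewrite ler_wpM2r.
Qed.

(** The weighted mean of the growth is bounded below by [growth_ge], with second moments for the
    penalties, and above by [min_mass_le], as a site is a minimum with probability at most
    [boost / 4]. *)
Lemma tasep_upper : half_mean <= N%:R ->
  half_mean <= 2 * lam + 2 * g%:R + m%:R * (1 - p) / 2 * boost +
    (2 * q).+1%:R * ((boost * N%:R + 4 * (3 * (m%:R * (1 - p)) + N%:R)) / (4 * lam)).
Proof.
move=> hN; have mg := mass_ge M' hp.
have Z0 : 0 < mass M' p by apply: lt_le_trans mg; rewrite ltr0n expn_gt0.
set V := (_ / (4 * lam)); set A := half_mean - 2 * lam - 2 * g%:R.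
have b0 : 0 <= boost by rewrite exprn_ge0// invr_ge0; case/andP: hp => /ltW.
have ld s z : local (fun w => defect s w z).
  apply: (local1 (fun x : R => (drift s z ^+ 2 + (x - wbar z) ^+ 2) / (4 * lam))); exact: Ur_local.
have lD s : local (fun w => \sum_(z <- grid) defect s w z) by apply: local_sum => z _ _.
have lgr s : local (fun w => (growth w s m (inord N))%:R : R) by apply: growth_local.
have step s : A - \sum_(z <- grid) E_ p (fun w => defect s w z) <= 2 * E_ p (fun w => (growth w s m (inord N))%:R).
  rewrite -E_Z// -(@E_sum _ _ _ _ xpredT) => [|z _ _]; last exact: ld.
  rewrite -[X in X - _](E_cst edge p) -E_B//; last exact: local_cst.
  apply: E_le => //; [exact: (local1 (fun x : R => _ - x))|exact: (local1 (fun x : R => 2 * x))|move=> w].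
  exact: growth_ge.
have sum : mass M' p * A - \sum_(z <- grid) \sum_s weight p s * E_ p (fun w => defect s w z) <=
    2 * (m%:R * (1 - p) * min_mass p (inord N : 'I_M'.+1)).
  rewrite -(mean_growth hp) mulr_sumr /mass mulr_suml exchange_big /= -sumrB; apply: ler_sum => s _.
  rewrite -mulr_sumr -mulrBr mulrCA ler_wpM2l//; apply: le_trans (weight_ge1 hp s); exact: ler01.
have sumd : \sum_(z <- grid) \sum_s weight p s * E_ p (fun w => defect s w z) <= (2 * q).+1%:R * (mass M' p * V).
  apply: (@le_trans _ _ (\sum_(z <- grid) (mass M' p * V))); last first.
    by rewrite big_const_seq count_predT size_map size_iota iter_addr addr0 -[X in X <= _]mulr_natl.
  rewrite big_seq [X in _ <= X]big_seq; apply: ler_sum => z /grid_le; exact: defect_mean.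
have M0 : (0 < M')%N by rewrite !muln_gt0 g0 q0.
have hmm : min_mass p (inord N : 'I_M'.+1) <= boost * (mass M' p / 4).
  apply: le_trans (min_mass_le hp (pred_neq _ M0)) _; rewrite -/boost ler_wpM2l// ler_wpM2r//.
have e0 : 0 <= m%:R * (1 - p) by rewrite mulr_ge0// subr_ge0; case/andP: p01.
have := ler_wpM2l e0 hmm => hmm2.
have fin : mass M' p * A <= mass M' p * (m%:R * (1 - p) / 2 * boost + (2 * q).+1%:R * V).
  move: sum sumd hmm2; move: (bigop _ _ _) (min_mass _ _) (mass _ _) => x y z; move: (_ * (1 - p)) => t; lra.
by move: fin; rewrite ler_pM2l// /A; lra.
Qed.

End UpperBound.

(** * Choice of the parameters and the final estimate *)

Section Expansion.
Variable (R : realType).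

Lemma boost_le (eps theta : R) (n : nat) : 0 <= eps -> eps < 1 -> 0 < theta -> n%:R * eps <= theta / (1 + theta) ->
  (1 - eps)^-1 ^+ n <= 1 + theta.
Proof.
move=> e0 e1 t0 h; have b := bernoulli_ineq n e0 (ltW e1).
have h1 : (1 + theta)^-1 <= 1 - n%:R * eps.
  have : theta / (1 + theta) = 1 - (1 + theta)^-1 by field; rewrite gt_eqF//; lra.
  by move: h; lra.
rewrite exprVn -[X in _ <= X]invrK lef_pV2 ?posrE; [|by rewrite exprn_gt0//; lra|by rewrite invr_gt0; lra].
exact: le_trans h1 b.
Qed.

(** The parameters are [lam = g = k ^ 2], [q = 3 k], [N = 3 k ^ 3] and [t = m * (1 - p)]: apart from
    the factor [P], every error is of order [k ^ 2], against a main term [k ^ 3 / 2]. *)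
Lemma block_arith (P k t : R) : 1 <= P -> 1 <= k -> 0 <= t -> t <= k * k ^+ 2 ->
  2 * k ^+ 2 + 2 * k ^+ 2 + t / 2 * P +
    (2 * (3 * k) + 1) * ((P * (3 * k ^+ 3) + 4 * (3 * t + 3 * k ^+ 3)) / (4 * k ^+ 2)) <=
  P * (k ^+ 3 / 2 + 60 * k ^+ 2).
Proof.
move=> P1 k1 t0 tk; have y0 : 0 < k ^+ 2 by rewrite exprn_gt0//; lra.
have exy : k ^+ 3 = k * k ^+ 2 by rewrite exprS.
have eyk : k * k = k ^+ 2 by rewrite expr2.
rewrite exy; move: y0 tk eyk; move: (k ^+ 2) => y y0 tk eyk.
have z0 : 0 < k * y by rewrite mulr_gt0//; lra.
have hP : 0 <= (P - 1) * (k * y) by rewrite mulr_ge0 ?subr_ge0// ltW.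
have d : (P * (3 * (k * y)) + 4 * (3 * t + 3 * (k * y))) / (4 * y) <= 27 / 4 * P * k.
  rewrite ler_pdivrMr ?mulr_gt0//; have -> : 27 / 4 * P * k * (4 * y) = 27 * (P * (k * y)) by field.
  by move: hP tk; move: (k * y) => z; lra.
have A0 : 0 <= (P * (3 * (k * y)) + 4 * (3 * t + 3 * (k * y))) / (4 * y).
  rewrite divr_ge0 ?mulr_ge0 ?(ltW y0)// addr_ge0// mulr_ge0//; try lra.
have d2 : (2 * (3 * k) + 1) * ((P * (3 * (k * y)) + 4 * (3 * t + 3 * (k * y))) / (4 * y)) <= 7 * k * (27 / 4 * P * k).
  by apply: ler_pM => //; lra.
have d3 : t / 2 * P <= P * (k * y / 2) by rewrite mulrC ler_wpM2l//; lra.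
have d4 : 0 <= (P - 1) * y by rewrite mulr_ge0 ?subr_ge0// ltW.
have d5 : 7 * k * (27 / 4 * P * k) = 189 / 4 * (P * y) by rewrite -eyk; ring.
have Py0 : 0 <= P * y by rewrite mulr_ge0// ?(ltW y0)//; lra.
have -> : P * (k * y / 2 + 60 * y) = P * (k * y / 2) + 60 * (P * y) by ring.
have {}d4 : y <= P * y by move: d4; rewrite mulrBl mul1r subr_ge0.
rewrite d5 in d2; move: d2 d3 d4 Py0; move: (_ * (_ / (4 * y))) (P * (k * y / 2)) (t / 2 * P) (P * y) => q1 q2 q3 q4; lra.
Qed.

(* [K = k ^ 3], on the window [3 * K] with grid step [k ^ 2]; [eta ^ 2 = 1 - p]. *)
Lemma mu_block (p : R) (k m : nat) (C eta : R) : (0 < k)%N -> (0 < m)%N -> 3 / 4 <= p -> p < 1 -> 0 < C ->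
  (forall l e, E_ p (taur R l e 4) <= C) -> eta ^+ 2 = 1 - p -> 0 < eta -> eta <= 1 ->
  m%:R * (1 - p) <= k%:R ^+ 3 ->
  mu p * (m + m)%N%:R <= (m + m)%N%:R + p^-1 ^+ (6 * k ^ 3).+1 * (k%:R ^+ 3 + 120 * k%:R ^+ 2) + 4 +
    ((8 * k ^ 3)%N%:R * (2 * (1 + C)) + 2 * k%:R ^+ 3 * ((2 * (8 * k ^ 3)).+1%:R * (5 * (1 + C)))) * eta.
Proof.
move=> k0 m0 pl pu C0 hC ee eta0 eta1 mK.
have hp0 : (1 / 2 : R) < 3 / 4 by lra.
have hp1 : (3 / 4 : R) <= 1 by lra.
have hp : 3 / 4 <= p <= 1 by lra.
have hp2 : 0 < p <= 1 by lra.
have p01 : 0 <= p <= 1 by lra.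
have kr1 : 1 <= k%:R :> R by rewrite ler1n.
have kr0 : 0 < k%:R :> R by lra.
have K0 : 0 < k%:R ^+ 3 :> R by rewrite exprn_gt0.
apply: le_trans (mu_le hp0 hp1 hp (m + m)) _; apply: (asup_le hp0 hp1 hp) => l.
pose r := (8 * k ^ 3)%N.
have mm : (m + m)%N%:R * (1 - p) <= 2 * k%:R ^+ 3 by rewrite natrD; lra.
have rK : 8 * k%:R ^+ 3 <= r%:R :> R by rewrite /r natrM natrX.
have S0 : 0 < eta^-1 by rewrite invr_gt0.
have lam0 : 0 < k%:R ^+ 2 :> R by rewrite exprn_gt0.
have g0 : (0 < k ^ 2)%N by rewrite expn_gt0 k0.
have q0 : (0 < 3 * k)%N by rewrite muln_gt0.
have eN : (k ^ 2 * (3 * k) = 3 * k ^ 3)%N by rewrite mulnCA -expnSr.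
have hN : half_mean p m <= (k ^ 2 * (3 * k))%N%:R.
  have := Ur_mean 0 (m + m) 0 p01 (lip1_wedge 0); rewrite (_ : wedge 0 0 = 0)// mulr0z add0r.
  rewrite /half_mean eN natrM natrX; move: mm; move: (E_ _ _) => a; lra.
have := tasep_upper hp2 lam0 g0 q0 hN.
rewrite /boost eN (_ : (2 * (3 * k ^ 3)).+1 = (6 * k ^ 3).+1); last by congr S; rewrite mulnA.
set P := p^-1 ^+ _ => hh.
have P1 : 1 <= P by rewrite /P exprn_ege1// invf_ge1; lra.
have tas : half_mean p m <= P * (k%:R ^+ 3 / 2 + 60 * k%:R ^+ 2).
  apply: le_trans hh _.
  rewrite natrM natrX -[(2 * (3 * k)).+1]addn1 natrD 2!natrM natrX.
  by apply: block_arith => //; rewrite mulr_ge0//; lra.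
apply: le_trans (corridor_mean l p01 K0 mm rK) _.
have -> : E_ p (Ur R 0 (m + m) (wedge 0) 0) = 2 * half_mean p m by rewrite /half_mean; field.
apply: (@le_trans _ _ ((m + m)%N%:R + 2 * half_mean p m + 4 +
    (r%:R * (2 * (1 + C)) + 2 * k%:R ^+ 3 * ((2 * r).+1%:R * (5 * (1 + C)))) * eta)).
  rewrite lerD2l; apply: le_trans (jam_box_mean p01 S0 (hC l) r (m + m)) _.
  have e1 : eta^-1 * (1 - p) = eta by rewrite -ee expr2 mulKf// gt_eqF.
  have e2 : (eta^-1 ^+ 3)^-1 = eta ^+ 3 by rewrite exprVn invrK.
  have e3 : eta^-1 * (1 - p) ^+ 2 = eta ^+ 3 by rewrite expr2 mulrA e1 -ee -exprS.
  rewrite e1 e2 e3 [X in _ <= X]mulrDl; apply: lerD.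
    rewrite -mulrA ler_wpM2l// -mulrA ler_wpM2l// mulrDl mul1r lerD2l mulrC ler_wpM2l ?(ltW C0)//.
    by rewrite -[X in _ <= X]expr1 ler_wiXn2l// ltW.
  have -> : (m + m)%N%:R * ((2 * r).+1%:R * (5 * (eta ^+ 3 + eta ^+ 3 * C))) =
      ((m + m)%N%:R * (1 - p)) * ((2 * r).+1%:R * (5 * (1 + C)) * eta) by rewrite -ee; ring.
  rewrite -[X in _ <= X]mulrA ler_wpM2r//.
  by rewrite !mulr_ge0// ?(ltW eta0)//; move: C0; lra.
rewrite lerD2r lerD2r lerD2l.
by move: tas; rewrite [P * (_ / 2 + _)]mulrDr [P * (_ + 120 * _)]mulrDr; move: (half_mean p m) (P) (k%:R ^+ 3) (k%:R ^+ 2); clear => a P x y; lra.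
Qed.

Lemma mu_upper (d : R) : 0 < d -> exists2 e0 : R, 0 < e0 & forall p, 1 - e0 < p -> p < 1 ->
  mu p <= 1 + (1 - p) / 2 + d * (1 - p).
Proof.
move=> d0; have hp0 : (1 / 2 : R) < 3 / 4 by lra.
have hp1 : (3 / 4 : R) <= 1 by lra.
have [C C0 hC] := tau_moment 4 hp0 hp1.
(* Ensures [126 + 2 * d <= d * k], where [126 = 120 + 5 + 1]: 120 is the coefficient of [k ^ 2] in
   [mu_block], 5 its constant 4 plus a last term kept below 1, and 1 the rounding loss in
   [x - 1 <= m * (1 - p)]. *)
pose k := (Num.trunc (126 / d) + 3)%N.
have hk : 126 + 2 * d <= d * k%:R.
  have := truncnS_gt (126 / d); rewrite ltr_pdivrMr// /k (natrD _ (Num.trunc _) 3).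
  have -> : (Num.trunc (126 / d)).+1%:R = (Num.trunc (126 / d))%:R + 1 :> R by exact/esym/natr1.
  by move: (Num.trunc (126 / d))%:R => a; lra.
have k0 : (0 < k)%N by rewrite /k addn3.
clearbody k; have kr1 : 1 <= k%:R :> R by rewrite ler1n.
set x : R := k%:R ^+ 3; set y : R := k%:R ^+ 2.
have y1 : 1 <= y by rewrite exprn_ege1.
have x1 : 1 <= x by rewrite exprn_ege1.
have xy : x = k%:R * y by rewrite /x exprS.
pose A := x + 120 * y + 5.
have A0 : 0 < A by rewrite /A; lra.
pose theta := d * x / A.
have t0 : 0 < theta by rewrite divr_gt0// mulr_gt0//; lra.
have key : A * (1 + theta) <= (x - 1) * (1 + 2 * d).
  have -> : A * (1 + theta) = A + d * x by rewrite /theta; field; rewrite gt_eqF.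
  have h1 : (126 + 2 * d) * y <= d * x.
    by rewrite xy mulrA ler_wpM2r//; lra.
  have h2 : 2 * d <= 2 * d * y by rewrite ler_peMr//; lra.
  have arith (X Y : R) : 1 <= Y -> (126 + 2 * d) * Y <= d * X -> 2 * d <= 2 * d * Y ->
    X + 120 * Y + 5 + d * X <= (X - 1) * (1 + 2 * d) by move=> *; lra.
  exact: arith.
pose n := (6 * k ^ 3).+1.
pose c := (8 * k ^ 3)%N%:R * (2 * (1 + C)) + 2 * x * ((2 * (8 * k ^ 3)).+1%:R * (5 * (1 + C))).
have c0 : 0 < c.
  apply: ltr_wpDl; first by rewrite !mulr_ge0//; lra.
  by rewrite !mulr_gt0//; lra.
(* The three bounds serve for [3 / 4 <= p], [P <= 1 + theta] and [c * eta <= 1]. *)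
pose e0 := Num.min (1 / 4) (Num.min (theta / (1 + theta) / n%:R) (c^-1 ^+ 2)).
have n0 : 0 < n%:R :> R by [].
have e00 : 0 < e0.
  rewrite !lt_min; apply/and3P; split; first by lra.
    by apply: divr_gt0 => //; apply: divr_gt0 => //; apply: addr_gt0.
  by rewrite exprn_gt0// invr_gt0.
exists e0 => // p; rewrite /e0 -ltrBDr => hp hp'.
pose e := 1 - p.
have ep : p = 1 - e by rewrite /e; ring.
have e_gt0 : 0 < e by rewrite /e subr_gt0.
have : e < e0 by move: hp; rewrite /e -/e0; lra.
rewrite /e0 !lt_min => /and3P[e1 e2 e3].
pose eta := Num.sqrt e.
have eta0 : 0 < eta by rewrite sqrtr_gt0.
have ee : eta ^+ 2 = 1 - p by rewrite sqr_sqrtr ?(ltW e_gt0).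
have eta1 : eta <= 1 by rewrite -sqrtr1 ler_sqrt//; lra.
have ceta : c * eta <= 1.
  have : eta <= c^-1.
    rewrite -(ler_pXn2r (_ : 0 < 2)%N) ?nnegrE ?invr_ge0 ?(ltW c0) ?(ltW eta0)//.
    by rewrite ee -/e ltW.
  by rewrite -(ler_pM2l c0) mulfV// gt_eqF.
pose m := Num.trunc (x / e).
have xe1 : 1 <= x / e by rewrite ler_pdivlMr//; lra.
have /andP[m1 m2] : m%:R <= x / e < m.+1%:R by apply: truncn_itv; lra.
have m0 : (0 < m)%N by rewrite truncn_gt0.
have mK : m%:R * (1 - p) <= k%:R ^+ 3 by rewrite -/e -ler_pdivlMr.
have mL : x - 1 <= m%:R * e.
  by move: m2; rewrite ltr_pdivrMr// -natr1 mulrDl mul1r; lra.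
have pl : 3 / 4 <= p by rewrite ep; lra.
have hC4 l f : E_ p (taur R l f 4) <= C by apply: hC; lra.
have := mu_block k0 m0 pl hp' C0 hC4 ee eta0 eta1 mK.
rewrite -/x -/y -/c -/n.
have hb : p^-1 ^+ n <= 1 + theta.
  rewrite ep; apply: boost_le; [exact: ltW|lra|exact: t0|].
  by rewrite mulrC -ler_pdivlMr// ltW.
set P := p^-1 ^+ n in hb * => hmu.
have P1 : 1 <= P by rewrite /P exprn_ege1// invf_ge1; lra.
have PA : P * (x + 120 * y) + 5 <= A * (1 + theta).
  apply: (@le_trans _ _ (A * P)); last by rewrite ler_wpM2l// ltW.
  have -> : A * P = P * (x + 120 * y) + 5 * P by rewrite /A; ring.
  by rewrite lerD2l ler_peMr.
have mm0 : 0 < (m + m)%N%:R :> R by rewrite ltr0n addn_gt0 m0.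
rewrite -(ler_pM2r mm0); apply: le_trans hmu _.
have -> : (1 + (1 - p) / 2 + d * (1 - p)) * (m + m)%N%:R = (m + m)%N%:R + m%:R * e * (1 + 2 * d).
  by rewrite natrD /e; field.
have h5 : (x - 1) * (1 + 2 * d) <= m%:R * e * (1 + 2 * d) by rewrite ler_wpM2r//; lra.
move: ceta PA key h5; move: (P * _) (A * _) ((x - 1) * _) (m%:R * e * _) (c * eta) => a1 a2 a3 a4 a5; lra.
Qed.

End Expansion.

Theorem theorem1 (R : realType) :
  exists mu : R -> R,
    (forall p : R, 1 / 2 < p < 1 ->
      forall (d : measure_display) (T : measurableType d)
             (P : probability T R) (w : T -> config),
        bernoulli_percolation P p w ->
        {ae P, forall t, inf_cluster (w t) origin ->
           (fun k : nat => (D (w t) ((T1 (w t) k)%:Z, 0%:Z) *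
                            (((T1 (w t) k)%:R : R)^-1)%:E)%E)
             @ \oo --> (mu p)%:E}) /\
    (fun p : R => (mu p - 1 - (1 - p) / 2) / (1 - p)) @ at_left (1 : R) --> 0.
Proof.
exists (@mu R); split.
  move=> p /andP[p1 p2] d T P w wP.
  by apply: (limit_ae p1 (ltW p2) _ wP); rewrite lexx ltW.
apply/cvgrPdist_le => d d0; have [e0 e00 H] := mu_upper d0.
near=> p; have p1 : p < 1 by near: p; exact: nbhs_left_lt.
have p2 : 1 - e0 < p by near: p; apply: nbhs_left_gt; rewrite gtrBl.
have p3 : 3 / 4 < p by near: p; apply: nbhs_left_gt; lra.
have hi := H p p2 p1.
have lo : 1 + (1 - p) / 2 <= mu p by apply: (@mu_lower R (3 / 4) p); lra.
have e1 : 0 < 1 - p by rewrite subr_gt0.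
rewrite sub0r normrN ger0_norm; last by rewrite divr_ge0//; lra.
by rewrite ler_pdivrMr//; lra.
Unshelve. all: by end_near.
Qed.
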